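(* Let $\mathcal H(\mu)$ be a stratum of differentials in genus zero with only simple poles, with $m+1$ zeros and $n+2$ poles. Let $k\le m$ and let $M\in\mathbb C^{(k+n)\times(m+n+1)}$ be any matrix in reduced row echelon form of the shape \[ M=\begin{pmatrix} A & B\\ 0 & C\end{pmatrix}, \] where $A\in\mathbb Q^{k\times m}$ is in reduced row echelon form, $B\in\mathbb C^{k\times(n+1)}$ has only its last column potentially non-zero, and $C=(I_n\mid q)$ is the $n\times(n+1)$ matrix consisting of the identity matrix $I_n$ followed by a last column $q=(q_1,\dots,q_n)^T\in\mathbb Q^n$ with $q_i\neq 0$ for all $i$. Let $S_M$ be the analytic variety defined locally in period coordinates, on a period chart $U\subseteq\mathcal H(\mu)$ with period map $\phi_U$, by \[ S_M:=\{(X,\omega) : M\cdot\phi_U(X,\omega)=0\}. \] Then the analytic variety $S_M\subseteq\mathcal H(\mu)$ is a well-defined, bi-algebraic subvariety of expected codimension $k+n$. Furthermore, $S_M$ is $\mathbb C$-linear. If the matrix $B$ is defined over a field $K\subseteq\mathbb C$, then $S_M$ is $K$-linear.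
   Context: Let $\mu=(e_0,\dots,e_m,-1,\dots,-1)$ with $e_i>0$, $n+2$ entries equal to $-1$, and $\sum_i e_i=n$. The stratum $\mathcal H(\mu)$ parametrizes pairs $(X,\omega)$ with $X$ a compact Riemann surface of genus $0$ and $\omega$ a meromorphic differential with labelled zeros $x_0,\dots,x_m$ of orders $e_0,\dots,e_m$ and simple poles $y_0,\dots,y_n,\infty$. With the normalization $x_0=0$, $y_0=1$, it is the variety of $(\lambda,x,y)\in\mathbb C^*\times\mathbb C^m\times\mathbb C^n$ such that $x_0,\dots,x_m,y_0,\dots,y_n$ are pairwise distinct, with $\omega=\lambda\frac{\prod_{i=0}^m(z-x_i)^{e_i}}{\prod_{j=0}^n(z-y_j)}dz$. Let $R_j=\operatorname{Res}_{z=y_j}\omega$. A period chart is a small open set $U\subseteq\mathcal H(\mu)$ on which paths from $x_0$ to $x_j$ are chosen consistently and on which the period map \[ \phi_U(X,\omega)=\Bigl(\int_{x_0}^{x_1}\omega,\dots,\int_{x_0}^{x_m}\omega,2\pi iR_0,\dots,2\pi iR_n\Bigr)\in\mathcal P=\mathbb C^{m+n+1} \] is a biholomorphism onto its image (period coordinates). A priori $S_M$ is defined only locally on a period chart; ''well-defined'' means that the equations defining $S_M$ are invariant under the monodromy and thus glue to give a global algebraic variety in $\mathcal H(\mu)$. Let $\pi:\widetilde{\mathcal H(\mu)}\to\mathcal H(\mu)$ be the universal covering and $\phi:\widetilde{\mathcal H(\mu)}\to\mathcal P$ the global period map, obtained by integrating $\omega$ over a global frame of relative homology. An algebraic variety $S\subseteq\mathcal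 H(\mu)$ is bi-algebraic if for some analytic irreducible component $S'$ of $\pi^{-1}(S)$ the Zariski closure of $\phi(S')$ has dimension $\dim S$. It is linear ($\mathbb C$-linear), respectively $K$-linear for a field $K\subseteq\mathbb C$, if locally in period coordinates it is defined by a finite union of linear subspaces, respectively of linear subspaces defined over $K$.
   Formalization: S_M is the union of the chart loci over all choices of paths, since one chart's equations are not monodromy-invariant for k ≥ 1; ''well-defined'' means this union is algebraic and agrees with each chart locus near its points. Bi-algebraicity is claimed only for S_M non-empty. *)

(* Defs.v *)
From HB Require Import structures.
From mathcomp Require Import all_boot all_order all_algebra.
From mathcomp Require Import all_classical all_reals all_analysis.
From mathcomp Require Import complex.
From mathcomp Require mpoly.
Import Order.TTheory GRing.Theory Num.Theory numFieldNormedType.Exports.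

Set Implicit Arguments.
Unset Strict Implicit.
Unset Printing Implicit Defensive.

Local Open Scope classical_set_scope.
Local Open Scope ring_scope.
Local Open Scope complex_scope.

(* The topology of the complex numbers is the one every numFieldType carries;
   'differentiable' over R[i] is complex differentiability. *)
HB.instance Definition _ (R : realType) := NormedModule.copy R[i] R[i]^o.

Definition leading_entry (F : fieldType) (r c : nat) (M : 'M[F]_(r, c))
    (i : 'I_r) (j : 'I_c) : Prop :=
  M i j != 0 /\ forall j' : 'I_c, (j' < j)%N -> M i j' = 0.

Definition reduced_row_echelon (F : fieldType) (r c : nat)
    (M : 'M[F]_(r, c)) : Prop :=
  [/\ forall i i' : 'I_r, (i < i')%N -> row i M = 0 -> row i' M = 0,
      forall (i i' : 'I_r) (j j' : 'I_c), (i < i')%N ->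
        leading_entry M i j -> leading_entry M i' j' -> (j < j')%N,
      forall (i : 'I_r) (j : 'I_c), leading_entry M i j -> M i j = 1
    & forall (i i' : 'I_r) (j : 'I_c),
        leading_entry M i j -> i' != i -> M i' j = 0].

Section Zariski.
Context (R : realType) (N : nat).
Implicit Types (X Y Z F G : set 'rV[R[i]]_N).

Definition zariski_closed F : Prop :=
  exists I : set (mpoly.mpoly N R[i]),
    F = [set p | forall f, I f -> mpoly.meval (fun i => p 0 i) f = 0].

Definition zariski_closure X : set 'rV[R[i]]_N :=
  \bigcap_(F in [set F | zariski_closed F /\ X `<=` F]) F.

Definition zariski_irreducible X : Prop :=
  X !=set0 /\ forall F G, zariski_closed F -> zariski_closed G ->
    X `<=` F `|` G -> X `<=` F \/ X `<=` G.

Definition zariski_component X Z : Prop :=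
  [/\ Z `<=` X, zariski_irreducible Z
    & forall Z', zariski_irreducible Z' -> Z `<=` Z' -> Z' `<=` X -> Z' = Z].

(* A strictly increasing chain Z_0, ..., Z_d of irreducible closed subsets of
   X, for the topology induced on X by the Zariski topology. *)
Definition zariski_chain X (d : nat) : Prop :=
  exists Z : nat -> set 'rV[R[i]]_N,
    (forall j, (j <= d)%N -> zariski_irreducible (Z j) /\
       exists2 F, zariski_closed F & Z j = X `&` F) /\
    (forall j, (j < d)%N -> Z j `<` Z j.+1).

(* The Krull dimension of X is d; the empty set has no dimension. *)
Definition has_dim X (d : nat) : Prop :=
  zariski_chain X d /\ ~ zariski_chain X d.+1.

End Zariski.

Section Covering.
Context (R : realType).

Definition unit_path (T : topologicalType) (f : R -> T) : Prop :=
  {within `[0, 1], continuous f}.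

Definition path_homotopic (T : topologicalType) (f g : R -> T) : Prop :=
  exists h : R * R -> T,
    [/\ {within `[0, 1] `*` `[0, 1], continuous h},
        forall t, 0 <= t <= 1 -> h (0, t) = f t /\ h (1, t) = g t
      & forall s, 0 <= s <= 1 -> h (s, 0) = f 0 /\ h (s, 1) = f 1].

Definition simply_connected (T : topologicalType) : Prop :=
  (forall a b : T, exists f : R -> T, [/\ unit_path f, f 0 = a & f 1 = b]) /\
  (forall f g : R -> T, unit_path f -> unit_path g ->
     f 0 = g 0 -> f 1 = g 1 -> path_homotopic f g).

(* V is evenly covered: the sheets over V are the images of the sections s_i. *)
Definition covering (T B : topologicalType) (X : set B) (pr : T -> B) : Prop :=
  [/\ continuous pr, range pr = X
    & forall p, X p -> exists V : set B, [/\ open V, V p, V `<=` X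
        & exists (I : Type) (s : I -> B -> T),
          [/\ forall i, {within V, continuous (s i)},
              forall i, open (s i @` V),
              forall i q, V q -> pr (s i q) = q
            & forall t, V (pr t) -> exists! i, s i (pr t) = t]]].

Definition universal_covering (T B : topologicalType) (X : set B)
    (pr : T -> B) : Prop :=
  covering X pr /\ simply_connected T.

End Covering.

Section Analytic.
Context (R : realType) (N : nat) (T : topologicalType) (pr : T -> 'rV[R[i]]_N).
Implicit Types Y Z : set T.

(* Analytic subsets of T for the complex structure that makes the local
   homeomorphism pr a local biholomorphism. *)
Definition analytic_subset Z : Prop :=
  forall t : T, exists (r : nat) (g : 'I_r -> 'rV[R[i]]_N -> R[i]),
    (forall i, \forall q \near pr t, differentiable (g i) q) /\
    (\forall u \near t, Z u <-> forall i, g i (pr u) = 0).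

Definition analytic_irreducible Z : Prop :=
  [/\ analytic_subset Z, Z !=set0
    & forall Z1 Z2, analytic_subset Z1 -> analytic_subset Z2 ->
        Z = Z1 `|` Z2 -> Z = Z1 \/ Z = Z2].

Definition analytic_component Y Z : Prop :=
  [/\ Z `<=` Y, analytic_irreducible Z
    & forall Z', analytic_irreducible Z' -> Z `<=` Z' -> Z' `<=` Y -> Z' = Z].

End Analytic.

Section Integration.
Context (R : realType).
Implicit Types (c : R -> R[i]) (f : R[i] -> R[i]).

Definition velocity c (t : R) : R[i] :=
  derive1 (fun s => complex.Re (c s)) t +i*
  derive1 (fun s => complex.Im (c s)) t.

Definition C1_path c : Prop :=
  [/\ forall t, derivable (fun s => complex.Re (c s)) t 1,
      forall t, derivable (fun s => complex.Im (c s)) t 1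
    & continuous (velocity c)].

Definition path_integral f c : R[i] :=
  (\int[lebesgue_measure]_(t in `[0, 1]) complex.Re (f (c t) * velocity c t)) +i*
  (\int[lebesgue_measure]_(t in `[0, 1]) complex.Im (f (c t) * velocity c t)).

(* For f with at most a simple pole at a, as is the case of omega below. *)
Definition residue f (a : R[i]) : R[i] :=
  lim ((z - a) * f z @[z --> a^']).

Definition two_pi_i : R[i] := 0 +i* (2 * pi).

End Integration.

Section Stratum.
Context (R : realType) (m n : nat) (e : 'I_m.+1 -> nat).

(* Coordinates (lambda, x_1, ..., x_m, y_1, ..., y_n) on the stratum. *)
Local Notation point := 'rV[R[i]]_(1 + (m + n)).
(* Coordinates (int_{x_0}^{x_1}, ..., int_{x_0}^{x_m},
   2 pi i R_0, ..., 2 pi i R_n) on the period space. *)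
Local Notation periods := 'rV[R[i]]_(m + n.+1).
Implicit Types (p q : point) (U S : set point).

Definition lambda_of p : R[i] := lsubmx p 0 0.

Definition zero_at p (i : 'I_m.+1) : R[i] :=
  if unlift ord0 i is Some j then lsubmx (rsubmx p) 0 j else 0.

Definition pole_at p (l : 'I_n.+1) : R[i] :=
  if unlift ord0 l is Some j then rsubmx (rsubmx p) 0 j else 1.

Definition stratum : set point :=
  [set p | [/\ lambda_of p != 0, injective (zero_at p), injective (pole_at p)
             & forall i l, zero_at p i != pole_at p l]].

Definition omega p (z : R[i]) : R[i] :=
  lambda_of p * (\prod_i (z - zero_at p i) ^+ e i) / (\prod_l (z - pole_at p l)).

(* The index j : 'I_m stands for the zero x_(j+1). *)
Definition period_paths p (c : 'I_m -> R -> R[i]) : Prop :=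
  forall j : 'I_m,
    [/\ C1_path (c j), c j 0 = zero_at p ord0,
        c j 1 = zero_at p (lift ord0 j)
      & forall t l, 0 <= t <= 1 -> c j t != pole_at p l].

Definition period_map (c : point -> 'I_m -> R -> R[i]) p : periods :=
  row_mx (\row_(j < m) path_integral (omega p) (c p j))
         (\row_(l < n.+1) (two_pi_i R * residue (omega p) (pole_at p l))).

(* The paths c p vary continuously with p, which is what makes their choice
   consistent over U. *)
Definition period_chart U (c : point -> 'I_m -> R -> R[i]) : Prop :=
  [/\ open U, U `<=` stratum,
      forall p, U p -> period_paths p (c p),
      forall j, {within U `*` `[0, 1],
                   continuous (fun pt : point * R => c pt.1 j pt.2)}
    & [/\ forall p, U p -> differentiable (period_map c) p,
          open (period_map c @` U)
        & exists psi : periods -> point,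
            (forall p, U p -> psi (period_map c p) = p) /\
            (forall v, (period_map c @` U) v -> differentiable psi v)]].

Definition algebraic S : Prop :=
  exists2 F, zariski_closed F & S = stratum `&` F.

(* The equation M *m period_map c p = 0 depends on the homology classes of the
   paths c, so the locus defined in one chart is not stable under monodromy; the
   union over all charts, hence over all choices of paths, is. *)
Definition period_locus (r : nat) (M : 'M[R[i]]_(r, m + n.+1)) : set point :=
  [set p | exists U c, [/\ period_chart U c, U p
                         & M *m (period_map c p)^T = 0]].

(* The loci of the various charts glue to an algebraic variety: around each of
   its points, the locus of a chart is the whole of period_locus M. *)
Definition well_defined (r : nat) (M : 'M[R[i]]_(r, m + n.+1)) : Prop :=
  algebraic (period_locus M) /\
  forall U c p, period_chart U c -> U p -> M *m (period_map c p)^T = 0 ->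
    \forall q \near p,
      period_locus M q <-> M *m (period_map c q)^T = 0.

(* Locally a finite union of linear subspaces defined over K; square matrices
   suffice, every subspace being the kernel of one. *)
Definition linear_over (K : {pred R[i]}) S : Prop :=
  forall U c p, period_chart U c -> U p ->
    exists L : seq 'M[R[i]]_(m + n.+1),
      {in L, forall X, X \is a mxOver K} /\
      \forall q \near p,
        S q <-> exists2 X, X \in L & X *m (period_map c q)^T = 0.

(* Local frames of relative homology are the path systems of period charts, so
   a period map of a global frame is locally the one of a chart. *)
Definition global_period_map (T : topologicalType) (pr : T -> point)
    (phi : T -> periods) : Prop :=
  forall t, exists U c, [/\ period_chart U c, U (pr t)
                          & \forall u \near t, phi u = period_map c (pr u)].

Definition bialgebraic S : Prop :=
  exists2 d, has_dim S d &
    forall (T : topologicalType) (pr : T -> point) (phi : T -> periods),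
      universal_covering R stratum pr -> global_period_map pr phi ->
      exists2 Z, analytic_component pr (pr @^-1` S) Z &
        has_dim (zariski_closure (phi @` Z)) d.

Definition pure_codim S (d : nat) : Prop :=
  forall Z, zariski_component S Z -> has_dim Z (m + n.+1 - d).

End Stratum.

Section Matrix.
Context (R : realType) (k m n : nat).

(* (I_n | q) *)
Definition residue_rows (q : 'I_n -> rat) : 'M[R[i]]_(n, n.+1) :=
  \matrix_(i < n, l < n.+1)
    if l == ord_max then ratr (q i) else (i == l :> nat)%:R.

Definition period_matrix (A : 'M[rat]_(k, m)) (B : 'M[R[i]]_(k, n.+1))
    (q : 'I_n -> rat) : 'M[R[i]]_(k + n, m + n.+1) :=
  block_mx (map_mx ratr A) B 0 (residue_rows q).

End Matrix.

(* Main.v *)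
Require Import Defs.
From HB Require Import structures.
From mathcomp Require Import all_boot all_order all_algebra.
From mathcomp Require Import all_classical all_reals all_analysis.
From mathcomp Require Import complex.
From mathcomp Require mpoly.
Import -(notations) mpoly.
From mathcomp Require Import ring lra zify.
Import Order.TTheory GRing.Theory Num.Theory numFieldNormedType.Exports.
Set Implicit Arguments.
Unset Strict Implicit.
Unset Printing Implicit Defensive.
Local Open Scope classical_set_scope.
Local Open Scope ring_scope.
Local Open Scope complex_scope.


(** On a period chart the j-th relative period is [sum_l R_l L_jl], where
    [L_jl] is the integral of [dz / (z - y_l)] along the j-th path, so that
    [exp L_jl = (x_j - y_l) / (x_0 - y_l)]. Where the residues are proportional
    to a rational vector [r], the remaining equations say that integral
    combinations of the [L_jl] are constant; after a change of basis (Smith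
    normal form) the integer vectors occurring are onto, so exponentiating gives
    monomial equations between the ratios, and every choice of logarithms is
    realised by some path system. Hence the locus is algebraic, and two path
    systems differ by a discrete ambiguity, which gives linearity. The Jacobian
    of the equations has full rank because the period map is an immersion: a
    first order deformation of [omega] with constant periods is the derivative
    of a rational function, which vanishes by comparing zeros and poles.
    This yields the codimension, through a dimension count
    by chains of irreducible closed sets. On the universal covering, a connected
    component [Z] of the preimage of the locus is, in the coordinates [phi], locally a
    ball in a fixed linear space; it is analytically irreducible by the identity
    theorem, and the Zariski closure of [phi Z] is that linear space. *)

(** * Norms and strict complex differentiability *)

(** Derivatives are strict: the error bound holds for two points moving independently near [p]. This
    form passes through products and logarithms, and it turns the inverse function theorem into a
    Newton iteration with a fixed matrix. The echelon hypothesis on the whole matrix enters through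
    [n > 0]: a zero row of [A] would give a zero row, or a pivot in the last column, above the
    pivots of [C]. So [A] has full row rank, and the Smith form yields an integral [a] with an
    integral right inverse [s]. An ambiguity [v] of the logarithms is then absorbed by changing them
    by [s v]. Both halves of the dimension count rest on one fact. Where the gradients are
    independent, an equation cannot vanish on a whole component of the locus of the remaining
    equations. Dropping equations therefore lengthens chains, up to the bound given by algebraic
    dependence, and adding coordinate hyperplanes produces a chain of the right length. Analytic
    sets are cut out by complex differentiable functions, so the identity theorem starts from
    Goursat: applied to [F z / z^k] on a square, it forces [F 1 = 0] as [k] grows. *)

Section ComplexModulus.
Context (R : realType).
Implicit Types (z w : R[i]) (r : R).

(** The norm of [R[i]] takes its values in [R[i]]; a modulus with values in [R] makes the estimates
    accessible to real arithmetic. *)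
Definition absc z : R := Num.sqrt (complex.Re z ^+ 2 + complex.Im z ^+ 2).

Lemma absc_norm z : `|z| = (absc z)%:C.
Proof. by rewrite normc_def. Qed.

Lemma absc_ge0 z : 0 <= absc z.
Proof. exact: sqrtr_ge0. Qed.

Lemma absc0 : absc 0 = 0.
Proof. by rewrite /absc /= expr0n addr0 sqrtr0. Qed.

Lemma absc1 : absc 1 = 1.
Proof. by rewrite /absc /= expr0n expr1n addr0 sqrtr1. Qed.

Lemma abscN z : absc (- z) = absc z.
Proof. by case: z => a b; rewrite /absc /= !sqrrN. Qed.

Lemma abscM z w : absc (z * w) = absc z * absc w.
Proof. by apply: (inj_eq (@complexI _)).1 || (apply: complexI; rewrite rmorphM /= -!absc_norm normrM). Qed.

Lemma ler_abscD z w : absc (z + w) <= absc z + absc w.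
Proof. by rewrite -lecR rmorphD /= -!absc_norm ler_normD. Qed.

Lemma ler_abscB z w : absc (z - w) <= absc z + absc w.
Proof. by rewrite (le_trans (ler_abscD _ _)) // abscN. Qed.

Lemma abscB z w : absc (z - w) = absc (w - z).
Proof. by rewrite -abscN opprB. Qed.

Lemma absc_eq0 z : (absc z == 0) = (z == 0).
Proof. by rewrite -(inj_eq (@complexI _)) -absc_norm normr_eq0. Qed.

Lemma absc_gt0 z : (0 < absc z) = (z != 0).
Proof. by rewrite lt_neqAle absc_ge0 andbT eq_sym absc_eq0. Qed.

Lemma abscV z : absc z^-1 = (absc z)^-1.
Proof. by apply: complexI; rewrite -absc_norm normfV absc_norm fmorphV. Qed.

Lemma absc_Re z : `|complex.Re z| <= absc z.
Proof.
rewrite -sqrtr_sqr ler_wsqrtr // lerDl sqr_ge0 //.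
Qed.

Lemma absc_Im z : `|complex.Im z| <= absc z.
Proof. by rewrite -sqrtr_sqr ler_wsqrtr // lerDr sqr_ge0. Qed.

Lemma absc_le z : absc z <= `|complex.Re z| + `|complex.Im z|.
Proof.
case: z => a b.
have -> : a +i* b = a%:C + (0 +i* b) by apply/eqP; rewrite eq_complex /= addr0 add0r !eqxx.
rewrite (le_trans (ler_abscD _ _)) // /absc /= expr0n addr0 add0r !sqrtr_sqr.
by rewrite addr0 add0r.
Qed.

Lemma absc_real r : absc r%:C = `|r|.
Proof. by rewrite /absc /= expr0n addr0 sqrtr_sqr. Qed.

Lemma absc_i r : absc (0 +i* r) = `|r|.
Proof. by rewrite /absc /= expr0n add0r sqrtr_sqr. Qed.

Lemma ler_abs_absc z w : `|absc z - absc w| <= absc (z - w).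
Proof.
have h1 := ler_abscD (z - w) w; have h2 := ler_abscD (w - z) z.
rewrite !subrK in h1 h2; rewrite (abscB w z) in h2.
by rewrite ler_norml; lra.
Qed.

Lemma complex_gt0P (e : R[i]) : 0 < e -> exists2 r : R, 0 < r & e = r%:C.
Proof. case: e => a b; rewrite ltcE /= => /andP[/eqP -> h]; by exists a. Qed.

End ComplexModulus.

Section RealNorm.
Context (R : realType).
Implicit Types N : nat.

(** A real-valued l1 norm. It defines the same neighbourhoods as the sup norm with values in [R[i]],
    as [nbhs_nrmP] shows. *)
Definition nrm N (v : 'rV[R[i]]_N) : R := \sum_j absc (v 0 j).

Lemma nrm_ge0 N (v : 'rV[R[i]]_N) : 0 <= nrm v.
Proof. by apply: sumr_ge0 => j _; exact: absc_ge0. Qed.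

Lemma nrm0 N : nrm (0 : 'rV[R[i]]_N) = 0.
Proof. by rewrite /nrm big1 // => j _; rewrite mxE absc0. Qed.

Lemma nrmN N (v : 'rV[R[i]]_N) : nrm (- v) = nrm v.
Proof. by apply: eq_bigr => j _; rewrite mxE abscN. Qed.

Lemma nrmBC N (v w : 'rV[R[i]]_N) : nrm (v - w) = nrm (w - v).
Proof. by rewrite -nrmN opprB. Qed.

Lemma ler_nrmD N (v w : 'rV[R[i]]_N) : nrm (v + w) <= nrm v + nrm w.
Proof. by rewrite -big_split ler_sum // => j _; rewrite mxE ler_abscD. Qed.

Lemma ler_nrmB N (v w : 'rV[R[i]]_N) : nrm (v - w) <= nrm v + nrm w.
Proof. by rewrite (le_trans (ler_nrmD _ _)) // nrmN. Qed.

Lemma ler_nrm_trans N (u v w : 'rV[R[i]]_N) : nrm (v - w) <= nrm (v - u) + nrm (u - w).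
Proof. by rewrite (le_trans _ (ler_nrmD _ _)) // addrA subrK. Qed.

Lemma nrmZ N a (v : 'rV[R[i]]_N) : nrm (a *: v) = absc a * nrm v.
Proof. by rewrite /nrm mulr_sumr; apply: eq_bigr => j _; rewrite mxE abscM. Qed.

Lemma ler_coord_nrm N (v : 'rV[R[i]]_N) j : absc (v 0 j) <= nrm v.
Proof.
rewrite /nrm (bigD1 j) //= lerDl sumr_ge0 // => k _; exact: absc_ge0.
Qed.

Lemma nrm_eq0 N (v : 'rV[R[i]]_N) : nrm v = 0 -> v = 0.
Proof.
move=> h; apply/rowP => j; rewrite mxE; apply/eqP; rewrite -absc_eq0 eq_le absc_ge0 andbT.
by rewrite -h ler_coord_nrm.
Qed.

Lemma mulmx_bounded N N' (D : 'M[R[i]]_(N, N')) :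
  exists2 K : R, 0 < K & forall v : 'rV_N, nrm (v *m D) <= K * nrm v.
Proof.
(* The summand 1 keeps the bound positive when [D = 0], so that radii can be divided by it. *)
exists (1 + \sum_i nrm (row i D)).
  by rewrite ltr_wpDr // sumr_ge0 // => i _; exact: nrm_ge0.
move=> v; rewrite mulrDl mul1r mulmx_sum_row.
have h : nrm (\sum_i v 0 i *: row i D) <= \sum_i nrm (v 0 i *: row i D).
  elim/big_rec2: _ => [|i y x _ h]; first by rewrite nrm0.
  by rewrite (le_trans (ler_nrmD _ _)) // lerD2l.
rewrite (le_trans h) // ler_wpDl ?nrm_ge0 //.
rewrite mulr_suml ler_sum // => i _; rewrite nrmZ mulrC ler_wpM2l ?nrm_ge0 //.
exact: ler_coord_nrm.
Qed.

Lemma nbhs_nrmP N (p : 'rV[R[i]]_N) (P : set 'rV[R[i]]_N) :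
  nbhs p P <-> exists2 e : R, 0 < e & forall q, nrm (q - p) < e -> P q.
Proof.
split.
  move=> /nbhs_ballP[e /= /complex_gt0P[r r0 ->] h]; exists r => // q hq.
  apply: h; split; first by rewrite ltcR.
  move=> i j; rewrite /ball /= !ord1 absc_norm ltcR.
  apply: le_lt_trans hq; rewrite nrmBC -/(nrm _).
  by have := ler_coord_nrm (p - q) j; rewrite !mxE.
move=> [e e0 h]; apply/nbhs_ballP.
exists (e / (N.+1)%:R)%:C => /=; first by rewrite ltcR divr_gt0.
move=> q hq; apply: h.
have {hq}hq j : absc ((q - p) 0 j) < e / N.+1%:R.
  by have := hq.2 0 j; rewrite /ball /= absc_norm ltcR !mxE abscB.
have : nrm (q - p) <= N%:R * (e / N.+1%:R).
  have -> : N%:R * (e / N.+1%:R) = \sum_(j < N) (e / N.+1%:R).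
    by rewrite sumr_const card_ord mulr_natl.
  rewrite /nrm.
  by apply: ler_sum => j _; apply: ltW.
move/le_lt_trans; apply; rewrite mulrCA gtr_pMr // ltr_pdivrMr // mul1r ltr_nat //.
Qed.

Lemma nbhs_abscP (p : R[i]) (P : set R[i]) :
  nbhs p P <-> exists2 e : R, 0 < e & forall q, absc (q - p) < e -> P q.
Proof.
split.
  move=> /nbhs_ballP[e /= /complex_gt0P[r r0 ->] h]; exists r => // q hq.
  by apply: h; rewrite /ball /= absc_norm ltcR abscB.
move=> [e e0 h]; apply/nbhs_ballP.
exists e%:C => /=; first by rewrite ltcR.
by move=> q; rewrite /ball /= absc_norm ltcR abscB => /h.
Qed.

End RealNorm.

(** * Strict complex derivatives and their calculus *)

Section StrictDerivative.
Context (R : realType).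
Local Notation C := R[i].

Lemma mulmx_colE N N' (u : 'rV[C]_N) (D : 'M[C]_(N, N')) j :
  (u *m col j D) 0 0 = (u *m D) 0 j.
Proof. by rewrite !mxE; apply: eq_bigr => i _; rewrite mxE. Qed.

Lemma mulmx_scaleE N (u : 'rV[C]_N) (a : C) (d : 'cV[C]_N) :
  (u *m (a *: d)) 0 0 = a * (u *m d) 0 0.
Proof. by rewrite -scalemxAr mxE. Qed.

Lemma mulmx_addE N (u : 'rV[C]_N) (d d' : 'cV[C]_N) :
  (u *m (d + d')) 0 0 = (u *m d) 0 0 + (u *m d') 0 0.
Proof. by rewrite mulmxDr mxE. Qed.

(** Strict differentiability: both [z] and [w] move near the base point. The bound on differences
    replaces any mean value inequality and contains a local Lipschitz estimate. *)
Definition sdiffC (f : C -> C) (a c : C) : Prop :=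
  forall e : R, 0 < e -> exists2 d : R, 0 < d & forall z w : C,
    absc (z - a) < d -> absc (w - a) < d ->
    absc (f z - f w - c * (z - w)) <= e * absc (z - w).

Definition sdiff1 N (f : 'rV[C]_N -> C) (p : 'rV[C]_N) (d : 'cV[C]_N) : Prop :=
  forall e : R, 0 < e -> exists2 r : R, 0 < r & forall x y,
    nrm (x - p) < r -> nrm (y - p) < r ->
    absc (f x - f y - ((x - y) *m d) 0 0) <= e * nrm (x - y).

Definition sdiff N N' (F : 'rV[C]_N -> 'rV[C]_N') (p : 'rV[C]_N)
    (D : 'M[C]_(N, N')) : Prop :=
  forall e : R, 0 < e -> exists2 r : R, 0 < r & forall x y,
    nrm (x - p) < r -> nrm (y - p) < r ->
    nrm (F x - F y - (x - y) *m D) <= e * nrm (x - y).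

Lemma sdiffP N N' (F : 'rV[C]_N -> 'rV[C]_N') p D :
  (forall j, sdiff1 (fun x => F x 0 j) p (col j D)) -> sdiff F p D.
Proof.
move=> h e e0.
have e1 : 0 < e / N'.+1%:R by rewrite divr_gt0.
have {}h j : exists r : R, 0 < r /\ forall x y, nrm (x - p) < r -> nrm (y - p) < r ->
    absc (F x 0 j - F y 0 j - ((x - y) *m col j D) 0 0) <= e / N'.+1%:R * nrm (x - y).
  by have [r r0 hr] := h j _ e1; exists r.
have [r hr] := choice h.
have [r0 [r00 hr0]] : exists r0 : R, 0 < r0 /\ forall j, r0 <= r j.
  exists (\big[Num.min/1]_j r j); split.
    elim/big_ind: _ => // [x y hx hy|j _]; first by rewrite lt_min hx.
    by have [] := hr j.
  by move=> j; rewrite (bigD1 j) //= ge_min lexx.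
exists r0 => // x y hx hy.
have hj j : absc ((F x - F y - (x - y) *m D) 0 j) <= e / N'.+1%:R * nrm (x - y).
  have [_] := hr j; move/(_ x y (lt_le_trans hx (hr0 j)) (lt_le_trans hy (hr0 j))).
  by apply: le_trans; rewrite mulmx_colE [in leLHS]mxE [in leLHS]mxE ![(- _ : 'rV__) _ _]mxE.
have -> : e * nrm (x - y) = N'.+1%:R * (e / N'.+1%:R * nrm (x - y)).
  by rewrite mulrA mulrCA divff ?mulr1 // pnatr_eq0.
apply: (@le_trans _ _ (N'%:R * (e / N'.+1%:R * nrm (x - y)))); last first.
  by rewrite ler_wpM2r ?ler_nat // mulr_ge0 ?nrm_ge0 ?ltW.
have -> : N'%:R * (e / N'.+1%:R * nrm (x - y)) = \sum_(j < N') (e / N'.+1%:R * nrm (x - y)).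
  by rewrite sumr_const card_ord mulr_natl.
exact: ler_sum.
Qed.

Lemma sdiff1_lip N (f : 'rV[C]_N -> C) p d : sdiff1 f p d ->
  exists K r : R, [/\ 0 < K, 0 < r & forall x y, nrm (x - p) < r -> nrm (y - p) < r ->
    absc (f x - f y) <= K * nrm (x - y)].
Proof.
move=> /(_ _ ltr01)[r r0 hr]; have [K K0 hK] := mulmx_bounded d.
exists (1 + K), r; split => // [|x y hx hy]; first exact: addr_gt0.
have {}hr := hr x y hx hy.
have := ler_abscD (f x - f y - ((x - y) *m d) 0 0) (((x - y) *m d) 0 0).
rewrite subrK => /le_trans; apply; rewrite mulrDl lerD //.
by apply: le_trans (hK _); exact: ler_coord_nrm.
Qed.

Lemma sdiff1_cts N (f : 'rV[C]_N -> C) p d : sdiff1 f p d ->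
  forall e : R, 0 < e -> exists2 r : R, 0 < r & forall x, nrm (x - p) < r -> absc (f x - f p) < e.
Proof.
move=> /sdiff1_lip[K [r [K0 r0 hr]]] e e0.
exists (Num.min r (e / K)); first by rewrite lt_min r0 divr_gt0.
move=> x; rewrite lt_min => /andP[h1 h2].
apply: le_lt_trans (hr x p h1 _) _; first by rewrite subrr nrm0.
by rewrite mulrC -ltr_pdivlMr.
Qed.

Lemma sdiff1_cst N c p : sdiff1 (fun _ : 'rV[C]_N => c) p 0.
Proof.
move=> e e0; exists 1 => // x y _ _.
by rewrite mulmx0 mxE !subrr absc0 mulr_ge0 ?nrm_ge0 // ltW.
Qed.

Lemma sdiff1_coord N j p : sdiff1 (fun x : 'rV[C]_N => x 0 j) p (delta_mx j 0).
Proof.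
move=> e e0; exists 1 => // x y _ _.
have -> : ((x - y) *m (delta_mx j 0 : 'cV_N)) 0 0 = x 0 j - y 0 j.
  rewrite mxE (bigD1 j) //= big1 ?addr0; last first.
    by move=> i ij; rewrite !mxE (negPf ij) mulr0.
  by rewrite !mxE !eqxx mulr1.
by rewrite subrr absc0 mulr_ge0 ?nrm_ge0 // ltW.
Qed.

Lemma sdiff1_add N (f g : 'rV[C]_N -> C) p df dg :
  sdiff1 f p df -> sdiff1 g p dg -> sdiff1 (fun x => f x + g x) p (df + dg).
Proof.
move=> hf hg e e0; have e2 : 0 < e / 2 by rewrite divr_gt0.
have [r r0 hr] := hf _ e2; have [s s0 hs] := hg _ e2.
exists (Num.min r s); first by rewrite lt_min r0.
move=> x y; rewrite !lt_min => /andP[x1 x2] /andP[y1 y2].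
have -> : f x + g x - (f y + g y) - ((x - y) *m (df + dg)) 0 0 =
  (f x - f y - ((x - y) *m df) 0 0) + (g x - g y - ((x - y) *m dg) 0 0).
  by rewrite mulmxDr mxE; ring.
apply: le_trans (ler_abscD _ _) _.
have -> : e * nrm (x - y) = e / 2 * nrm (x - y) + e / 2 * nrm (x - y) by field.
by rewrite lerD ?hr ?hs.
Qed.

Lemma sdiff1_mul N (f g : 'rV[C]_N -> C) p df dg :
  sdiff1 f p df -> sdiff1 g p dg ->
  sdiff1 (fun x => f x * g x) p (g p *: df + f p *: dg).
Proof.
move=> hf hg e e0.
have [Kf Kf0 hKf] := mulmx_bounded df; have [Kg Kg0 hKg] := mulmx_bounded dg.
have G0 : 0 < absc (g p) + 1 by rewrite ltr_wpDl ?absc_ge0.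
have F0 : 0 < absc (f p) + 1 by rewrite ltr_wpDl ?absc_ge0.
have e4 : 0 < e / 4 by rewrite divr_gt0.
have [r1 r10 h1] := hf _ (divr_gt0 e4 G0).
have [r2 r20 h2] := hg _ (divr_gt0 e4 F0).
have [r3 r30 h3] := sdiff1_cts hg ltr01.
have [r4 r40 h4] := sdiff1_cts hf ltr01.
have [r5 r50 h5] := sdiff1_cts hg (divr_gt0 e4 Kf0).
have [r6 r60 h6] := sdiff1_cts hf (divr_gt0 e4 Kg0).
exists (Num.min (Num.min r1 r2) (Num.min (Num.min r3 r4) (Num.min r5 r6))).
  by rewrite !lt_min r10 r20 r30 r40 r50 r60.
move=> x y; rewrite !lt_min => /and3P[/andP[x1 x2] /andP[x3 x4] /andP[x5 x6]].
move=> /and3P[/andP[y1 y2] /andP[y3 y4] /andP[y5 y6]].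
set u := x - y; set n := nrm u.
have n0 : 0 <= n by exact: nrm_ge0.
have -> : f x * g x - f y * g y - (u *m (g p *: df + f p *: dg)) 0 0 =
  (f x - f y - (u *m df) 0 0) * g x + f y * (g x - g y - (u *m dg) 0 0) +
  ((u *m df) 0 0 * (g x - g p) + (u *m dg) 0 0 * (f y - f p)).
  rewrite mulmx_addE !mulmx_scaleE.
  by move: ((u *m df) 0 0) ((u *m dg) 0 0) => a b; ring.
have a1 : absc ((f x - f y - (u *m df) 0 0) * g x) <= e / 4 * n.
  rewrite abscM; have gx : absc (g x) <= absc (g p) + 1.
    have := ler_abscD (g x - g p) (g p); rewrite subrK => /le_trans; apply.
    by rewrite addrC lerD2l ltW // h3.
  apply: (@le_trans _ _ (e / 4 / (absc (g p) + 1) * n * (absc (g p) + 1))).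
    by apply: ler_pM; rewrite ?absc_ge0 // h1.
  by rewrite mulrAC divfK // gt_eqF.
have a2 : absc (f y * (g x - g y - (u *m dg) 0 0)) <= e / 4 * n.
  rewrite abscM; have fy : absc (f y) <= absc (f p) + 1.
    have := ler_abscD (f y - f p) (f p); rewrite subrK => /le_trans; apply.
    by rewrite addrC lerD2l ltW // h4.
  apply: (@le_trans _ _ ((absc (f p) + 1) * (e / 4 / (absc (f p) + 1) * n))).
    by apply: ler_pM; rewrite ?absc_ge0 // h2.
  by rewrite mulrC mulrAC divfK // gt_eqF.
have a3 : absc ((u *m df) 0 0 * (g x - g p)) <= e / 4 * n.
  rewrite abscM; apply: (@le_trans _ _ (Kf * n * (e / 4 / Kf))).
    apply: ler_pM; rewrite ?absc_ge0 //; last by apply: ltW; exact: h5.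
    by apply: le_trans (hKf u); exact: ler_coord_nrm.
  by rewrite mulrAC mulrCA divff ?mulr1 // gt_eqF.
have a4 : absc ((u *m dg) 0 0 * (f y - f p)) <= e / 4 * n.
  rewrite abscM; apply: (@le_trans _ _ (Kg * n * (e / 4 / Kg))).
    apply: ler_pM; rewrite ?absc_ge0 //; last by apply: ltW; exact: h6.
    by apply: le_trans (hKg u); exact: ler_coord_nrm.
  by rewrite mulrAC mulrCA divff ?mulr1 // gt_eqF.
apply: le_trans (ler_abscD _ _) _.
apply: (@le_trans _ _ ((e / 4 * n + e / 4 * n) + (e / 4 * n + e / 4 * n))); last by lra.
by apply: lerD; apply: le_trans (ler_abscD _ _) _; exact: lerD.
Qed.

Lemma sdiff1_comp N (f : 'rV[C]_N -> C) p df (g : C -> C) c :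
  sdiff1 f p df -> sdiffC g (f p) c -> sdiff1 (fun x => g (f x)) p (c *: df).
Proof.
move=> hf hg e e0.
have [K [r1 [K0 r10 hK]]] := sdiff1_lip hf.
have e2 : 0 < e / 2 by rewrite divr_gt0.
have c0 : 0 < absc c + 1 by rewrite ltr_wpDl ?absc_ge0.
have [d d0 hd] := hg _ (divr_gt0 e2 K0).
have [r2 r20 h2] := sdiff1_cts hf d0.
have [r3 r30 h3] := hf _ (divr_gt0 e2 c0).
exists (Num.min r1 (Num.min r2 r3)); first by rewrite !lt_min r10 r20.
move=> x y; rewrite !lt_min => /and3P[x1 x2 x3] /and3P[y1 y2 y3].
have -> : g (f x) - g (f y) - ((x - y) *m (c *: df)) 0 0 =
  (g (f x) - g (f y) - c * (f x - f y)) + c * (f x - f y - ((x - y) *m df) 0 0).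
  by rewrite mulmx_scaleE; ring.
apply: le_trans (ler_abscD _ _) _.
have -> : e * nrm (x - y) = e / 2 * nrm (x - y) + e / 2 * nrm (x - y) by field.
apply: lerD.
  apply: le_trans (hd _ _ (h2 _ x2) (h2 _ y2)) _.
  apply: (@le_trans _ _ (e / 2 / K * (K * nrm (x - y)))).
    by rewrite ler_wpM2l ?hK // ltW // divr_gt0.
  by rewrite mulrA divfK // gt_eqF.
rewrite abscM; apply: (@le_trans _ _ ((absc c + 1) * (e / 2 / (absc c + 1) * nrm (x - y)))).
  by apply: ler_pM; rewrite ?absc_ge0 ?h3 // lerDl.
by rewrite mulrA [_ * (_ / _)]mulrC divfK // gt_eqF.
Qed.

Lemma sdiffC_inv (a : C) : a != 0 -> sdiffC (fun z => z^-1) a (- a^-1 ^+ 2).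
Proof.
rewrite -absc_gt0 => a0 e e0.
set A := absc a in a0 *.
have e1 : 0 < Num.min (A / 2) (e * A ^+ 4 / 16 / (A + 1)).
  by rewrite lt_min !divr_gt0 // ?ltr_wpDl ?mulr_gt0 ?exprn_gt0 // ltW.
exists (Num.min 1 (Num.min (A / 2) (e * A ^+ 4 / 16 / (A + 1)))); first by rewrite lt_min ltr01.
move=> z w; rewrite !lt_min => /and3P[z0 z1 z2] /and3P[w0 w1 w2].
have hz : A / 2 < absc z.
  have := ler_abscD (a - z) z; rewrite subrK abscB; rewrite -/A; lra.
have hw : A / 2 < absc w.
  have := ler_abscD (a - w) w; rewrite subrK abscB; rewrite -/A; lra.
have zn : z != 0 by rewrite -absc_gt0; lra.
have wn : w != 0 by rewrite -absc_gt0; lra.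
have an : a != 0 by rewrite -absc_gt0.
(* The first factor is [z w - a^2], which is small, while [z], [w] and [a] stay away from 0. *)
have -> : z^-1 - w^-1 - - a^-1 ^+ 2 * (z - w) =
  ((z - a) * w + a * (w - a)) * (z * w * a ^+ 2)^-1 * (z - w).
  by field; rewrite zn wn an.
rewrite abscM ler_wpM2r ?absc_ge0 // abscM abscV.
rewrite !abscM -/A.
have hW : absc w < A + 1.
  by have := ler_abscD (w - a) a; rewrite subrK; rewrite -/A; lra.
have hD : A ^+ 4 / 4 <= absc z * absc w * (A * A).
  have -> : A ^+ 4 / 4 = (A / 2 * (A / 2)) * (A * A) by field.
  by rewrite ler_wpM2r ?mulr_ge0 ?ltW // ltr_pM // ?divr_ge0 // ltW.
have D0 : 0 < A ^+ 4 / 4 by rewrite divr_gt0 // exprn_gt0.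
rewrite ler_pdivrMr; last exact: lt_le_trans hD.
apply: (@le_trans _ _ (e * (A ^+ 4 / 4))); last by rewrite ler_wpM2l // ltW.
set t := e * A ^+ 4 / 16 / (A + 1) in z2 w2.
have tE : t * (A + 1) = e * A ^+ 4 / 16 by rewrite /t divfK // gt_eqF // ltr_wpDl // ltW.
apply: le_trans (ler_abscD _ _) _; rewrite !abscM -/A.
have b1 : absc (z - a) * absc w <= t * (A + 1).
  by apply: ler_pM; rewrite ?absc_ge0 // ltW.
have b2 : A * absc (w - a) <= (A + 1) * t.
  by apply: ler_pM; rewrite ?absc_ge0 // ltW // ltr_pwDr.
have -> : e * (A ^+ 4 / 4) = 4 * (e * A ^+ 4 / 16) by field.
have := mulr_ge0 (ltW e0) (exprn_ge0 4 (ltW a0)).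
rewrite -tE in b1 b2 *; lra.
Qed.

Lemma sdiff1_inv N (f : 'rV[C]_N -> C) p df : f p != 0 -> sdiff1 f p df ->
  sdiff1 (fun x => (f x)^-1) p (- (f p)^-1 ^+ 2 *: df).
Proof. by move=> fp hf; exact: sdiff1_comp hf (sdiffC_inv fp). Qed.

Lemma sdiff1_near N (f g : 'rV[C]_N -> C) p d :
  (exists2 r : R, 0 < r & forall x, nrm (x - p) < r -> f x = g x) ->
  sdiff1 f p d -> sdiff1 g p d.
Proof.
move=> [r r0 h] hf e e0; have [s s0 hs] := hf _ e0.
exists (Num.min r s); first by rewrite lt_min r0.
move=> x y; rewrite !lt_min => /andP[x1 x2] /andP[y1 y2].
by rewrite -!h //; exact: hs.
Qed.

(** A continuous lift [L] of [h] through [g] is as regular as [h]. Since [g] is nearly [c] times the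
    identity, [L] is first seen to be Lipschitz; the error of [g] is then negligible and dividing by
    [c] gives the derivative. The case [g = cexp] handles logarithms depending on parameters. *)
Lemma sdiff1_lift N (L h : 'rV[C]_N -> C) p dh (g : C -> C) c :
  c != 0 -> sdiffC g (L p) c -> sdiff1 h p dh ->
  (exists2 r : R, 0 < r & forall x, nrm (x - p) < r -> g (L x) = h x) ->
  (forall e : R, 0 < e -> exists2 r : R, 0 < r & forall x, nrm (x - p) < r -> absc (L x - L p) < e) ->
  sdiff1 L p (c^-1 *: dh).
Proof.
move=> c0 hg hh [r r0 hr] hL e e0.
have [K [r1 [K0 r10 hK]]] := sdiff1_lip hh.
have ca : 0 < absc c by rewrite absc_gt0.
have c2 : 0 < absc c / 2 by rewrite divr_gt0.
(* Chosen so that [e2] times the Lipschitz constant [2 K / |c|] of [L] is half of the allowed error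
   [e |c|]. *)
set e2 := e / 2 * absc c / (2 * K / absc c).
have e20 : 0 < e2 by rewrite /e2 !(divr_gt0, mulr_gt0).
have [d1 d10 hd1] := hg _ c2.
have [d2 d20 hd2] := hg _ e20.
have [s1 s10 hs1] := hL _ d10; have [s2 s20 hs2] := hL _ d20.
have e3 : 0 < e / 2 * absc c by rewrite mulr_gt0 // divr_gt0.
have [r2 r20 h2] := hh _ e3.
exists (Num.min (Num.min r r1) (Num.min r2 (Num.min s1 s2))).
  by rewrite !lt_min r0 r10 r20 s10.
move=> x y; rewrite !lt_min => /and4P[/andP[x1 x2] x3 x4 x5] /and4P[/andP[y1 y2] y3 y4 y5].
set n := nrm (x - y).
have lip : absc (L x - L y) <= 2 * K / absc c * n.
  have q1 := hd1 _ _ (hs1 _ x4) (hs1 _ y4).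
  have := ler_abscB (h x - h y) (g (L x) - g (L y) - c * (L x - L y)).
  rewrite !hr // opprB addrC subrK => q2.
  have q3 := hK _ _ x2 y2; rewrite -/n in q3.
  rewrite abscM in q2; rewrite !hr // in q1.
  have {q1 q2 q3} : absc c * absc (L x - L y) <= 2 * (K * n) by lra.
  rewrite -ler_pdivlMl // => /le_trans; apply.
  by have -> : (absc c)^-1 * (2 * (K * n)) = 2 * K / absc c * n by ring.
have -> : L x - L y - ((x - y) *m (c^-1 *: dh)) 0 0 =
  c^-1 * ((h x - h y - ((x - y) *m dh) 0 0) - (g (L x) - g (L y) - c * (L x - L y))).
  rewrite !hr // mulmx_scaleE.
  by move: ((_ *m dh) 0 0) => a; field.
rewrite abscM abscV ler_pdivrMl //.
apply: le_trans (ler_abscB _ _) _.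
have -> : absc c * (e * n) = e / 2 * absc c * n + e / 2 * absc c * n by field.
apply: lerD; first exact: h2.
apply: le_trans (hd2 _ _ (hs2 _ x5) (hs2 _ y5)) _.
apply: (@le_trans _ _ (e2 * (2 * K / absc c * n))); first by rewrite ler_wpM2l // ltW.
rewrite mulrA /e2 divfK // gt_eqF // divr_gt0 // mulr_gt0 //.
Qed.

End StrictDerivative.

(** * The inverse function theorem *)

Section InverseFunction.
Context (R : realType).
Local Notation C := R[i].

(** With [q k = K / 2^k], the sequence [a k - 2 q k] increases and [a k + 2 q k] decreases; the
    limit is the supremum of the first one. *)
Lemma geometric_cauchy (a : nat -> R) (K : R) : 0 <= K ->
  (forall k, `|a k.+1 - a k| <= K / 2 ^+ k) ->
  exists l, forall k, `|a k - l| <= 2 * K / 2 ^+ k.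
Proof.
move=> K0 h.
have p2 k : 0 < (2 : R) ^+ k by rewrite exprn_gt0.
pose q k := K / 2 ^+ k.
have qS k : q k = 2 * q k.+1 by rewrite /q exprS; field; rewrite gt_eqF.
have q0 k : 0 <= q k by rewrite /q divr_ge0 // ltW.
have st k : `|a k.+1 - a k| <= q k by exact: h.
have up : forall k d, a (k + d)%N - 2 * q (k + d)%N >= a k - 2 * q k.
  move=> k; elim=> [|d IH]; rewrite ?addn0 // addnS.
  apply: le_trans IH _; have := st (k + d)%N; have := qS (k + d)%N.
  by rewrite ler_norml => -> /andP[]; lra.
have dn : forall k d, a (k + d)%N + 2 * q (k + d)%N <= a k + 2 * q k.
  move=> k; elim=> [|d IH]; rewrite ?addn0 // addnS.
  apply: le_trans _ IH; have := st (k + d)%N; have := qS (k + d)%N.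
  by rewrite ler_norml => -> /andP[]; lra.
have cr j k : a j - 2 * q j <= a k + 2 * q k.
  have [jk|/ltnW kj] := leqP j k.
    by have := up j (k - j)%N; rewrite subnKC //; have := q0 k; lra.
  by have := dn k (j - k)%N; rewrite subnKC //; have := q0 j; lra.
pose E := [set a j - 2 * q j | j in setT].
have hs : has_sup E.
  split; first by exists (a 0%N - 2 * q 0%N); exists 0%N.
  by exists (a 0%N + 2 * q 0%N) => _ [j _ <-].
exists (sup E) => k.
have l1 : a k - 2 * q k <= sup E by apply: sup_upper_bound => //; exists k.
have l2 : sup E <= a k + 2 * q k by apply: sup_le_ub; [case: hs | move=> _ [j _ <-]].
have -> : 2 * K / 2 ^+ k = 2 * q k by rewrite mulrA.
by rewrite ler_norml; lra.
Qed.

Lemma nrm_geometric_cauchy N (y : nat -> 'rV[C]_N) (K : R) : 0 <= K ->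
  (forall k, nrm (y k.+1 - y k) <= K / 2 ^+ k) ->
  exists l, forall k, nrm (y k - l) <= N%:R * (4 * K) / 2 ^+ k.
Proof.
move=> K0 h.
have hj j k : absc (y k.+1 0 j - y k 0 j) <= K / 2 ^+ k.
  apply: le_trans (h k); have := ler_coord_nrm (y k.+1 - y k) j.
  by rewrite !mxE.
have hre j : exists l, forall k, `|complex.Re (y k 0 j) - l| <= 2 * K / 2 ^+ k.
  apply: geometric_cauchy => // k; apply: le_trans (hj j k).
  by rewrite -raddfB absc_Re.
have him j : exists l, forall k, `|complex.Im (y k 0 j) - l| <= 2 * K / 2 ^+ k.
  apply: geometric_cauchy => // k; apply: le_trans (hj j k).
  by rewrite -raddfB absc_Im.
have [lr hlr] := choice hre; have [li hli] := choice him.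
exists (\row_j (lr j +i* li j)) => k.
have -> : N%:R * (4 * K) / 2 ^+ k = \sum_(j < N) (2 * K / 2 ^+ k + 2 * K / 2 ^+ k).
  by rewrite sumr_const card_ord mulr_natl -!mulrA -mulrnAl; ring.
apply: ler_sum => j _; apply: le_trans (absc_le _) _.
by apply: lerD; rewrite !mxE raddfB /=.
Qed.

(** Newton iteration [y + (v - F y) E] with the inverse [E] of the derivative at [p] kept fixed.
    Strictness with error [1 / (2 K)], where [K] bounds [E], halves the correction at each step. The
    same estimate gives the lower Lipschitz bound, and the radius [c rho] makes the openness
    quantitative. *)
Lemma inverse_function N N' (F : 'rV[C]_N -> 'rV[C]_N') p (D : 'M[C]_(N, N')) (E : 'M[C]_(N', N)) :
  sdiff F p D -> D *m E = 1%:M -> E *m D = 1%:M ->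
  exists r c : R, [/\ 0 < r, 0 < c,
    forall x y, nrm (x - p) < r -> nrm (y - p) < r -> c * nrm (x - y) <= nrm (F x - F y)
  & forall x rho v, 0 < rho -> nrm (x - p) + rho <= r -> nrm (v - F x) < c * rho ->
      exists2 y, nrm (y - x) < rho & F y = v].
Proof.
move=> hF DE ED.
have [K K0 hK] := mulmx_bounded E.
have DK (v : 'rV_N) : v *m D *m E = v by rewrite -mulmxA DE mulmx1.
have EK (v : 'rV_N') : v *m E *m D = v by rewrite -mulmxA ED mulmx1.
have e0 : 0 < (2 * K)^-1 by rewrite invr_gt0 mulr_gt0.
have [r r0 hr] := hF _ e0.
exists r, (2 * K)^-1; split => //.
  move=> x y hx hy; rewrite mulrC ler_pdivrMr ?mulr_gt0 //.
  have h1 := hK ((x - y) *m D); rewrite DK in h1.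
  have h2 := ler_nrmB (F x - F y) (F x - F y - (x - y) *m D).
  rewrite opprB addrC subrK in h2.
  have h3 := hr x y hx hy.
  have h4 : K * nrm ((x - y) *m D) <= K * (nrm (F x - F y) + (2 * K)^-1 * nrm (x - y)).
    by rewrite ler_wpM2l ?(ltW K0) //; apply: le_trans h2 _; rewrite lerD2l.
  have h5 : K * (nrm (F x - F y) + (2 * K)^-1 * nrm (x - y)) =
    K * nrm (F x - F y) + nrm (x - y) / 2 by field; rewrite gt_eqF.
  by rewrite h5 in h4; lra.
move=> x rho v rho0 xr hv.
(* [eta] bounds the first correction. The later ones are at most [eta / 2^k], so all iterates stay
   within [2 eta < rho] of [x], inside the ball where the strict estimate holds. *)
set eta := K * nrm (v - F x).
have eta0 : 0 <= eta by rewrite mulr_ge0 ?nrm_ge0 // ltW.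
have eta1 : eta < rho / 2.
  have -> : rho / 2 = K * ((2 * K)^-1 * rho) by field; rewrite gt_eqF.
  by rewrite ltr_pM2l.
pose T y := y + (v - F y) *m E.
pose y k := iter k T x.
have yS k : y k.+1 - y k = (v - F (y k)) *m E by rewrite /y /= {1}/T addrC addKr.
have main k : nrm (y k - x) <= 2 * eta - 2 * eta / 2 ^+ k /\ nrm (y k.+1 - y k) <= eta / 2 ^+ k.
  elim: k => [|k [h1 h2]].
    by rewrite expr0 !divr1 subrr nrm0 subrr yS; split => //; exact: hK.
  have p0 : 0 < 2 ^+ k :> R by rewrite exprn_gt0.
  have q0 : 0 <= eta / 2 ^+ k by rewrite divr_ge0 // ltW.
  have A1 : eta / 2 ^+ k.+1 = eta / 2 ^+ k / 2 by rewrite exprS; field; rewrite gt_eqF.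
  have h3 : nrm (y k.+1 - x) <= 2 * eta - 2 * eta / 2 ^+ k.+1.
    apply: le_trans (ler_nrm_trans (y k) _ _) _.
    by rewrite -mulrA A1; rewrite -mulrA in h1; lra.
  split => //; rewrite yS.
  have in1 : nrm (y k - p) < r.
    apply: le_lt_trans (ler_nrm_trans x _ _) _; rewrite -mulrA in h1; lra.
  have in2 : nrm (y k.+1 - p) < r.
    apply: le_lt_trans (ler_nrm_trans x _ _) _; rewrite -mulrA A1 in h3; lra.
  have -> : v - F (y k.+1) = - (F (y k.+1) - F (y k) - (y k.+1 - y k) *m D).
    by rewrite yS EK !opprB addrA subrK.
  apply: le_trans (hK _) _; rewrite nrmN A1.
  apply: (@le_trans _ _ (K * ((2 * K)^-1 * (eta / 2 ^+ k)))).
    rewrite ler_wpM2l ?(ltW K0) //; apply: le_trans (hr _ _ in2 in1) _.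
    by rewrite ler_wpM2l // ltW.
  by rewrite le_eqVlt; apply/orP; left; apply/eqP; field; rewrite !gt_eqF.
have [l hl] := nrm_geometric_cauchy eta0 (fun k => (main k).2).
have small (e : R) : 0 < e -> exists k, N%:R * (4 * eta) / 2 ^+ k < e.
  move=> e1; pose B := N%:R * (4 * eta).
  have B0 : 0 <= B by rewrite mulr_ge0 ?ler0n // mulr_ge0.
  exists (Num.bound (B / e)); rewrite -/B ltr_pdivrMr ?exprn_gt0 // mulrC -ltr_pdivrMr //.
  apply: lt_trans (archi_boundP (divr_ge0 B0 (ltW e1))) _.
  by rewrite -natrX ltr_nat ltn_expl.
have lx : nrm (l - x) <= 2 * eta.
  rewrite leNgt; apply/negP => lt.
  have dl : 0 < nrm (l - x) - 2 * eta by rewrite subr_gt0.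
  have [k hk] := small _ dl.
  have h1 := hl k; have [h2 _] := main k; rewrite nrmBC in h1.
  have h3 := ler_nrm_trans (y k) l x.
  have : 0 <= 2 * eta / 2 ^+ k by rewrite divr_ge0 ?exprn_ge0 // mulr_ge0.
  move: hk h1 h2 h3; clear; set B := (N%:R * _ / _); lra.
exists l; first by apply: le_lt_trans lx _; lra.
have lp : nrm (l - p) < r by apply: le_lt_trans (ler_nrm_trans x _ _) _; lra.
apply/eqP; rewrite -subr_eq0; apply/eqP; apply: nrm_eq0; apply/eqP.
rewrite eq_le nrm_ge0 andbT leNgt; apply/negP => lt.
have [M M0 hM] := mulmx_bounded D.
have yp k : nrm (y k - p) < r.
  apply: le_lt_trans (ler_nrm_trans x _ _) _; have [h1 _] := main k.
  have : 0 <= 2 * eta / 2 ^+ k by rewrite divr_ge0 ?exprn_ge0 // mulr_ge0.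
  lra.
set A := M + (M + (2 * K)^-1).
have A0 : 0 < A by rewrite !addr_gt0.
have b1 k : nrm (F l - v) <= A * (N%:R * (4 * eta) / 2 ^+ k) + M * (eta / 2 ^+ k).
  apply: le_trans (ler_nrm_trans (F (y k)) _ _) _.
  have c1 : nrm (F (y k) - v) <= M * (eta / 2 ^+ k).
    have -> : F (y k) - v = - ((y k.+1 - y k) *m D) by rewrite yS EK opprB.
    rewrite nrmN; apply: le_trans (hM _) _; rewrite ler_wpM2l // ?(ltW M0) //.
    by have [] := main k.
  apply: lerD c1.
  have c2 := hr l (y k) lp (yp k).
  have c3 := ler_nrmD (F l - F (y k) - (l - y k) *m D) ((l - y k) *m D).
  rewrite subrK in c3; apply: le_trans c3 _.
  have c4 := hM (l - y k); have c5 := hl k; rewrite nrmBC in c5.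
  apply: (@le_trans _ _ ((M + (2 * K)^-1) * nrm (l - y k))); first by rewrite mulrDl; lra.
  apply: ler_pM => //; rewrite ?nrm_ge0 //; first by rewrite addr_ge0 // ltW.
  by rewrite /A lerDr ltW.
have [k hk] : exists k, (A * (N%:R * (4 * eta)) + M * eta) / 2 ^+ k < nrm (F l - v).
  set B := A * (N%:R * (4 * eta)) + M * eta.
  have B0 : 0 <= B.
    by rewrite addr_ge0 //; apply: mulr_ge0; rewrite ?(ltW A0) ?(ltW M0) // mulr_ge0 ?ler0n // mulr_ge0.
  exists (Num.bound (B / nrm (F l - v))); rewrite ltr_pdivrMr ?exprn_gt0 // mulrC -ltr_pdivrMr //.
  apply: lt_trans (archi_boundP (divr_ge0 B0 (ltW lt))) _.
  by rewrite -natrX ltr_nat ltn_expl.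
have := b1 k; rewrite leNgt => /negP; apply.
by move: hk; rewrite mulrDl -!mulrA.
Qed.

(** The strict estimate of [F] at the points [G x] and [G y], multiplied by [E], is the estimate for
    [G]; the Lipschitz bound on [G] converts its right-hand side into a multiple of
    [nrm (x - y)]. *)
Lemma sdiff_inverse N N' (F : 'rV[C]_N -> 'rV[C]_N') (G : 'rV[C]_N' -> 'rV[C]_N) p
    (D : 'M[C]_(N, N')) (E : 'M[C]_(N', N)) (c : R) (W : set 'rV[C]_N') :
  sdiff F p D -> D *m E = 1%:M -> 0 < c ->
  (exists2 r : R, 0 < r & forall v, nrm (v - F p) < r -> W v) ->
  (forall v, W v -> F (G v) = v) -> G (F p) = p ->
  (forall v w, W v -> W w -> c * nrm (G v - G w) <= nrm (v - w)) ->
  sdiff G (F p) E.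
Proof.
move=> hF DE c0 [r r0 hr] hG Gp lip e e0.
have DK (v : 'rV_N) : v *m D *m E = v by rewrite -mulmxA DE mulmx1.
have [K K0 hK] := mulmx_bounded (E).
have ee : 0 < e * c / K by rewrite divr_gt0 // mulr_gt0.
have [s s0 hs] := hF _ ee.
exists (Num.min r (c * s)); first by rewrite lt_min r0 mulr_gt0.
have Wp : W (F p) by apply: hr; rewrite subrr nrm0.
have near v : nrm (v - F p) < r -> nrm (v - F p) < c * s -> nrm (G v - p) < s.
  move=> h1 h2; have := lip v (F p) (hr _ h1) Wp; rewrite Gp => h3.
  by rewrite -(ltr_pM2l c0); exact: le_lt_trans h3 h2.
move=> x y; rewrite !lt_min => /andP[x1 x2] /andP[y1 y2].
have -> : G x - G y - (x - y) *m E =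
   - ((F (G x) - F (G y) - (G x - G y) *m D) *m E).
  rewrite !hG; [|exact: hr..].
  by rewrite (mulmxBl (x - y)) DK opprB.
rewrite nrmN; apply: le_trans (hK _) _.
have := hs _ _ (near _ x1 x2) (near _ y1 y2) => h1.
have h2 := lip x y (hr _ x1) (hr _ y1).
apply: (@le_trans _ _ (K * (e * c / K * nrm (G x - G y)))); first by rewrite ler_wpM2l // ltW.
have -> : K * (e * c / K * nrm (G x - G y)) = e * (c * nrm (G x - G y)).
  by field; rewrite gt_eqF.
by rewrite ler_wpM2l // ltW.
Qed.

Lemma sdiff_unique N N' (F : 'rV[C]_N -> 'rV[C]_N') p D D' :
  sdiff F p D -> sdiff F p D' -> D = D'.
Proof.
move=> h h'; apply/row_matrixP => i; rewrite !rowE.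
set v := delta_mx 0 i.
apply/eqP; rewrite -subr_eq0 -mulmxBr; apply/eqP/nrm_eq0/eqP.
rewrite eq_le nrm_ge0 andbT leNgt; apply/negP => lt.
have n0 := nrm_ge0 v.
set e := nrm (v *m (D - D')) / (4 * (nrm v + 1)).
have d0 : 0 < 4 * (nrm v + 1) by rewrite mulr_gt0 // ltr_wpDl.
have e0 : 0 < e by rewrite divr_gt0.
have [r r0 hr] := h _ e0; have [s s0 hs] := h' _ e0.
set t := Num.min r s / (2 * (nrm v + 1)).
have m0 : 0 < Num.min r s by rewrite lt_min r0.
have d1 : 0 < 2 * (nrm v + 1) by rewrite mulr_gt0 // ltr_wpDl.
have t0 : 0 < t by rewrite divr_gt0.
have tv : t * nrm v < Num.min r s.
  have : t * (2 * (nrm v + 1)) = Num.min r s by rewrite /t divfK // gt_eqF.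
  have : 0 <= t * nrm v by rewrite mulr_ge0 // ltW.
  by move: t0; set a := Num.min r s; nra.
have nt : nrm (t%:C *: v) = t * nrm v by rewrite nrmZ absc_real gtr0_norm.
have hx : nrm (p + t%:C *: v - p) < Num.min r s by rewrite addrC addKr nt.
have hp : nrm (p - p) < Num.min r s by rewrite subrr nrm0.
move: hx hp; rewrite !lt_min => /andP[x1 x2] /andP[y1 y2].
have q1 := hr _ _ x1 y1; have q2 := hs _ _ x2 y2.
have := ler_nrmB (F (p + t%:C *: v) - F p - (p + t%:C *: v - p) *m D')
                 (F (p + t%:C *: v) - F p - (p + t%:C *: v - p) *m D).
have -> : (p + t%:C *: v - p) = t%:C *: v by rewrite addrC addKr.
set A := F _ - F p.
have -> : A - (t%:C *: v) *m D' - (A - (t%:C *: v) *m D) = t%:C *: (v *m (D - D')).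
  rewrite -!scalemxAl mulmxBr scalerBr.
  by rewrite opprB addrC addrA subrK.
rewrite nrmZ absc_real (gtr0_norm t0) => q3.
have q4 : t * nrm (v *m (D - D')) <= e * (t * nrm v) + e * (t * nrm v).
  have E : p + t%:C *: v - p = t%:C *: v by rewrite addrC addKr.
  by rewrite E nt in q1 q2; apply: le_trans q3 _; exact: lerD.
have q5 : e * (4 * (nrm v + 1)) = nrm (v *m (D - D')) by rewrite /e divfK // gt_eqF.
rewrite -q5 in q4.
have et : 0 < e * t by rewrite mulr_gt0.
have etn : 0 <= e * t * nrm v by rewrite mulr_ge0 // ltW.
have E1 : t * (e * (4 * (nrm v + 1))) = 4 * (e * t * nrm v) + 4 * (e * t) by ring.
have E2 : e * (t * nrm v) = e * t * nrm v by ring.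
rewrite E1 E2 in q4; move: q4 et etn; clear; lra.
Qed.

Lemma norm_le_nrm N (v : 'rV[C]_N) : `|v| <= (nrm v)%:C.
Proof.
have [->|v0] := eqVneq `|v| 0; first by rewrite lecR nrm_ge0.
have [[i j] E] := mx_norm_neq0 v0.
by rewrite [leLHS]E absc_norm lecR /= (ord1 i) ler_coord_nrm.
Qed.

Lemma nrm_le_norm N (v : 'rV[C]_N) : (nrm v)%:C <= N%:R * `|v|.
Proof.
have [r r0 rE] : exists2 r : R, 0 <= r & `|v| = r%:C.
  have := normr_ge0 v; case: (`|v|) => a b; rewrite lecE /= => /andP[/eqP -> a0].
  by exists a.
have hj j : absc (v 0 j) <= r.
  apply/ler_addgt0Pr => e e0; apply: ltW.
  have : ball 0 (r + e)%:C v.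
    rewrite -ball_normE /ball_ /= sub0r normrN rE ltcR ltrDl //.
  by move=> [_ /(_ 0 j)]; rewrite mxE /ball /= sub0r normrN absc_norm ltcR.
rewrite rE; have -> : N%:R * r%:C = (N%:R * r)%:C :> C by rewrite rmorphM /= rmorph_nat.
rewrite lecR; have -> : N%:R * r = \sum_(j < N) r by rewrite sumr_const card_ord mulr_natl.
exact: ler_sum.
Qed.

Lemma sdiff_differentiable N N' (F : 'rV[C]_N -> 'rV[C]_N') p D :
  sdiff F p D -> differentiable F p.
Proof.
move=> h.
pose V : normedModType C := 'rV[C]_N.
pose W : normedModType C := 'rV[C]_N'.
pose L : {linear V -> W} := mulmxr D.
have cL : continuous L.
  have [K K0 hK] := mulmx_bounded D.
  move=> x P /nbhs_nrmP[e e0 he].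
  apply/nbhs_nrmP; exists (e / K); first by rewrite divr_gt0.
  move=> y hy; apply: he; rewrite -linearB.
  apply: le_lt_trans (hK _) _.
  by rewrite mulrC -ltr_pdivlMr.
have hF : (F : V -> W) \o shift (p : V) = cst (F p : W) + (L : V -> W) +o_ (0 : V) (id : V -> V).
  apply/eqaddoP => _ /complex_gt0P[e e0 ->].
  have e1 : 0 < e / N.+1%:R by rewrite divr_gt0.
  have [r r0 hr] := h _ e1.
  apply/nbhs_nrmP; exists r => // v; rewrite subr0 => hv /=.
  rewrite opprD addrA.
  apply: le_trans (norm_le_nrm _) _.
  have := hr (v + p) p; rewrite addrK subrr nrm0 => /(_ hv r0) q.
  apply: (@le_trans _ _ (e / N.+1%:R * nrm v)%:C); first by rewrite lecR.
  rewrite rmorphM /=.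
  have q2 := nrm_le_norm v.
  apply: (@le_trans _ _ ((e / N.+1%:R)%:C * (N%:R * `|v|))).
    by rewrite ler_wpM2l // lecR ltW.
  rewrite mulrA ler_wpM2r ?normr_ge0 //.
  rewrite -(rmorph_nat (@real_complex R)) -rmorphM lecR /= mulrAC ler_pdivrMr //.
  by rewrite ler_wpM2l ?(ltW e0) // ler_nat leqnSn.
apply/diff_locallyP.
by rewrite (diff_unique cL hF).
Qed.

End InverseFunction.

(** * Logarithms along paths *)

Section ComplexExponential.
Context (R : realType).
Local Notation C := R[i].

Lemma ReB (z w : C) : complex.Re (z - w) = complex.Re z - complex.Re w.
Proof. by case: z w => a b []. Qed.

Lemma ImB (z w : C) : complex.Im (z - w) = complex.Im z - complex.Im w.
Proof. by case: z w => a b []. Qed.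

Definition cexp (z : C) : C :=
  (expR (complex.Re z))%:C * (cos (complex.Im z) +i* sin (complex.Im z)).

Lemma cexpE z : cexp z = (expR (complex.Re z) * cos (complex.Im z)) +i*
  (expR (complex.Re z) * sin (complex.Im z)).
Proof.
apply/eqP; rewrite eq_complex /cexp; case: z => a b /=.
by rewrite !mul0r subr0 addr0 !eqxx.
Qed.

Lemma cexp0 : cexp 0 = 1.
Proof. by rewrite cexpE /= expR0 cos0 sin0 mulr1 mulr0. Qed.

Lemma cexpD z w : cexp (z + w) = cexp z * cexp w.
Proof.
rewrite !cexpE; case: z w => a b [c d] /=.
apply/eqP; rewrite eq_complex /= expRD cosD sinD; apply/andP; split; apply/eqP; ring.
Qed.

Lemma cexpN_mul z : cexp (- z) * cexp z = 1.
Proof. by rewrite -cexpD addNr cexp0. Qed.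

Lemma cexp_neq0 z : cexp z != 0.
Proof.
apply/negP => /eqP h; have := cexpN_mul z; rewrite h mulr0 => /eqP.
by rewrite eq_sym oner_eq0.
Qed.

Lemma cexpN z : cexp (- z) = (cexp z)^-1.
Proof. by apply: (mulIf (cexp_neq0 z)); rewrite cexpN_mul mulVf // cexp_neq0. Qed.

Lemma cexp_sum (I : Type) (s : seq I) (P : pred I) (F : I -> C) :
  cexp (\sum_(i <- s | P i) F i) = \prod_(i <- s | P i) cexp (F i).
Proof. by elim/big_rec2: _ => [|i x y _ <-]; rewrite ?cexp0 ?cexpD. Qed.

Lemma cexp_mulz z (k : int) : cexp (z *~ k) = cexp z ^ k.
Proof.
have hn (n : nat) : cexp (z *+ n) = cexp z ^+ n.
  by elim: n => [|n IH]; rewrite ?mulr0n ?cexp0 // mulrS cexpD IH exprS.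
case: k => n; first exact: hn.
by rewrite NegzE mulrNz cexpN -exprnN -pmulrn hn.
Qed.

Lemma cexp_two_pi_i : cexp (two_pi_i R) = 1.
Proof.
by rewrite cexpE /= expR0 !mul1r mulr_natl cos2pi sin2pi.
Qed.

(** Subtracting the multiple of [2 pi i] given by the floor brings the imaginary part into
    [[0, 2 pi)]. There the sine is 0 and the cosine is 1, and the half-angle formula leaves only
    0. *)
Lemma cexp_eq1 z : cexp z = 1 <-> exists k : int, z = (two_pi_i R) *~ k.
Proof.
split; last by move=> [k ->]; rewrite cexp_mulz cexp_two_pi_i exp1rz.
have pi0 : 0 < 2 * pi :> R by rewrite mulr_gt0 // pi_gt0.
pose k := Num.floor (complex.Im z / (2 * pi)).
move=> h; exists k; apply/eqP; rewrite -subr_eq0; apply/eqP.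
set w := z - _.
have hw : cexp w = 1 by rewrite cexpD h mul1r cexpN cexp_mulz cexp_two_pi_i exp1rz invr1.
have imk : complex.Im ((two_pi_i R) *~ k) = (2 * pi) * k%:~R.
  by rewrite raddfMz /= mulrzr.
have rek : complex.Re ((two_pi_i R) *~ k) = 0 by rewrite raddfMz /= mul0rz.
have [w0 w1] : 0 <= complex.Im w /\ complex.Im w < 2 * pi.
  rewrite /w ImB imk.
  have fl := floor_le (complex.Im z / (2 * pi)).
  have fg := lt_succ_floor (complex.Im z / (2 * pi)).
  rewrite -/k in fl fg; split.
    by rewrite subr_ge0 mulrC -ler_pdivlMr.
  rewrite ltrBlDr -[X in X + _]mulr1 -mulrDr mulrC -ltr_pdivrMr //.
  by move: fg; rewrite intrD addrC.
move: hw w0 w1; clearbody w; case: w => a b.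
rewrite cexpE => -[/= h1 h2] b0 b1.
have ea : expR a != 0 by rewrite gt_eqF // expR_gt0.
have sb : sin b = 0 by move/eqP: h2; rewrite mulf_eq0 (negPf ea) /= => /eqP.
have cb : cos b = 1.
  have := cos2Dsin2 b; rewrite sb expr0n addr0 => /eqP; rewrite sqrf_eq1.
  case/orP => /eqP // cb; have := expR_gt0 a; move: h1; rewrite cb mulrN1 => h1.
  have : - expR a > 0 by rewrite h1.
  lra.
have a0 : a = 0.
  by move: h1; rewrite cb mulr1 -(@expR0 R) => /expR_inj.
have b00 : b = 0.
  apply/eqP; rewrite eq_le b0 andbT leNgt; apply/negP => bp.
  have hb : 0 < b / 2 < pi by lra.
  have := sin_gt0_pi hb.
  have : cos (b / 2 + b / 2) = 1 by rewrite -splitr.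
  rewrite cosD; have := cos2Dsin2 (b / 2); rewrite !expr2.
  move=> q1 q2 q3; have : sin (b / 2) * sin (b / 2) = 0 by lra.
  by move=> /eqP; rewrite mulf_eq0 orbb => /eqP; lra.
by rewrite a0 b00.
Qed.

Lemma is_derive_eps (f : R -> R) (x df : R) : is_derive x 1 f df ->
  forall e : R, 0 < e -> exists2 d : R, 0 < d &
    forall h, `|h| < d -> `|f (x + h) - f x - h * df| <= e * `|h|.
Proof.
move=> [dv <-] e e0.
have := derivable_nbhs dv => /eqaddoP/(_ _ e0) /nbhs_ballP[d /= d0 hd].
exists d => // h hh.
have : `|f (h *: 1 + x) - (f x + h *: 'D_1 f x)| <= e * `|h|.
  by apply: hd; rewrite /ball /= sub0r normrN.
by rewrite opprD addrA [h *: 1]mulr1 [h + x]addrC.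
Qed.

Lemma cexp_near0 (e : R) : 0 < e -> exists2 d : R, 0 < d &
  forall h, absc h < d -> absc (cexp h - 1 - h) <= e * absc h.
Proof.
move=> e0; have e8 : 0 < e / 8 by rewrite divr_gt0.
have [d1 d10 h1] := is_derive_eps (is_derive_expR (0 : R)) e8.
have [d2 d20 h2] := is_derive_eps (is_derive_cos (0 : R)) e8.
have [d3 d30 h3] := is_derive_eps (is_derive_sin (0 : R)) e8.
have [d4 d40 h4] := is_derive_eps (is_derive_expR (0 : R)) ltr01.
have [d5 d50 h5] := is_derive_eps (is_derive_sin (0 : R)) ltr01.
exists (Num.min 1 (Num.min (Num.min d1 d2) (Num.min d3 (Num.min d4 (Num.min d5 (e / 16)))))).
  by rewrite !lt_min ltr01 d10 d20 d30 d40 d50 divr_gt0.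
move=> [a b]; rewrite !lt_min.
move=> /and3P[z0 /andP[z1 z2] /and4P[z3 z4 z5 z6]].
have /= ra := absc_Re (a +i* b); have /= rb := absc_Im (a +i* b).
set z := absc _ in ra rb z0 z1 z2 z3 z4 z5 z6 *.
have {h1} := h1 a (le_lt_trans ra z1); have {h2} := h2 b (le_lt_trans rb z2).
have {h3} := h3 b (le_lt_trans rb z3); have {h4} := h4 a (le_lt_trans ra z4).
have {h5} := h5 b (le_lt_trans rb z5).
rewrite !add0r expR0 cos0 sin0 oppr0 !mulr1 mulr0 !subr0 mul1r mul1r !addr0 => h5 h4 h3 h2 h1.
rewrite cexpE /=.
have -> : (expR a * cos b +i* (expR a * sin b) - 1 - (a +i* b)) =
  (expR a * cos b - 1 - a) +i* (expR a * sin b - b).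
  by apply/eqP; rewrite eq_complex /= subr0 !eqxx.
apply: le_trans (absc_le _) _ => /=.
have cb : `|cos b| <= 1 by exact: ler_norm_cos || (rewrite ler_norml cos_geN1 cos_le1).
have a1 : `|a| <= 1 by apply: ltW; exact: le_lt_trans ra z0.
have A : `|expR a * cos b - 1 - a| <= e / 8 * z + 2 * (e / 8 * z).
  have -> : expR a * cos b - 1 - a = (expR a - 1 - a) * cos b + (1 + a) * (cos b - 1) by ring.
  apply: le_trans (ler_normD _ _) _; rewrite !normrM; apply: lerD.
    rewrite -[leRHS]mulr1; apply: ler_pM => //; apply: le_trans h1 _.
    by rewrite ler_pM2l.
  apply: ler_pM => //; last by apply: le_trans h2 _; rewrite ler_pM2l.
  by apply: le_trans (ler_normD _ _) _; rewrite normr1; lra.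
have B : `|expR a * sin b - b| <= e / 4 * z + e / 8 * z.
  have -> : expR a * sin b - b = (expR a - 1) * sin b + (sin b - b) by ring.
  apply: le_trans (ler_normD _ _) _; rewrite normrM; apply: lerD; last first.
    by apply: le_trans h3 _; rewrite ler_pM2l.
  have q1 : `|expR a - 1| <= 2 * z.
    have := ler_normD (expR a - 1 - a) a; rewrite subrK; lra.
  have q2 : `|sin b| <= 2 * z.
    have := ler_normD (sin b - b) b; rewrite subrK; lra.
  apply: le_trans (ler_pM _ _ q1 q2) _ => //.
  have -> : 2 * z * (2 * z) = (4 * z) * z by ring.
  rewrite ler_wpM2r ?absc_ge0 //; lra.
have := absc_ge0 (a +i* b); rewrite -/z => z00.
have : 0 <= e * z by rewrite mulr_ge0 // ltW.
have E4 : e / 4 * z = 2 * (e / 8 * z) by field.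
have -> : e * z = 8 * (e / 8 * z) by field.
rewrite E4 in B; lra.
Qed.

Lemma sdiffC_cexp (a : C) : sdiffC cexp a (cexp a).
Proof.
move=> e e0.
have A0 : 0 < absc (cexp a) by rewrite absc_gt0 cexp_neq0.
have c0 : 0 < e / (4 * absc (cexp a)) by rewrite divr_gt0 // mulr_gt0.
have [d1 d10 h1] := cexp_near0 c0.
have [d2 d20 h2] := cexp_near0 (ltr01 : 0 < (1 : R)).
exists (Num.min (Num.min (d1 / 2) d2) (Num.min (2^-1) (e / (4 * absc (cexp a))))).
  by rewrite !lt_min d20 c0 invr_gt0 divr_gt0 // ltr0n.
move=> z w; rewrite !lt_min => /andP[/andP[z1 z2] /andP[z3 z4]] /andP[/andP[w1 w2] /andP[w3 w4]].
have -> : cexp z - cexp w - cexp a * (z - w) =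
   cexp w * (cexp (z - w) - 1 - (z - w)) + (cexp w - cexp a) * (z - w).
  have -> : cexp z = cexp (z - w) * cexp w by rewrite -cexpD subrK.
  by ring.
have hwa : absc (cexp w - cexp a) <= absc (cexp a) * (2 * absc (w - a)).
  rewrite -{1}(subrK a w) cexpD -[X in _ - X]mul1r -mulrBl abscM mulrC.
  rewrite ler_wpM2l ?absc_ge0 //.
  have := h2 _ w2; have := ler_abscD (cexp (w - a) - 1 - (w - a)) (w - a).
  by rewrite subrK; lra.
have hw : absc (cexp w) <= 2 * absc (cexp a).
  have := ler_abscD (cexp w - cexp a) (cexp a); rewrite subrK => /le_trans; apply.
  rewrite mulr_natl mulr2n lerD2r; apply: le_trans hwa _.
  by rewrite -[leRHS]mulr1 ler_wpM2l ?absc_ge0 //; lra.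
apply: le_trans (ler_abscD _ _) _.
rewrite (abscM (cexp w)) (abscM (cexp w - cexp a)).
have zw : absc (z - w) < d1.
  have := ler_abscB (z - a) (w - a); rewrite opprB addrA subrK; lra.
have {h1} := h1 _ zw => h1.
have z0 := absc_ge0 (z - w).
have -> : e * absc (z - w) = e / 2 * absc (z - w) + e / 2 * absc (z - w) by field.
apply: lerD.
  apply: le_trans (ler_pM _ _ hw h1) _; rewrite ?absc_ge0 //.
  by rewrite le_eqVlt; apply/orP; left; apply/eqP; field; rewrite gt_eqF.
rewrite ler_wpM2r //; apply: le_trans hwa _.
apply: (@le_trans _ _ (absc (cexp a) * (2 * (e / (4 * absc (cexp a)))))).
  by rewrite ler_wpM2l ?absc_ge0 //; lra.
by rewrite le_eqVlt; apply/orP; left; apply/eqP; field; rewrite gt_eqF.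
Qed.

(** A local logarithm near 1: the inverse function theorem applied to [cexp] in dimension one. The
    last clause says that [Lg] is Lipschitz; outside the disc nothing is claimed about it. *)
Lemma clog_near1 : exists (r c : R) (Lg : C -> C), [/\ 0 < r, 0 < c, Lg 1 = 0,
  forall w, absc (w - 1) < r -> cexp (Lg w) = w &
  forall v w, absc (v - 1) < r -> absc (w - 1) < r -> c * absc (Lg v - Lg w) <= absc (v - w)].
Proof.
pose F (v : 'rV[C]_1) : 'rV[C]_1 := \row_(j < 1) cexp (v 0 0).
have nrm1 (v : 'rV[C]_1) : nrm v = absc (v 0 0) by rewrite /nrm big_ord1.
have dF : sdiff F 0 1%:M.
  move=> e e0; have [d d0 hd] := sdiffC_cexp 0 e0; exists d => // x y.
  rewrite !nrm1 !subr0 => hx hy.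
  have := hd (x 0 0) (y 0 0); rewrite !subr0 cexp0 mul1r => /(_ hx hy).
  by rewrite mulmx1 !mxE.
have [r [c [r0 c0 lip sur]]] := inverse_function dF (mulmx1 1%:M) (mulmx1 1%:M).
have cr : 0 < c * r by rewrite mulr_gt0.
have ex w : exists l : C, absc (w - 1) < c * r -> absc l < r /\ cexp l = w.
  have [hw|hw] := ltP (absc (w - 1)) (c * r); last by exists 0.
  have [||y hy Fy] := sur 0 r (\row_(j < 1) w) r0.
  - by rewrite subr0 nrm0 add0r.
  - by rewrite nrm1 !mxE cexp0.
  exists (y 0 0) => _; split; first by rewrite -nrm1 -[y]subr0.
  by move/rowP/(_ 0): Fy; rewrite !mxE.
have [Lg hL] := choice ex.
have lipL v w : absc (v - 1) < c * r -> absc (w - 1) < c * r ->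
    c * absc (Lg v - Lg w) <= absc (v - w).
  move=> hv hw; have [v1 v2] := hL _ hv; have [w1 w2] := hL _ hw.
  have := lip (\row_(j < 1) Lg v) (\row_(j < 1) Lg w).
  by rewrite !subr0 !nrm1 !mxE v2 w2; apply.
exists (c * r), c, Lg; split => //; last by move=> w /hL[].
have h1 : absc (1 - 1 : C) < c * r by rewrite subrr absc0.
have [l1 l2] := hL _ h1.
have := lip (\row_(j < 1) Lg 1) 0; rewrite !nrm1 !subr0 !mxE l2 absc0 cexp0 subrr absc0.
move=> /(_ l1 r0) h; apply/eqP; rewrite -absc_eq0 eq_le absc_ge0 andbT.
by rewrite -(ler_pM2l c0) mulr0.
Qed.

End ComplexExponential.

(** * Primitives on an interval, and continuous logarithms along a path *)

Section RealIntegration.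
Context (R : realType).

Lemma within_cts (f : R -> R) (A : set R) : continuous f -> {within A, continuous f}.
Proof. by move=> h; apply: continuous_subspaceT. Qed.

Lemma primitive_exists (f : R -> R) (M : R) : continuous f -> 0 < M ->
  exists Phi : R -> R, forall t : R, `|t| < M -> is_derive t 1 Phi (f t).
Proof.
move=> cf M0.
have itg : lebesgue_measure.-integrable `[- M, M] (EFin \o f).
  apply: continuous_compact_integrable; first exact: segment_compact.
  exact: within_cts.
exists (fun x => \int[lebesgue_measure]_(t in [set` `[- M, x]]) f t) => t.
rewrite ltr_norml => /andP[t1 t2].
have [h1 h2] := continuous_FTC1_closed t2 itg t1 (cf t).
by rewrite -h2 derive1E; exact: (DeriveDef h1 erefl).
Qed.

Lemma integral_primitive (f Phi : R -> R) :
  {within `[0, 1], continuous f} -> (forall t : R, 0 <= t <= 1 -> is_derive t 1 Phi (f t)) ->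
  \int[lebesgue_measure]_(t in `[0, 1]) f t = Phi 1 - Phi 0.
Proof.
move=> cf hP.
have cP t : 0 <= t <= 1 -> {for t, continuous Phi}.
  move=> ht; have [d _] := hP t ht; apply: differentiable_continuous.
  exact/derivable1_diffP.
have h := @continuous_FTC2 R f Phi 0 1 ltr01 cf.
rewrite /Rintegral h //=.
- split.
  + by move=> t; rewrite in_itv /= => /andP[t0 t1]; have [] := hP t; rewrite ?(ltW t0) ?(ltW t1).
  + by apply: cvg_at_right_filter; apply: cP; rewrite lexx ler01.
  + by apply: cvg_at_left_filter; apply: cP; rewrite lexx ler01.
- move=> t; rewrite in_itv /= => /andP[t0 t1].
  have [|_ <-] := hP t; first by rewrite (ltW t0) (ltW t1).
  by rewrite derive1E.
Qed.

End RealIntegration.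

Section PathLogarithm.
Context (R : realType).
Local Notation C := R[i].
Implicit Types (c : R -> C) (y : C).

Definition ctsA (A : R -> Prop) (f : R -> C) : Prop :=
  forall t : R, A t -> forall e : R, 0 < e -> exists2 d : R, 0 < d &
    forall s : R, A s -> `|s - t| < d -> absc (f s - f t) < e.

Definition unit_itv (t : R) : Prop := 0 <= t <= 1.

Local Notation cts01 := (ctsA unit_itv).

Lemma within01P (f : R -> R) : {within `[0, 1], continuous f} <->
  forall t : R, 0 <= t <= 1 -> forall e : R, 0 < e -> exists2 d : R, 0 < d &
    forall s : R, 0 <= s <= 1 -> `|s - t| < d -> `|f s - f t| < e.
Proof.
split=> [/subspace_continuousP h t ht e e0|h].
  have /cvgrPdist_lt/(_ _ e0) : f x @[x --> within `[0, 1] (nbhs t)] --> f t.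
    by apply: h; rewrite /= in_itv.
  rewrite /within /= => /nbhs_ballP[d /= d0 hd].
  exists d => // s hs st; rewrite distrC; apply: hd; last by rewrite /= in_itv.
  by rewrite /ball /= distrC.
apply/subspace_continuousP => t; rewrite /= in_itv /= => ht.
apply/cvgrPdist_lt => e e0; have [d d0 hd] := h t ht e e0.
rewrite /within /=; apply/nbhs_ballP; exists d => // s.
rewrite /ball /= in_itv /= distrC => hs st; rewrite distrC; exact: hd.
Qed.

Lemma cts01_Re f : cts01 f -> {within `[0, 1], continuous (fun t => complex.Re (f t))}.
Proof.
move=> h; apply/within01P => t ht e e0; have [d d0 hd] := h t ht e e0.
exists d => // s hs st; rewrite -ReB; apply: le_lt_trans (absc_Re _) _; exact: hd.
Qed.

Lemma cts01_Im f : cts01 f -> {within `[0, 1], continuous (fun t => complex.Im (f t))}.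
Proof.
move=> h; apply/within01P => t ht e e0; have [d d0 hd] := h t ht e e0.
exists d => // s hs st; rewrite -ImB; apply: le_lt_trans (absc_Im _) _; exact: hd.
Qed.

Lemma cts_comb A f g (a b : C) : ctsA A f -> ctsA A g -> ctsA A (fun t => a * f t + b * g t).
Proof.
move=> hf hg t ht e e0.
have e2 x : 0 < e / 2 / (absc x + 1) by rewrite !divr_gt0 // ltr_wpDl ?absc_ge0.
have [d d0 hd] := hf t ht _ (e2 a); have [d' d'0 hd'] := hg t ht _ (e2 b).
exists (Num.min d d'); first by rewrite lt_min d0.
move=> s hs; rewrite lt_min => /andP[s1 s2].
have := hd s hs s1; have := hd' s hs s2.
have -> : a * f s + b * g s - (a * f t + b * g t) = a * (f s - f t) + b * (g s - g t) by ring.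
have p0 x : 0 < absc x + 1 :> R by rewrite ltr_wpDl ?absc_ge0.
rewrite !ltr_pdivlMr // => q1 q2.
apply: le_lt_trans (ler_abscD _ _) _; rewrite !abscM.
have := absc_ge0 (f s - f t); have := absc_ge0 (g s - g t); nra.
Qed.

Lemma cts_mul A f g : ctsA A f -> ctsA A g -> ctsA A (fun t => f t * g t).
Proof.
move=> hf hg t ht e e0.
have e2 x : 0 < e / 2 / (absc x + 1) by rewrite !divr_gt0 // ltr_wpDl ?absc_ge0.
have [d d0 hd] := hf t ht _ (e2 (g t)); have [d' d'0 hd'] := hg t ht _ (e2 (f t)).
have [d'' d''0 hd''] := hf t ht _ ltr01.
exists (Num.min d (Num.min d' d'')); first by rewrite !lt_min d0 d'0.
move=> s hs; rewrite !lt_min => /and3P[s1 s2 s3].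
have := hd s hs s1; have := hd' s hs s2; have := hd'' s hs s3.
have -> : f s * g s - f t * g t = f s * (g s - g t) + g t * (f s - f t) by ring.
have p0 x : 0 < absc x + 1 :> R by rewrite ltr_wpDl ?absc_ge0.
rewrite !ltr_pdivlMr // => q0 q1 q2.
have q3 : absc (f s) <= absc (f t) + 1.
  by have := ler_abscD (f s - f t) (f t); rewrite subrK; lra.
apply: le_lt_trans (ler_abscD _ _) _; rewrite !abscM.
have z1 := absc_ge0 (f s - f t); have z2 := absc_ge0 (g s - g t).
have := absc_ge0 (g t).
have : absc (f s) * absc (g s - g t) <= (absc (f t) + 1) * absc (g s - g t) by rewrite ler_wpM2r.
nra.
Qed.

Lemma cts_inv A f : (forall t, A t -> f t != 0) -> ctsA A f -> ctsA A (fun t => (f t)^-1).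
Proof.
move=> fn hf t ht e e0; have f0 := fn t ht; rewrite -absc_gt0 in f0.
set B := absc (f t) in f0.
have e1 : 0 < Num.min (B / 2) (e * B ^+ 2 / 4).
  by rewrite lt_min !divr_gt0 // mulr_gt0 // exprn_gt0.
have [d d0 hd] := hf t ht _ e1; exists d => // s hs st.
have := hd s hs st; rewrite lt_min => /andP[h1 h2].
have fs : B / 2 < absc (f s).
  by have := ler_abscD (f t - f s) (f s); rewrite subrK abscB -/B; lra.
have fs0 : f s != 0 by apply: fn.
have -> : (f s)^-1 - (f t)^-1 = - (f s - f t) / (f s * f t).
  by field; rewrite fs0 fn.
rewrite abscM abscN abscV abscM -/B ltr_pdivrMr ?mulr_gt0 //; last by lra.
apply: lt_le_trans h2 _; rewrite -mulrA ler_pM2l // expr2.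
have -> : B * B / 4 = B / 2 * B / 2 by field.
have : B / 2 * B <= absc (f s) * B by rewrite ler_pM2r // ltW.
have : 0 < B / 2 * B by rewrite mulr_gt0 // divr_gt0.
lra.
Qed.

Lemma cts_cst A a : ctsA A (fun=> a).
Proof. by move=> t ht e e0; exists 1 => // s _ _; rewrite subrr absc0. Qed.

Lemma cts_sum A (I : Type) (s : seq I) (F : I -> R -> C) :
  (forall i, ctsA A (F i)) -> ctsA A (fun t => \sum_(i <- s) F i t).
Proof.
move=> h; elim: s => [|i s IH].
  by have := @cts_cst A 0; congr ctsA; apply/funext => t; rewrite big_nil.
have := cts_comb 1 1 (h i) IH; congr ctsA.
by apply/funext => t; rewrite big_cons !mul1r.
Qed.

(** By the intermediate value theorem a non-zero value would force the value [a / 2] or [- a / 2],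
    which is not an integral multiple of [a]. *)
Lemma int_valued_constant (f : R -> R) (a : R) : 0 < a ->
  {within `[0, 1], continuous f} -> f 0 = 0 ->
  (forall t, 0 <= t <= 1 -> exists k : int, f t = a * k%:~R) ->
  forall t, 0 <= t <= 1 -> f t = 0.
Proof.
move=> a0 cf f0 hk t /andP[t0 t1].
have [//|ft] := eqVneq (f t) 0.
have [|k kE] := hk t; first by rewrite t0 t1.
have k0 : k != 0 by apply: contraNneq ft => k0; rewrite kE k0 mulr0.
have cf' : {within `[0, t], continuous f}.
  apply: continuous_subspaceW cf => s /=; rewrite !in_itv /= => /andP[-> s1].
  exact: le_trans s1 t1.
pose v : R := a / 2 * (if 0 < k then 1 else -1).
have hv : Num.min (f 0) (f t) <= v <= Num.max (f 0) (f t).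
  rewrite f0 kE /v; case: ifPn => kp.
    have : 1 <= k%:~R :> R by rewrite ler1z.
    move=> k1; have ak : a <= a * k%:~R by rewrite -[leLHS]mulr1 ler_pM2l.
    by rewrite ge_min le_max; apply/andP; split; apply/orP; [left|right]; lra.
  have : k%:~R <= -1 :> R.
    by rewrite (_ : -1 = (-1)%:~R) // ler_int; lia.
  move=> k1; have ak : a * k%:~R <= - a by rewrite -mulrN1 ler_pM2l.
  by rewrite ge_min le_max; apply/andP; split; apply/orP; [right|left]; lra.
have [s] := IVT t0 cf' hv.
rewrite in_itv /= => /andP[s0 s1] fs.
have [|l lE] := hk s; first by rewrite s0 (le_trans s1).
have : a * (2 * l%:~R) = a * (if 0 < k then 1 else -1).
  by rewrite mulrCA -lE fs /v; field.
move/(mulfI (lt0r_neq0 a0)) => h.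
have : (2 * l)%:~R = (if 0 < k then 1 else -1 : int)%:~R :> R.
  by rewrite intrM h; case: ifP.
by move/eqP; rewrite eqr_int; case: ifP => _ /eqP; lia.
Qed.

Lemma unique_lift (f g : R -> C) :
  cts01 f -> cts01 g ->
  f 0 = g 0 -> (forall t, 0 <= t <= 1 -> cexp (f t) = cexp (g t)) ->
  forall t, 0 <= t <= 1 -> f t = g t.
Proof.
move=> cf cg e0 he.
have pi0 : 0 < 2 * pi :> R by rewrite mulr_gt0 // pi_gt0.
have hk t : 0 <= t <= 1 -> exists k : int, f t - g t = 0 +i* (2 * pi * k%:~R).
  move=> ht; have : cexp (f t - g t) = 1.
    by rewrite cexpD cexpN he // mulfV // cexp_neq0.
  move=> /cexp_eq1[k ->]; exists k; apply/eqP.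
  by rewrite eq_complex /= raddfMz raddfMz /= mul0rz mulrzr !eqxx.
have h := @int_valued_constant (fun t => complex.Im (f t - g t)) (2 * pi) pi0.
move=> t ht; apply/eqP; rewrite -subr_eq0; apply/eqP.
have [k kE] := hk t ht; rewrite kE.
have -> : 2 * pi * k%:~R = complex.Im (f t - g t) by rewrite kE.
rewrite h //.
- apply: cts01_Im; have := cts_comb 1 (-1) cf cg.
  by congr ctsA; apply/funext => s; rewrite mul1r mulN1r.
- by rewrite e0 subrr.
- by move=> s hs; have [l ->] := hk s hs; exists l.
Qed.

(** Composition with [clamp] extends a function on the unit interval to a continuous function on the
    line, constant beyond the ends. *)
Definition clamp (t : R) : R := Num.max 0 (Num.min 1 t).

Lemma clamp_in t : 0 <= clamp t <= 1.
Proof. by rewrite /clamp le_max lexx ge_max ler01 ge_min lexx. Qed.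

Lemma clamp_id t : 0 <= t <= 1 -> clamp t = t.
Proof. by move=> /andP[t0 t1]; rewrite /clamp (min_idPr t1) (max_idPr t0). Qed.

Lemma clamp_lip s t : `|clamp s - clamp t| <= `|s - t|.
Proof.
rewrite /clamp /Num.max /Num.min; do 2?case: ifP; do 2?case: ifP;
  rewrite !(lt_def, ler_norml, ler_norm) => *; 
  rewrite ?ler_norml; case: (lerP 0 (s - t)) => h; rewrite ?(ger0_norm h) ?(ltr0_norm h); lra.
Qed.

Lemma clamp_continuous (f : R -> R) :
  {within `[0, 1], continuous f} -> continuous (f \o clamp).
Proof.
move=> cf t; apply/cvgrPdist_lt => e e0.
have /within01P/(_ _ (clamp_in t) _ e0)[d d0 hd] := cf.
apply/nbhs_ballP; exists d => // s hs /=; rewrite distrC; apply: hd; first exact: clamp_in.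
by apply: le_lt_trans (clamp_lip _ _) _; rewrite distrC.
Qed.

Lemma complex_primitive (f : R -> C) : cts01 f ->
  exists a b : R -> R, forall t : R, 0 <= t <= 1 ->
    is_derive t 1 a (complex.Re (f t)) /\ is_derive t 1 b (complex.Im (f t)).
Proof.
move=> cf.
have [a ha] := primitive_exists (clamp_continuous (cts01_Re cf)) (ltr0n _ 2).
have [b hb] := primitive_exists (clamp_continuous (cts01_Im cf)) (ltr0n _ 2).
exists a, b => t ht; have t2 : `|t| < 2 by move: ht => /andP[h1 h2]; rewrite ger0_norm; lra.
by have := ha t t2; have := hb t t2; rewrite /= clamp_id.
Qed.

Lemma is_derive0_constant (f : R -> R) :
  (forall t : R, 0 <= t <= 1 -> is_derive t 1 f 0) ->
  forall t, 0 <= t <= 1 -> f t = f 0.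
Proof.
move=> h t /andP[t0 t1]; have [->//|tn] := eqVneq t 0.
have tp : 0 < t by rewrite lt_def tn.
have h1 (s : R) : s \in `]0, t[ -> is_derive s 1 f ((fun=> 0) s).
  by rewrite in_itv /= => /andP[s0 s1]; apply: h; rewrite (ltW s0) (le_trans (ltW s1)).
have h2 : {within `[0, t], continuous f}.
  apply: derivable_within_continuous => s; rewrite in_itv /= => /andP[s0 s1].
  by have [] := h s; rewrite ?s0 ?(le_trans s1).
have [s _] := MVT tp h1 h2.
by rewrite mul0r => /eqP; rewrite subr_eq0 => /eqP.
Qed.

End PathLogarithm.

Local Notation cts01 := (ctsA (@unit_itv _)).

Section ComplexDerivative.
Context (R : realType).
Local Notation C := R[i].
Implicit Types (c f g : R -> C) (t : R).

Lemma is_derive_ext (f g : R -> R) (x df dg : R) :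
  f = g -> df = dg -> is_derive x 1 f df -> is_derive x 1 g dg.
Proof. by move=> -> ->. Qed.

(** [R[i]] is used as a normed space over itself, so a path with a real parameter is differentiated
    by components. *)
Definition cderiv f (v : C) t : Prop :=
  is_derive t (1 : R) (fun s => complex.Re (f s)) (complex.Re v) /\
  is_derive t (1 : R) (fun s => complex.Im (f s)) (complex.Im v).

Lemma cderiv_cst (a : C) t : cderiv (fun=> a) 0 t.
Proof. by split; exact: is_derive_cst. Qed.

Lemma cderivD f g v w t : cderiv f v t -> cderiv g w t ->
  cderiv (fun s => f s + g s) (v + w) t.
Proof.
move=> [f1 f2] [g1 g2]; split.
  rewrite raddfD /=; have := is_deriveD f1 g1; congr is_derive.
  by apply/funext => s; rewrite raddfD.
rewrite raddfD /=; have := is_deriveD f2 g2; congr is_derive.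
by apply/funext => s; rewrite raddfD.
Qed.

Lemma cderivN f v t : cderiv f v t -> cderiv (fun s => - f s) (- v) t.
Proof.
move=> [f1 f2]; split.
  rewrite raddfN /=; have := is_deriveN f1; congr is_derive.
  by apply/funext => s; rewrite raddfN.
rewrite raddfN /=; have := is_deriveN f2; congr is_derive.
by apply/funext => s; rewrite raddfN.
Qed.

Lemma cderivM f g v w t : cderiv f v t -> cderiv g w t ->
  cderiv (fun s => f s * g s) (v * g t + f t * w) t.
Proof.
move=> [f1 f2] [g1 g2]; split.
  apply: is_derive_ext (is_deriveB (is_deriveM f1 g1) (is_deriveM f2 g2)).
    by apply/funext => s; rewrite !fctE; case: (f s) => a b; case: (g s).
  clear f1 f2 g1 g2; move: (f t) (g t) v w => [a b] [a' b'] [p q] [p' q'] /=.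
  by rewrite /GRing.scale /=; ring.
apply: is_derive_ext (is_deriveD (is_deriveM f1 g2) (is_deriveM f2 g1)).
  by apply/funext => s; rewrite !fctE; case: (f s) => a b; case: (g s).
clear f1 f2 g1 g2; move: (f t) (g t) v w => [a b] [a' b'] [p q] [p' q'] /=.
by rewrite /GRing.scale /=; ring.
Qed.

Lemma cderiv_eq f v w t : cderiv f v t -> v = w -> cderiv f w t.
Proof. by move=> h <-. Qed.

Lemma cderiv_sum (I : Type) (s : seq I) (F : I -> R -> C) (v : I -> C) t :
  (forall i, cderiv (F i) (v i) t) ->
  cderiv (fun u => \sum_(i <- s) F i u) (\sum_(i <- s) v i) t.
Proof.
move=> h; elim: s => [|i s IH].
  rewrite big_nil; have := cderiv_cst 0 t; congr cderiv.
  by apply/funext => u; rewrite big_nil.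
rewrite big_cons; have := cderivD (h i) IH; congr cderiv.
by apply/funext => u; rewrite big_cons.
Qed.

Lemma cderiv_cexp f v t : cderiv f v t -> cderiv (fun s => cexp (f s)) (cexp (f t) * v) t.
Proof.
move=> [f1 f2].
have e1 := is_derive1_comp (is_derive_expR (complex.Re (f t))) f1.
have c1 := is_derive1_comp (is_derive_cos (complex.Im (f t))) f2.
have s1 := is_derive1_comp (is_derive_sin (complex.Im (f t))) f2.
split.
  apply: is_derive_ext (is_deriveM e1 c1).
    by apply/funext => s; rewrite cexpE.
  rewrite cexpE /=; case: v {f1 f2 e1 c1 s1} => p q /=.
  by rewrite /GRing.scale /=; ring.
apply: is_derive_ext (is_deriveM e1 s1).
  by apply/funext => s; rewrite cexpE.
rewrite cexpE /=; case: v {f1 f2 e1 c1 s1} => p q /=.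
by rewrite /GRing.scale /=; ring.
Qed.

Lemma cderiv0_constant f : (forall t, 0 <= t <= 1 -> cderiv f 0 t) ->
  forall t, 0 <= t <= 1 -> f t = f 0.
Proof.
move=> h t ht.
have := is_derive0_constant (fun s hs => (h s hs).1) ht.
have := is_derive0_constant (fun s hs => (h s hs).2) ht.
by case: (f t) => a b; case: (f 0) => a' b' /= -> ->.
Qed.

Lemma cderiv_cts f v t : cderiv f v t ->
  forall e : R, 0 < e -> exists2 d : R, 0 < d & forall s, `|s - t| < d -> absc (f s - f t) < e.
Proof.
move=> [[d1 _] [d2 _]] e e0.
have e2 : 0 < e / 2 by rewrite divr_gt0.
have /cvgrPdist_lt/(_ _ e2)/nbhs_ballP[r /= r0 hr] : {for t, continuous (fun s => complex.Re (f s))}.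
  by apply: differentiable_continuous; exact/derivable1_diffP.
have /cvgrPdist_lt/(_ _ e2)/nbhs_ballP[r' /= r'0 hr'] : {for t, continuous (fun s => complex.Im (f s))}.
  by apply: differentiable_continuous; exact/derivable1_diffP.
exists (Num.min r r'); first by rewrite lt_min r0.
move=> s; rewrite lt_min => /andP[s1 s2].
have := hr s; have := hr' s; rewrite /ball /= distrC => /(_ s2) q1 /(_ s1) q2.
by have := absc_le (f s - f t); rewrite ReB ImB (distrC (complex.Re (f s))) (distrC (complex.Im (f s))); lra.
Qed.

Lemma cderiv_cts01 f (v : R -> C) : (forall t, 0 <= t <= 1 -> cderiv f (v t) t) -> cts01 f.
Proof.
move=> h t ht e e0; have [d d0 hd] := cderiv_cts (h t ht) e0.
by exists d => // s _; exact: hd.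
Qed.

Lemma continuous_cts01 f : continuous f -> cts01 f.
Proof.
move=> h t ht e e0.
have : nbhs (f t) [set z | absc (z - f t) < e] by apply/nbhs_abscP; exists e.
move=> /(h t) /= /nbhs_ballP[d /= d0 hd]; exists d => // s _ st; apply: hd.
by rewrite /ball /= distrC.
Qed.

Lemma C1_path_cderiv c t : C1_path c -> cderiv c (velocity c t) t.
Proof. by move=> [h1 h2 _]; split; rewrite /= derive1E; exact: DeriveDef. Qed.

Lemma C1_path_of c (v : R -> C) : (forall t, cderiv c (v t) t) -> continuous v ->
  C1_path c /\ velocity c = v.
Proof.
move=> h cv; have vE : velocity c = v.
  apply/funext => t; rewrite /velocity !derive1E.
  by have [[_ ->] [_ ->]] := h t; case: (v t).
split; last exact: vE.
split; last by rewrite vE.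
  by move=> t; have [[d _] _] := h t; exact: d.
by move=> t; have [_ [d _]] := h t; exact: d.
Qed.

Lemma path_integral_primitive (f : C -> C) c (Phi : R -> C) :
  cts01 (fun t => f (c t) * velocity c t) ->
  (forall t, 0 <= t <= 1 -> cderiv Phi (f (c t) * velocity c t) t) ->
  path_integral f c = Phi 1 - Phi 0.
Proof.
move=> hc hP; rewrite /path_integral.
rewrite (integral_primitive (cts01_Re hc) (fun t ht => (hP t ht).1)).
rewrite (integral_primitive (cts01_Im hc) (fun t ht => (hP t ht).2)).
by case: (Phi 1) => a b; case: (Phi 0).
Qed.

Definition logint c (y : C) : C := path_integral (fun z => (z - y)^-1) c.

Definition avoids c (y : C) : Prop := forall t, 0 <= t <= 1 -> c t != y.

Lemma logint_cts01 c y : C1_path c -> avoids c y ->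
  cts01 (fun t => (c t - y)^-1 * velocity c t).
Proof.
move=> hc hy; have cc := cderiv_cts01 (fun t _ => C1_path_cderiv t hc).
apply: cts_mul; last by apply: continuous_cts01; case: hc.
apply: cts_inv => [t ht|]; first by rewrite subr_eq0 hy.
have := cts_comb 1 (- 1) cc (cts_cst y).
by congr ctsA; apply/funext => t; rewrite mul1r mulN1r.
Qed.

(** The lift [l] is the primitive of [c' / (c - y)] starting at 0. The product [exp (- l) (c - y)]
    has derivative 0, so it keeps its initial value. *)
Lemma logint_lift c y : C1_path c -> avoids c y ->
  exists l : R -> C, [/\ cts01 l, l 0 = 0, l 1 = logint c y,
    forall t, 0 <= t <= 1 -> cderiv l ((c t - y)^-1 * velocity c t) t &
    forall t, 0 <= t <= 1 -> cexp (l t) * (c 0 - y) = c t - y].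
Proof.
move=> hc hy; have hcts := logint_cts01 hc hy.
have [a [b hab]] := complex_primitive hcts.
pose l t := (a t - a 0) +i* (b t - b 0).
have dl t : 0 <= t <= 1 -> cderiv l ((c t - y)^-1 * velocity c t) t.
  move=> ht; have [h1 h2] := hab t ht; split => /=.
    by have := is_deriveB h1 (is_derive_cst (a 0) t 1); rewrite subr0.
  by have := is_deriveB h2 (is_derive_cst (b 0) t 1); rewrite subr0.
have l0 : l 0 = 0 by rewrite /l !subrr.
exists l; split => //.
- exact: cderiv_cts01 dl.
- by rewrite /logint (path_integral_primitive hcts dl) l0 subr0.
- move=> t ht.
  have h s : 0 <= s <= 1 -> cderiv (fun u => cexp (- l u) * (c u - y)) 0 s.
    move=> hs; apply: cderiv_eq.
      apply: cderivM (cderiv_cexp (cderivN (dl s hs))) _.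
      exact: cderivD (C1_path_cderiv s hc) (cderiv_cst (- y) s).
    have : c s - y != 0 by rewrite subr_eq0 hy.
    by move: (cexp _) (c s - y) (velocity c s) => p q r q0; rewrite addr0; field.
  have := cderiv0_constant h ht; rewrite l0 oppr0 cexp0 mul1r => <-.
  by rewrite mulrA -cexpD addrN cexp0 mul1r.
Qed.

Lemma logint_exp c y : C1_path c -> avoids c y ->
  cexp (logint c y) = (c 1 - y) / (c 0 - y).
Proof.
move=> hc hy; have [l [_ _ <- _ h]] := logint_lift hc hy.
rewrite -h ?ler01 ?lexx // mulfK // subr_eq0; apply: hy.
by rewrite lexx ler01.
Qed.

(** The way logarithmic integrals are computed below: exhibit any continuous logarithm of
    [(c t - y) / (c 0 - y)] starting at 0 and read off its end value. *)
Lemma logint_unique c y (l : R -> C) : C1_path c -> avoids c y ->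
  cts01 l -> l 0 = 0 -> (forall t, 0 <= t <= 1 -> cexp (l t) * (c 0 - y) = c t - y) ->
  logint c y = l 1.
Proof.
move=> hc hy cl l0 hl; have [l' [cl' l'0 <- _ hl']] := logint_lift hc hy.
apply: unique_lift => //; last by rewrite ler01 lexx.
  by rewrite l0.
move=> t ht; apply: (@mulIf _ (c 0 - y)); last by rewrite (hl t ht) (hl' t ht).
by rewrite subr_eq0; apply: hy; rewrite lexx ler01.
Qed.

Lemma path_integral_partial_fractions (I : finType) (r y : I -> C) (f : C -> C) c :
  C1_path c -> (forall i, avoids c (y i)) ->
  (forall z, (forall i, z != y i) -> f z = \sum_i r i / (z - y i)) ->
  path_integral f c = \sum_i r i * logint c (y i).
Proof.
move=> hc hy hf.
have hl i := logint_lift hc (hy i).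
have [l hl'] := choice hl.
have E t : 0 <= t <= 1 -> f (c t) * velocity c t =
    \sum_i r i * ((c t - y i)^-1 * velocity c t).
  move=> ht; rewrite hf => [|i]; last exact: hy.
  by rewrite mulr_suml; apply: eq_bigr => i _; rewrite mulrA.
have dPhi t : 0 <= t <= 1 -> cderiv (fun s => \sum_i r i * l i s) (f (c t) * velocity c t) t.
  move=> ht; rewrite E //; apply: cderiv_sum => i.
  have [_ _ _ d _] := hl' i.
  apply: cderiv_eq; first exact: cderivM (cderiv_cst (r i) t) (d t ht).
  by rewrite mul0r add0r.
have cc : cts01 (fun t => \sum_i r i * ((c t - y i)^-1 * velocity c t)).
  apply: cts_sum => i; have := cts_comb (r i) 0 (logint_cts01 hc (hy i)) (cts_cst 0).
  by congr ctsA; apply/funext => s; rewrite mul0r addr0.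
have cf : cts01 (fun t => f (c t) * velocity c t).
  move=> t ht e e0; have [d d0 hd] := cc t ht e e0; exists d => // s hs st.
  by rewrite !E //; exact: hd.
rewrite (path_integral_primitive cf dPhi).
rewrite -sumrB; apply: eq_bigr => i _.
by have [_ -> <- _ _] := hl' i; rewrite mulr0 subr0.
Qed.

End ComplexDerivative.

(** * Paths with prescribed logarithms *)

Section Paths.
Context (R : realType).
Local Notation C := R[i].
Implicit Types (c : R -> C).

Lemma ctsA_continuous c : ctsA (fun=> True) c -> continuous c.
Proof.
move=> h t P /nbhs_abscP[e e0 he]; have [d d0 hd] := h t I e e0.
apply/nbhs_ballP; exists d => // s hs; apply: he; apply: hd => //.
by rewrite distrC.
Qed.

Lemma continuous_ctsA A c : continuous c -> ctsA A c.
Proof.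
move=> h t _ e e0.
have : nbhs (c t) [set z | absc (z - c t) < e] by apply/nbhs_abscP; exists e.
move=> /(h t) /= /nbhs_ballP[d /= d0 hd]; exists d => // s _ st; apply: hd.
by rewrite /ball /= distrC.
Qed.

Lemma ctsA_real (A : R -> Prop) (f : R -> R) (K : R) : 0 <= K ->
  (forall s t, `|f s - f t| <= K * `|s - t|) -> ctsA A (fun t => (f t)%:C).
Proof.
move=> K0 h t _ e e0; exists (e / (K + 1)); first by rewrite divr_gt0 // ltr_wpDl.
move=> s _ hs; rewrite -rmorphB absc_real; apply: le_lt_trans (h s t) _.
have K1 : 0 < K + 1 by rewrite ltr_wpDl.
move: hs; rewrite ltr_pdivlMr // => hs; have := normr_ge0 (s - t); nra.
Qed.

Lemma ctsA_comp (A B : R -> Prop) c (f : R -> R) (K : R) : 0 < K ->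
  (forall s t, `|f s - f t| <= K * `|s - t|) -> (forall t, A t -> B (f t)) ->
  ctsA B c -> ctsA A (fun t => c (f t)).
Proof.
move=> K0 h AB hc t /AB ht e e0; have [d d0 hd] := hc _ ht e e0.
exists (d / K); first by rewrite divr_gt0.
move=> s /AB hs st; apply: hd => //; apply: le_lt_trans (h s t) _.
by rewrite mulrC -ltr_pdivlMr.
Qed.

Definition pospart (t : R) : R := Num.max 0 t.

Lemma pospart_lip s t : `|pospart s - pospart t| <= `|s - t|.
Proof.
rewrite /pospart; case: (lerP 0 s) => hs; case: (lerP 0 t) => ht;
  rewrite ?subrr ?normr0 // ?subr0 ?sub0r ?normrN; rewrite ?ler_normr; apply/orP.
- by left; rewrite ger0_norm //; lra.
- by right; rewrite ger0_norm //; lra.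
Qed.

Lemma is_derive_quad (f : R -> R) (x d K : R) :
  (forall h, `|f (x + h) - f x - h * d| <= K * h ^+ 2) -> is_derive x (1 : R) f d.
Proof.
move=> hf.
have K0 : 0 <= K by have := hf 1; rewrite expr1n mulr1; apply: le_trans.
have hc : (fun h : R => h^-1 *: ((f \o shift x) (h *: (1 : R)) - f x)) @ 0^' --> d.
  apply/cvgrPdist_lt => e e0; apply/nbhs_ballP; exists (e / (K + 1)).
    by rewrite /= divr_gt0 // ltr_wpDl.
  move=> h; rewrite /ball /= sub0r normrN => hh h0.
  rewrite -[X in `|d - X|]/(h^-1 * (f (h * 1 + x) - f x)) mulr1 (addrC h x).
  have -> : d - h^-1 * (f (x + h) - f x) = - (h^-1 * (f (x + h) - f x - h * d)).
    by field.
  rewrite normrN normrM normfV ltr_pdivrMl ?normr_gt0 //.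
  apply: le_lt_trans (hf h) _.
  rewrite -normr_id -[h ^+ 2]ger0_norm ?sqr_ge0 // normrX normr_id expr2 mulrA mulrC.
  rewrite ltr_pM2l ?normr_gt0 //.
  move: hh; rewrite ltr_pdivlMr ?ltr_wpDl // => hh.
  have : 0 < `|h| by rewrite normr_gt0.
  nra.
by apply: DeriveDef; [exact: cvgP hc|exact: cvg_lim hc].
Qed.

Lemma is_derive_pospart_sqr (a t : R) :
  is_derive t (1 : R) (fun u => pospart (u - a) ^+ 2) (2 * pospart (t - a)).
Proof.
apply: (@is_derive_quad _ _ _ 1) => h.
have -> : t + h - a = (t - a) + h by ring.
move: (t - a) => {t a} t.
rewrite mul1r ler_norml /pospart; apply/andP.
case: (lerP 0 t) => ht; case: (lerP 0 (t + h)) => hh; split; nra.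
Qed.

(** A piecewise quadratic function of class C^1, equal to 0 before 0, to [2 t^2] up to 1/2, to
    [1 - 2 (1 - t)^2] up to 1, and to 1 afterwards. It reparametrizes arcs so that they start and
    end with zero velocity. *)
Definition step (t : R) : R :=
  2 * pospart (t - 0) ^+ 2 - 4 * pospart (t - 2^-1) ^+ 2 + 2 * pospart (t - 1) ^+ 2.

Definition dstep (t : R) : R :=
  4 * pospart (t - 0) - 8 * pospart (t - 2^-1) + 4 * pospart (t - 1).

Lemma is_derive_step (t : R) : is_derive t (1 : R) step (dstep t).
Proof.
have h0 := is_derive_pospart_sqr 0 t.
have h1 := is_derive_pospart_sqr 2^-1 t.
have h2 := is_derive_pospart_sqr 1 t.
have h := is_deriveD (is_deriveB (is_deriveZ 2 h0) (is_deriveZ 4 h1)) (is_deriveZ 2 h2).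
apply: is_derive_ext h; first by apply/funext.
by rewrite /dstep /GRing.scale /=; ring.
Qed.

Lemma step_le0 (t : R) : t <= 0 -> step t = 0.
Proof.
move=> h; rewrite /step /pospart !(max_idPl _) ?expr0n; [ring|lra|lra|lra].
Qed.

Lemma step_ge1 (t : R) : 1 <= t -> step t = 1.
Proof.
by move=> h; rewrite /step /pospart !(max_idPr _); [field|lra|lra|lra].
Qed.

Lemma step_in (t : R) : 0 <= t <= 1 -> 0 <= step t <= 1.
Proof.
move=> /andP[t0 t1]; rewrite /step /pospart subr0 (max_idPr t0).
have -> : Num.max 0 (t - 1) = 0 by apply/max_idPl; lra.
rewrite expr0n mulr0 addr0; have [h|h] := lerP t 2^-1.
  have -> : Num.max 0 (t - 2^-1) = 0 by apply/max_idPl; lra.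
  have h2 : 0 <= t * (2^-1 - t) by rewrite mulr_ge0 // subr_ge0.
  by rewrite expr0n /= mulr0 subr0 expr2; apply/andP; split; nra.
have -> : Num.max 0 (t - 2^-1) = t - 2^-1 by apply/max_idPr; lra.
by apply/andP; split; nra.
Qed.

Lemma cderiv_step (t : R) : cderiv (fun u => (step u)%:C) (dstep t)%:C t.
Proof. by split => /=; [exact: is_derive_step | exact: is_derive_cst]. Qed.

Lemma cts_step A : ctsA A (fun u => (step u)%:C).
Proof.
apply: continuous_ctsA; apply: ctsA_continuous => t _ e e0.
by have [d d0 hd] := cderiv_cts (cderiv_step t) e0; exists d => // s _; exact: hd.
Qed.

Lemma cts_dstep A : ctsA A (fun u => (dstep u)%:C).
Proof.
apply: (@ctsA_real _ _ 16) => // s t; rewrite /dstep.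
have h0 := pospart_lip (s - 0) (t - 0).
have h1 := pospart_lip (s - 2^-1) (t - 2^-1).
have h2 := pospart_lip (s - 1) (t - 1).
have E a : s - a - (t - a) = s - t by ring.
rewrite !E in h0 h1 h2.
move: h0 h1 h2; rewrite !ler_norml => /andP[a0 b0] /andP[a1 b1] /andP[a2 b2].
by apply/andP; split; lra.
Qed.

(** Constancy outside the unit interval forces zero velocity at both ends, so concatenations remain
    of class C^1. *)
Definition flat_path c (a b : C) : Prop :=
  [/\ C1_path c, forall t, t <= 0 -> c t = a & forall t, 1 <= t -> c t = b].

Section Achievable.
Context (I : finType) (y : I -> C).

Definition log_vector (a b : C) (L : I -> C) : Prop :=
  exists c, [/\ flat_path c a b, forall i, avoids c (y i) & forall i, logint c (y i) = L i].

(** The segment may meet some [y i], so it is bent into a one-parameter family of arcs [c tau]. Each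
    [y i] lies on at most one arc of the family, hence some [tau] avoids all of them. *)
Lemma log_vector_segment a b : (forall i, a != y i) -> (forall i, b != y i) ->
  exists L, log_vector a b L.
Proof.
move=> ha hb.
pose c (tau : R) (t : R) : C :=
  a + (b - a) * ((step t)%:C + (0 +i* tau) * ((step t)%:C * (1 - (step t)%:C))).
have fl tau : flat_path (c tau) a b.
  pose v t : C := (b - a) * ((dstep t)%:C + (0 +i* tau) * ((dstep t)%:C * (1 - 2 * (step t)%:C))).
  have dc t : cderiv (c tau) (v t) t.
    have ds := cderiv_step t.
    have d1 := cderivD (cderiv_cst 1 t) (cderivN ds).
    have d2 := cderivM (cderiv_cst (0 +i* tau) t) (cderivM ds d1).
    have d3 := cderivM (cderiv_cst (b - a) t) (cderivD ds d2).
    apply: cderiv_eq (cderivD (cderiv_cst a t) d3) _.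
    by rewrite /v; ring.
  have cv : continuous v.
    apply: ctsA_continuous; apply: cts_mul; first exact: cts_cst.
    have := cts_comb 1 (0 +i* tau) (@cts_dstep (fun=> True)) (cts_mul (@cts_dstep _)
      (cts_comb 1 (-2) (@cts_cst _ _ 1) (@cts_step _))).
    by congr ctsA; apply/funext => t; rewrite !mul1r mulNr.
  have [hc _] := C1_path_of dc cv.
  split => // t ht; rewrite /c.
    by rewrite step_le0 //= mul0r mulr0 addr0 mulr0 addr0.
  by rewrite step_ge1 //= subrr !mulr0 addr0 mulr1 addrC subrK.
have [->|ab] := eqVneq b a.
  exists (logint (fun=> a) \o y); exists (fun=> a); split => // [|i t _]; last by rewrite ha.
  have [hc _] : C1_path (fun=> a) /\ velocity (fun=> a) = fun=> 0.
    by apply: C1_path_of => t; [exact: cderiv_cst|exact: cvg_cst].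
  by [].
have bad i : exists tau : R, forall tau', ~ avoids (c tau') (y i) -> tau' = tau.
  (* In the coordinate [(z - a) / (b - a)] the arc is [s + i tau s (1 - s)]: a point on it
     determines [s] by its real part, and then [tau], as [s] is neither 0 nor 1. *)
  set w := (y i - a) / (b - a).
  exists (complex.Im w / (complex.Re w * (1 - complex.Re w))) => tau' /existsNP[t].
  move=> /not_implyP[ht /negP]; rewrite negbK => /eqP E.
  have ba : b - a != 0 by rewrite subr_eq0.
  have wE : w = (step t) +i* (tau' * (step t * (1 - step t))).
    rewrite /w -E /c addrC addKr mulrC mulKf //.
    apply/eqP; rewrite eq_complex /=; apply/andP; split; apply/eqP; ring.
  have s0 : step t != 0.
    apply: contra_neq (ha i) => s0; move: wE; rewrite s0 mul0r mulr0 => /eqP.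
    rewrite -[0 +i* 0]/(0 : C) /w mulf_eq0 invr_eq0 (negPf ba) orbF subr_eq0 => /eqP ->.
    by [].
  have s1 : 1 - step t != 0.
    apply: contra_neq (hb i) => s1; have s1' : step t = 1 by lra.
    move: wE; rewrite s1' subrr !mulr0 => wE.
    have : y i - a = b - a by rewrite -[LHS](divfK ba) -/w wE -[1 +i* 0]/(1 : C) mul1r.
    by move/addIr ->.
  by rewrite wE /=; field; rewrite s0 s1.
have [f hf] := choice bad.
have [tau ht] : exists tau : R, forall i, tau != f i.
  exists (1 + \sum_i `|f i|) => i; apply/negP => /eqP h.
  have := ler_norm (f i); rewrite (bigD1 i) //= in h.
  have : 0 <= \sum_(j | j != i) `|f j| by apply: sumr_ge0.
  lra.
exists (logint (c tau) \o y), (c tau); split => // i.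
apply: contrapT => /hf h; have := ht i; rewrite h eqxx //.
Qed.

Lemma cderiv_affine c v (k l t : R) : cderiv c v (k * t + l) ->
  cderiv (fun s => c (k * s + l)) (k%:C * v) t.
Proof.
move=> [h1 h2].
have da : is_derive t (1 : R) (fun s => k * s + l) k.
  have := is_deriveD (is_deriveZ k (is_derive_id t (1 : R))) (is_derive_cst l t 1).
  by apply: is_derive_ext; [apply/funext | rewrite addr0 /GRing.scale /= mulr1].
split.
  apply: is_derive_ext (@is_derive1_comp _ (fun s => complex.Re (c s)) (fun s => k * s + l) t _ _ h1 da); first by [].
  by case: v {h1 h2} => p q /=; ring.
apply: is_derive_ext (@is_derive1_comp _ (fun s => complex.Im (c s)) (fun s => k * s + l) t _ _ h2 da); first by [].
by case: v {h1 h2} => p q /=; ring.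
Qed.

Lemma affine_lip (k l s t : R) : `|(k * s + l) - (k * t + l)| <= `|k| * `|s - t|.
Proof. by rewrite -normrM; have -> : k * s + l - (k * t + l) = k * (s - t) by ring. Qed.

Lemma C1_affine c (k l : R) : C1_path c -> k != 0 ->
  continuous (fun t => k%:C * velocity c (k * t + l)).
Proof.
move=> hc k0; apply: ctsA_continuous; apply: cts_mul; first exact: cts_cst.
apply: (@ctsA_comp _ (fun=> True) _ _ `|k|) => //; rewrite ?normr_gt0 //.
  by move=> s t; exact: affine_lip.
by apply: continuous_ctsA; case: hc.
Qed.

Lemma flat_lift c a b i : flat_path c a b -> avoids c (y i) ->
  exists l : R -> C, [/\ continuous l, forall t, t <= 0 -> l t = 0,
    forall t, 1 <= t -> l t = logint c (y i) &
    forall t, cexp (l t) * (a - y i) = c t - y i].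
Proof.
move=> [hc h0 h1] hy; have [l [cl l0 l1 _ hl]] := logint_lift hc hy.
exists (fun t => l (clamp t)); split.
- apply: ctsA_continuous; apply: (@ctsA_comp _ (@unit_itv R) _ _ 1) cl => //.
    by move=> s t; rewrite mul1r clamp_lip.
  by move=> t _; exact: clamp_in.
- by move=> t t0; rewrite /= /clamp (max_idPl _) // ge_min t0 orbT.
- by move=> t t1; rewrite /= /clamp (min_idPl t1) (max_idPr _) ?ler01.
- move=> t; have := hl _ (clamp_in t); rewrite h0 // => ->; congr (_ - _).
  rewrite /clamp; case: (lerP 1 t) => ht.
    by rewrite (max_idPr _) ?ler01 // !h1.
  by case: (lerP 0 t) => t0 //; rewrite !h0 // ltW.
Qed.

Lemma log_vector_cat a b d L L' : log_vector a b L -> log_vector b d L' ->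
  log_vector a d (fun i => L i + L' i).
Proof.
move=> [c [hc ac lc]] [c' [hc' ac' lc']].
have [C1 s1 e1] := hc; have [C1' s1' e1'] := hc'.
(* On each half of the interval one of the two paths rests at [b], so subtracting [b] leaves the
   other; written as a sum, the concatenation is visibly of class C^1. *)
pose g t := c (2 * t + 0) + c' (2 * t + -1) - b.
have dg t : cderiv g (2%:C * velocity c (2 * t + 0) + 2%:C * velocity c' (2 * t + -1)) t.
  have := cderivD (cderivD (cderiv_affine (C1_path_cderiv (2 * t + 0) C1))
     (cderiv_affine (C1_path_cderiv (2 * t + -1) C1'))) (cderiv_cst (- b) t).
  by rewrite addr0.
have cv : continuous (fun t : R => 2%:C * velocity c (2 * t + 0) + 2%:C * velocity c' (2 * t + -1)).
  apply: ctsA_continuous.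
  have n2 : 2 != 0 :> R by rewrite pnatr_eq0.
  have := cts_comb 1 1 (@continuous_ctsA (fun=> True) _ (@C1_affine c 2 0 C1 n2))
     (@continuous_ctsA (fun=> True) _ (@C1_affine c' 2 (-1) C1' n2)).
  by congr ctsA; apply/funext => t; rewrite !mul1r.
have [Cg _] := C1_path_of dg cv.
have gl t : t <= 2^-1 -> g t = c (2 * t + 0).
  by move=> ht; rewrite /g s1' ?addrK //; lra.
have gr t : 2^-1 <= t -> g t = c' (2 * t + -1).
  by move=> ht; rewrite /g e1 ?[b + _]addrC ?addrK //; lra.
have fg : flat_path g a d.
  split => // t ht; first by rewrite gl ?s1 //; lra.
  by rewrite gr ?e1' //; lra.
have ag i : avoids g (y i).
  move=> t /andP[t0 t1]; have [h|h] := lerP t 2^-1.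
    by rewrite gl //; apply: ac; apply/andP; split; lra.
  by rewrite gr ?ltW //; apply: ac'; apply/andP; split; lra.
exists g; split => // i.
have [l [cl l0 l1 el]] := flat_lift hc (ac i).
have [l' [cl' l'0 l'1 el']] := flat_lift hc' (ac' i).
rewrite (@logint_unique _ _ _ (fun t => l (2 * t + 0) + l' (2 * t + -1))) //.
- by rewrite l1 ?l'1 ?lc ?lc' //; lra.
- have lp k : forall s t, `|(2 * s + k) - (2 * t + k)| <= 2 * `|s - t| :> R.
    by move=> s t; apply: le_trans (affine_lip _ _ _ _) _; rewrite ger0_norm.
  have := cts_comb 1 1 (@ctsA_comp (@unit_itv R) (fun=> True) l _ 2 (ltr0n _ 2) (lp 0) (fun _ _ => Logic.I) (@continuous_ctsA _ _ cl))
    (@ctsA_comp (@unit_itv R) (fun=> True) l' _ 2 (ltr0n _ 2) (lp (-1)) (fun _ _ => Logic.I) (@continuous_ctsA _ _ cl')).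
  by congr ctsA; apply/funext => t; rewrite !mul1r.
- by rewrite l0 ?l'0 ?addr0 //; lra.
- move=> t ht; have [_ g0 _] := fg; rewrite g0 // cexpD.
  have [h|h] := lerP t 2^-1.
    rewrite gl // -el l'0 ?cexp0 ?mulr1 //; lra.
  rewrite gr ?ltW // -el' mulrAC [cexp _ * (a - _)]el e1 1?mulrC //; lra.
Qed.

Lemma log_vector_rev a b L : log_vector a b L -> log_vector b a (fun i => - L i).
Proof.
move=> [c [hc ac lc]]; have [C1 s1 e1] := hc.
pose g t := c (-1 * t + 1).
have dg t : cderiv g ((-1)%:C * velocity c (-1 * t + 1)) t.
  exact: cderiv_affine (C1_path_cderiv (-1 * t + 1) C1).
have n1 : -1 != 0 :> R by rewrite oppr_eq0 oner_eq0.
have [Cg _] := C1_path_of dg (@C1_affine c (-1) 1 C1 n1).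
have fg : flat_path g b a.
  by split => // t ht; rewrite /g; [apply: e1; lra|apply: s1; lra].
have ag i : avoids g (y i).
  by move=> t /andP[t0 t1]; apply: ac; apply/andP; split; lra.
exists g; split => // i.
have [l [cl l0 l1 el]] := flat_lift hc (ac i).
rewrite (@logint_unique _ _ _ (fun t => l (-1 * t + 1) - L i)) //.
- by rewrite l0 ?sub0r //; lra.
- have lp : forall s t, `|(-1 * s + 1) - (-1 * t + 1)| <= 1 * `|s - t| :> R.
    by move=> s t; apply: le_trans (affine_lip _ _ _ _) _; rewrite normrN normr1.
  have := cts_comb 1 (-1) (@ctsA_comp (@unit_itv R) (fun=> True) l _ 1 (ltr0n _ 1) lp (fun _ _ => Logic.I) (@continuous_ctsA _ _ cl))
    (@cts_cst _ _ (L i)).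
  by congr ctsA; apply/funext => t; rewrite mul1r (mulN1r (L i)).
- by rewrite l1 ?lc ?subrr //; lra.
- move=> t ht; have [_ g0 _] := fg; rewrite g0 // cexpD -el.
  have := el 1; rewrite l1 // lc e1 // => <-.
  by rewrite -mulrA (mulrA _ (cexp (L i))) cexpN_mul mul1r.
Qed.

Lemma log_vector_const a : (forall i, a != y i) -> log_vector a a (fun=> 0).
Proof.
move=> ha; have [L h] := log_vector_segment ha ha.
have := log_vector_cat h (log_vector_rev h); congr log_vector.
by apply/funext => i; rewrite subrr.
Qed.

(** A small circle around [y i]. The logarithm of [c - y i] is the angle and gains [2 pi i]; for the
    other poles the ratio [(c - y j) / (p - y j)] stays in the domain of the local logarithm [Lg],
    whose value returns to 0. *)
Lemma log_vector_circle i : injective y ->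
  exists p, (forall j, p != y j) /\ log_vector p p (fun j => if j == i then two_pi_i R else 0).
Proof.
move=> yi.
have [r [k [Lg [r0 k0 Lg1 hLg lipLg]]]] := clog_near1 R.
(* The first bound keeps [p] at distance more than [|y i - y j| / 2] from [y j]; the second then
   gives [|c t - p| <= 2 rho < r |p - y j|]. *)
have [rho rho0 hrho] : exists2 rho : R, 0 < rho & forall j, j != i ->
    2 * rho < absc (y i - y j) /\ 2 * rho < r * (absc (y i - y j) / 2).
  pose m j : R := Num.min (absc (y i - y j)) (r * (absc (y i - y j) / 2)).
  exists (\big[Num.min/1]_(j | j != i) m j / 4).
    rewrite divr_gt0 //; elim/big_ind: _ => // [u v hu hv|j ji]; first by rewrite lt_min hu.
    have dj : 0 < absc (y i - y j).
      by rewrite absc_gt0 subr_eq0; apply: contra_neq ji => /yi.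
    by rewrite lt_min dj mulr_gt0 // divr_gt0.
  move=> j ji; set M := \big[_/_]_(_ | _) _.
  have hM : M <= m j by rewrite /M (bigD1 j) //= ge_min lexx.
  have M0 : 0 < M.
    rewrite /M; elim/big_ind: _ => // [u v hu hv|l li]; first by rewrite lt_min hu.
    have dj : 0 < absc (y i - y l).
      by rewrite absc_gt0 subr_eq0; apply: contra_neq li => /yi.
    by rewrite lt_min dj mulr_gt0 // divr_gt0.
  by move: hM; rewrite le_min => /andP[h1 h2]; split; lra.
pose p := y i + rho%:C.
have absE (x : R) : absc (cexp (0 +i* x)) = 1.
  by rewrite cexpE /absc /= expR0 !mul1r cos2Dsin2 sqrtr1.
pose th t : C := two_pi_i R * (step t)%:C.
have thE t : th t = 0 +i* (2 * pi * step t).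
  by apply/eqP; rewrite eq_complex /= !mul0r mulr0 subr0 add0r !eqxx.
pose c t := y i + rho%:C * cexp (th t).
have dth t : cderiv th (two_pi_i R * (dstep t)%:C) t.
  apply: cderiv_eq (cderivM (cderiv_cst _ t) (cderiv_step t)) _.
  by rewrite mul0r add0r.
have dc t : cderiv c (rho%:C * (cexp (th t) * (two_pi_i R * (dstep t)%:C))) t.
  apply: cderiv_eq (cderivD (cderiv_cst _ t) (cderivM (cderiv_cst _ t) (cderiv_cexp (dth t)))) _.
  by rewrite mul0r !add0r.
have cth A : ctsA A th by apply: cts_mul; [exact: cts_cst|exact: cts_step].
have cev A : ctsA A (fun t => cexp (th t)).
  apply: continuous_ctsA; apply: ctsA_continuous => t _ e e0.
  by have [d d0 hd] := cderiv_cts (cderiv_cexp (dth t)) e0; exists d => // s _; exact: hd.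
have cv : continuous (fun t : R => rho%:C * (cexp (th t) * (two_pi_i R * (dstep t)%:C))).
  apply: ctsA_continuous.
  exact: cts_mul (cts_cst _) (cts_mul (cev _) (cts_mul (cts_cst _) (@cts_dstep _))).
have [Cc _] := C1_path_of dc cv.
have fc : flat_path c p p.
  split => // t ht; rewrite /c /p /th.
    by rewrite step_le0 //= mulr0 cexp0 mulr1.
  by rewrite step_ge1 //= mulr1 cexp_two_pi_i mulr1.
have cyi t : absc (c t - y i) = rho.
  by rewrite /c addrC addKr abscM absc_real thE absE mulr1 gtr0_norm.
have hp j : j != i -> absc (y i - y j) / 2 < absc (p - y j).
  move=> ji; have [h _] := hrho j ji.
  have := ler_abscD (y i - p) (p - y j); rewrite addrA subrK /p opprD addrA subrr add0r.
  by rewrite abscN absc_real gtr0_norm; lra.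
have av j : avoids c (y j).
  move=> t _; have [->|ji] := eqVneq j i.
    by rewrite -subr_eq0 -absc_gt0 cyi.
  have [h _] := hrho j ji; rewrite -subr_eq0 -absc_gt0.
  by have := ler_abscD (y i - c t) (c t - y j); rewrite addrA subrK (abscB (y i)) cyi; lra.
exists p; split.
  by move=> j; have := av j 0; rewrite /c /th step_le0 //= mulr0 cexp0 mulr1; apply; rewrite lexx ler01.
exists c; split => // j; have [_ c0 _] := fc; have [->|ji] := eqVneq j i.
  rewrite (@logint_unique _ _ _ th) //.
  - by rewrite /th step_ge1 //= mulr1.
  - by rewrite /th step_le0 //= mulr0.
  - by move=> t _; rewrite c0 // /p /c !(addrC (y i)) !addrK mulrC.
have pn : p - y j != 0.
  by rewrite -absc_gt0; have := hp j ji; have := absc_ge0 (y i - y j); lra.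
pose w t := 1 + (c t - p) / (p - y j).
have hw t : absc (w t - 1) < r.
  rewrite /w addrC addKr abscM abscV ltr_pdivrMr ?absc_gt0 //.
  have [_ h] := hrho j ji; have h2 := hp j ji.
  have h3 : absc (c t - p) <= 2 * rho.
    have := ler_abscD (c t - y i) (y i - p); rewrite addrA subrK cyi.
    have -> : absc (y i - p) = rho.
      by rewrite /p opprD addrA subrr add0r abscN absc_real gtr0_norm.
    lra.
  apply: le_lt_trans h3 _; apply: lt_trans h _; by rewrite ltr_pM2l.
have cw : cts01 w.
  have := cts_comb (p - y j)^-1 (1 - p / (p - y j)) (cderiv_cts01 (fun t _ => dc t)) (@cts_cst _ _ 1).
  by congr ctsA; apply/funext => t; rewrite /w; field.
rewrite (@logint_unique _ _ _ (Lg \o w)) //=.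
- by rewrite /w (_ : c 1 = p) ?subrr ?mul0r ?addr0 //; case: fc => _ _ ->.
- move=> t ht e e0; have [d d0 hd] := cw t ht (k * e) (mulr_gt0 k0 e0); exists d => // s hs st.
  rewrite -(ltr_pM2l k0); apply: le_lt_trans (lipLg _ _ (hw s) (hw t)) _; exact: hd.
- by rewrite /w c0 // subrr mul0r addr0.
- by move=> t ht; rewrite hLg // c0 // /w; field.
Qed.

(** Conjugating a small circle by an arc from [a] gives a loop at [a] whose vector is [2 pi i] in
    one coordinate and 0 elsewhere. Any prescribed [L] differs from that of one arc by integral
    multiples of [2 pi i], hence by a concatenation of such loops. *)
Lemma log_vector_all a b L : injective y -> (forall i, a != y i) -> (forall i, b != y i) ->
  (forall i, cexp (L i) = (b - y i) / (a - y i)) -> log_vector a b L.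
Proof.
move=> yi ha hb hL.
have loop i : log_vector a a (fun j => if j == i then two_pi_i R else 0).
  have [p [hp h]] := log_vector_circle i yi.
  have [L' h'] := log_vector_segment ha hp.
  have := log_vector_cat (log_vector_cat h' h) (log_vector_rev h'); congr log_vector.
  by apply/funext => j; rewrite addrAC subrr add0r.
have loopz i (k : int) : log_vector a a (fun j => if j == i then two_pi_i R *~ k else 0).
  have hn (n : nat) : log_vector a a (fun j => if j == i then two_pi_i R *+ n else 0).
    elim: n => [|n IH].
      by have := log_vector_const ha; congr log_vector; apply/funext => j; rewrite if_same.
    have := log_vector_cat (loop i) IH; congr log_vector; apply/funext => j.
    by case: ifP => _; rewrite ?addr0 // mulrS.
  case: k => n; first exact: hn.
  have := log_vector_rev (hn n.+1); congr log_vector; apply/funext => j.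
  by rewrite NegzE; case: ifP => _; rewrite ?oppr0 // mulrNz.
have [L' h'] := log_vector_segment ha hb.
have hz i : exists k : int, L i - L' i = two_pi_i R *~ k.
  apply/cexp_eq1; rewrite cexpD cexpN hL; have [c [[C1 c0 c1] ac lc]] := h'.
  rewrite -lc logint_exp // (c0 0) // (c1 1) // mulfV // mulf_neq0 ?invr_eq0 //.
    by rewrite subr_eq0.
  by rewrite subr_eq0.
have [k hk] := choice hz.
have hs : forall s : seq I, log_vector a a (fun j => \sum_(i <- s) (if j == i then two_pi_i R *~ k i else 0)).
  elim=> [|i s IH].
    by have := log_vector_const ha; congr log_vector; apply/funext => j; rewrite big_nil.
  have := log_vector_cat (loopz i (k i)) IH; congr log_vector; apply/funext => j.
  by rewrite big_cons.
have := log_vector_cat (hs (index_enum I)) h'; congr log_vector; apply/funext => j.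
rewrite (bigD1 j) //= eqxx big1 ?addr0 -?hk ?subrK // => i ij.
by rewrite eq_sym (negPf ij).
Qed.

End Achievable.
End Paths.

(** * Injectivity of the period Jacobian *)

Section ResidueAlgebra.
Context (F : numFieldType).
Implicit Types (P Q D : {poly F}).

Lemma poly_eq_cofinite P Q (s : seq F) : (forall z, z \notin s -> P.[z] = Q.[z]) -> P = Q.
Proof.
move=> h; apply/eqP; rewrite -subr_eq0; apply/eqP.
set T := P - Q; apply: contraTeq (leqnn (size T)) => T0; rewrite -ltnNge.
(* Multiplying by the exceptional factors gives a polynomial that vanishes at every natural number,
   and those are distinct in characteristic 0. *)
pose S := T * \prod_(a <- s) ('X - a%:P).
have S0 : S = 0.
  pose rs := [seq (i%:R : F) | i <- iota 0 (size S)].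
  apply: (@roots_geq_poly_eq0 _ _ rs); last by rewrite size_map size_iota.
    apply/allP => _ /mapP[i _ ->]; rewrite /root hornerM.
    have [zs|zs] := boolP (i%:R \in s).
      rewrite mulf_eq0; apply/orP; right.
      by rewrite -/(root _ _) root_prod_XsubC.
    by rewrite /T hornerD hornerN h // subrr mul0r.
  rewrite map_inj_uniq ?iota_uniq // => i j /eqP; rewrite eqr_nat => /eqP //.
have := S0 => /eqP; rewrite mulf_eq0 (negPf T0) /= => /eqP p0.
have := monic_prod_XsubC s xpredT id; rewrite p0.
by rewrite monicE lead_coef0 eq_sym oner_eq0.
Qed.

(** The Wronskian is [D^2] times the derivative of [Q / D]. In characteristic 0, differentiation
    lowers a positive order of vanishing by exactly one, so order [k] of the derivative gives order
    [k + 1] of [Q]. *)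
Lemma dvdp_wronskian (a : F) (k : nat) D Q : D.[a] != 0 -> Q.[a] = 0 ->
  ('X - a%:P) ^+ k %| Q^`() * D - Q * D^`() -> ('X - a%:P) ^+ k.+1 %| Q.
Proof.
move=> Da Qa hW.
suff : forall j, (j <= k)%N -> ('X - a%:P) ^+ j.+1 %| Q by apply.
elim=> [_|j IH jk]; first by rewrite expr1 dvdp_XsubCl /root Qa.
have /dvdpP[S QE] := IH (ltnW jk).
set X := 'X - a%:P in hW QE *.
have dX : X^`() = 1 by rewrite derivB derivX derivC subr0.
have E : Q^`() * D - Q * D^`() = X ^+ j * ((j.+1%:R *: S) * D + X * (S^`() * D - S * D^`())).
  rewrite QE derivM deriv_exp dX mul1r /= exprS scaler_nat -[X ^+ j *+ _]mulr_natl -[S *+ _]mulr_natl.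
  by ring.
have : X ^+ j.+1 %| Q^`() * D - Q * D^`() by apply: dvdp_trans hW; apply: dvdp_exp2l.
have X0 : X ^+ j != 0 by rewrite expf_neq0 // polyXsubC_eq0.
rewrite E exprSr dvdp_mul2l // dvdp_XsubCl /root !hornerE subrr mul0r addr0.
rewrite !mulf_eq0 (negPf Da) orbF pnatr_eq0 /= => Sa.
by rewrite QE [X ^+ j.+2]exprS dvdp_mul2r ?expf_neq0 ?polyXsubC_eq0 // dvdp_XsubCl /root.
Qed.

Lemma dvdp_prod_XsubC_exp (I : finType) (x : I -> F) (e : I -> nat) Q : injective x ->
  (forall i, ('X - (x i)%:P) ^+ e i %| Q) -> \prod_i ('X - (x i)%:P) ^+ e i %| Q.
Proof.
move=> xi h.
have : forall s : seq I, uniq s -> \prod_(i <- s) ('X - (x i)%:P) ^+ e i %| Q.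
  elim=> [|i s IH] /=; first by rewrite big_nil dvd1p.
  move=> /andP[ni us]; rewrite big_cons Gauss_dvdp ?h ?IH //.
  rewrite coprimep_sym big_seq; elim/big_rec: _ => [|j P js IHp].
    by rewrite coprimep1 || rewrite coprime1p.
  rewrite coprimepMl IHp andbT.
  apply: coprimep_expl; apply: coprimep_expr; rewrite coprimep_XsubC root_XsubC.
  by apply: contra ni => /eqP /xi ->.
by apply; exact: index_enum_uniq.
Qed.

Section Data.
Context (m n : nat) (e : 'I_m.+1 -> nat) (lam : F) (x : 'I_m.+1 -> F) (y : 'I_n.+1 -> F).
Hypotheses (he : forall i, (0 < e i)%N) (hsum : (\sum_(i < m.+1) e i)%N = n)
  (lam0 : lam != 0) (xi : injective x) (yi : injective y) (xy : forall i l, x i != y l).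

Definition num_poly : {poly F} := lam *: \prod_i ('X - (x i)%:P) ^+ e i.
Definition den_poly : {poly F} := \prod_l ('X - (y l)%:P).
Definition den_but l : {poly F} := \prod_(l' | l' != l) ('X - (y l')%:P).
Definition num_but i : {poly F} :=
  lam *: (('X - (x i)%:P) ^+ (e i).-1 * \prod_(i' | i' != i) ('X - (x i')%:P) ^+ e i').
Definition res_at l : F := num_poly.[y l] / (den_but l).[y l].

Lemma num_polyE z : num_poly.[z] = lam * \prod_i (z - x i) ^+ e i.
Proof.
by rewrite hornerZ horner_prod; congr (_ * _); apply: eq_bigr => i _; rewrite !hornerE.
Qed.

Lemma den_polyE z : den_poly.[z] = \prod_l (z - y l).
Proof. by rewrite horner_prod; apply: eq_bigr => i _; rewrite !hornerE. Qed.

Lemma den_butE l z : (den_but l).[z] = \prod_(l' | l' != l) (z - y l').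
Proof. by rewrite horner_prod; apply: eq_bigr => i _; rewrite !hornerE. Qed.

Lemma den_polyD1 l : den_poly = ('X - (y l)%:P) * den_but l.
Proof. by rewrite /den_poly (bigD1 l). Qed.

Lemma num_polyD1 i : num_poly = ('X - (x i)%:P) * num_but i.
Proof.
rewrite /num_poly (bigD1 i) //= -scalerAr mulrA -exprS prednK //.
Qed.

Lemma size_den_poly : size den_poly = n.+2.
Proof. by rewrite size_prod_XsubC /index_enum -enumT size_enum_ord. Qed.

Lemma size_num_poly : size num_poly = n.+1.
Proof.
rewrite size_scale // size_prod => [|i _]; last by rewrite expf_neq0 // polyXsubC_eq0.
have -> : (\sum_(i < m.+1) size (('X - (x i)%:P) ^+ e i) = \sum_(i < m.+1) (e i).+1)%N.
  by apply: eq_bigr => i _; rewrite size_exp_XsubC.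
have -> : (\sum_(i < m.+1) (e i).+1 = n + m.+1)%N.
  rewrite -hsum; under eq_bigr do rewrite -addn1.
  by rewrite big_split /= sum_nat_const card_ord muln1.
by rewrite cardT size_enum_ord -addSn addnK.
Qed.

Lemma den_but_pole l : (den_but l).[y l] != 0.
Proof.
rewrite den_butE; apply/prodf_neq0 => l' l'l.
by rewrite subr_eq0; apply: contra_neq l'l => /yi.
Qed.

Lemma den_but_other l l' : l' != l -> (den_but l).[y l'] = 0.
Proof. by move=> h; rewrite den_butE (bigD1 l') //= subrr mul0r. Qed.

Lemma size_den_but l : size (den_but l) = n.+1.
Proof.
have := size_den_poly; rewrite (den_polyD1 l) size_Mmonic ?polyXsubC_eq0 //.
  by rewrite size_XsubC add2n /= => -[].
exact: monic_prod_XsubC.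
Qed.

Lemma num_poly_pole l : num_poly.[y l] != 0.
Proof.
rewrite num_polyE mulf_neq0 //; apply/prodf_neq0 => i _.
by rewrite expf_neq0 // subr_eq0 eq_sym.
Qed.

Lemma res_at_neq0 l : res_at l != 0.
Proof. by rewrite mulf_neq0 ?invr_eq0 ?num_poly_pole ?den_but_pole. Qed.

(** Lagrange interpolation at the [n + 1] poles: [num_poly] has degree [n], which expresses the
    simple pole at infinity. *)
Lemma interpolation : num_poly = \sum_l res_at l *: den_but l.
Proof.
apply/eqP; rewrite -subr_eq0; apply/eqP.
apply: (@roots_geq_poly_eq0 _ _ [seq y l | l <- enum 'I_n.+1]).
- apply/allP => _ /mapP[l _ ->]; rewrite /root hornerD hornerN horner_sum (bigD1 l) //=.
  rewrite big1 => [|l' l'l]; last by rewrite hornerZ den_but_other ?mulr0 // eq_sym.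
  by rewrite addr0 (hornerZ (res_at l)) /res_at divfK ?subrr // den_but_pole.
- by rewrite map_inj_uniq ?enum_uniq.
- rewrite size_map size_enum_ord.
  apply: leq_trans (size_polyD _ _) _; rewrite size_polyN geq_max size_num_poly leqnn /=.
  apply: leq_trans (size_sum _ _ _) _; apply/bigmax_leqP => l _.
  apply: leq_trans (size_scale_leq _ _) _.
  by rewrite size_den_but.
Qed.

Lemma partial_fractions z : (forall l, z != y l) ->
  num_poly.[z] / den_poly.[z] = \sum_l res_at l / (z - y l).
Proof.
move=> hz.
rewrite {1}interpolation horner_sum mulr_suml; apply: eq_bigr => l _.
rewrite hornerZ (den_polyD1 l) hornerM !hornerE -mulrA; congr (_ * _).
have b0 : (den_but l).[z] != 0.
  by rewrite den_butE; apply/prodf_neq0 => l' _; rewrite subr_eq0.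
by rewrite invfM mulrCA mulfV ?mulr1.
Qed.

Section Jacobian.
Context (lam' : F) (x' : 'I_m.+1 -> F) (y' : 'I_n.+1 -> F).
Hypotheses (x'0 : x' ord0 = 0) (y'0 : y' ord0 = 0).

(** The primed data are a first order deformation with constant residues. Its effect on the form is
    the derivative of [h = - \sum_l R_l y'_l / (z - y_l)], and [H2] says that [h] takes one value at
    all zeros. That derivative vanishes at [x_i] to order [e_i - 1], so [h] minus this value
    vanishes to order [e_i] and its numerator [Q] is [T num_poly] with [T] of degree at most 1. Two
    roots of [T] give [Q = 0]; then all [y'] vanish, and comparing orders at each [x_i] kills [x']
    and [lam']. *)
Lemma period_jacobian_inj :
  x ord0 = 0 -> y ord0 = 1 ->
  (forall z, (forall i, z != x i) -> (forall l, z != y l) ->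
    \sum_l res_at l * y' l / (z - y l) ^+ 2 =
    num_poly.[z] / den_poly.[z] *
      (lam' / lam - \sum_i (e i)%:R * x' i / (z - x i) + \sum_l y' l / (z - y l))) ->
  (forall i, \sum_l res_at l * y' l / (x i - y l) = \sum_l res_at l * y' l / (x ord0 - y l)) ->
  [/\ lam' = 0, forall i, x' i = 0 & forall l, y' l = 0].
Proof.
move=> x0 y0 H1 H2.
(* [kap] is the common value of [h] at the zeros, [Q0] is [den_poly h], [Q] is [den_poly (h - kap)],
   and [W] is [den_poly^2] times the deformation of the form, computed from its product
   expression. *)
pose kap := - \sum_l res_at l * y' l / (x ord0 - y l).
pose Q0 := - \sum_l (res_at l * y' l) *: den_but l.
pose Q := Q0 - kap *: den_poly.
pose W := (lam' / lam) *: (den_poly * num_poly) -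
  den_poly * (\sum_i ((e i)%:R * x' i) *: num_but i) + num_poly * (\sum_l y' l *: den_but l).
have Dz z : (forall l, z != y l) -> den_poly.[z] != 0.
  by move=> h; rewrite den_polyE; apply/prodf_neq0 => l _; rewrite subr_eq0.
have butz l z : (forall l, z != y l) -> (den_but l).[z] = den_poly.[z] / (z - y l).
  by move=> h; rewrite (den_polyD1 l) hornerM !hornerE mulrAC mulfV ?mul1r // subr_eq0.
have Q0z z : (forall l, z != y l) -> Q0.[z] = - den_poly.[z] * \sum_l res_at l * y' l / (z - y l).
  move=> h; rewrite hornerN horner_sum mulNr mulr_sumr; congr (- _); apply: eq_bigr => l _.
  by rewrite hornerZ butz // mulrCA.
have Qx i : Q.[x i] = 0.
  rewrite hornerD hornerN hornerZ Q0z; last by move=> l; exact: xy.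
  by rewrite /kap H2 mulNr mulNr opprK mulrC addNr.
have wr : Q^`() * den_poly - Q * den_poly^`() = W.
  apply: (@poly_eq_cofinite _ _ ([seq x i | i <- enum 'I_m.+1] ++ [seq y l | l <- enum 'I_n.+1])).
  move=> z; rewrite mem_cat negb_or => /andP[zx zy].
  have hx i : z != x i by apply: contraNneq zx => ->; rewrite map_f ?mem_enum.
  have hy l : z != y l by apply: contraNneq zy => ->; rewrite map_f ?mem_enum.
  have h1 := H1 z hx hy.
  have D0 := Dz z hy.
  have -> : Q^`() * den_poly - Q * den_poly^`() =
     - \sum_l (res_at l * y' l) *: ((den_but l)^`() * den_poly - den_but l * den_poly^`()).
    rewrite /Q derivB derivZ /Q0 derivN raddf_sum /=.
    have -> : (- (\sum_i ((res_at i * y' i) *: den_but i)^`()) - kap *: den_poly^`()) * den_poly -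
      (- (\sum_l (res_at l * y' l) *: den_but l) - kap *: den_poly) * den_poly^`() =
      - ((\sum_i ((res_at i * y' i) *: den_but i)^`()) * den_poly - (\sum_l (res_at l * y' l) *: den_but l) * den_poly^`()).
      by rewrite -!mul_polyC; ring.
    rewrite !mulr_suml -sumrB; congr (- _); apply: eq_bigr => l _.
    by rewrite derivZ -!scalerAl scalerBr.
  have but2 l : (den_but l)^`() * den_poly - den_but l * den_poly^`() = - (den_but l) ^+ 2.
    rewrite (den_polyD1 l) derivM derivB derivX derivC subr0; ring.
  rewrite hornerN horner_sum.
  have -> : - (\sum_l ((res_at l * y' l) *: ((den_but l)^`() * den_poly - den_but l * den_poly^`())).[z])
     = den_poly.[z] ^+ 2 * \sum_l res_at l * y' l / (z - y l) ^+ 2.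
    rewrite mulr_sumr -sumrN; apply: eq_bigr => l _.
    by rewrite but2 hornerZ hornerN horner_exp butz // mulrN opprK expr_div_n mulrCA.
  rewrite h1 /W hornerD hornerD hornerN (hornerZ (lam' / lam)) !hornerM !horner_sum.
  have -> : \sum_i (((e i)%:R * x' i) *: num_but i).[z] = num_poly.[z] * \sum_i (e i)%:R * x' i / (z - x i).
    rewrite mulr_sumr; apply: eq_bigr => i _; rewrite hornerZ (num_polyD1 i) hornerM hornerXsubC.
    by move: ((num_but i).[z]) => b; field; rewrite subr_eq0.
  have -> : \sum_l (y' l *: den_but l).[z] = den_poly.[z] * \sum_l y' l / (z - y l).
    by rewrite mulr_sumr; apply: eq_bigr => l _; rewrite hornerZ butz // mulrCA.
  move: (\sum_i _ / (z - x i)) (\sum_l y' l / _) (num_poly.[z]) (den_poly.[z]) D0 => s1 s2 N0 D1 D10.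
  by field; rewrite lam0.
have dvN i : ('X - (x i)%:P) ^+ e i %| num_poly.
  by rewrite dvdpZr // (bigD1 i) //= dvdp_mulr.
have dvNo i i' : i' != i -> ('X - (x i)%:P) ^+ e i %| num_but i'.
  by move=> h; rewrite dvdpZr // dvdp_mull // (bigD1 i) 1?eq_sym //= dvdp_mulr.
have dvNi i : ('X - (x i)%:P) ^+ (e i).-1 %| num_but i by rewrite dvdpZr // dvdp_mulr.
have le i : ('X - (x i)%:P) ^+ (e i).-1 %| ('X - (x i)%:P) ^+ e i by rewrite dvdp_exp2l // leq_pred.
have dvQ i : ('X - (x i)%:P) ^+ e i %| Q.
  rewrite -(prednK (he i)); apply: (dvdp_wronskian (D := den_poly)) => //.
    by apply: Dz => l; exact: xy.
  rewrite wr /W; apply: dvdp_add.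
    apply: dvdp_sub.
      by rewrite -mul_polyC dvdp_mull // dvdp_mull // (dvdp_trans (le i)).
    rewrite dvdp_mull // (bigD1 i) //=; apply: dvdp_add.
      by rewrite -mul_polyC dvdp_mull.
    apply: (big_ind (fun p => _ %| p)) => [|p q|i' i'i]; [exact: dvdp0|exact: dvdp_add|].
    by rewrite -mul_polyC dvdp_mull // (dvdp_trans (le i)) // dvNo.
  by rewrite dvdp_mulr // (dvdp_trans (le i)).
have /dvdpP[T QT] : num_poly %| Q by rewrite dvdpZl // dvdp_prod_XsubC_exp.
have N0 : num_poly != 0 by rewrite -size_poly_gt0 size_num_poly.
have sT : (size T <= 2)%N.
  have [->|T0] := eqVneq T 0; first by rewrite size_poly0.
  have : (size Q <= n.+2)%N.
    apply: leq_trans (size_polyD _ _) _; rewrite !size_polyN geq_max; apply/andP; split.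
      apply: leq_trans (size_sum _ _ _) _; apply/bigmax_leqP => l _.
      apply: leq_trans (size_scale_leq _ _) _.
      by rewrite size_den_but.
    by apply: leq_trans (size_scale_leq _ _) _; rewrite size_den_poly.
  rewrite QT size_mul // size_num_poly addnS /= => h; by rewrite -(leq_add2r n) add2n.
(* The two normalizations supply the roots of [T]: [y'_0 = 0] removes the pole of [h] at [y_0], and
   [x'_0 = 0] raises the order of [Q] at [x_0] by one. *)
have Ty0 : T.[y ord0] = 0.
  have : Q.[y ord0] = 0.
    rewrite /Q hornerD hornerN hornerZ (den_polyD1 ord0) hornerM hornerXsubC subrr mul0r mulr0 subr0.
    rewrite /Q0 hornerN horner_sum (bigD1 ord0) //= hornerZ y'0 mulr0 mul0r add0r big1 ?oppr0 // => l l0.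
    by rewrite hornerZ den_but_other ?mulr0 // eq_sym.
  by rewrite QT hornerM => /eqP; rewrite mulf_eq0 (negPf (num_poly_pole _)) orbF => /eqP.
have Tx0 : T.[x ord0] = 0.
  have dv : ('X - (x ord0)%:P) ^+ (e ord0).+1 %| Q.
    apply: (dvdp_wronskian (D := den_poly)) => //; first by apply: Dz => l; exact: xy.
    rewrite wr /W; apply: dvdp_add.
      apply: dvdp_sub.
        by rewrite -mul_polyC dvdp_mull // dvdp_mull.
      rewrite dvdp_mull // (bigD1 ord0) //= x'0 mulr0 scale0r add0r.
      apply: (big_ind (fun p => _ %| p)) => [|p q|i' i'i]; [exact: dvdp0|exact: dvdp_add|].
      by rewrite -mul_polyC dvdp_mull // dvNo.
    by rewrite dvdp_mulr.
  move: dv; rewrite QT /num_poly (bigD1 ord0) //= -scalerAr dvdpZr //.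
  rewrite mulrCA exprSr dvdp_mul2l; last by rewrite expf_neq0 // polyXsubC_eq0.
  rewrite dvdp_XsubCl /root hornerM mulf_eq0 => /orP[/eqP //|].
  rewrite horner_prod => /eqP h; exfalso; move/eqP: h; apply/negP/prodf_neq0 => i i0.
  by rewrite !hornerE expf_neq0 // subr_eq0; apply: contra_neq i0 => /xi ->.
have Q00 : Q = 0.
  have T0 : T = 0.
    apply: (@roots_geq_poly_eq0 _ _ [:: x ord0; y ord0]) => //=.
      by rewrite /root Tx0 Ty0 eqxx.
    by rewrite inE xy.
  by rewrite QT T0 mul0r.
have yl l : y' l = 0.
  have : Q.[y l] = 0 by rewrite Q00 horner0.
  rewrite /Q hornerD hornerN hornerZ (den_polyD1 l) hornerM hornerXsubC subrr mul0r mulr0 subr0.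
  rewrite /Q0 hornerN horner_sum (bigD1 l) //= big1 => [|l' l'l]; last by rewrite hornerZ den_but_other ?mulr0 // eq_sym.
  rewrite addr0 hornerZ => /eqP; rewrite oppr_eq0 mulf_eq0 (negPf (den_but_pole l)) orbF.
  by rewrite mulf_eq0 (negPf (res_at_neq0 l)) => /eqP.
have W0 : W = 0 by rewrite -wr Q00 deriv0 !mul0r subrr.
have D0 : den_poly != 0 by rewrite -size_poly_gt0 size_den_poly.
have W1 : (lam' / lam) *: num_poly = \sum_i ((e i)%:R * x' i) *: num_but i.
  apply: (mulfI D0); apply/eqP; rewrite -subr_eq0 -scalerAr; apply/eqP.
  have Y0 : \sum_l y' l *: den_but l = 0 by rewrite big1 // => l _; rewrite yl scale0r.
  by move: W0; rewrite /W Y0 mulr0 addr0.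
have xz i : x' i = 0.
  have : ('X - (x i)%:P) ^+ e i %| ((e i)%:R * x' i) *: num_but i.
    have -> : ((e i)%:R * x' i) *: num_but i = (lam' / lam) *: num_poly -
       \sum_(i' | i' != i) ((e i')%:R * x' i') *: num_but i'.
      by rewrite W1 [in RHS](bigD1 i) //= addrK.
    apply: dvdp_sub; first by rewrite -mul_polyC dvdp_mull.
    apply: (big_ind (fun p => _ %| p)) => [|p q|i' i'i]; [exact: dvdp0|exact: dvdp_add|].
    by rewrite -mul_polyC dvdp_mull // dvNo.
  apply: contraTeq => xn.
  have c0 : (e i)%:R * x' i != 0 by rewrite mulf_neq0 // pnatr_eq0 -lt0n.
  rewrite dvdpZr // dvdpZr // -(prednK (he i)) exprSr /=.
  rewrite dvdp_mul2l ?expf_neq0 ?polyXsubC_eq0 //.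
  rewrite dvdp_XsubCl /root horner_prod; apply/prodf_neq0 => j ji.
  by rewrite !hornerE expf_neq0 // subr_eq0; apply: contra_neq ji => /xi ->.
split => //.
move: W1; rewrite big1 => [|i _]; last by rewrite xz mulr0 scale0r.
move/eqP; rewrite scaler_eq0 (negPf N0) orbF mulf_eq0 invr_eq0 (negPf lam0) orbF.
by move/eqP.
Qed.

End Jacobian.
End Data.
End ResidueAlgebra.

(** * Coordinates on the stratum *)

Section DifferentiableFunctions.
Context (R : realType) (N : nat).
Local Notation C := R[i].
Implicit Types (f g : 'rV[C]_N -> C) (p : 'rV[C]_N).

Definition sdiffable f p : Prop := exists d, sdiff1 f p d.

Lemma sdiff1_ext f g p d d' : (forall x, g x = f x) -> d' = d -> sdiff1 f p d -> sdiff1 g p d'.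
Proof. by move=> /funext -> ->. Qed.

Lemma sdiffable_ext f g p : (forall x, g x = f x) -> sdiffable f p -> sdiffable g p.
Proof. by move=> /funext ->. Qed.

Lemma sdiffable_cst a p : sdiffable (fun=> a) p.
Proof. by exists 0; exact: sdiff1_cst. Qed.

Lemma sdiffable_coord j p : sdiffable (fun x => x 0 j) p.
Proof. by exists (delta_mx j 0); exact: sdiff1_coord. Qed.

Lemma sdiffableM f g p : sdiffable f p -> sdiffable g p -> sdiffable (fun x => f x * g x) p.
Proof. by move=> [d hd] [d' hd']; eexists; exact: sdiff1_mul hd hd'. Qed.

Lemma sdiff1_scale a f p d : sdiff1 f p d -> sdiff1 (fun x => a * f x) p (a *: d).
Proof.
by move=> h; have := sdiff1_mul (sdiff1_cst a p) h; rewrite scaler0 add0r.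
Qed.

Lemma sdiff1_opp f p d : sdiff1 f p d -> sdiff1 (fun x => - f x) p (- d).
Proof.
move=> /(sdiff1_scale (-1)); apply: sdiff1_ext => [x|]; rewrite ?mulN1r //.
by rewrite scaleN1r.
Qed.

Lemma sdiff1_sub f g p d d' : sdiff1 f p d -> sdiff1 g p d' ->
  sdiff1 (fun x => f x - g x) p (d - d').
Proof. by move=> hf hg; exact: sdiff1_add hf (sdiff1_opp hg). Qed.

Lemma sdiffableB f g p : sdiffable f p -> sdiffable g p -> sdiffable (fun x => f x - g x) p.
Proof. by move=> [d hd] [d' hd']; eexists; exact: sdiff1_sub hd hd'. Qed.

Lemma sdiffableV f p : f p != 0 -> sdiffable f p -> sdiffable (fun x => (f x)^-1) p.
Proof. by move=> f0 [d hd]; eexists; exact: sdiff1_inv f0 hd. Qed.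

Lemma sdiff1_sum (I : Type) (s : seq I) (P : pred I) (F : I -> 'rV[C]_N -> C) d p :
  (forall i, P i -> sdiff1 (F i) p (d i)) ->
  sdiff1 (fun x => \sum_(i <- s | P i) F i x) p (\sum_(i <- s | P i) d i).
Proof.
move=> h; elim: s => [|i s IH].
  by rewrite big_nil; apply: (sdiff1_ext _ _ (sdiff1_cst 0 p)) => // x; rewrite big_nil.
rewrite big_cons; case: ifPn => Pi; last first.
  by apply: (sdiff1_ext _ _ IH) => // x; rewrite big_cons (negPf Pi).
by apply: (sdiff1_ext _ _ (sdiff1_add (h i Pi) IH)) => // x; rewrite big_cons Pi.
Qed.

Lemma sdiffable_prod (I : Type) (s : seq I) (P : pred I) (F : I -> 'rV[C]_N -> C) p :
  (forall i, P i -> sdiffable (F i) p) -> sdiffable (fun x => \prod_(i <- s | P i) F i x) p.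
Proof.
move=> h; elim: s => [|i s IH].
  by apply: sdiffable_ext (sdiffable_cst 1 p) => x; rewrite big_nil.
have [Pi|Pi] := boolP (P i).
  by apply: sdiffable_ext (sdiffableM (h i Pi) IH) => x; rewrite big_cons Pi.
by apply: sdiffable_ext IH => x; rewrite big_cons (negPf Pi).
Qed.

Lemma sdiffableX f p k : sdiffable f p -> sdiffable (fun x => f x ^+ k) p.
Proof.
move=> h; elim: k => [|k IH].
  by apply: sdiffable_ext (sdiffable_cst 1 p) => x; rewrite expr0.
by apply: sdiffable_ext (sdiffableM h IH) => x; rewrite exprS.
Qed.

Lemma sdiffable_cts f p : sdiffable f p -> forall e : R, 0 < e ->
  exists2 r : R, 0 < r & forall x, nrm (x - p) < r -> absc (f x - f p) < e.
Proof. by move=> [d hd]; exact: sdiff1_cts hd. Qed.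

Lemma sdiffable_neq0 f p : sdiffable f p -> f p != 0 ->
  exists2 r : R, 0 < r & forall x, nrm (x - p) < r -> f x != 0.
Proof.
move=> h f0; have f1 : 0 < absc (f p) by rewrite absc_gt0.
have [r r0 hr] := sdiffable_cts h f1; exists r => // x /hr.
by apply: contraTneq => ->; rewrite sub0r abscN ltxx.
Qed.

Lemma sdiff1_unique f p d d' : sdiff1 f p d -> sdiff1 f p d' -> d = d'.
Proof.
move=> h h'; apply: (@sdiff_unique _ _ 1 (fun x => \row_(j < 1) f x) p).
  apply: sdiffP => j; rewrite ord1.
  by apply: (sdiff1_ext _ _ h) => [x|]; [rewrite mxE|apply/colP => i; rewrite !mxE].
apply: sdiffP => j; rewrite ord1.
by apply: (sdiff1_ext _ _ h') => [x|]; [rewrite mxE|apply/colP => i; rewrite !mxE].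
Qed.

Lemma sdiff1_differentiable f p d : sdiff1 f p d -> differentiable f p.
Proof.
move=> h; pose F (x : 'rV[C]_N) : 'rV[C]_1 := \row_(j < 1) f x.
have dF : sdiff F p d.
  apply: sdiffP => j; rewrite ord1.
  by apply: (sdiff1_ext _ _ h) => [x|]; [rewrite mxE|apply/colP => i; rewrite !mxE].
have -> : f = (fun M : 'rV[C]_1 => M 0 0) \o F by apply/funext => x; rewrite /= mxE.
apply: differentiable_comp; first exact: sdiff_differentiable dF.
exact: differentiable_coord.
Qed.

(** [d] is the logarithmic derivative of [f] at [p]. It is additive on products, which suits both
    [omega] and the monomials in the ratios. *)
Definition ldiff f p (d : 'cV[C]_N) : Prop := f p != 0 /\ sdiff1 f p (f p *: d).

Lemma ldiffM f g p d d' : ldiff f p d -> ldiff g p d' -> ldiff (fun x => f x * g x) p (d + d').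
Proof.
move=> [f0 hf] [g0 hg]; split; first by rewrite mulf_neq0.
have := sdiff1_mul hf hg; congr sdiff1.
by rewrite !scalerA scalerDr; congr (_ *: _ + _); rewrite mulrC.
Qed.

Lemma ldiffV f p d : ldiff f p d -> ldiff (fun x => (f x)^-1) p (- d).
Proof.
move=> [f0 hf]; split; first by rewrite invr_eq0.
have := sdiff1_inv f0 hf; congr sdiff1.
by rewrite scalerA scalerN -scaleNr; congr (_ *: _); field.
Qed.

Lemma ldiff1 p : ldiff (fun=> 1) p 0.
Proof. by split; [exact: oner_neq0 | rewrite scaler0; exact: sdiff1_cst]. Qed.

Lemma ldiffX f p d k : ldiff f p d -> ldiff (fun x => f x ^+ k) p (k%:R *: d).
Proof.
move=> h; elim: k => [|k IH].
  by have := ldiff1 p; rewrite scale0r; congr ldiff; apply/funext => x; rewrite expr0.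
have := ldiffM h IH; rewrite -natr1 scalerDl scale1r addrC; congr ldiff.
by apply/funext => x; rewrite exprS.
Qed.

Lemma ldiff_prod (I : Type) (s : seq I) (P : pred I) (F : I -> 'rV[C]_N -> C) d p :
  (forall i, P i -> ldiff (F i) p (d i)) ->
  ldiff (fun x => \prod_(i <- s | P i) F i x) p (\sum_(i <- s | P i) d i).
Proof.
move=> h; elim: s => [|i s IH].
  rewrite big_nil; have := ldiff1 p; congr ldiff.
  by apply/funext => x; rewrite big_nil.
rewrite big_cons; case: ifPn => Pi; last first.
  by move: IH; congr ldiff; apply/funext => x; rewrite big_cons (negPf Pi).
have := ldiffM (h i Pi) IH; congr ldiff.
by apply/funext => x; rewrite big_cons Pi.
Qed.

Lemma ldiff_of f p d : f p != 0 -> sdiff1 f p d -> ldiff f p ((f p)^-1 *: d).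
Proof. by move=> f0 h; split => //; rewrite scalerA mulfV // scale1r. Qed.

End DifferentiableFunctions.

Section Coordinates.
Context (R : realType) (m n : nat) (e : 'I_m.+1 -> nat).
Hypotheses (he : forall i, (0 < e i)%N) (hsum : (\sum_(i < m.+1) e i)%N = n).
Local Notation C := R[i].
Local Notation point := 'rV[C]_(1 + (m + n)).
Implicit Types p q v : point.

Lemma lambda_ofE p : lambda_of p = p 0 (lshift _ 0).
Proof. by rewrite /lambda_of mxE. Qed.

Lemma zero_at0 p : zero_at p ord0 = 0.
Proof. by rewrite /zero_at unlift_none. Qed.

Lemma zero_at_lift p j : zero_at p (lift ord0 j) = p 0 (rshift 1 (lshift n j)).
Proof. by rewrite /zero_at liftK !mxE. Qed.

Lemma pole_at0 p : pole_at p ord0 = 1.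
Proof. by rewrite /pole_at unlift_none. Qed.

Lemma pole_at_lift p j : pole_at p (lift ord0 j) = p 0 (rshift 1 (rshift m j)).
Proof. by rewrite /pole_at liftK !mxE. Qed.

(** The differentials of the coordinates; those of [x_0] and [y_0] are 0 because these points are
    normalized to 0 and 1. *)
Definition dlam : 'cV[C]_(1 + (m + n)) := delta_mx (lshift _ 0) 0.
Definition dzero (i : 'I_m.+1) : 'cV[C]_(1 + (m + n)) :=
  if unlift ord0 i is Some j then delta_mx (rshift 1 (lshift n j)) 0 else 0.
Definition dpole (l : 'I_n.+1) : 'cV[C]_(1 + (m + n)) :=
  if unlift ord0 l is Some j then delta_mx (rshift 1 (rshift m j)) 0 else 0.

Lemma sdiff1_lambda p : sdiff1 (@lambda_of R m n) p dlam.
Proof.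
by apply: (sdiff1_ext _ _ (sdiff1_coord (lshift _ 0) p)) => // x; rewrite lambda_ofE.
Qed.

Lemma sdiff1_zero p i : sdiff1 (fun q => zero_at q i) p (dzero i).
Proof.
rewrite /dzero; case: (unliftP ord0 i) => [j ->|->].
  by apply: (sdiff1_ext _ _ (sdiff1_coord (rshift 1 (lshift n j)) p)) => // x; rewrite zero_at_lift.
by apply: (sdiff1_ext _ _ (sdiff1_cst 0 p)) => // x; rewrite zero_at0.
Qed.

Lemma sdiff1_pole p l : sdiff1 (fun q => pole_at q l) p (dpole l).
Proof.
rewrite /dpole; case: (unliftP ord0 l) => [j ->|->].
  by apply: (sdiff1_ext _ _ (sdiff1_coord (rshift 1 (rshift m j)) p)) => // x; rewrite pole_at_lift.
by apply: (sdiff1_ext _ _ (sdiff1_cst 1 p)) => // x; rewrite pole_at0.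
Qed.

Lemma mul_delta_col (v : point) i : (v *m (delta_mx i 0 : 'cV_(1 + (m + n)))) 0 0 = v 0 i.
Proof.
rewrite mxE (bigD1 i) //= big1 ?addr0; last first.
  by move=> k ki; rewrite !mxE (negPf ki) mulr0.
by rewrite !mxE !eqxx mulr1.
Qed.

Lemma tangent_eq0 v : (v *m dlam) 0 0 = 0 -> (forall i, (v *m dzero i) 0 0 = 0) ->
  (forall l, (v *m dpole l) 0 0 = 0) -> v = 0.
Proof.
move=> h1 h2 h3; apply/rowP => k; rewrite [RHS]mxE.
case: (split_ordP k) => [k' ->|k' ->].
  by rewrite (ord1 k') -(mul_delta_col v) h1.
case: (split_ordP k') => [j ->|j ->].
  by have := h2 (lift ord0 j); rewrite /dzero liftK mul_delta_col.
by have := h3 (lift ord0 j); rewrite /dpole liftK mul_delta_col.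
Qed.

(** One polynomial function whose non-vanishing defines the stratum. It makes the stratum open by
    continuity, and a principal open set in the dimension count. *)
Definition discr p : C := lambda_of p *
  (\prod_i \prod_(i' | i' != i) (zero_at p i - zero_at p i')) *
  (\prod_l \prod_(l' | l' != l) (pole_at p l - pole_at p l')) *
  (\prod_i \prod_l (zero_at p i - pole_at p l)).

Lemma prod2_neq0P (I J : finType) (P : I -> pred J) (F : I -> J -> C) :
  reflect (forall i j, P i j -> F i j != 0) (\prod_i \prod_(j | P i j) F i j != 0).
Proof.
apply: (iffP idP) => [/prodf_neq0 h i j Pij|h].
  by have /prodf_neq0 := h i isT; apply.
by apply/prodf_neq0 => i _; apply/prodf_neq0 => j; exact: h.
Qed.

Lemma stratumP p : stratum p <-> discr p != 0.
Proof.
rewrite /stratum /= /discr !mulf_eq0 !negb_or; split.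
  move=> [l0 zi pi zp]; rewrite l0 /=; apply/andP; split; last first.
    by apply/(prod2_neq0P (fun=> xpredT)) => i l _; rewrite subr_eq0.
  apply/andP; split; apply/prod2_neq0P => i j ji; rewrite subr_eq0.
    by apply: contra_neq ji => /zi ->.
  by apply: contra_neq ji => /pi ->.
move=> /andP[/andP[/andP[l0 /prod2_neq0P zi] /prod2_neq0P pi] /(prod2_neq0P (fun=> xpredT)) zp].
split => //.
- move=> i j E; apply/eqP; apply: contraT => ij; have := zi j i ij.
  by rewrite E subrr eqxx.
- move=> i j E; apply/eqP; apply: contraT => ij; have := pi j i ij.
  by rewrite E subrr eqxx.
- by move=> i l; have := zp i l isT; rewrite subr_eq0.
Qed.

Lemma sdiffable_zero p i : sdiffable (fun q => zero_at q i) p.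
Proof. by eexists; exact: sdiff1_zero. Qed.

Lemma sdiffable_pole p l : sdiffable (fun q => pole_at q l) p.
Proof. by eexists; exact: sdiff1_pole. Qed.

Lemma sdiffable_lambda p : sdiffable (@lambda_of R m n) p.
Proof. by eexists; exact: sdiff1_lambda. Qed.

Lemma sdiffable_discr p : sdiffable discr p.
Proof.
apply: sdiffableM; first apply: sdiffableM; first apply: sdiffableM.
- exact: sdiffable_lambda.
- apply: sdiffable_prod => i _; apply: sdiffable_prod => j _.
  by apply: sdiffableB; exact: sdiffable_zero.
- apply: sdiffable_prod => i _; apply: sdiffable_prod => j _.
  by apply: sdiffableB; exact: sdiffable_pole.
- apply: sdiffable_prod => i _; apply: sdiffable_prod => j _.
  by apply: sdiffableB; [exact: sdiffable_zero|exact: sdiffable_pole].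
Qed.

Lemma stratum_ball p : stratum p -> exists2 r : R, 0 < r &
  forall q, nrm (q - p) < r -> stratum q.
Proof.
move=> /stratumP h; have [r r0 hr] := sdiffable_neq0 (sdiffable_discr p) h.
by exists r => // q /hr /stratumP.
Qed.

Definition resid p (l : 'I_n.+1) : C := res_at e (lambda_of p) (zero_at p) (@pole_at R m n p) l.

Lemma residE p l : resid p l = lambda_of p * \prod_i (pole_at p l - zero_at p i) ^+ e i /
  \prod_(l' | l' != l) (pole_at p l - pole_at p l').
Proof. by rewrite /resid /res_at num_polyE den_butE. Qed.

Lemma resid_neq0 p l : stratum p -> resid p l != 0.
Proof. by move=> [l0 zi pi zp]; apply: res_at_neq0. Qed.

Lemma omega_partial_fractions p z : stratum p -> (forall l, z != pole_at p l) ->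
  omega e p z = \sum_l resid p l / (z - pole_at p l).
Proof.
move=> [l0 zi pi zp] hz.
rewrite /resid -partial_fractions //.
by rewrite num_polyE den_polyE.
Qed.

Lemma omega_zero p i : omega e p (zero_at p i) = 0.
Proof.
by rewrite /omega (bigD1 i) //= subrr expr0n gtn_eqF ?he // mul0r mulr0 mul0r.
Qed.

Lemma sdiffable_resid p l : stratum p -> sdiffable (fun q => resid q l) p.
Proof.
move=> [l0 zi pi zp].
have -> : (fun q => resid q l) = fun q => lambda_of q * \prod_i (pole_at q l - zero_at q i) ^+ e i /
  \prod_(l' | l' != l) (pole_at q l - pole_at q l') by apply/funext => q; rewrite residE.
apply: sdiffableM; first apply: sdiffableM.
- exact: sdiffable_lambda.
- apply: sdiffable_prod => i _; apply: sdiffableX.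
  by apply: sdiffableB; [exact: sdiffable_pole|exact: sdiffable_zero].
- apply: sdiffableV.
    by apply/prodf_neq0 => l' l'l; rewrite subr_eq0; apply: contra_neq l'l => /pi ->.
  by apply: sdiffable_prod => l' _; apply: sdiffableB; exact: sdiffable_pole.
Qed.

Lemma residue_omega p l : stratum p -> residue (omega e p) (pole_at p l) = resid p l.
Proof.
move=> sp; have [l0 zi pi zp] := sp.
pose g (z : 'rV[C]_1) : C := lambda_of p * \prod_i (z 0 0 - zero_at p i) ^+ e i /
  \prod_(l' | l' != l) (z 0 0 - pole_at p l').
have dg : sdiffable g (\row_(j < 1) pole_at p l).
  have hs (a : C) : sdiffable (fun z : 'rV[C]_1 => z 0 0 - a) (\row_(j < 1) pole_at p l).
    by apply: sdiffableB; [exact: sdiffable_coord|exact: sdiffable_cst].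
  apply: sdiffableM; first apply: sdiffableM; first exact: sdiffable_cst.
    by apply: sdiffable_prod => i _; apply: sdiffableX; exact: hs.
  apply: sdiffableV; last by apply: sdiffable_prod => l' _; exact: hs.
  by apply/prodf_neq0 => l' l'l; rewrite mxE subr_eq0; apply: contra_neq l'l => /pi ->.
apply: cvg_lim => //.
move=> P /nbhs_abscP[eps e0 he'].
have [r r0 hr] := sdiffable_cts dg e0.
apply/nbhs_abscP; exists r => // z hz zy; apply: he'.
have -> : resid p l = g (\row_(j < 1) pole_at p l).
  rewrite residE /g mxE; congr (_ * _ / _).
have := hr (\row_(j < 1) z); rewrite /nrm big_ord1 !mxE => /(_ hz).
suff -> : g (\row_(j < 1) z) = (z - pole_at p l) * omega e p z by [].
rewrite /omega /g mxE [X in _ = _ * (_ / X)](bigD1 l) //= invfM.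
move: (\prod_(i < n.+1 | _) _)^-1 (lambda_of p * _) => K A.
by rewrite [RHS]mulrCA mulVKf // subr_eq0.
Qed.

Lemma period_mapE p c : stratum p -> (forall j : 'I_m, C1_path (c p j)) ->
  (forall j l, avoids (c p j) (pole_at p l)) ->
  period_map e c p = row_mx (\row_j \sum_l resid p l * logint (c p j) (pole_at p l))
    (\row_l (two_pi_i R * resid p l)).
Proof.
move=> sp hc ha; rewrite /period_map; congr row_mx; apply/rowP => j; rewrite !mxE.
  by apply: path_integral_partial_fractions => // z hz; exact: omega_partial_fractions.
by rewrite residue_omega.
Qed.

Definition dlog (p : point) (i : 'I_m.+1) (l : 'I_n.+1) : 'cV[C]_(1 + (m + n)) :=
  (zero_at p i - pole_at p l)^-1 *: (dzero i - dpole l).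

(** The logarithmic derivative of [pole_ratio], hence the differential of the logarithm [L_jl]. *)
Definition dratio p (j : 'I_m) l := dlog p (lift ord0 j) l - dlog p ord0 l.

Lemma ldiff_diff p i l : stratum p -> ldiff (fun q => zero_at q i - pole_at q l) p (dlog p i l).
Proof.
move=> [l0 zi pi zp]; apply: ldiff_of; first by rewrite subr_eq0.
exact: sdiff1_sub (sdiff1_zero _ _) (sdiff1_pole _ _).
Qed.

Definition pole_ratio p (j : 'I_m) (l : 'I_n.+1) : C :=
  (zero_at p (lift ord0 j) - pole_at p l) / (zero_at p ord0 - pole_at p l).

Lemma ldiff_pole_ratio p j l : stratum p -> ldiff (fun q => pole_ratio q j l) p (dratio p j l).
Proof. by move=> sp; apply: ldiffM; [exact: ldiff_diff|apply: ldiffV; exact: ldiff_diff]. Qed.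

(** When the residues are constant to first order along [v], the derivative of [\sum_l R_l L_jl]
    reduces to the sum in the last hypothesis. The two inputs of [period_jacobian_inj] are extracted
    from these data. *)
Lemma period_covectors_inj p (dR : 'I_n.+1 -> 'cV[C]_(1 + (m + n))) v : stratum p ->
  (forall l, sdiff1 (fun q => resid q l) p (dR l)) ->
  (forall l, (v *m dR l) 0 0 = 0) ->
  (forall j, \sum_l resid p l * (v *m dratio p j l) 0 0 = 0) -> v = 0.
Proof.
move=> sp hR vR vP; have [l0 zi pi zp] := sp.
pose lam' := (v *m dlam) 0 0; pose x' i := (v *m dzero i) 0 0; pose y' l := (v *m dpole l) 0 0.
have x'0 : x' ord0 = 0 by rewrite /x' /dzero unlift_none mulmx0 mxE.
have y'0 : y' ord0 = 0 by rewrite /y' /dpole unlift_none mulmx0 mxE.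
have subE (d d' : 'cV[C]_(1 + (m + n))) : (v *m (d - d')) 0 0 = (v *m d) 0 0 - (v *m d') 0 0.
  by rewrite mulmxBr !mxE.
have sumE (I : finType) (F : I -> 'cV[C]_(1 + (m + n))) :
   (v *m \sum_i F i) 0 0 = \sum_i (v *m F i) 0 0 by rewrite mulmx_sumr summxE.
(* For fixed [z], [omega] is differentiated along [v] twice, once as a product and once as a sum of
   partial fractions; uniqueness of the derivative equates the results. *)
have H1 z : (forall i, z != zero_at p i) -> (forall l, z != pole_at p l) ->
    \sum_l resid p l * y' l / (z - pole_at p l) ^+ 2 =
    (num_poly e (lambda_of p) (zero_at p)).[z] / (den_poly (@pole_at R m n p)).[z] *
      (lam' / lambda_of p - \sum_i (e i)%:R * x' i / (z - zero_at p i) + \sum_l y' l / (z - pole_at p l)).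
  move=> zx zy.
  have dpol l : ldiff (fun q => z - pole_at q l) p ((z - pole_at p l)^-1 *: (0 - dpole l)).
    apply: ldiff_of; first by rewrite subr_eq0.
    exact: sdiff1_sub (sdiff1_cst _ _) (sdiff1_pole _ _).
  have dzer i : ldiff (fun q => z - zero_at q i) p ((z - zero_at p i)^-1 *: (0 - dzero i)).
    apply: ldiff_of; first by rewrite subr_eq0.
    exact: sdiff1_sub (sdiff1_cst _ _) (sdiff1_zero _ _).
  have dom : ldiff (fun q => omega e q z) p ((lambda_of p)^-1 *: dlam +
      \sum_i (e i)%:R *: ((z - zero_at p i)^-1 *: (0 - dzero i)) -
      \sum_l ((z - pole_at p l)^-1 *: (0 - dpole l))).
    apply: ldiffM; first apply: ldiffM.
    - exact: ldiff_of l0 (sdiff1_lambda p).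
    - by apply: ldiff_prod => i _; apply: ldiffX.
    - by apply: ldiffV; apply: ldiff_prod.
  have dpf : sdiff1 (fun q => omega e q z) p (\sum_l ((z - pole_at p l)^-1 *: dR l +
      resid p l *: (- (z - pole_at p l)^-1 ^+ 2 *: (0 - dpole l)))).
    apply: (@sdiff1_near _ _ (fun q => \sum_l resid q l / (z - pole_at q l))).
      have [r r0 hr] := stratum_ball sp.
      have [r' r'0 hr'] : exists2 r' : R, 0 < r' &
          forall q, nrm (q - p) < r' -> forall l, z != pole_at q l.
        have hd : sdiffable (fun q => \prod_l (z - pole_at q l)) p.
          by apply: sdiffable_prod => l _; eexists; exact: (dpol l).2.
        have hn : \prod_l (z - pole_at p l) != 0.
          by apply/prodf_neq0 => l _; rewrite subr_eq0.
        have [r' r'0 hr'] := sdiffable_neq0 hd hn; exists r' => // q /hr' /prodf_neq0 h l.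
        by have := h l isT; rewrite subr_eq0.
      exists (Num.min r r'); first by rewrite lt_min r0.
      move=> q; rewrite lt_min => /andP[h1 h2].
      by rewrite omega_partial_fractions //; [exact: hr | exact: hr'].
    apply: sdiff1_sum => l _; apply: sdiff1_mul; first exact: hR.
    apply: sdiff1_inv; first by rewrite subr_eq0.
    exact: sdiff1_sub (sdiff1_cst _ _) (sdiff1_pole _ _).
  have := sdiff1_unique dom.2 dpf => /(congr1 (fun d => (v *m d) 0 0)).
  rewrite mulmx_scaleE subE mulmx_addE !sumE mulmx_scaleE.
  have -> : (num_poly e (lambda_of p) (zero_at p)).[z] / (den_poly (@pole_at R m n p)).[z] = omega e p z.
    by rewrite num_polyE den_polyE.
  have -> : \sum_l (v *m ((z - pole_at p l)^-1 *: dR l +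
      resid p l *: (- (z - pole_at p l)^-1 ^+ 2 *: (0 - dpole l)))) 0 0 =
      \sum_l resid p l * y' l / (z - pole_at p l) ^+ 2.
    apply: eq_bigr => l _; rewrite mulmx_addE !mulmx_scaleE vR subE mulmx0 mxE /y'.
    by field; rewrite subr_eq0.
  move=> <-; congr (_ * _); congr (_ + _ + _).
  - by rewrite mulrC.
  - rewrite -sumrN; apply: eq_bigr => i _; rewrite !mulmx_scaleE subE mulmx0 mxE /x'.
    by field; rewrite subr_eq0.
  - by rewrite -sumrN; apply: eq_bigr => l _; rewrite mulmx_scaleE subE mulmx0 mxE /y'; field; rewrite subr_eq0.
(* The form vanishes at its zeros, so the contribution of the moving zero [x_i] drops out and only
   that of the poles remains. *)
have om i : \sum_l resid p l / (zero_at p i - pole_at p l) = 0.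
  by rewrite -omega_partial_fractions // omega_zero.
have split2 i : \sum_l resid p l * (v *m dlog p i l) 0 0 =
    - \sum_l resid p l * y' l / (zero_at p i - pole_at p l).
  have -> : \sum_l resid p l * (v *m dlog p i l) 0 0 =
      x' i * (\sum_l resid p l / (zero_at p i - pole_at p l)) -
      \sum_l resid p l * y' l / (zero_at p i - pole_at p l).
    rewrite mulr_sumr -sumrB; apply: eq_bigr => l _.
    by rewrite mulmx_scaleE subE /x' /y'; ring.
  by rewrite om mulr0 sub0r.
have H2 i : \sum_l resid p l * y' l / (zero_at p i - pole_at p l) =
    \sum_l resid p l * y' l / (zero_at p ord0 - pole_at p l).
  case: (unliftP ord0 i) => [j ->|-> //].
  apply: oppr_inj; rewrite -!split2; apply/eqP; rewrite -subr_eq0 -sumrB.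
  rewrite -[X in _ == X](vP j); apply/eqP; apply: eq_bigr => l _.
  by rewrite subE mulrBr.
have [h1 h2 h3] := period_jacobian_inj he hsum l0 zi pi zp x'0 y'0 (zero_at0 p) (pole_at0 p) H1 H2.
exact: tangent_eq0.
Qed.

End Coordinates.

(** * Existence of period charts *)

Section LocalBiholomorphism.
Context (R : realType).
Local Notation C := R[i].

Lemma open_nrm_ball N (p : 'rV[C]_N) (r : R) : open [set q | nrm (q - p) < r].
Proof.
rewrite openE => q /= hq; apply/nbhs_nrmP; exists (r - nrm (q - p)).
  by rewrite subr_gt0.
by move=> q' h /=; have := ler_nrm_trans q q' p; lra.
Qed.

(** On one ball the lower Lipschitz bound gives injectivity, and the quantitative surjectivity gives
    openness. Invertibility of the derivative at every point of the ball then makes the inverse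
    differentiable on the whole image. *)
Lemma local_biholomorphism N N' (F : 'rV[C]_N -> 'rV[C]_N') p (r1 : R) : 0 < r1 ->
  (forall q, nrm (q - p) < r1 -> exists D E, [/\ sdiff F q D, D *m E = 1%:M & E *m D = 1%:M]) ->
  exists r : R, [/\ 0 < r, r <= r1, open (F @` [set q | nrm (q - p) < r]),
    forall q, nrm (q - p) < r -> differentiable F q &
    exists psi : 'rV[C]_N' -> 'rV[C]_N,
      (forall q, nrm (q - p) < r -> psi (F q) = q) /\
      (forall v, (F @` [set q | nrm (q - p) < r]) v -> differentiable psi v)].
Proof.
move=> r10 hF.
have pp : nrm (p - p) < r1 by rewrite subrr nrm0.
have [D [E [dF DE ED]]] := hF p pp.
have [r2 [c [r20 c0 lip sur]]] := inverse_function dF DE ED.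
pose r := Num.min r1 r2.
have rr1 : r <= r1 by rewrite ge_min lexx.
have rr2 : r <= r2 by rewrite ge_min lexx orbT.
have r0 : 0 < r by rewrite lt_min r10.
have img x : nrm (x - p) < r -> exists2 s : R, 0 < s &
    forall v, nrm (v - F x) < s -> (F @` [set q | nrm (q - p) < r]) v.
  move=> hx; pose rho := r - nrm (x - p).
  have rho0 : 0 < rho by rewrite subr_gt0.
  exists (c * rho); first exact: mulr_gt0.
  move=> v hv; have [|y hy <-] := sur x rho v rho0 _ hv.
    by rewrite addrC subrK.
  by exists y => //=; have := ler_nrm_trans x y p; rewrite /rho in hy; lra.
exists r; split => //.
- rewrite openE => _ [x hx <-]; apply/nbhs_nrmP; exact: img.
- move=> q hq; have [D' [E' [dF' _ _]]] := hF q (lt_le_trans hq rr1).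
  exact: sdiff_differentiable dF'.
- have ex v : exists q, (F @` [set q | nrm (q - p) < r]) v -> nrm (q - p) < r /\ F q = v.
    have [[q hq <-]|h] := pselect ((F @` [set q | nrm (q - p) < r]) v).
      by exists q.
    by exists p.
  have [psi hpsi] := choice ex.
  have psiF q : nrm (q - p) < r -> psi (F q) = q.
    move=> hq; have [|h1 h2] := hpsi (F q); first by exists q.
    have := lip _ _ (lt_le_trans h1 rr2) (lt_le_trans hq rr2).
    rewrite h2 subrr nrm0 pmulr_rle0 // => h3.
    apply/eqP; rewrite -subr_eq0; apply/eqP; apply: nrm_eq0; apply/eqP.
    by rewrite eq_le h3 nrm_ge0.
  exists psi; split => // _ [x hx <-].
  have [D' [E' [dF' DE' ED']]] := hF x (lt_le_trans hx rr1).
  apply: (@sdiff_differentiable _ _ _ _ _ E').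
  apply: (sdiff_inverse (W := F @` [set q | nrm (q - p) < r]) dF' DE' c0) => //.
  + exact: img.
  + by move=> v /hpsi[].
  + exact: psiF.
  + move=> v w /hpsi[v1 v2] /hpsi[w1 w2].
    by have := lip _ _ (lt_le_trans v1 rr2) (lt_le_trans w1 rr2); rewrite v2 w2.
Qed.

Lemma injective_inverse N N' (D : 'M[C]_(N, N')) : N = N' ->
  (forall v : 'rV_N, v *m D = 0 -> v = 0) -> exists E, D *m E = 1%:M /\ E *m D = 1%:M.
Proof.
move=> NN; case: N' / NN D => D h; exists (invmx D).
have uD : D \in unitmx.
  rewrite -row_free_unit -kermx_eq0; apply/eqP/row_matrixP => i.
  by rewrite row0; apply: h; rewrite -row_mul mulmx_ker row0.
by rewrite mulmxV // mulVmx.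
Qed.

End LocalBiholomorphism.

Section ChartExistence.
Context (R : realType) (m n : nat) (e : 'I_m.+1 -> nat).
Hypotheses (he : forall i, (0 < e i)%N) (hsum : (\sum_(i < m.+1) e i)%N = n).
Local Notation C := R[i].
Local Notation point := 'rV[C]_(1 + (m + n)).
Implicit Types p q v : point.

Lemma absc_zero_at p q i : absc (zero_at q i - zero_at p i) <= nrm (q - p).
Proof.
case: (unliftP ord0 i) => [j ->|->]; last by rewrite !zero_at0 subrr absc0 nrm_ge0.
rewrite !zero_at_lift; have := ler_coord_nrm (q - p) (rshift 1 (lshift n j)).
by rewrite !mxE.
Qed.

Lemma absc_pole_at p q l : absc (pole_at q l - pole_at p l) <= nrm (q - p).
Proof.
case: (unliftP ord0 l) => [j ->|->]; last by rewrite !pole_at0 subrr absc0 nrm_ge0.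
rewrite !pole_at_lift; have := ler_coord_nrm (q - p) (rshift 1 (rshift m j)).
by rewrite !mxE.
Qed.

Lemma avoids_dist (c : R -> C) (y : C) : cts01 c -> avoids c y ->
  exists2 eps : R, 0 < eps & forall t, 0 <= t <= 1 -> eps <= absc (c t - y).
Proof.
move=> hc hy.
have cf : {within `[0, 1], continuous (fun t => absc (c t - y))}.
  apply/within01P => t ht eps e0; have [d d0 hd] := hc t ht eps e0.
  exists d => // s hs st; apply: le_lt_trans (ler_abs_absc _ _) _.
  have -> : c s - y - (c t - y) = c s - c t by ring.
  exact: hd.
have [t0 ht0 hmin] := EVT_min ler01 cf.
exists (absc (c t0 - y)).
  by rewrite absc_gt0 subr_eq0; apply: hy; rewrite in_itv in ht0.
by move=> t ht; apply: hmin; rewrite in_itv.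
Qed.

Lemma finite_min_pos (I : finType) (f : I -> R) : (forall i, 0 < f i) ->
  exists2 eps : R, 0 < eps & forall i, eps <= f i.
Proof.
move=> h; exists (\big[Num.min/1]_i f i).
  by elim/big_ind: _ => // x y hx hy; rewrite lt_min hx.
by move=> i; rewrite (bigD1 i) //= ge_min lexx.
Qed.

Section Deformation.
Context (p : point) (L : 'I_m -> 'I_n.+1 -> C) (c0 : 'I_m -> R -> C).
Hypotheses (sp : stratum p)
  (hfl : forall j, flat_path (c0 j) (zero_at p ord0) (zero_at p (lift ord0 j)))
  (hav : forall j l, avoids (c0 j) (pole_at p l))
  (hL : forall j l, logint (c0 j) (pole_at p l) = L j l).

(** The start [x_0 = 0] does not move. The displacement of the end point is spread along the path by
    [step], which preserves the class C^1 and is affine in [q]. *)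
Definition deformed q (j : 'I_m) (t : R) : C :=
  c0 j t + (step t)%:C * (zero_at q (lift ord0 j) - zero_at p (lift ord0 j)).

Lemma deformed_C1 q j : C1_path (deformed q j).
Proof.
have [C1 _ _] := hfl j.
set a := zero_at q (lift ord0 j) - zero_at p (lift ord0 j).
have d t : cderiv (deformed q j) (velocity (c0 j) t + (dstep t)%:C * a) t.
  have := cderivD (C1_path_cderiv t C1) (cderivM (cderiv_step t) (cderiv_cst a t)).
  by rewrite mulr0 addr0.
have cv : continuous (fun t : R => velocity (c0 j) t + (dstep t)%:C * a).
  apply: ctsA_continuous.
  have := cts_comb 1 1 (@continuous_ctsA _ (fun=> True) _ (let: And3 _ _ h := C1 in h))
     (cts_mul (@cts_dstep _ _) (@cts_cst _ _ a)).
  by congr ctsA; apply/funext => t; rewrite !mul1r.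
by have [] := C1_path_of d cv.
Qed.

Lemma deformed0 q j : deformed q j 0 = zero_at q ord0.
Proof.
have [_ h0 _] := hfl j.
by rewrite /deformed h0 // step_le0 // mul0r addr0 !zero_at0.
Qed.

Lemma deformed1 q j : deformed q j 1 = zero_at q (lift ord0 j).
Proof.
have [_ _ h1] := hfl j.
by rewrite /deformed h1 // step_ge1 // mul1r addrC subrK.
Qed.

Lemma deformed_id j : deformed p j = c0 j.
Proof. by apply/funext => t; rewrite /deformed subrr mulr0 addr0. Qed.

Lemma deformed_diff q j t l : 0 <= t <= 1 ->
  absc (deformed q j t - pole_at q l - (c0 j t - pole_at p l)) <= 2 * nrm (q - p).
Proof.
move=> ht; have /andP[s0 s1] := step_in ht.
have -> : deformed q j t - pole_at q l - (c0 j t - pole_at p l) =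
  (step t)%:C * (zero_at q (lift ord0 j) - zero_at p (lift ord0 j)) - (pole_at q l - pole_at p l).
  by rewrite /deformed; ring.
apply: le_trans (ler_abscB _ _) _; rewrite abscM absc_real (ger0_norm s0).
have h1 := absc_pole_at p q l; have h2 := absc_zero_at p q (lift ord0 j).
have h3 := absc_ge0 (zero_at q (lift ord0 j) - zero_at p (lift ord0 j)).
nra.
Qed.

Lemma deformed_joint_cts (U : set point) j :
  {within U `*` `[0, 1], continuous (fun pt : point * R => deformed pt.1 j pt.2)}.
Proof.
apply: continuous_subspaceT => -[q t] P /nbhs_abscP[eps e0 hP].
have [C1 _ _] := hfl j.
have e3 : 0 < eps / 3 by rewrite divr_gt0.
set a := zero_at q (lift ord0 j) - zero_at p (lift ord0 j).
have e4 : 0 < eps / 3 / (absc a + 1) by rewrite divr_gt0 // ltr_wpDl ?absc_ge0.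
have e5 : 0 < Num.min 1 (eps / 3 / (absc (step t)%:C + 1)).
  by rewrite lt_min ltr01 divr_gt0 // ltr_wpDl ?absc_ge0.
have [d1 d10 h1] := cderiv_cts (C1_path_cderiv t C1) e3.
have [d2 d20 h2] := cderiv_cts (cderiv_step t) e4.
exists ([set q' | nrm (q' - q) < Num.min 1 (eps / 3 / (absc (step t)%:C + 1))],
        [set t' | `|t' - t| < Num.min d1 d2]).
  split => /=; first by apply/nbhs_nrmP; exists (Num.min 1 (eps / 3 / (absc (step t)%:C + 1))).
  apply/nbhs_ballP; exists (Num.min d1 d2); first by rewrite /= lt_min d10.
  by move=> s; rewrite /ball /= distrC.
move=> [q' t'] /= [hq ht]; apply: hP => /=.
move: hq ht; rewrite !lt_min => /andP[q1 q2] /andP[t1 t2].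
have {h1} := h1 t' t1; have {h2} := h2 t' t2 => h2 h1.
set a' := zero_at q' (lift ord0 j) - zero_at p (lift ord0 j).
have ha : absc (a' - a) <= nrm (q' - q).
  have -> : a' - a = zero_at q' (lift ord0 j) - zero_at q (lift ord0 j) by rewrite /a /a'; ring.
  exact: absc_zero_at.
have ha' : absc a' <= absc a + 1.
  by have := ler_abscD (a' - a) a; rewrite subrK; lra.
have -> : deformed q' j t' - deformed q j t = (c0 j t' - c0 j t) +
    (((step t')%:C - (step t)%:C) * a' + (step t)%:C * (a' - a)).
  by rewrite /deformed -/a -/a'; ring.
apply: le_lt_trans (ler_abscD _ _) _.
have := ler_abscD (((step t')%:C - (step t)%:C) * a') ((step t)%:C * (a' - a)).
rewrite !abscM; move: h1 h2 q2; rewrite !ltr_pdivlMr ?ltr_wpDl ?absc_ge0 //.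
set S := absc ((step t')%:C - (step t)%:C); set T := absc (step t)%:C.
have S0 : 0 <= S by exact: absc_ge0. have T0 : 0 <= T by exact: absc_ge0.
have : S * absc a' <= S * (absc a + 1) by rewrite ler_wpM2l.
have : T * absc (a' - a) <= T * nrm (q' - q) by rewrite ler_wpM2l.
have := nrm_ge0 (q' - q).
nra.
Qed.

(** Near [p] the quotient of [deformed q j t - y_l(q)] by [c0 j t - y_l(p)] stays close to 1. Its
    local logarithm measures the change of the logarithmic integral, which is therefore continuous
    in [q]; [sdiff1_lift] upgrades this to a strict derivative, as its exponential is
    [pole_ratio]. *)
Lemma deformed_near : exists r : R, [/\ 0 < r,
   forall q, nrm (q - p) < r -> stratum q,
   forall q, nrm (q - p) < r -> forall j l, avoids (deformed q j) (pole_at q l) &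
   forall q, nrm (q - p) < r -> forall j l,
     sdiff1 (fun q' => logint (deformed q' j) (pole_at q' l)) q (dratio q j l)].
Proof.
have [r0 r00 hst] := stratum_ball sp.
have c0c j : cts01 (c0 j) by have [C1 _ _] := hfl j; exact: cderiv_cts01 (fun t _ => C1_path_cderiv t C1).
have [eps eps0 heps] : exists2 eps : R, 0 < eps & forall j l t, 0 <= t <= 1 -> eps <= absc (c0 j t - pole_at p l).
  have h1 (jl : 'I_m * 'I_n.+1) : exists eps : R, 0 < eps /\
      forall t, 0 <= t <= 1 -> eps <= absc (c0 jl.1 t - pole_at p jl.2).
    by have [eps e0 h] := avoids_dist (c0c jl.1) (hav jl.1 jl.2); exists eps.
  have [f hf] := choice h1.
  have [eps e0 h] := finite_min_pos (fun jl => (hf jl).1).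
  by exists eps => // j l t ht; apply: le_trans (h (j, l)) _; exact: (hf (j, l)).2.
have [rL [k [Lg [rL0 k0 Lg1 hLg lipLg]]]] := clog_near1 R.
(* The difference of numerator and denominator is at most [2 nrm (q - p)] and the denominator is at
   least [eps]; so the paths avoid the poles and the quotient is within [rL] of 1. *)
pose r := Num.min r0 (Num.min (eps / 4) (rL * eps / 4)).
have rpos : 0 < r by rewrite !lt_min r00 !divr_gt0 // mulr_gt0.
have hr0 q : nrm (q - p) < r -> nrm (q - p) < r0 by rewrite lt_min => /andP[].
have hr1 q : nrm (q - p) < r -> 2 * nrm (q - p) < eps by rewrite !lt_min => /and3P[_ h _]; lra.
have hr2 q : nrm (q - p) < r -> 2 * nrm (q - p) < rL * eps.
  by rewrite !lt_min => /and3P[_ _ h]; have := mulr_gt0 rL0 eps0; lra.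
have hst' q : nrm (q - p) < r -> stratum q by move/hr0; exact: hst.
have av q : nrm (q - p) < r -> forall j l, avoids (deformed q j) (pole_at q l).
  move=> hq j l t ht; rewrite -subr_eq0 -absc_gt0.
  have h1 := heps j l t ht; have h2 := deformed_diff q j l ht; have h3 := hr1 q hq.
  have := ler_abscD (deformed q j t - pole_at q l) (c0 j t - pole_at p l - (deformed q j t - pole_at q l)).
  by rewrite addrC subrK (abscB _ (deformed q j t - pole_at q l)); lra.
pose del q j l t := (deformed q j t - pole_at q l) / (c0 j t - pole_at p l).
have c0n j l t : 0 <= t <= 1 -> c0 j t - pole_at p l != 0.
  by move=> ht; rewrite subr_eq0; exact: hav.
have hdel q j l t : nrm (q - p) < r -> 0 <= t <= 1 -> absc (del q j l t - 1) < rL.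
  move=> hq ht; have -> : del q j l t - 1 =
      (deformed q j t - pole_at q l - (c0 j t - pole_at p l)) / (c0 j t - pole_at p l).
    by rewrite [RHS]mulrBl mulfV // c0n.
  have h1 := heps j l t ht.
  rewrite abscM abscV ltr_pdivrMr; last exact: lt_le_trans h1.
  apply: le_lt_trans (deformed_diff q j l ht) _; apply: lt_le_trans (hr2 q hq) _.
  by rewrite ler_wpM2l // ltW.
have i0 : 0 <= (0 : R) <= 1 by rewrite lexx ler01.
have i1 : 0 <= (1 : R) <= 1 by rewrite lexx ler01.
(* The logarithm along [c0] plus the local logarithm of the quotient is a continuous logarithm along
   the deformed path; subtracting the value at 0 makes it start at 0. *)
have formula q j l : nrm (q - p) < r ->
    logint (deformed q j) (pole_at q l) = L j l + Lg (del q j l 1) - Lg (del q j l 0).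
  move=> hq; have [C1 s0 s1] := hfl j.
  have [l0 [cl l00 l01 _ hl]] := logint_lift C1 (hav j l).
  rewrite (@logint_unique _ _ _ (fun t => l0 t + Lg (del q j l t) - Lg (del q j l 0))).
  - by rewrite l01 hL.
  - exact: deformed_C1.
  - exact: av.
  - have cd : cts01 (del q j l).
      have cdef := cderiv_cts01 (fun t _ => C1_path_cderiv t (deformed_C1 q j)).
      have := cts_mul (cts_comb 1 (-1) cdef (@cts_cst _ _ (pole_at q l)))
        (cts_inv (c0n j l) (_ : cts01 (fun t => c0 j t - pole_at p l))).
      have hc : cts01 (fun t => c0 j t - pole_at p l).
        by have := cts_comb 1 (-1) (c0c j) (@cts_cst _ _ (pole_at p l)); congr ctsA; apply/funext => t; rewrite mul1r mulN1r.
      by move=> /(_ hc); congr ctsA; apply/funext => t; rewrite mul1r mulN1r.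
    have cLg : cts01 (fun t => Lg (del q j l t)).
      move=> t ht x x0; have [d d0 hd] := cd t ht (k * x) (mulr_gt0 k0 x0); exists d => // s hs st.
      rewrite -(ltr_pM2l k0); apply: le_lt_trans (lipLg _ _ (hdel _ _ _ _ hq hs) (hdel _ _ _ _ hq ht)) _.
      exact: hd.
    have := cts_comb 1 1 cl (cts_comb 1 (-1) cLg (@cts_cst _ _ (Lg (del q j l 0)))).
    by congr ctsA; apply/funext => t; rewrite !mul1r mulN1r addrA.
  - by rewrite l00 add0r subrr.
  - move=> t ht; rewrite !cexpD cexpN !hLg; try exact: hdel.
    have := hl t ht; have := s0 0 (lexx _) => E0 E1.
    rewrite /del deformed0 E0 in E1 *.
    have n0 : zero_at p ord0 - pole_at p l != 0 by rewrite -E0; exact: c0n.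
    have n1 : zero_at q ord0 - pole_at q l != 0.
      by rewrite -(deformed0 q j) subr_eq0; apply: (av q hq).
    have n2 := c0n j l t ht; rewrite -E1 in n2 *.
    by field; rewrite n1 n0 (_ : cexp _ != 0) // cexp_neq0.
exists r; split => // q hq j l.
have sq := hst' q hq.
have lexp q' : nrm (q' - p) < r -> cexp (logint (deformed q' j) (pole_at q' l)) = pole_ratio q' j l.
  by move=> hq'; rewrite logint_exp; [rewrite deformed0 deformed1|exact: deformed_C1|exact: av].
have rat0 : pole_ratio q j l != 0 by rewrite -lexp // cexp_neq0.
have h := ldiff_pole_ratio j l sq.
have -> : dratio q j l = (cexp (logint (deformed q j) (pole_at q l)))^-1 *: (pole_ratio q j l *: dratio q j l).
  by rewrite lexp // scalerA mulVf // scale1r.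
have nb : forall q', nrm (q' - q) < r - nrm (q - p) -> nrm (q' - p) < r.
  by move=> q' hq'; have := ler_nrm_trans q q' p; lra.
apply: (sdiff1_lift _ (sdiffC_cexp _) h.2).
- exact: cexp_neq0.
- by exists (r - nrm (q - p)); [rewrite subr_gt0|move=> q' /nb; exact: lexp].
- move=> x x0; have kx : 0 < k * (x / 2) by rewrite mulr_gt0 // divr_gt0.
  have ctd t : t = 0 \/ t = 1 -> exists2 s : R, 0 < s & forall q', nrm (q' - q) < s -> absc (del q' j l t - del q j l t) < k * (x / 2).
    move=> ht; suff : sdiffable (fun q' => del q' j l t) q by move/sdiffable_cts => /(_ _ kx).
    apply: sdiffableM; last exact: sdiffable_cst.
    apply: sdiffableB; last exact: sdiffable_pole.
    case: ht => ->.
      by apply: sdiffable_ext (sdiffable_zero q ord0) => q'; rewrite deformed0.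
    by apply: sdiffable_ext (sdiffable_zero q (lift ord0 j)) => q'; rewrite deformed1.
  have [s s0 hs] := ctd 0 (or_introl erefl); have [s' s'0 hs'] := ctd 1 (or_intror erefl).
  exists (Num.min (r - nrm (q - p)) (Num.min s s')); first by rewrite !lt_min s0 s'0 subr_gt0 hq.
  move=> q'; rewrite !lt_min => /and3P[q0 /hs q1 /hs' q2]; have hq' := nb q' q0.
  rewrite !formula //.
  have -> : L j l + Lg (del q' j l 1) - Lg (del q' j l 0) - (L j l + Lg (del q j l 1) - Lg (del q j l 0))
    = (Lg (del q' j l 1) - Lg (del q j l 1)) - (Lg (del q' j l 0) - Lg (del q j l 0)) by ring.
  apply: le_lt_trans (ler_abscB _ _) _.
  have u1 := lipLg _ _ (hdel q' j l 1 hq' i1) (hdel q j l 1 hq i1).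
  have u0 := lipLg _ _ (hdel q' j l 0 hq' i0) (hdel q j l 0 hq i0).
  have v1 := le_lt_trans u1 q2; have v0 := le_lt_trans u0 q1.
  by rewrite !ltr_pM2l // in v0 v1; lra.
Qed.

End Deformation.

Lemma two_pi_i_neq0 : two_pi_i R != 0.
Proof. by rewrite eq_complex /= eqxx /= mulf_neq0 ?pnatr_eq0 // gt_eqF // pi_gt0. Qed.

(** Paths realizing [L] at [p] are deformed to nearby points. The period map of this family has an
    injective derivative between spaces of equal dimension, so it is a biholomorphism on a small
    ball. *)
Lemma chart_exists p (L : 'I_m -> 'I_n.+1 -> C) : stratum p ->
  (forall j l, cexp (L j l) = pole_ratio p j l) ->
  exists U c, [/\ period_chart e U c, U p & forall j l, logint (c p j) (pole_at p l) = L j l].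
Proof.
move=> sp hL; have [lam0 zi pi zp] := sp.
have hc j : exists c, [/\ flat_path c (zero_at p ord0) (zero_at p (lift ord0 j)),
    forall l, avoids c (pole_at p l) & forall l, logint c (pole_at p l) = L j l].
  by apply: log_vector_all.
have [c0 hc0] := choice hc.
have hfl j := let: And3 h _ _ := hc0 j in h.
have hav j := let: And3 _ h _ := hc0 j in h.
have hlg j := let: And3 _ _ h := hc0 j in h.
have [r1 [r10 hst av hdl]] := deformed_near sp hfl hav hlg.
pose c q := deformed p c0 q.
pose Phi := period_map e c.
have PhiE q : nrm (q - p) < r1 -> Phi q =
    row_mx (\row_j \sum_l resid e q l * logint (c q j) (pole_at q l)) (\row_l (two_pi_i R * resid e q l)).
  move=> hq; apply: period_mapE => //; first exact: hst.
    by move=> j; exact: deformed_C1.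
  exact: av.
have loc q : nrm (q - p) < r1 -> exists D E, [/\ sdiff Phi q D, D *m E = 1%:M & E *m D = 1%:M].
  move=> hq; have sq := hst q hq.
  have hR l : exists d, sdiff1 (fun q' => resid e q' l) q d by exact: sdiffable_resid.
  have [dR hdR] := choice hR.
  (* The product rule for [\sum_l R_l L_jl]; its first terms vanish on directions in which the
     residues are stationary. *)
  pose dP j := \sum_l (logint (c q j) (pole_at q l) *: dR l + resid e q l *: dratio q j l).
  pose D : 'M[C]_(1 + (m + n), m + n.+1) := row_mx (\matrix_(a, j) dP j a 0) (\matrix_(a, l) (two_pi_i R * dR l a 0)).
  have nb : forall q', nrm (q' - q) < r1 - nrm (q - p) -> nrm (q' - p) < r1.
    by move=> q' hq'; have := ler_nrm_trans q q' p; lra.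
  have rq : 0 < r1 - nrm (q - p) by rewrite subr_gt0.
  have colDP j : col (lshift _ j) D = dP j by apply/colP => a; rewrite mxE row_mxEl mxE.
  have colR l : col (rshift _ l) D = two_pi_i R *: dR l by apply/colP => a; rewrite mxE row_mxEr !mxE.
  have dPhi : sdiff Phi q D.
    apply: sdiffP => b; case: (split_ordP b) => [j ->|l ->].
      rewrite colDP.
      apply: (@sdiff1_near _ _ (fun q' => \sum_l resid e q' l * logint (c q' j) (pole_at q' l))).
        by exists (r1 - nrm (q - p)) => // q' /nb/PhiE ->; rewrite row_mxEl mxE.
      by apply: sdiff1_sum => l _; apply: sdiff1_mul; [exact: hdR|exact: hdl].
    rewrite colR.
    apply: (@sdiff1_near _ _ (fun q' => two_pi_i R * resid e q' l)).
      by exists (r1 - nrm (q - p)) => // q' /nb/PhiE ->; rewrite row_mxEr mxE.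
    exact: sdiff1_scale.
  have inj (v : point) : v *m D = 0 -> v = 0.
    move=> vD.
    have vR l : (v *m dR l) 0 0 = 0.
      have := mulmx_colE v D (rshift _ l); rewrite vD colR mulmx_scaleE [RHS]mxE => /eqP.
      by rewrite mulf_eq0 (negPf two_pi_i_neq0) => /eqP.
    apply: (period_covectors_inj he hsum sq hdR vR) => j.
    have h := mulmx_colE v D (lshift _ j); rewrite vD colDP [RHS]mxE mulmx_sumr summxE in h.
    rewrite -[RHS]h.
    apply: eq_bigr => l _; by rewrite (mulmx_addE v (_ *: dR l)) !mulmx_scaleE vR mulr0 add0r.
  have [|E [DE ED]] := injective_inverse _ inj; first by rewrite addnS add1n.
  by exists D, E.
have [r [r0 rr1 oI dI hpsi]] := local_biholomorphism r10 loc.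
have rr q : nrm (q - p) < r -> nrm (q - p) < r1 by move=> h; exact: lt_le_trans h rr1.
exists [set q | nrm (q - p) < r], c; split.
- split.
  + exact: open_nrm_ball.
  + by move=> q /rr /hst.
  + move=> q /rr hq j; split.
    * exact: deformed_C1.
    * exact: deformed0.
    * exact: deformed1.
    * by move=> t l ht; apply: av.
  + by move=> j; exact: deformed_joint_cts.
  + by split.
- by rewrite /= subrr nrm0.
- by move=> j l; rewrite /c deformed_id hlg.
Qed.

End ChartExistence.

(** * Polynomial ideals and algebraic dependence *)

Section Noetherian.

Inductive generated (A : comNzRingType) (S : A -> Prop) : A -> Prop :=
| generated0 : generated S 0
| generatedD a x y : S x -> generated S y -> generated S (a * x + y).

Definition noetherian (A : comNzRingType) : Prop :=
  forall I : A -> Prop, I 0 -> (forall x y, I x -> I y -> I (x + y)) ->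
    (forall a x, I x -> I (a * x)) ->
    exists s : seq A, (forall x, x \in s -> I x) /\
      forall x, I x -> generated (fun y => y \in s) x.

Section Generated.
Context (A : comNzRingType).
Implicit Types S T : A -> Prop.

Lemma generated_add S x y : generated S x -> generated S y -> generated S (x + y).
Proof.
move=> hx hy; elim: hx => [|a x0 z Sx _ IH]; first by rewrite add0r.
by rewrite -addrA; exact: generatedD.
Qed.

Lemma generated_mul S a x : generated S x -> generated S (a * x).
Proof.
elim=> [|b x0 z Sx _ IH]; first by rewrite mulr0; exact: generated0.
by rewrite mulrDr mulrA; exact: generatedD.
Qed.

Lemma generated_mem S x : S x -> generated S x.
Proof. by move=> Sx; rewrite -[x]mul1r -[1 * x]addr0; apply: generatedD => //; exact: generated0. Qed.

Lemma generated_trans S T x : (forall y, S y -> generated T y) -> generated S x -> generated T x.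
Proof.
move=> h; elim=> [|a y z Sy _ IH]; first exact: generated0.
by apply: generated_add => //; apply: generated_mul; exact: h.
Qed.

Lemma generated_ideal S (I : A -> Prop) x : (I 0) -> (forall x y, I x -> I y -> I (x + y)) ->
  (forall a x, I x -> I (a * x)) -> (forall y, S y -> I y) -> generated S x -> I x.
Proof. by move=> I0 ID IM SI; elim=> [//|a y z Sy _ Iz]; apply: ID => //; apply: IM; exact: SI. Qed.

(** The union of the ideals generated by initial segments is finitely generated, hence equal to one
    of them, say the ideal of the first [n] terms; it contains [a n]. *)
Lemma noetherian_seq (a : nat -> A) : noetherian A ->
  exists n, generated (fun y => exists2 i, (i < n)%N & y = a i) (a n).
Proof.
move=> nA; pose B n := generated (fun y => exists2 i, (i < n)%N & y = a i).
have Bmono n k x : (n <= k)%N -> B n x -> B k x.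
  move=> nk; apply: generated_trans => y [i ni ->].
  by apply: generated_mem; exists i => //; exact: leq_trans nk.
have [|||s [sI sgen]] := nA (fun x => exists n, B n x).
- by exists 0%N; exact: generated0.
- move=> x y [n1 h1] [n2 h2]; exists (maxn n1 n2); apply: generated_add.
    by apply: Bmono h1; exact: leq_maxl.
  by apply: Bmono h2; exact: leq_maxr.
- by move=> b x [n1 h1]; exists n1; exact: generated_mul.
have [k hk] : exists k, forall x, x \in s -> B k x.
  elim: s sI {sgen} => [_|y s IH sI]; first by exists 0%N.
  have [|k hk] := IH; first by move=> x xs; apply: sI; rewrite inE xs orbT.
  have [k' hk'] := sI y (mem_head _ _); exists (maxn k k') => x.
  rewrite inE => /predU1P[->|/hk h]; first exact: Bmono (leq_maxr _ _) hk'.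
  exact: Bmono (leq_maxl _ _) h.
exists k; apply: generated_trans (sgen (a k) _); first exact: hk.
by exists k.+1; apply: generated_mem; exists k.
Qed.

End Generated.

Lemma noetherian_field (F : fieldType) : noetherian F.
Proof.
move=> I I0 ID IM; have [[x Ix x0]|h] := pselect (exists2 x, I x & x != 0).
  exists [:: x]; split => [y|y _]; first by rewrite inE => /eqP ->.
  rewrite -[y](divfK x0); apply: generated_mul; apply: generated_mem; exact: mem_head.
exists [::]; split => // y Iy; have -> : y = 0; last exact: generated0.
by apply/eqP; apply: contrapT => /negP y0; apply: h; exists y.
Qed.

Lemma noetherian_image (A B : comNzRingType) (f : {rmorphism A -> B}) :
  (forall b, exists a, f a = b) -> noetherian A -> noetherian B.
Proof.
move=> sf nA I I0 ID IM.
have [|||s [sI sgen]] := nA (fun x => I (f x)).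
- by rewrite rmorph0.
- by move=> x y hx hy; rewrite rmorphD; exact: ID.
- by move=> a x hx; rewrite rmorphM; exact: IM.
exists (map f s); split => [y /mapP[x xs ->]|y Iy]; first exact: sI.
have [x fx] := sf y; rewrite -fx in Iy *.
elim: (sgen x Iy) => [|a z t zs _ IH]; first by rewrite rmorph0; exact: generated0.
by rewrite rmorphD rmorphM; apply: generatedD => //; exact: map_f.
Qed.

(** Hilbert's basis theorem. Successively choose [f n] of least size in [I] outside the ideal of its
    predecessors. Some leading coefficient is a combination of earlier ones; subtracting the
    corresponding multiples of earlier [f i] gives a smaller element still outside that ideal. *)
Lemma noetherian_poly (A : comNzRingType) : noetherian A -> noetherian {poly A}.
Proof.
move=> nA I I0 ID IM; apply: contrapT => bad.
have step (s : seq {poly A}) : exists f, (forall x, x \in s -> I x) ->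
    [/\ I f, ~ generated (fun y => y \in s) f &
      forall g, I g -> ~ generated (fun y => y \in s) g -> (size f <= size g)%N].
  have [sI|] := pselect (forall x, x \in s -> I x); last by exists 0.
  have [f If nf] : exists2 f, I f & ~ generated (fun y => y \in s) f.
    apply: contrapT => h; apply: bad; exists s; split => // x Ix.
    by apply: contrapT => nx; apply: h; exists x.
  have : exists k, `[< exists f, [/\ I f, ~ generated (fun y => y \in s) f & size f = k] >].
    by exists (size f); apply/asboolP; exists f.
  move=> exk; have := ex_minnP exk => -[k /asboolP[g [Ig ng gk]] hmin].
  exists g => _; split => // g' Ig' ng'; rewrite gk; apply: hmin.
  by apply/asboolP; exists g'.
have [F hF] := choice step.
pose s n := iter n (fun s => F s :: s) [::].
have sI n : forall x, x \in s n -> I x.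
  elim: n => [//|n IH] x; rewrite /s /= inE => /predU1P[->|]; last exact: IH.
  by have [] := hF _ IH.
pose f n := F (s n).
have fI n : I (f n) by have [] := hF _ (sI n).
have nf n : ~ generated (fun y => y \in s n) (f n) by have [] := hF _ (sI n).
have fmin n g : I g -> ~ generated (fun y => y \in s n) g -> (size (f n) <= size g)%N.
  by have [_ _] := hF _ (sI n); apply.
have fs i n : (i < n)%N -> f i \in s n.
  elim: n => // n IH; rewrite ltnS leq_eqVlt => /predU1P[->|/IH h]; rewrite /s /= inE ?eqxx //.
  by rewrite h orbT.
have ss i n x : (i <= n)%N -> x \in s i -> x \in s n.
  elim: n => [|n IH]; first by rewrite leqn0 => /eqP ->.
  rewrite leq_eqVlt => /predU1P[->|/IH h] // xs; by rewrite /s /= inE h ?orbT.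
have szf i n : (i <= n)%N -> (size (f i) <= size (f n))%N.
  move=> le_in; apply: fmin => // h; apply: (nf n); apply: generated_trans h => y ys.
  by apply: generated_mem; exact: ss le_in ys.
have [n gn] := noetherian_seq (fun n => lead_coef (f n)) nA.
have fn0 : f n != 0.
  by apply/eqP => h; apply: (nf n); rewrite h; exact: generated0.
have hlift a : generated (fun y => exists2 i, (i < n)%N & y = lead_coef (f i)) a ->
   exists g, [/\ generated (fun y => y \in s n) g, (size g <= size (f n))%N &
     g`_(size (f n)).-1 = a].
  elim=> [|b x y [i lin ->] _ [g [hg sg cg]]].
    by exists 0; split; [exact: generated0|rewrite size_poly0|rewrite coef0].
  have fi0 : f i != 0 by apply/eqP => h; apply: (nf i); rewrite h; exact: generated0.
  have si : (size (f i) <= size (f n))%N by apply: szf; exact: ltnW.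
  have si0 : (0 < size (f i))%N by rewrite size_poly_gt0.
  exists (b%:P * 'X^(size (f n) - size (f i)) * f i + g); split.
  - by apply: generatedD => //; exact: fs.
  - apply: leq_trans (size_polyD _ _) _; rewrite geq_max sg andbT -mulrA -['X^_ * _]mulrC mul_polyC.
    apply: leq_trans (size_scale_leq _ _) _.
    by rewrite size_mulXn // subnK.
  - rewrite coefD cg -mulrA -['X^_ * _]mulrC mul_polyC coefZ coefMXn lead_coefE.
    case: ltnP => h; first by lia.
    by congr (_ * (f i)`_ _ + _); lia.
have [g [hg sg cg]] := hlift _ gn.
have Ig : I g by apply: generated_ideal hg => //; exact: sI.
have Id : I (f n - g) by apply: ID => //; rewrite -mulN1r; exact: IM.
have nd : ~ generated (fun y => y \in s n) (f n - g).
  by move=> h; apply: (nf n); rewrite -(subrK g (f n)); exact: generated_add.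
have := fmin n _ Id nd; rewrite leqNgt => /negP; apply.
have s0 : (0 < size (f n))%N by rewrite size_poly_gt0.
rewrite -(prednK s0) ltnS; apply/leq_sizeP => j hj.
rewrite coefB; move: hj; rewrite leq_eqVlt => /predU1P[<-|hj].
  by rewrite cg lead_coefE subrr.
rewrite !nth_default ?subrr //; last by rewrite -(prednK s0).
by apply: leq_trans sg _; rewrite -(prednK s0).
Qed.

Lemma mpoly_alg_ind (N : nat) (A : comNzRingType) (P : mpoly N A -> Prop) :
  (forall c, P (mpolyC N c)) -> (forall i, P (mpolyX A (mnm1 i))) ->
  (forall f g, P f -> P g -> P (f + g)) -> (forall f g, P f -> P g -> P (f * g)) ->
  forall f, P f.
Proof.
move=> hC hX hD hM; apply: mpolyind => [|c mm f _ _ Pf]; first by rewrite -(mpolyC0 N A).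
apply: (hD) => //; rewrite -mul_mpolyC; apply: (hM) => //.
rewrite mpolyXE_id; apply: (big_ind P) => [||i _].
- by rewrite -(mpolyC1 N A).
- exact: hM.
- elim: (mm i) => [|k IH]; first by rewrite expr0 -(mpolyC1 N A).
  by rewrite exprS; exact: hM.
Qed.

(** Substitutes the last variable for the indeterminate. Being a surjective ring morphism, it
    transports noetherianity and permits induction on the power of the last variable. *)
Definition poly_to_mpoly (N : nat) (A : comNzRingType) : {poly mpoly N A} -> mpoly N.+1 A :=
  horner_eval (mpolyX A (mnm1 ord_max)) \o map_poly (@mwiden N A).

HB.instance Definition _ (N : nat) (A : comNzRingType) := GRing.RMorphism.on (@poly_to_mpoly N A).

Lemma poly_to_mpolyE N (A : comNzRingType) (P : {poly mpoly N A}) :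
  poly_to_mpoly P = (map_poly (@mwiden N A) P).[mpolyX A (mnm1 ord_max)].
Proof. by []. Qed.

Lemma poly_to_mpolyC N (A : comNzRingType) (f : mpoly N A) : poly_to_mpoly f%:P = mwiden f.
Proof. by rewrite poly_to_mpolyE map_polyC hornerC. Qed.

Lemma poly_to_mpolyX N (A : comNzRingType) :
  poly_to_mpoly ('X : {poly mpoly N A}) = mpolyX A (mnm1 ord_max).
Proof. by rewrite poly_to_mpolyE map_polyX hornerX. Qed.

Lemma mwiden_var N (A : comNzRingType) (i : 'I_N) :
  mwiden (mpolyX A (mnm1 i)) = mpolyX A (mnm1 (widen_ord (leqnSn N) i)).
Proof. by rewrite mwidenX mnmwiden1. Qed.

Lemma poly_to_mpoly_surj N (A : comNzRingType) (f : mpoly N.+1 A) :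
  exists P, poly_to_mpoly P = f.
Proof.
elim/mpoly_alg_ind: f => [c|i|f g [P <-] [Q <-]|f g [P <-] [Q <-]].
- by exists (mpolyC N c)%:P; rewrite poly_to_mpolyC mwidenC.
- case: (unliftP ord_max i) => [j ->|->]; last by exists 'X; rewrite poly_to_mpolyX.
  exists (mpolyX A (mnm1 j))%:P; rewrite poly_to_mpolyC mwiden_var.
  by congr (mpolyX A (mnm1 _)); apply: val_inj; rewrite /= /bump leqNgt ltn_ord.
- by exists (P + Q); rewrite rmorphD.
- by exists (P * Q); rewrite rmorphM.
Qed.

Lemma noetherian_mpoly N (F : fieldType) : noetherian (mpoly N F).
Proof.
elim: N => [|N IH].
  have sf (f : mpoly 0 F) : exists c, mpolyC 0 c = f.
    elim/mpoly_alg_ind: f => [c|[]//|f g [c <-] [d <-]|f g [c <-] [d <-]]; first by exists c.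
      by exists (c + d); rewrite rmorphD.
    by exists (c * d); rewrite rmorphM.
  exact: (@noetherian_image _ _ (mpolyC 0 (R:=F)) sf (@noetherian_field F)).
exact: (@noetherian_image {poly mpoly N F} (mpoly N.+1 F) (@poly_to_mpoly N F)
  (@poly_to_mpoly_surj N F) (noetherian_poly IH)).
Qed.

End Noetherian.

(** * Algebraic dependence of [N + 1] polynomials in [N] variables *)

Section AlgebraicDependence.

Definition mnm_of k (g : 'I_k -> nat) : multinom k := Multinom (mktuple g).

Lemma mnm_ofE k (g : 'I_k -> nat) i : mnm_of g i = g i.
Proof. exact: mnmE. Qed.

Context (F : fieldType) (N : nat).

Lemma msizeM_bound (p q : mpoly N F) a b :
  (msize p <= a.+1)%N -> (msize q <= b.+1)%N -> (msize (p * q) <= (a + b).+1)%N.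
Proof.
have [->|p0] := eqVneq p 0; first by rewrite mul0r msize0.
have [->|q0] := eqVneq q 0; first by rewrite mulr0 msize0.
rewrite msizeM //; move: (msize p) (msize q) => u v; lia.
Qed.

Lemma mcoeff_high (f : mpoly N F) (mu : multinom N) : (msize f <= mdeg mu)%N -> mcoeff mu f = 0.
Proof. by move=> h; apply: memN_msupp_eq0; apply: msize_mdeg_ge. Qed.

(** A dimension count: the monomials in the [f i] with exponents at most [K] outnumber the available
    monomials in the [N] variables, so they are linearly dependent. *)
Lemma algebraic_dependence (f : 'I_N.+1 -> mpoly N F) :
  exists2 P : mpoly N.+1 F, P != 0 & mmap (@mpolyC N F) f P = 0.
Proof.
(* Products with exponents at most [K] have size at most [S = A (K + 1)]. There are
   [(K + 1)^(N + 1)] of them, against [S^N = A^N (K + 1)^N] exponent vectors; [K = A^N] makes the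
   first number larger. *)
pose D := (\max_i msize (f i))%N.
pose A := (N.+1 * D).+1.
pose K := (A ^ N)%N.
pose S := (A * K.+1)%N.
pose rowT := {ffun 'I_N.+1 -> 'I_K.+1}.
pose colT := {ffun 'I_N -> 'I_S}.
pose mon (r : rowT) : mpoly N F := \prod_i f i ^+ r i.
pose mc (c : colT) : multinom N := mnm_of (fun i => c i : nat).
have smon r : (msize (mon r) <= S)%N.
  have h : forall s : seq 'I_N.+1, (msize (\prod_(i <- s) f i ^+ r i) <= (size s * D * K).+1)%N.
    elim=> [|i s IH]; first by rewrite big_nil msize1.
    rewrite big_cons.
    have hx : forall k : nat, (msize (f i ^+ k) <= (D * k).+1)%N.
      elim=> [|k IHk]; first by rewrite expr0 msize1.
      rewrite exprS.
      rewrite mulnS; apply: msizeM_bound => //.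
      by rewrite /D; apply: leqW; exact: (leq_bigmax i).
    have rK : (r i <= K)%N by rewrite -ltnS ltn_ord.
    have -> : (size (i :: s) * D * K = D * K + size s * D * K)%N by rewrite /= mulSn mulnDl.
    apply: msizeM_bound => //; apply: leq_trans (hx (r i)) _.
    by rewrite ltnS leq_mul2l rK orbT.
  apply: leq_trans (h _) _; rewrite /index_enum -enumT size_enum_ord /S /A.
  rewrite mulSn mulnS; nia.
pose M : 'M[F]_(#|{: rowT}|, #|{: colT}|) :=
  \matrix_(r, c) mcoeff (mc (enum_val c)) (mon (enum_val r)).
have lt : (#|{: colT}| < #|{: rowT}|)%N.
  by rewrite !card_ffun !card_ord /S expnMn expnS ltn_pmul2r ?expn_gt0 // /K.
have : kermx M != 0.
  rewrite -mxrank_eq0 mxrank_ker subn_eq0 -ltnNge.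
  exact: leq_ltn_trans (rank_leq_col _) lt.
move/rowV0Pn => [c /sub_kermxP cM c0].
pose P : mpoly N.+1 F := \sum_(r : rowT) c 0 (enum_rank r) *: mpolyX F (mnm_of (fun i => r i : nat)).
have Pc (r : rowT) : mcoeff (mnm_of (fun i => r i : nat)) P = c 0 (enum_rank r).
  rewrite /P raddf_sum (bigD1 r) //= mcoeffZ mcoeffX eqxx mulr1 big1 ?addr0 // => r' r'r.
  rewrite mcoeffZ mcoeffX; case: eqP => [E|]; last by rewrite mulr0.
  case/eqP: r'r; apply/ffunP => i; apply: val_inj.
  by have := congr1 (fun mu : multinom N.+1 => mu i) E; rewrite !mnm_ofE.
exists P.
  apply: contra_neq c0 => P0; apply/rowP => j; rewrite mxE -(enum_valK j) -Pc P0.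
  exact: mcoeff0.
rewrite /P raddf_sum /=.
have -> : \sum_(r : rowT) mmap (@mpolyC N F) f (c 0 (enum_rank r) *: mpolyX F (mnm_of (fun i => r i : nat)))
   = \sum_(r : rowT) c 0 (enum_rank r) *: mon r.
  apply: eq_bigr => r _; rewrite mmapZ mmapX mul_mpolyC; congr (_ *: _).
  by apply: eq_bigr => i _; rewrite mnm_ofE.
apply/mpolyP => mu; rewrite mcoeff0.
have [hmu|hmu] := ltnP (mdeg mu) S; last first.
  apply: mcoeff_high; apply: leq_trans hmu.
  apply: (big_ind (fun p => (msize p <= S)%N)) => [|p q hp hq|r _]; first by rewrite msize0.
    by apply: leq_trans (msizeD_le _ _) _; rewrite geq_max hp.
  by apply: leq_trans (msizeZ_le _ _) _.
have hi (i : 'I_N) : (mu i < S)%N.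
  by apply: leq_ltn_trans hmu; rewrite mdegE (bigD1 i) //= leq_addr.
pose cc : colT := [ffun i => Ordinal (hi i)].
have -> : mu = mc cc by apply/mnmP => i; rewrite mnm_ofE ffunE.
rewrite raddf_sum /=.
have cE := congr1 (fun v : 'rV_ _ => v 0 (enum_rank cc)) cM; rewrite !mxE in cE; rewrite -[RHS]cE.
rewrite (reindex (@enum_val rowT predT)) /=; last by exact: onW_bij (enum_val_bij _).
by apply: eq_bigr => r _; rewrite mcoeffZ mxE !enum_rankK enum_valK.
Qed.

End AlgebraicDependence.

(** * Zariski dimension *)

Section ZariskiTopology.
Context (R : realType) (N : nat).
Local Notation C := R[i].
Local Notation mp := (mpoly N C).
Implicit Types (p q : 'rV[C]_N) (f g h : mp) (F G X W : set 'rV[C]_N).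

Definition ev p f : C := meval (fun i => p 0 i) f.

Lemma evD p f g : ev p (f + g) = ev p f + ev p g. Proof. exact: mevalD. Qed.
Lemma evM p f g : ev p (f * g) = ev p f * ev p g. Proof. exact: mevalM. Qed.
Lemma evC p c : ev p (mpolyC N c) = c. Proof. exact: mevalC. Qed.
Lemma evX p i : ev p (mpolyX C (mnm1 i)) = p 0 i. Proof. exact: mevalXU. Qed.
Lemma ev0 p : ev p 0 = 0. Proof. by rewrite -(mpolyC0 N C) evC. Qed.
Lemma ev1 p : ev p 1 = 1. Proof. by rewrite -(mpolyC1 N C) evC. Qed.
Lemma evN p f : ev p (- f) = - ev p f. Proof. exact: mevalN. Qed.
Lemma evB p f g : ev p (f - g) = ev p f - ev p g. Proof. by rewrite evD evN. Qed.
Lemma ev_sum p (I : Type) (s : seq I) (P : pred I) (f : I -> mp) :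
  ev p (\sum_(i <- s | P i) f i) = \sum_(i <- s | P i) ev p (f i).
Proof. by elim/big_rec2: _ => [|i x y _ <-]; rewrite ?ev0 ?evD. Qed.
Lemma ev_prod p (I : Type) (s : seq I) (P : pred I) (f : I -> mp) :
  ev p (\prod_(i <- s | P i) f i) = \prod_(i <- s | P i) ev p (f i).
Proof. by elim/big_rec2: _ => [|i x y _ <-]; rewrite ?ev1 ?evM. Qed.
Lemma evXn p f k : ev p (f ^+ k) = ev p f ^+ k.
Proof. by elim: k => [|k IH]; rewrite ?expr0 ?ev1 // !exprS evM IH. Qed.

Lemma zariski_closed_poly F p : zariski_closed F -> ~ F p ->
  exists2 f, (forall q, F q -> ev q f = 0) & ev p f != 0.
Proof.
move=> [I ->] h; have : exists2 f, I f & ev p f != 0.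
  apply: contrapT => nh; apply: h => f If; apply/eqP; apply: contrapT => /negP fp.
  by apply: nh; exists f.
by move=> [f If fp]; exists f => // q; apply.
Qed.

Lemma zariski_closed_zeros (S : set mp) : zariski_closed [set p | forall f, S f -> ev p f = 0].
Proof. by exists S. Qed.

Lemma zariski_closedT : zariski_closed (@setT 'rV[C]_N).
Proof. by exists set0; apply/seteqP; split => // p _ f []. Qed.

Lemma zariski_closed0 : zariski_closed (@set0 'rV[C]_N).
Proof.
exists [set 1]; apply/seteqP; split => // p /= /(_ 1 erefl) /eqP.
by rewrite -/(ev p 1) ev1 oner_eq0.
Qed.

Lemma zariski_closedI F G : zariski_closed F -> zariski_closed G -> zariski_closed (F `&` G).
Proof.
move=> [I ->] [J ->]; exists (I `|` J); apply/seteqP; split => p /=.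
  by move=> [hI hJ] f [/hI|/hJ].
by move=> h; split => f hf; apply: h; [left|right].
Qed.

Lemma zariski_closedU F G : zariski_closed F -> zariski_closed G -> zariski_closed (F `|` G).
Proof.
move=> cF cG; exists [set f | forall p, (F `|` G) p -> ev p f = 0].
apply/seteqP; split => p /=; first by move=> hp f; apply.
move=> h; apply: contrapT => /not_orP[nF nG].
have [f hf fp] := zariski_closed_poly cF nF; have [g hg gp] := zariski_closed_poly cG nG.
have := h (f * g); rewrite -/(ev p (f * g)) evM => /(_ _)/eqP.
rewrite mulf_eq0 (negPf fp) (negPf gp) => H; suff : false by []; apply: H => q [/hf|/hg] E.
  by rewrite evM E mul0r.
by rewrite evM E mulr0.
Qed.

(** An infinite strict descent would give polynomials [f n] vanishing on the next set but not on the
    current one, and [noetherian_seq] puts some [f n] into the ideal of its predecessors. *)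
Lemma zariski_closed_min (P : set 'rV[C]_N -> Prop) :
  (exists2 F, zariski_closed F & P F) ->
  exists F, [/\ zariski_closed F, P F & forall G, zariski_closed G -> P G -> G `<=` F -> G = F].
Proof.
move=> [F0 cF0 PF0]; apply: contrapT => bad.
have step (F : set 'rV[C]_N) : exists G, zariski_closed F /\ P F ->
    [/\ zariski_closed G, P G, G `<=` F & exists2 p, F p & ~ G p].
  have [[cF PF]|] := pselect (zariski_closed F /\ P F); last by exists F.
  apply: contrapT => h; apply: bad; exists F; split => // G cG PG GF.
  apply/seteqP; split => // p Fp; apply: contrapT => nG.
  by apply: h; exists G => _; split => //; exists p.
have [S hS] := choice step.
pose Fs n := iter n S F0.
have cP n : zariski_closed (Fs n) /\ P (Fs n).
  by elim: n => // n IH; have [] := hS _ IH.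
have dec n k : (n <= k)%N -> Fs k `<=` Fs n.
  elim: k => [|k IH]; first by rewrite leqn0 => /eqP ->.
  rewrite leq_eqVlt => /predU1P[->//|/IH h].
  by have [_ _ h' _] := hS _ (cP k); apply: subset_trans h.
have hf n : exists f, (forall q, Fs n.+1 q -> ev q f = 0) /\ exists2 p, Fs n p & ev p f != 0.
  have [cG _ _ [p Fp nGp]] := hS _ (cP n).
  by have [f f1 f2] := zariski_closed_poly cG nGp; exists f; split => //; exists p.
have [f hf'] := choice hf.
have [n gn] := noetherian_seq f (@noetherian_mpoly N C).
have [_ [p Fp fp]] := hf' n.
have : ev p (f n) = 0.
  apply: (generated_ideal (I := fun g => ev p g = 0)) gn.
  - exact: ev0.
  - by move=> x y hx hy; rewrite evD hx hy addr0.
  - by move=> a x hx; rewrite evM hx mulr0.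
  - by move=> _ [i lin ->]; have [h _] := hf' i; apply: h; exact: dec lin _ Fp.
by move/eqP; rewrite (negPf fp).
Qed.

Lemma irreducible_mul X f g : zariski_irreducible X ->
  (forall p, X p -> ev p f * ev p g = 0) ->
  (forall p, X p -> ev p f = 0) \/ (forall p, X p -> ev p g = 0).
Proof.
move=> [_ irr] h.
have [||p /h/eqP|hf|hg] := irr [set p | forall f', [set f] f' -> ev p f' = 0] [set p | forall f', [set g] f' -> ev p f' = 0].
- exact: zariski_closed_zeros.
- exact: zariski_closed_zeros.
- by rewrite mulf_eq0 => /orP[]/eqP E; [left|right] => f' ->.
- by left => p /hf; apply.
- by right => p /hg; apply.
Qed.

Lemma irreducible_cover X (I : eqType) (s : seq I) (G : I -> set 'rV[C]_N) :
  zariski_irreducible X -> (forall i, zariski_closed (G i)) ->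
  (forall p, X p -> exists2 i, i \in s & G i p) -> exists2 i, i \in s & X `<=` G i.
Proof.
move=> [X0 irr] cG.
pose U (t : seq I) : set 'rV[C]_N := [set p | exists2 i, i \in t & G i p].
have cU t : zariski_closed (U t).
  elim: t => [|i t IH].
    suff -> : U [::] = set0 by exact: zariski_closed0.
    by apply/seteqP; split => // p [].
  suff -> : U (i :: t) = G i `|` U t by exact: zariski_closedU.
  apply/seteqP; split => p /=.
    by move=> [j]; rewrite inE => /predU1P[->|jt] Gp; [left|right; exists j].
  by move=> [Gp|[j jt Gp]]; [exists i; rewrite ?mem_head|exists j; rewrite ?inE ?jt ?orbT].
elim: s => [h|i s IH h]; first by have [p Xp] := X0; have [] := h p Xp.
have [p Xp|hX|hX] := irr (G i) (U s) (cG i) (cU s).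
- have [j] := h p Xp; rewrite inE => /predU1P[->|js] Gp; [by left|by right; exists j].
- by exists i => //; exact: mem_head.
- by have [j js Gj] := IH hX; exists j => //; rewrite inE js orbT.
Qed.

(** [X] may be any subset, with pieces [X ∩ G i]. A minimal closed set on which [X] has no finite
    decomposition would split into two smaller ones. Taking the least number of pieces makes each of
    them own a point outside the others. *)
Lemma irreducible_decomposition X : exists (k : nat) (G : 'I_k -> set 'rV[C]_N),
  [/\ forall i, zariski_closed (G i), forall i, zariski_irreducible (X `&` G i),
      forall p, X p -> exists i, G i p &
      forall i, exists p, [/\ X p, G i p & forall j, j != i -> ~ G j p]].
Proof.
pose dec (F : set 'rV[C]_N) k := exists G : nat -> set 'rV[C]_N,
  [/\ forall i, zariski_closed (G i), forall i, (i < k)%N -> zariski_irreducible (X `&` G i) &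
      forall p, X p -> F p -> exists2 i, (i < k)%N & G i p].
have [k0 hk0] : exists k, dec setT k.
  apply: contrapT => bad.
  have [|F [cF nF mF]] := @zariski_closed_min (fun F => ~ exists k, dec F k).
    by exists setT => //; exact: zariski_closedT.
  have [[p0 [Xp0 Fp0]]|emp] := pselect (exists p, X p /\ F p); last first.
    apply: nF; exists 0%N, (fun=> set0); split => // [i|p Xp Fp]; first exact: zariski_closed0.
    by case: emp; exists p.
  have nirr : ~ zariski_irreducible (X `&` F).
    move=> irr; apply: nF; exists 1%N, (fun=> F); split => // p _ Fp; by exists 0%N.
  have [G [H [cG cH cov nG nH]]] : exists G H, [/\ zariski_closed G, zariski_closed H,
      X `&` F `<=` G `|` H, ~ (X `&` F `<=` G) & ~ (X `&` F `<=` H)].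
    apply: contrapT => h; apply: nirr; split; first by exists p0.
    move=> G H cG cH cov; apply: contrapT => /not_orP[nG nH].
    by apply: h; exists G, H.
  have sub K : zariski_closed K -> ~ (X `&` F `<=` K) -> exists k, dec (F `&` K) k.
    move=> cK nK; apply: contrapT => nd.
    have E := mF _ (zariski_closedI cF cK) nd (@subIsetl _ _ _).
    by apply: nK => p [_]; rewrite -E => -[].
  have [kG [GG [cGG iGG covG]]] := sub G cG nG; have [kH [HH [cHH iHH covH]]] := sub H cH nH.
  apply: nF; exists (kG + kH)%N, (fun i => if (i < kG)%N then GG i else HH (i - kG)%N); split.
  - by move=> i; case: ifP.
  - move=> i ik; case: ltnP => h; first exact: iGG.
    by apply: iHH; rewrite ltn_subLR.
  - move=> p Xp Fp; have [//|Gp|Hp] := cov p.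
      have [//|i ik Gi] := covG p Xp; exists i; first exact: ltn_addr.
      by rewrite ik.
    have [//|i ik Hi] := covH p Xp; exists (kG + i)%N; first by rewrite ltn_add2l.
    by rewrite ltnNge leq_addr /= addKn.
have exk : exists k, `[< dec setT k >] by exists k0; apply/asboolP.
have [k /asboolP[G [cG iG cov]] kmin] := ex_minnP exk.
exists k, (fun i : 'I_k => G i); split => //.
- by move=> i; exact: iG.
- by move=> p Xp; have [//|i ik Gp] := cov p Xp; exists (Ordinal ik).
- move=> i; apply: contrapT => h.
  have hcov p : X p -> exists2 j : nat, (j < k)%N && (j != i) & G j p.
    move=> Xp; have [//|j jk Gj] := cov p Xp; have [ji|ji] := eqVneq j i; last by exists j; rewrite ?jk.
    apply: contrapT => nj; apply: h; exists p; split => //; first by rewrite -ji.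
    by move=> j' j'i Gj'; apply: nj; exists j' => //; rewrite ltn_ord.
  have k0' : (0 < k)%N by apply: leq_ltn_trans (ltn_ord i).
  have : (k <= k.-1)%N.
    apply: kmin; apply/asboolP; exists (fun j => G (if (j < i)%N then j else j.+1)); split => //.
      move=> j jk; apply: iG; case: ifP => _; [apply: leq_trans jk (leq_pred _)|by rewrite -(prednK k0') ltnS].
    move=> p Xp _; have [j /andP[jk ji] Gj] := hcov p Xp.
    have [lt|gt|eq] := ltngtP j i; last by rewrite eq eqxx in ji.
      exists j; last by rewrite lt.
      by rewrite -ltnS prednK //; apply: leq_ltn_trans (ltn_ord i).
    have j0 : (0 < j)%N by apply: leq_ltn_trans gt.
    exists j.-1; first by rewrite -ltnS !prednK.
    have -> : (j.-1 < i)%N = false by apply/negbTE; rewrite -leqNgt -ltnS prednK.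
    by rewrite prednK.
  by rewrite -ltnS prednK // ltnn.
Qed.

End ZariskiTopology.

(** * Chains of irreducible sets and algebraic independence *)

Section ChainLength.
Context (R : realType) (N : nat).
Local Notation C := R[i].
Local Notation mp := (mpoly N C).
Implicit Types (p q : 'rV[C]_N) (W : set 'rV[C]_N).

(** A chain of irreducible sets ending in [W], each inclusion witnessed by a polynomial that
    vanishes on the smaller set only. Since no ambient set is fixed, such a chain can be extended
    upwards into larger loci. *)
Fixpoint poly_chain (r : nat) W : Prop := zariski_irreducible W /\
  if r is r'.+1 then exists W0 f, [/\ poly_chain r' W0, W0 `<=` W,
    forall p, W0 p -> ev p f = 0 & exists2 p, W p & ev p f != 0] else True.

Lemma poly_chain_irreducible r W : poly_chain r W -> zariski_irreducible W.
Proof. by case: r => [|r] []. Qed.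

Lemma meval_mwiden k (v : 'I_k.+1 -> C) (f : mpoly k C) :
  meval v (mwiden f) = meval (fun j => v (widen_ord (leqnSn k) j)) f.
Proof.
elim/mpoly_alg_ind: f => [c|i|f g IHf IHg|f g IHf IHg].
- by rewrite mwidenC !mevalC.
- by rewrite mwiden_var !mevalXU.
- apply: etrans (congr1 (meval v) (mwidenD f g)) _; apply: etrans (mevalD v _ _) _.
  by apply: etrans (congr2 +%R IHf IHg) _; apply/esym/mevalD.
- apply: etrans (congr1 (meval v) (mwidenM f g)) _; apply: etrans (mevalM v _ _) _.
  by apply: etrans (congr2 *%R IHf IHg) _; apply/esym/mevalM.
Qed.

Lemma meval_poly_to_mpoly k (v : 'I_k.+1 -> C) (Q : {poly mpoly k C}) (c : mpoly k C) :
  meval v (poly_to_mpoly (Q * 'X + c%:P)) = meval v (poly_to_mpoly Q) * v ord_max +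
    meval (fun j => v (widen_ord (leqnSn k) j)) c.
Proof.
by rewrite rmorphD rmorphM /= poly_to_mpolyX poly_to_mpolyC mevalD mevalM mevalXU meval_mwiden.
Qed.

Lemma ev_mmap k (f : 'I_k -> mp) (P : mpoly k C) p :
  ev p (mmap (@mpolyC N C) f P) = meval (fun i => ev p (f i)) P.
Proof.
elim/mpoly_alg_ind: P => [c|i|P Q IHP IHQ|P Q IHP IHQ].
- by rewrite mmapC evC mevalC.
- by rewrite mmapX mmap1U mevalXU.
- apply: etrans (congr1 (ev p) (mmapD _ _ P Q)) _; apply: etrans (evD p _ _) _.
  by apply: etrans (congr2 +%R IHP IHQ) _; apply/esym/mevalD.
- apply: etrans (congr1 (ev p) (rmorphM (mmap (@mpolyC N C) f) P Q)) _; apply: etrans (evM p _ _) _.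
  by apply: etrans (congr2 *%R IHP IHQ) _; apply/esym/mevalM.
Qed.

(** The separating polynomials are algebraically independent on [W]. Expand a relation in powers of
    the last one, [g]: on [W0] only the constant coefficient survives and it is 0 by induction. What
    remains is a multiple of [g], which irreducibility allows to be cancelled. *)
Lemma poly_chain_indep r W : poly_chain r W -> exists f : 'I_r -> mp,
  forall P : mpoly r C, (forall p, W p -> meval (fun i => ev p (f i)) P = 0) -> P = 0.
Proof.
elim: r W => [|r IH] W.
  move=> [[[p Wp] _] _]; exists (fun=> 0) => P /(_ p Wp).
  have [c ->] : exists c, P = mpolyC 0 c.
    elim/mpoly_alg_ind: P => [c|[]//|P Q [c ->] [d ->]|P Q [c ->] [d ->]]; first by exists c.
      by exists (c + d); rewrite rmorphD.
    by exists (c * d); rewrite rmorphM.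
  by rewrite mevalC => ->; rewrite mpolyC0.
move=> [irr [W0 [g [ch0 W0W g0 [p0 Wp0 gp0]]]]].
have [f hf] := IH _ ch0.
pose F (i : 'I_r.+1) : mp := if unlift ord_max i is Some j then f j else g.
have Fw j : F (widen_ord (leqnSn r) j) = f j.
  have -> : widen_ord (leqnSn r) j = lift ord_max j.
    by apply: val_inj; rewrite /= /bump leqNgt ltn_ord.
  by rewrite /F liftK.
have Fm : F ord_max = g by rewrite /F unlift_none.
exists F => P; have [Q <-] := poly_to_mpoly_surj P.
suff H : (forall p, W p -> meval (fun i => ev p (F i)) (poly_to_mpoly Q) = 0) -> Q = 0.
  by move/H => ->; rewrite rmorph0.
elim/poly_ind: Q => [//|Q c IHQ] hv.
have c0 : c = 0.
  apply: hf => p W0p; have := hv p (W0W _ W0p).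
  rewrite meval_poly_to_mpoly Fm g0 // mulr0 add0r => <-.
  by congr meval; apply/funext => j; rewrite Fw.
suff Q0 : Q = 0 by rewrite Q0 c0 addr0; exact: mul0r.
apply: IHQ => p Wp.
have hm q : W q -> ev q (mmap (@mpolyC N C) F (poly_to_mpoly Q)) * ev q g = 0.
  move=> Wq; apply: etrans (hv q Wq); apply/esym.
  rewrite meval_poly_to_mpoly c0 Fm ev_mmap -[X in _ + X]/(meval _ (mpolyC r 0)).
  by rewrite [X in _ + X]mevalC addr0.
have [h|h] := irreducible_mul irr hm; first by rewrite -ev_mmap h.
by have := h p0 Wp0 => /eqP; rewrite (negPf gp0).
Qed.

Lemma poly_chain_down r k W : poly_chain (r + k) W -> exists W', poly_chain r W'.
Proof.
elim: k W => [|k IH] W; first by rewrite addn0; exists W.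
by rewrite addnS => -[_ [W0 [f [/IH]]]].
Qed.

Lemma poly_chain_le r W : poly_chain r W -> (r <= N)%N.
Proof.
move=> ch; rewrite leqNgt; apply/negP => lt.
have [W' /poly_chain_indep[f hf]] : exists W', poly_chain N.+1 W'.
  by apply: (@poly_chain_down _ (r - N.+1) W); rewrite subnKC.
have [P P0 Pf] := algebraic_dependence f.
by case/eqP: P0; apply: hf => p _; rewrite -ev_mmap Pf ev0.
Qed.

Lemma zariski_chain_poly X d : zariski_chain X d -> exists2 W, poly_chain d W & W `<=` X.
Proof.
move=> [Z [hZ sZ]]; exists (Z d); last by have [_ [F _ ->]] := hZ d (leqnn d).
have : forall j, (j <= d)%N -> poly_chain j (Z j).
  elim=> [|j IH] jd; first by split => //; have [] := hZ 0%N jd.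
  split; first by have [] := hZ _ jd.
  have [sub nsub] := sZ j jd; have /existsNP[p /not_implyP[Zp nZp]] := nsub.
  have [_ [F cF ZF]] := hZ j (ltnW jd).
  have [_ [F' _ ZF']] := hZ _ jd.
  have nFp : ~ F p by move=> Fp; apply: nZp; rewrite ZF; split => //; move: Zp; rewrite ZF' => -[].
  have [f f0 fp] := zariski_closed_poly cF nFp.
  exists (Z j), f; split => //; [exact: IH (ltnW jd)|by move=> q; rewrite ZF => -[_ /f0]|by exists p].
by apply.
Qed.

End ChainLength.

(** * Dimension of loci with independent gradients *)

Section Dimension.
Context (R : realType) (N : nat).
Local Notation C := R[i].
Local Notation mp := (mpoly N C).
Implicit Types (p q : 'rV[C]_N) (f g h : mp) (gs : seq mp) (W X : set 'rV[C]_N).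

Definition grad f p : 'cV[C]_N := \col_a ev p (mderiv a f).

Lemma sdiff1_ev f p : sdiff1 (fun q => ev q f) p (grad f p).
Proof.
elim/mpoly_alg_ind: f => [c|i|f g IHf IHg|f g IHf IHg].
- apply: (sdiff1_ext _ _ (sdiff1_cst c p)) => [x|]; first by rewrite evC.
  by apply/colP => a; rewrite !mxE mderivC ev0.
- apply: (sdiff1_ext _ _ (sdiff1_coord i p)) => [x|]; first by rewrite evX.
  apply/colP => a; rewrite !mxE mderivX mnm1E eqxx andbT eq_sym; case: eqVneq => [->|_].
    rewrite scale1r (_ : mnm_sub _ _ = mnm0) ?mpolyX0 ?ev1 //.
    by apply/mnmP => l; rewrite mnmBE subnn mnm0E.
  by rewrite scale0r ev0.
- apply: (sdiff1_ext _ _ (sdiff1_add IHf IHg)) => [x|]; first by rewrite evD.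
  by apply/colP => a; rewrite !mxE mderivD evD.
- apply: (sdiff1_ext _ _ (sdiff1_mul IHf IHg)) => [x|]; first by rewrite evM.
  apply/colP => a; rewrite [LHS]mxE mderivM; apply: etrans (evD _ _ _) _.
  by rewrite (evM p (mderiv a f)) (evM p f) 5!mxE [_ * ev p g]mulrC.
Qed.

Lemma ev_near_neq0 f p : ev p f != 0 ->
  exists2 r : R, 0 < r & forall q, nrm (q - p) < r -> ev q f != 0.
Proof. by apply: sdiffable_neq0; eexists; exact: sdiff1_ev. Qed.

(** Independence of the gradients, given by a dual family: along [w i] only the [i]-th equation
    changes to first order. *)
Definition full_rank gs p : Prop := exists w : nat -> 'rV[C]_N,
  forall i j, (i < size gs)%N -> (j < size gs)%N ->
    (w i *m grad (nth 0 gs j) p) 0 0 = (i == j)%:R.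

Lemma full_rank_cons g gs p : full_rank (g :: gs) p -> full_rank gs p.
Proof. by move=> [w hw]; exists (fun i => w i.+1) => i j hi hj; have := hw i.+1 j.+1 hi hj. Qed.

(** [dl] is the determinant of the derivatives of the equations along the vectors [w i], kept
    constant. It is 1 at [p]; where it is non-zero the inverse matrix recombines the [w i] into a
    dual family. *)
Lemma full_rank_open gs p : full_rank gs p ->
  exists2 dl : mp, ev p dl != 0 & forall q, ev q dl != 0 -> full_rank gs q.
Proof.
move=> [w hw]; set s := size gs in hw *.
pose M : 'M[mp]_s := \matrix_(i, j) \sum_a mpolyC N (w i 0 a) * mderiv a (nth 0 gs j).
pose Mq q : 'M[C]_s := \matrix_(i, j) (w i *m grad (nth 0 gs j) q) 0 0.
have evd q : ev q (\det M) = \det (Mq q).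
  rewrite -[ev q _]/(meval (fun i => q 0 i) _) -det_map_mx; congr (\det _).
  apply/matrixP => i j; rewrite !mxE -[LHS]/(ev q _) ev_sum; apply: eq_bigr => a _.
  by rewrite evM evC mxE.
exists (\det M).
  rewrite evd (_ : Mq p = 1%:M) ?det1 ?oner_neq0 //.
  by apply/matrixP => i j; rewrite mxE hw // mxE.
move=> q; rewrite evd => dq.
have uM : Mq q \in unitmx by rewrite unitmxE unitfE.
pose w' (i : nat) : 'rV[C]_N := \sum_(k < s) (if insub i is Some i' then invmx (Mq q) i' k else 0) *: w k.
exists w' => i j hi hj; rewrite -/s in hi hj.
have := congr1 (fun A : 'M[C]_s => A (Ordinal hi) (Ordinal hj)) (mulVmx uM).
rewrite /= mxE [X in _ = X]mxE => E.
rewrite /w' mulmx_suml summxE -[RHS]E; apply: eq_bigr => k _.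
by rewrite insubT -scalemxAl mxE [Mq q k _]mxE.
Qed.

(** A non-zero vector [u] killed by all gradients has some coordinate [u_a] different from 0, and
    the hyperplane through [p] in that coordinate is transverse to the locus. *)
Lemma full_rank_extend gs p : full_rank gs p -> (size gs < N)%N ->
  exists a : 'I_N, full_rank ((mpolyX C (mnm1 a) - mpolyC N (p 0 a)) :: gs) p.
Proof.
move=> [w hw] lt.
pose J : 'M[C]_(N, size gs) := \matrix_(a, j) grad (nth 0 gs j) p a 0.
have colJ j : col j J = grad (nth 0 gs j) p by apply/colP => a; rewrite !mxE.
have : kermx J != 0.
  rewrite -mxrank_eq0 mxrank_ker subn_eq0 -ltnNge.
  exact: leq_ltn_trans (rank_leq_col _) lt.
move=> /rowV0Pn[u /sub_kermxP uJ u0].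
have [a ua] : exists a, u 0 a != 0.
  apply: contrapT => h; case/eqP: u0; apply/rowP => a; rewrite mxE.
  by apply/eqP; apply: contrapT => /negP ua; apply: h; exists a.
have uj j : (j < size gs)%N -> (u *m grad (nth 0 gs j) p) 0 0 = 0.
  by move=> hj; rewrite -(colJ (Ordinal hj)) mulmx_colE uJ mxE.
have gE : grad (mpolyX C (mnm1 a) - mpolyC N (p 0 a)) p = delta_mx a 0.
  have h : sdiff1 (fun q => ev q (mpolyX C (mnm1 a) - mpolyC N (p 0 a))) p (delta_mx a 0 - 0).
    by apply: (sdiff1_ext _ _ (sdiff1_sub (sdiff1_coord a p) (sdiff1_cst (p 0 a) p))) => [x|//]; rewrite evB evX evC.
  by rewrite (sdiff1_unique (sdiff1_ev _ _) h) subr0.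
have vE (v : 'rV[C]_N) : (v *m (delta_mx a 0 : 'cV_N)) 0 0 = v 0 a.
  rewrite mxE (bigD1 a) //= big1 ?addr0; last by move=> k ka; rewrite !mxE (negPf ka) mulr0.
  by rewrite !mxE !eqxx mulr1.
exists a, (fun i => if i is i'.+1 then w i' - (w i' 0 a / u 0 a) *: u else (u 0 a)^-1 *: u).
move=> [|i] [|j] hi hj /=.
- by rewrite gE vE mxE mulVf.
- by rewrite -scalemxAl mxE uj // mulr0.
- by rewrite gE vE 3!mxE divfK // subrr.
- rewrite mulmxBl -scalemxAl.
  have -> (A B : 'M[C]_1) : (A - B) 0 0 = A 0 0 - B 0 0 by rewrite !mxE.
  by rewrite [X in _ - X]mxE uj // mulr0 subr0 hw.
Qed.

Definition locus h gs : set 'rV[C]_N := [set p | ev p h != 0 /\ forall g, g \in gs -> ev p g = 0].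

Lemma locus_closed h gs : exists2 F, zariski_closed F & locus h gs = [set p | ev p h != 0] `&` F.
Proof. by exists [set p | forall g, [set g | g \in gs] g -> ev p g = 0]; [exists [set g | g \in gs]|]. Qed.

(** Along the dual vectors the equations have identity derivative, so the inverse function theorem
    reaches a small non-zero value of [g] while all equations in [gs] keep the value 0. *)
Lemma submersion h g gs p (rho : R) : locus h gs p -> full_rank (g :: gs) p -> 0 < rho ->
  exists q, [/\ locus h gs q, nrm (q - p) < rho & ev q g != 0].
Proof.
move=> Vp fr rho0; have [gp|gp] := eqVneq (ev p g) 0; last first.
  by exists p; split; rewrite ?subrr ?nrm0.
have [w hw] := fr; set s := size (g :: gs) in hw.
pose E : 'M[C]_(s, N) := \matrix_(i < s) w i.
pose F (u : 'rV[C]_s) : 'rV[C]_s := \row_j ev (p + u *m E) (nth 0 (g :: gs) j).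
have [K K0 hK] := mulmx_bounded E.
have dF : sdiff F 0 1%:M.
  apply: sdiffP => j eps eps0; set f := nth 0 (g :: gs) j.
  have eK : 0 < eps / K by rewrite divr_gt0.
  have [r r0 hr] := sdiff1_ev f p eK.
  exists (r / K) => [|x y]; first by rewrite divr_gt0.
  rewrite !subr0 => hx hy.
  have near z : nrm z < r / K -> nrm (p + z *m E - p) < r.
    rewrite addrC addKr ltr_pdivlMr // mulrC => h'.
    exact: le_lt_trans (hK _) h'.
  have := hr _ _ (near x hx) (near y hy).
  have -> : p + x *m E - (p + y *m E) = (x - y) *m E by rewrite mulmxBl opprD addrACA subrr add0r.
  have -> : ((x - y) *m E *m grad f p) 0 0 = ((x - y) *m col j 1%:M) 0 0.
    rewrite -mulmxA; congr ((_ *m _) 0 0); apply/colP => i; rewrite !mxE.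
    have := hw i j (ltn_ord i) (ltn_ord j); rewrite mxE => <-.
    by apply: eq_bigr => a _; rewrite !mxE.
  rewrite ![F _ _ _]mxE => /le_trans; apply.
  apply: le_trans (ler_wpM2l (ltW eK) (hK _)) _.
  by rewrite mulrA divfK ?lexx // gt_eqF.
have [r [c [r0 c0 _ sur]]] := inverse_function dF (mulmx1 1%:M) (mulmx1 1%:M).
have [rh rh0 hrh] := ev_near_neq0 Vp.1.
pose r' := Num.min r (Num.min (rho / K) (rh / K)).
have r'0 : 0 < r' by rewrite !lt_min r0 !divr_gt0.
have F0 : F 0 = 0.
  apply/rowP => j; rewrite !mxE mul0mx addr0; case: (nat_of_ord j) (ltn_ord j) => [//|k] hk.
  by have [_ V] := Vp; apply: V; apply: mem_nth.
pose v : 'rV[C]_s := (c * r' / 2)%:C *: delta_mx 0 ord0.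
have nv : nrm v = c * r' / 2.
  have n1 : nrm (delta_mx 0 ord0 : 'rV[C]_s) = 1.
    rewrite /nrm (bigD1 ord0) //= mxE !eqxx absc1 big1 ?addr0 // => k k0.
    by rewrite mxE (negPf k0) andbF absc0.
  by rewrite nrmZ n1 mulr1 absc_real ger0_norm // divr_ge0 // mulr_ge0 // ltW.
have [||u hu Fu] := sur 0 r' v r'0.
- by rewrite subr0 nrm0 add0r ge_min lexx.
- by rewrite F0 subr0 nv; have := mulr_gt0 c0 r'0; lra.
rewrite subr0 in hu.
have Eu j : (j < s)%N -> ev (p + u *m E) (nth 0 (g :: gs) j) = (c * r' / 2)%:C * (j == 0)%:R.
  by move=> hj; move/rowP/(_ (Ordinal hj)): Fu; rewrite !mxE.
have nq : nrm (p + u *m E - p) <= K * nrm u by rewrite addrC addKr hK.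
move: hu; rewrite !lt_min => /and3P[_ hu1 hu2].
exists (p + u *m E); split.
- split; first by apply: hrh; apply: le_lt_trans nq _; rewrite mulrC -ltr_pdivlMr.
  move=> g' gin; have := Eu (index g' gs).+1; rewrite ltnS index_mem => /(_ gin).
  by rewrite /= nth_index // mulr0.
- by apply: le_lt_trans nq _; rewrite mulrC -ltr_pdivlMr.
- rewrite (Eu 0%N isT) mulr1 (_ : 0 = 0%:C) // (inj_eq (@complexI _)) gt_eqF //.
  by rewrite divr_gt0 // mulr_gt0.
Qed.


Definition irredundant_decomposition X k (G : 'I_k -> set 'rV[C]_N) :=
  [/\ forall i, zariski_closed (G i), forall i, zariski_irreducible (X `&` G i),
      forall p, X p -> exists i, G i p &
      forall i, exists p, [/\ X p, G i p & forall j, j != i -> ~ G j p]].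

Lemma irreducible_sub_component X k (G : 'I_k -> set 'rV[C]_N) W :
  irredundant_decomposition X G -> zariski_irreducible W -> W `<=` X -> exists i, W `<=` G i.
Proof.
move=> [cG _ cov _] iW WX.
have [|i _ Wi] := irreducible_cover (s := enum 'I_k) iW cG; last by exists i.
by move=> p /WX/cov[i Gi]; exists i => //; rewrite mem_enum.
Qed.

(** Full rank is an open condition, so within the irreducible piece [p] can be moved to a point
    lying on no other piece. The points given by [submersion] close to it stay on piece [i]. *)
Lemma component_strict h g gs k (G : 'I_k -> set 'rV[C]_N) i p :
  irredundant_decomposition (locus h gs) G -> locus h gs p -> G i p -> full_rank (g :: gs) p ->
  exists q, [/\ locus h gs q, G i q & ev q g != 0].
Proof.
move=> [cG iG cov irr] Vp Gp fr; have [dl dlp hdl] := full_rank_open fr.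
have [p' [Vp' Gp' dlp' np']] : exists p', [/\ locus h gs p', G i p', ev p' dl != 0 & forall j, j != i -> ~ G j p'].
  apply: contrapT => bad.
  pose H (o : option 'I_k) := if o is Some j then G j else [set p | forall f, [set dl] f -> ev p f = 0].
  have cH o : zariski_closed (H o) by case: o => [j|]; [exact: cG|exact: zariski_closed_zeros].
  have [|o] := irreducible_cover (s := None :: [seq Some j | j <- enum 'I_k & j != i]) (iG i) cH.
    move=> x [Vx Gx]; apply: contrapT => no; apply: bad; exists x; split => //.
      by apply/negP => /eqP dx; apply: no; exists None; [exact: mem_head|move=> f ->].
    move=> j ji Gj; apply: no; exists (Some j) => //.
    by rewrite inE map_f // mem_filter ji mem_enum.
  rewrite inE => /predU1P[->|/mapP[j]]; first by move=> /(_ p (conj Vp Gp) dl erefl)/eqP; rewrite (negPf dlp).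
  rewrite mem_filter => /andP[ji _] -> sub; have [x [Vx Gx nx]] := irr i.
  exact: nx ji (sub x (conj Vx Gx)).
have hf j : exists f, j != i -> (forall q, G j q -> ev q f = 0) /\ ev p' f != 0.
  have [_|ji] := eqVneq j i; first by exists 0.
  by have [f f0 fp] := zariski_closed_poly (cG j) (np' j ji); exists f.
have [f {}hf] := choice hf.
have fp' : ev p' (\prod_(j | j != i) f j) != 0.
  by rewrite ev_prod; apply/prodf_neq0 => j /hf[].
have [rho rho0 hrho] := ev_near_neq0 fp'.
have [q [Vq qp gq]] := submersion Vp' (hdl _ dlp') rho0.
exists q; split => //; have [j Gj] := cov q Vq; have [<- //|ji] := eqVneq j i.
have := hrho q qp; rewrite ev_prod (bigD1 j) //= (proj1 (hf j ji) q Gj) mul0r eqxx //.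
Qed.

(** Dropping the equation [g] enlarges [W] to a component of the larger locus on which [g] is not
    identically 0. The chain gains one step for each equation dropped, and [poly_chain_le] bounds
    its final length by [N]. *)
Lemma poly_chain_locus h gs r W p :
  poly_chain r W -> W `<=` locus h gs -> W p -> full_rank gs p -> (r + size gs <= N)%N.
Proof.
elim: gs r W => [|g gs IH] r W ch WV Wp fr; first by rewrite addn0; exact: poly_chain_le ch.
have WV' : W `<=` locus h gs.
  by move=> q /WV[hq gq]; split => // g' g'in; apply: gq; rewrite inE g'in orbT.
have [k [G dec]] := irreducible_decomposition (locus h gs).
have [i Wi] := irreducible_sub_component dec (poly_chain_irreducible ch) WV'.
have [q [Vq Gq gq]] := component_strict dec (WV' _ Wp) (Wi _ Wp) fr.
have [_ iG _ _] := dec.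
rewrite addnS -addSn; apply: (IH r.+1 (locus h gs `&` G i)) => //.
- split=> //; exists W, g; split => //; first by move=> x Wx; split; [exact: WV'|exact: Wi].
    by move=> x /WV[_]; apply; exact: mem_head.
  by exists q.
- by split; [exact: WV'|exact: Wi].
- exact: full_rank_cons fr.
Qed.

(** Cut by coordinate hyperplanes through [p], one at a time, keeping full rank. Removing them
    again, each step passes to a component that is strictly larger because the hyperplane does not
    contain it. *)
Lemma locus_chain h d gs p : locus h gs p -> full_rank gs p -> (size gs + d)%N = N ->
  exists Z : nat -> set 'rV[C]_N,
    [/\ forall j, (j <= d)%N -> zariski_irreducible (Z j) /\
          exists2 F, zariski_closed F & Z j = [set q | ev q h != 0] `&` F,
        forall j, (j < d)%N -> Z j `<` Z j.+1,
        Z d p & Z d `<=` locus h gs].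
Proof.
elim: d gs => [|d IH] gs Vp fr hN; have [k [G dec]] := irreducible_decomposition (locus h gs);
  have [cG iG cov _] := dec.
  have [i Gi] := cov p Vp; exists (fun=> locus h gs `&` G i); split => //.
  move=> _ _; split => //; have [F cF ->] := locus_closed h gs.
  by exists (F `&` G i); [exact: zariski_closedI|rewrite setIA].
have lt : (size gs < N)%N by rewrite -[X in (_ < X)%N]hN addnS ltnS leq_addr.
have [a fr'] := full_rank_extend fr lt; set l := _ - _ in fr'.
have Vp' : locus h (l :: gs) p.
  split; first by case: Vp.
  move=> g; rewrite inE => /predU1P[->|]; last by case: Vp => _; apply.
  by rewrite evB evX evC subrr.
have [|Z [Zc Zs Zp ZV]] := IH _ Vp' fr'; first by rewrite /= addSnnS.
have ZV' : Z d `<=` locus h gs.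
  by move=> q /ZV[hq gq]; split => // g' g'in; apply: gq; rewrite inE g'in orbT.
have [i Zi] := irreducible_sub_component dec (Zc d (leqnn d)).1 ZV'.
have [q [Vq Gq lq]] := component_strict dec Vp (Zi _ Zp) fr'.
exists (fun j => if (j <= d)%N then Z j else locus h gs `&` G i); split.
- move=> j; rewrite leq_eqVlt => /predU1P[->|]; last by rewrite ltnS => jd; rewrite jd; exact: Zc.
  rewrite ltnn; split => //; have [F cF ->] := locus_closed h gs.
  by exists (F `&` G i); [exact: zariski_closedI|rewrite setIA].
- move=> j; rewrite ltnS {1}leq_eqVlt => /predU1P[->|jd]; last by rewrite jd (ltnW jd); exact: Zs.
  rewrite leqnn ltnn; split; first by move=> x Zx; split; [exact: ZV'|exact: Zi].
  by move=> /(_ q (conj Vq Gq)) /ZV[_ /(_ l (mem_head _ _))/eqP]; rewrite (negPf lq).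
- by rewrite ltnn; split => //; exact: Zi.
- by rewrite ltnn; exact: subIsetl.
Qed.

(* The second hypothesis on [p] says that [Y] is locally all of the locus. *)
Lemma has_dim_locus h gs d Y p : (size gs + d)%N = N -> Y `<=` locus h gs ->
  (forall q, Y q -> full_rank gs q) -> Y p ->
  (forall W, zariski_irreducible W -> W p -> W `<=` locus h gs -> W `<=` Y) -> has_dim Y d.
Proof.
move=> hN YV fr Yp hW; split.
  have [Z [Zc Zs Zp ZV]] := locus_chain (YV _ Yp) (fr _ Yp) hN.
  have ZY : Z d `<=` Y by apply: hW => //; have [] := Zc d (leqnn d).
  have Zd j : (j <= d)%N -> Z j `<=` Z d.
    move=> jd; have -> : d = (j + (d - j))%N by rewrite subnKC.
    have : (j + (d - j) <= d)%N by rewrite subnKC.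
    elim: (d - j)%N => [|i IH]; first by rewrite addn0 => _ x.
    by rewrite addnS => lt; apply: subset_trans (IH (ltnW lt)) (Zs _ lt).1.
  exists Z; split => // j jd; have [iZ [F cF ZF]] := Zc j jd; split => //; exists F => //.
  apply/seteqP; split => q; first by move=> Zq; split; [apply: ZY; exact: Zd Zq|move: Zq; rewrite ZF => -[]].
  by move=> [/YV[hq _] Fq]; rewrite ZF.
move=> /zariski_chain_poly[W ch WY].
have [q Wq] := (poly_chain_irreducible ch).1.
have := poly_chain_locus ch (subset_trans WY YV) Wq (fr _ (WY _ Wq)).
by rewrite addSn addnC hN ltnn.
Qed.

(** Irredundancy provides a point of the component on no other one; near it, in the sense of
    irreducible subsets, the component is the whole locus. *)
Lemma has_dim_component h gs d Z : (size gs + d)%N = N ->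
  (forall q, locus h gs q -> full_rank gs q) -> zariski_component (locus h gs) Z -> has_dim Z d.
Proof.
move=> hN fr [ZV iZ mZ].
have [k [G dec]] := irreducible_decomposition (locus h gs); have [_ iG _ irr] := dec.
have [i Zi] := irreducible_sub_component dec iZ ZV.
have E : locus h gs `&` G i = Z.
  by apply: mZ => // q Zq; split; [exact: ZV|exact: Zi].
have [p [Vp Gp np]] := irr i.
apply: (has_dim_locus (h := h) (gs := gs) (p := p)) => //.
- by move=> q /ZV; exact: fr.
- by rewrite -E.
- move=> W iW Wp WV; have [j Wj] := irreducible_sub_component dec iW WV.
  have ji : j = i by have [//|ji] := eqVneq j i; case: (np j ji); exact: Wj.
  by move=> q Wq; rewrite -E; split; [exact: WV|rewrite -ji; exact: Wj].
Qed.

Lemma locus_has_dim h gs d : (size gs + d)%N = N ->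
  (forall q, locus h gs q -> full_rank gs q) -> locus h gs !=set0 -> has_dim (locus h gs) d.
Proof. by move=> hN fr [p Vp]; apply: (has_dim_locus (h := h) (gs := gs) (p := p)). Qed.

End Dimension.

(** * Cauchy's theorem and the identity theorem *)

Section RectangleIntegral.
Context (R : realType).
Local Notation C := R[i].
Local Notation rcts := (ctsA (fun _ : R => True)).
Implicit Types (f : R -> C) (F : C -> C) (a b c d t : R) (p z : C).

Definition ccts F : Prop := forall z (e : R), 0 < e ->
  exists2 r : R, 0 < r & forall w, absc (w - z) < r -> absc (F w - F z) < e.

Lemma rcts_continuous f : rcts f ->
  continuous (fun t => complex.Re (f t)) /\ continuous (fun t => complex.Im (f t)).
Proof.
move=> cf; split => t; apply/cvgrPdist_lt => e e0; have [r r0 hr] := cf t Logic.I e e0;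
  apply/nbhs_ballP; exists r => // s hs /=; rewrite distrC.
  by rewrite -ReB; apply: le_lt_trans (absc_Re _) _; apply: hr => //; rewrite distrC.
by rewrite -ImB; apply: le_lt_trans (absc_Im _) _; apply: hr => //; rewrite distrC.
Qed.

(* Bounded intervals suffice below, and on them primitives come for free from
   the fundamental theorem of calculus. *)
Definition prim f : R -> C :=
  xget (fun=> 0) [set Phi | forall t, `|t| < 3 -> cderiv Phi (f t) t].

Lemma prim_deriv f t : rcts f -> `|t| < 3 -> cderiv (prim f) (f t) t.
Proof.
move=> cf; move: t; rewrite /prim; case: xgetP => [Phi _ //|no].
have [cr ci] := rcts_continuous cf.
have [u hu] := primitive_exists cr (ltr0n _ 3); have [v hv] := primitive_exists ci (ltr0n _ 3).
by case: (no (fun t => u t +i* v t)) => t ht; split; [exact: hu|exact: hv].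
Qed.

(** The mean value theorem is applied to real and imaginary parts separately, whence the factor
    2. *)
Lemma cderiv_bound (Phi v : R -> C) a b (M : R) : a <= b ->
  (forall t, a <= t <= b -> cderiv Phi (v t) t) ->
  (forall t, a <= t <= b -> absc (v t) <= M) -> absc (Phi b - Phi a) <= 2 * M * (b - a).
Proof.
move=> ab dP hv.
have main (g dg : R -> R) : (forall t, a <= t <= b -> is_derive t 1 g (dg t)) ->
    (forall t, a <= t <= b -> `|dg t| <= M) -> `|g b - g a| <= M * (b - a).
  move=> hg hM; have h1 (t : R) : t \in `]a, b[ -> is_derive t 1 g (dg t).
    by rewrite in_itv /= => /andP[h1 h2]; apply: hg; rewrite (ltW h1) (ltW h2).
  have h2 : {within `[a, b], continuous g}.
    by apply: derivable_within_continuous => t; rewrite in_itv /= => ht; have [] := hg t ht.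
  have [t tab ->] := MVT_segment ab h1 h2.
  rewrite normrM (ger0_norm (x := b - a)) ?subr_ge0 // ler_wpM2r ?subr_ge0 // hM //.
apply: le_trans (absc_le _) _; rewrite ReB ImB.
rewrite (_ : 2 * M * (b - a) = M * (b - a) + M * (b - a)); last by ring.
apply: lerD.
  apply: (main (fun t => complex.Re (Phi t)) (fun t => complex.Re (v t))) => t.
    by case/dP.
  by move/hv; apply: le_trans (absc_Re _).
apply: (main (fun t => complex.Im (Phi t)) (fun t => complex.Im (v t))) => t.
  by case/dP.
by move/hv; apply: le_trans (absc_Im _).
Qed.

Definition seg f a b : C := prim f b - prim f a.

Lemma seg_close f (Phi v : R -> C) a b (M : R) : rcts f -> - 3 < a -> a <= b -> b < 3 ->
  (forall t, a <= t <= b -> cderiv Phi (v t) t) ->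
  (forall t, a <= t <= b -> absc (f t - v t) <= M) ->
  absc (seg f a b - (Phi b - Phi a)) <= 2 * M * (b - a).
Proof.
move=> cf a3 ab b3 dP hM.
have -> : seg f a b - (Phi b - Phi a) = (prim f b + - Phi b) - (prim f a + - Phi a).
  by rewrite /seg; ring.
apply: (@cderiv_bound (fun t => prim f t + - Phi t) (fun t => f t + - v t)) => // t ht.
apply: cderivD; last by apply: cderivN; exact: dP.
by apply: prim_deriv => //; rewrite ltr_norml; lra.
Qed.

(** The integral of [F] over the boundary of a rectangle, counterclockwise. As each side is a
    difference of a primitive, additivity under subdivision is an algebraic identity. *)
Definition rectint F a b c d : C :=
  seg (fun x => F (x +i* c)) a b + (0 +i* 1) * seg (fun y => F (b +i* y)) c d
  - seg (fun x => F (x +i* d)) a b - (0 +i* 1) * seg (fun y => F (a +i* y)) c d.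

Definition in_rect a b c d z : Prop :=
  a <= complex.Re z <= b /\ c <= complex.Im z <= d.

Lemma rectint_vert F u a b c d :
  rectint F a b c d = rectint F a u c d + rectint F u b c d.
Proof. rewrite /rectint /seg; ring. Qed.

Lemma rectint_horiz F u a b c d :
  rectint F a b c d = rectint F a b c u + rectint F a b u d.
Proof. rewrite /rectint /seg; ring. Qed.

Lemma ccts_horiz F c : ccts F -> rcts (fun x => F (x +i* c)).
Proof.
move=> cF t _ e e0; have [r r0 hr] := cF (t +i* c) e e0; exists r => // s _ hs.
apply: hr; have -> : (s +i* c) - (t +i* c) = (s - t)%:C :> C.
  by apply/eqP; rewrite eq_complex ReB ImB /= subrr !eqxx.
by rewrite absc_real.
Qed.

Lemma ccts_vert F c : ccts F -> rcts (fun y => F (c +i* y)).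
Proof.
move=> cF t _ e e0; have [r r0 hr] := cF (c +i* t) e e0; exists r => // s _ hs.
apply: hr; have -> : (c +i* s) - (c +i* t) = 0 +i* (s - t) :> C.
  by apply/eqP; rewrite eq_complex ReB ImB /= subrr !eqxx.
by rewrite absc_i.
Qed.

Lemma cderiv_horiz c t : cderiv (fun x => x +i* c) 1 t.
Proof. by split => /=; [exact: is_derive_id|exact: is_derive_cst]. Qed.

Lemma cderiv_vert c t : cderiv (fun y => c +i* y) (0 +i* 1) t.
Proof. by split => /=; [exact: is_derive_cst|exact: is_derive_id]. Qed.

(** An affine function has a quadratic primitive, so its boundary integral is 0. An error of size
    [M] costs [2 M] times the length of each of the four sides. *)
Lemma rectint_close F (al D p : C) a b c d (M : R) : ccts F ->
  - 3 < a -> a <= b -> b < 3 -> - 3 < c -> c <= d -> d < 3 ->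
  (forall z, in_rect a b c d z -> absc (F z - (al + D * (z - p))) <= M) ->
  absc (rectint F a b c d) <= 4 * M * ((b - a) + (d - c)).
Proof.
move=> cF a3 ab b3 c3 cd d3 hM.
pose G z := al * z + D * (2^-1 * (z * z) + - p * z).
have dG (g : R -> C) v t : cderiv g v t ->
    cderiv (fun s => G (g s)) ((al + D * (g t - p)) * v) t.
  move=> dg; apply: cderiv_eq.
    apply: cderivD; first exact: (cderivM (cderiv_cst _ _) dg).
    apply: cderivM (cderiv_cst _ _) _; apply: cderivD.
      by apply: cderivM (cderiv_cst _ _) _; exact: (cderivM dg dg).
    exact: (cderivM (cderiv_cst _ _) dg).
  by cbv beta; field.
have ii : (0 +i* 1 : C) * (0 +i* 1) = -1.
  by apply/eqP; rewrite eq_complex /=; apply/andP; split; apply/eqP; ring.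
have h1 y : c <= y <= d -> absc (seg (fun x => F (x +i* y)) a b - (G (b +i* y) - G (a +i* y))) <= 2 * M * (b - a).
  move=> hy; apply: (seg_close (Phi := fun t => G (t +i* y)) (v := fun t => al + D * (t +i* y - p))) => //; first exact: ccts_horiz.
    by move=> t _; apply: cderiv_eq (dG _ _ _ (cderiv_horiz y t)) _; rewrite mulr1.
  by move=> t ht; apply: hM.
pose G' z := - (0 +i* 1) * G z.
have h2 x : a <= x <= b -> absc (seg (fun y => F (x +i* y)) c d - (G' (x +i* d) - G' (x +i* c))) <= 2 * M * (d - c).
  move=> hx; apply: (seg_close (Phi := fun t => G' (x +i* t)) (v := fun t => al + D * (x +i* t - p))) => //; first exact: ccts_vert.
    move=> t _; apply: cderiv_eq (cderivM (cderiv_cst _ _) (dG _ _ _ (cderiv_vert x t))) _.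
    by rewrite mul0r add0r mulrCA mulNr ii opprK mulr1.
  by move=> t ht; apply: hM.
have acd : c <= c <= d by rewrite lexx.
have add' : c <= d <= d by rewrite lexx cd.
have aab : a <= a <= b by rewrite lexx.
have abb : a <= b <= b by rewrite lexx ab.
have := h1 c acd; have := h1 d add'; have := h2 a aab; have := h2 b abb.
set e1 := seg _ _ _ - _; set e2 := seg _ _ _ - _; set e3 := seg _ _ _ - _; set e4 := seg _ _ _ - _.
move=> H1 H2 H3 H4.
have -> : rectint F a b c d = e4 + (0 +i* 1) * e1 - e3 - (0 +i* 1) * e2.
  rewrite /rectint /e1 /e2 /e3 /e4 /G'.
  have E (x y s : C) : (0 +i* 1) * (s - (- (0 +i* 1) * x - - (0 +i* 1) * y)) = (0 +i* 1) * s - (x - y).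
    clear -ii; move: (0 +i* 1 : C) ii => j jj.
    transitivity (j * s + (j * j) * x - (j * j) * y); first by ring.
    by rewrite jj; ring.
  rewrite !E; move: (0 +i* 1 : C) => j; ring.
have ai z : absc ((0 +i* 1) * z) = absc z by rewrite abscM absc_i normr1 mul1r.
apply: le_trans (ler_abscB _ _) _; rewrite ai.
apply: le_trans (lerD (ler_abscB _ _) (lexx _)) _.
apply: le_trans (lerD (lerD (ler_abscD _ _) (lexx _)) (lexx _)) _; rewrite ai.
lra.
Qed.

(** Differentiability relative to the closed rectangle, one-sided on the boundary: the functions
    used below are extended from a square by a retraction, which destroys differentiability across
    its sides. *)
Definition rdiff a b c d F p : Prop := exists D, forall e : R, 0 < e ->
  exists2 r : R, 0 < r & forall z, in_rect a b c d z -> absc (z - p) < r ->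
    absc (F z - F p - D * (z - p)) <= e * absc (z - p).

Lemma half_pow (K : R) n : K / 2 ^+ n.+1 = K / 2 ^+ n / 2.
Proof. by rewrite exprS; field; rewrite expf_neq0 // pnatr_eq0. Qed.

Lemma small_pow (K e : R) : 0 < e -> exists n, K / 2 ^+ n < e.
Proof.
move=> e0; have h : 0 <= `|K| / e by rewrite divr_ge0 // ltW.
exists (Num.bound (`|K| / e)); rewrite ltr_pdivrMr ?exprn_gt0 // mulrC -ltr_pdivrMr //.
apply: le_lt_trans (ler_wpM2r _ (ler_norm K)) _; first by rewrite invr_ge0 ltW.
by apply: lt_trans (archi_boundP h) _; rewrite -natrX ltr_nat ltn_expl.
Qed.

Lemma bisection_limit (x : nat -> R) (K lo hi : R) : 0 <= K ->
  (forall n, `|x n.+1 - x n| <= K / 2 ^+ n) -> (forall n, lo <= x n <= hi) ->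
  exists2 l, lo <= l <= hi & forall n, `|x n - l| <= 2 * K / 2 ^+ n.
Proof.
move=> K0 hx hb; have [l hl] := geometric_cauchy K0 hx; exists l => //.
apply/andP; split; rewrite leNgt; apply/negP => lt; have := lt; rewrite -subr_gt0 => /(small_pow (2 * K))[n hn];
  have := le_lt_trans (hl n) hn; have /andP[] := hb n; rewrite ltr_norml; lra.
Qed.

(* The quantity [e (width^2 + height^2)] is additive under quadrisection, so a
   rectangle violating the bound contains one a quarter of its size. *)
Lemma goursat F a b c d : ccts F -> - 3 < a -> a <= b -> b < 3 -> - 3 < c -> c <= d -> d < 3 ->
  (forall p, in_rect a b c d p -> rdiff a b c d F p) -> rectint F a b c d = 0.
Proof.
move=> cF a3 ab b3 c3 cd d3 hd; apply/eqP; rewrite -absc_eq0 eq_le absc_ge0 andbT.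
set X := b - a; set Y := d - c; have X0 : 0 <= X by rewrite subr_ge0. have Y0 : 0 <= Y by rewrite subr_ge0.
have Q0 : 0 <= X ^+ 2 + Y ^+ 2 by rewrite addr_ge0 ?sqr_ge0.
suff main (e : R) : 0 < e -> absc (rectint F a b c d) <= e * (X ^+ 2 + Y ^+ 2).
  apply: contrapT => /negP; rewrite -ltNge => I0.
  have := main (absc (rectint F a b c d) / (2 * (X ^+ 2 + Y ^+ 2 + 1))).
  have d0 : 0 < 2 * (X ^+ 2 + Y ^+ 2 + 1) by lra.
  rewrite divr_gt0 // => /(_ isT); rewrite mulrAC ler_pdivlMr //.
  set I := absc _ in I0 *; nra.
move=> e0; rewrite leNgt; apply/negP => bad.
pose W (n : nat) := X / 2 ^+ n; pose H (n : nat) := Y / 2 ^+ n.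
pose Bad n (u : R * R) := e * (W n ^+ 2 + H n ^+ 2) < absc (rectint F u.1 (u.1 + W n) u.2 (u.2 + H n)).
have step (nu : nat * (R * R)) : exists v : R * R, Bad nu.1 nu.2 ->
    [/\ Bad nu.1.+1 v, nu.2.1 <= v.1, v.1 + W nu.1.+1 <= nu.2.1 + W nu.1,
        nu.2.2 <= v.2 & v.2 + H nu.1.+1 <= nu.2.2 + H nu.1].
  case: nu => n [x y] /=; apply: contrapT => no.
  have Wn : W n = W n.+1 + W n.+1 by rewrite /W half_pow; field.
  have Hn : H n = H n.+1 + H n.+1 by rewrite /H half_pow; field.
  have W0 : 0 <= W n.+1 by rewrite divr_ge0 // exprn_ge0.
  have H0 : 0 <= H n.+1 by rewrite divr_ge0 // exprn_ge0.
  have [bd|nb] := pselect (Bad n (x, y)); last by apply: no; exists (0, 0).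
  have good v : x <= v.1 -> v.1 <= x + W n.+1 -> y <= v.2 -> v.2 <= y + H n.+1 ->
      absc (rectint F v.1 (v.1 + W n.+1) v.2 (v.2 + H n.+1)) <= e * (W n.+1 ^+ 2 + H n.+1 ^+ 2).
    move=> h1 h2 h3 h4; rewrite leNgt; apply/negP => bv; apply: no; exists v => _; split => //.
      by rewrite Wn; lra.
    by rewrite Hn; lra.
  move: bd; rewrite /Bad /= Wn Hn (rectint_vert _ (x + W n.+1)) (rectint_horiz _ (y + H n.+1) x).
  rewrite (rectint_horiz _ (y + H n.+1) (x + W n.+1)) !(addrA x) !(addrA y).
  have := good (x, y); have := good (x + W n.+1, y).
  have := good (x, y + H n.+1); have := good (x + W n.+1, y + H n.+1) => /=.
  rewrite !lexx !lerDl W0 H0 => /(_ isT isT isT isT) g1 /(_ isT isT isT isT) g2 /(_ isT isT isT isT) g3 /(_ isT isT isT isT) g4.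
  apply/negP; rewrite -leNgt.
  apply: le_trans (ler_abscD _ _) _; apply: le_trans (lerD (ler_abscD _ _) (ler_abscD _ _)) _.
  apply: le_trans (lerD (lerD g4 g2) (lerD g3 g1)) _; nra.
have [st hst] := choice step.
pose fix u n : R * R := if n is n'.+1 then st (n', u n') else (a, c).
have bu n : Bad n (u n).
  elim: n => [|n IH]; last by have [] := hst (n, u n) IH.
  by rewrite /Bad /W /H /= expr0 !divr1 /X /Y !subrKC; exact: bad.
have inc n : [/\ (u n).1 <= (u n.+1).1, (u n.+1).1 + W n.+1 <= (u n).1 + W n,
    (u n).2 <= (u n.+1).2 & (u n.+1).2 + H n.+1 <= (u n).2 + H n].
  by have [] := hst (n, u n) (bu n).
have W0 n : 0 <= W n by rewrite divr_ge0 // exprn_ge0.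
have H0 n : 0 <= H n by rewrite divr_ge0 // exprn_ge0.
have bnd n : [/\ a <= (u n).1, (u n).1 + W n <= b, c <= (u n).2 & (u n).2 + H n <= d].
  elim: n => [|n [h1 h2 h3 h4]]; first by rewrite /W /H /= expr0 !divr1 /X /Y !subrKC.
  have [i1 i2 i3 i4] := inc n; split.
  - exact: le_trans i1.
  - exact: le_trans h2.
  - exact: le_trans i3.
  - exact: le_trans h4.
have [|n|px hpx lx] := @bisection_limit (fun n => (u n).1) X a b X0.
- move=> n; have [i1 i2 _ _] := inc n; have := W0 n.+1.
  by rewrite ger0_norm ?subr_ge0 //; rewrite /W in i2 *; lra.
- by have [h1 h2 _ _] := bnd n; have W0n := W0 n; apply/andP; split; lra.
have [|n|py hpy ly] := @bisection_limit (fun n => (u n).2) Y c d Y0.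
- move=> n; have [_ _ i1 i2] := inc n; have := H0 n.+1.
  by rewrite ger0_norm ?subr_ge0 //; rewrite /H in i2 *; lra.
- by have [_ _ h1 h2] := bnd n; have H0n := H0 n; apply/andP; split; lra.
have [D hD] := hd (px +i* py) (conj hpx hpy).
(* With distances at most [3 (w + h)] the bound of [rectint_close] becomes [e (w + h)^2 / 2], which
   is at most [e (w^2 + h^2)]. *)
have e24 : 0 < e / 24 by rewrite divr_gt0.
have [r r0 hr] := hD _ e24.
have [n hn] := small_pow (3 * (X + Y)) r0.
have WHn : 3 * (W n + H n) < r by rewrite /W /H -mulrDl mulrA.
have [b1 b2 b3' b4] := bnd n.
have near z : in_rect (u n).1 ((u n).1 + W n) (u n).2 ((u n).2 + H n) z -> absc (z - (px +i* py)) <= 3 * (W n + H n).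
  case: z => x y [/= /andP[x1 x2] /andP[y1 y2]].
  apply: le_trans (absc_le _) _; rewrite ReB ImB /=.
  have := lx n; have := ly n; rewrite -!mulrA -/(W n) -/(H n) => l1 l2.
  have : `|x - px| <= 3 * W n.
    by move: l2; rewrite !ler_norml => /andP[]; lra.
  have : `|y - py| <= 3 * H n.
    by move: l1; rewrite !ler_norml => /andP[]; lra.
  lra.
have cl z : in_rect (u n).1 ((u n).1 + W n) (u n).2 ((u n).2 + H n) z ->
    absc (F z - (F (px +i* py) + D * (z - (px +i* py)))) <= e / 24 * (3 * (W n + H n)).
  move=> hz; rewrite opprD addrA; apply: le_trans (hr z _ _) _.
  - clear -hz b1 b2 b3' b4; move: hz => [/andP[x1 x2] /andP[y1 y2]].
    by split; apply/andP; split; lra.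
  - exact: le_lt_trans (near z hz) WHn.
  - by rewrite ler_wpM2l ?(ltW e24) // near.
have := bu n; rewrite /Bad; apply/negP; rewrite -leNgt.
have w0 := W0 n; have h0 := H0 n.
apply: le_trans (rectint_close cF _ _ _ _ _ _ cl) _;
  try by clear -a3 b3 c3 d3 b1 b2 b3' b4 w0 h0; lra.
rewrite ![_ + W n - _]addrC ![_ + H n - _]addrC !addKr.
set w := W n in w0 *; set h := H n in h0 *.
have -> : 4 * (e / 24 * (3 * (w + h))) * (w + h) = e * ((w + h) ^+ 2 / 2) by field.
rewrite ler_wpM2l ?(ltW e0) //; have := sqr_ge0 (w - h); clear; rewrite !expr2; lra.
Qed.

Lemma rdiff_sub a b c d a' b' c' d' F p : a <= a' -> b' <= b -> c <= c' -> d' <= d ->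
  rdiff a b c d F p -> rdiff a' b' c' d' F p.
Proof.
move=> ha hb hc hd [D hD]; exists D => e /hD[r r0 hr]; exists r => // z [/andP[h1 h2] /andP[h3 h4]].
by apply: hr; split; apply/andP; split; lra.
Qed.

(** Cut out a small square around the exceptional point. The four surrounding rectangles contribute
    0 by [goursat], and the integral over the small square tends to 0 because [F] is bounded near
    [w]. *)
Lemma goursat_except F (s : R) w : ccts F -> 0 < s < 3 -> `|complex.Re w| < s -> `|complex.Im w| < s ->
  (forall p, in_rect (- s) s (- s) s p -> p != w -> rdiff (- s) s (- s) s F p) ->
  rectint F (- s) s (- s) s = 0.
Proof.
move=> cF /andP[s0 s3]; case: w => x y /=; rewrite !ltr_norml => /andP[x1 x2] /andP[y1 y2] hd.
apply/eqP; rewrite -absc_eq0 eq_le absc_ge0 andbT.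
have [r r0 hr] := cF (x +i* y) 1 ltr01.
set M := absc (F (x +i* y)) + 1.
have M0 : 0 < M by rewrite ltr_pwDr // absc_ge0.
rewrite leNgt; apply/negP; set I := absc _ => I0.
(* A boundary integral [I] over the square of half-side [dl] is at most [16 M dl], whereas
   [dl <= I / (64 M)]; the remaining terms keep the small square inside the large one and inside the
   disc where [|F| <= M]. *)
pose dl := Num.min (Num.min (r / 4) (I / (32 * M))) (Num.min (Num.min (s - x) (s + x)) (Num.min (s - y) (s + y))) / 2.
have dl0 : 0 < dl by rewrite divr_gt0 // !lt_min !divr_gt0 ?mulr_gt0 //=; lra.
have : 2 * dl <= Num.min (Num.min (r / 4) (I / (32 * M))) (Num.min (Num.min (s - x) (s + x)) (Num.min (s - y) (s + y))).
  by rewrite /dl mulrC divfK // pnatr_eq0.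
rewrite !le_min => /andP[/andP[k1 k2] /andP[/andP[k3 k4] /andP[k5 k6]]].
clearbody dl.
have zero a b c d : [&& - s <= a, a <= b, b <= s, - s <= c, c <= d & d <= s] ->
    [|| b < x, x < a, d < y | y < c] -> rectint F a b c d = 0.
  move=> /andP[h1 /and5P[h2 h3 h4 h5 h6]] nin.
  apply: goursat => //; [by clear -h1 h2 h3 h4 h5 h6 s3; lra..|].
  move=> p hp; have pw : p != x +i* y.
    apply/eqP => E; move: hp; rewrite E => -[/= /andP[g1 g2] /andP[g3 g4]].
    by move: nin => /or4P[]; apply/negP; rewrite -leNgt.
  apply: (rdiff_sub h1 h3 h4 h6); apply: hd => //.
  move: hp => [/andP[g1 g2] /andP[g3 g4]]; clear -h1 h3 h4 h6 g1 g2 g3 g4.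
  by split; apply/andP; split; lra.
have IE : rectint F (- s) s (- s) s = rectint F (x - dl) (x + dl) (y - dl) (y + dl).
  clear -cF zero dl0 k3 k4 k5 k6.
  rewrite (rectint_vert _ (x - dl)) (rectint_vert _ (x + dl) (x - dl)).
  rewrite (rectint_horiz _ (y - dl) (x - dl) (x + dl)) (rectint_horiz _ (y + dl) (x - dl) (x + dl) (y - dl)).
  rewrite (@zero (- s) (x - dl) (- s) s); [|by apply/andP; split; [lra|apply/and5P; split; lra]|by apply/or4P; constructor 1; lra].
  rewrite (@zero (x + dl) s (- s) s); [|by apply/andP; split; [lra|apply/and5P; split; lra]|by apply/or4P; constructor 2; lra].
  rewrite (@zero (x - dl) (x + dl) (- s) (y - dl)); [|by apply/andP; split; [lra|apply/and5P; split; lra]|by apply/or4P; constructor 3; lra].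
  rewrite (@zero (x - dl) (x + dl) (y + dl) s); [|by apply/andP; split; [lra|apply/and5P; split; lra]|by apply/or4P; constructor 4; lra].
  by rewrite !add0r !addr0.
have := @rectint_close F 0 0 0 (x - dl) (x + dl) (y - dl) (y + dl) M cF.
rewrite -IE -/I => H; have {H} : I <= 4 * M * (x + dl - (x - dl) + (y + dl - (y - dl))).
  apply: H; try by clear -k3 k4 k5 k6 dl0 s3; lra.
  case=> u v [/= /andP[g1 g2] /andP[g3 g4]]; rewrite mul0r addr0 subr0.
  have : absc (F (u +i* v) - F (x +i* y)) < 1.
    apply: hr; apply: le_lt_trans (absc_le _) _; rewrite ReB ImB /=.
    have : `|u - x| <= dl by rewrite ler_norml; lra.
    have : `|v - y| <= dl by rewrite ler_norml; lra.
    lra.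
  move=> lt1; have -> : F (u +i* v) = (F (u +i* v) - F (x +i* y)) + F (x +i* y) by rewrite subrK.
  by apply: le_trans (ler_abscD _ _) _; rewrite /M addrC lerD2l ltW.
have : 2 * dl * (32 * M) <= I by rewrite -ler_pdivlMr // mulr_gt0.
nra.
Qed.

End RectangleIntegral.

(** * The identity theorem for complex differentiable functions *)

Section IdentityTheorem.
Context (R : realType).
Local Notation C := R[i].
Local Notation rcts := (ctsA (fun _ : R => True)).
Implicit Types (F G : C -> C) (p z w : C).

Definition ccts_at F p : Prop := forall e : R, 0 < e ->
  exists2 r : R, 0 < r & forall z, absc (z - p) < r -> absc (F z - F p) < e.

Definition near_at p (P : C -> Prop) : Prop := exists2 r : R, 0 < r & forall z, absc (z - p) < r -> P z.

Lemma near_atI p (P Q : C -> Prop) : near_at p P -> near_at p Q -> near_at p (fun z => P z /\ Q z).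
Proof.
move=> [r r0 hr] [s s0 hs]; exists (Num.min r s); first by rewrite lt_min r0.
by move=> z; rewrite lt_min => /andP[/hr ? /hs].
Qed.

Lemma near_atS p (P Q : C -> Prop) : (forall z, P z -> Q z) -> near_at p P -> near_at p Q.
Proof. by move=> h [r r0 hr]; exists r => // z /hr /h. Qed.

Lemma near_at_pt p P : near_at p P -> P p.
Proof. by move=> [r r0]; apply; rewrite subrr absc0. Qed.

Lemma ccts_at_cst (a : C) p : ccts_at (fun=> a) p.
Proof. by move=> e e0; exists 1 => // z _; rewrite subrr absc0. Qed.

Lemma ccts_at_near F G p : near_at p (fun z => F z = G z) -> ccts_at F p -> ccts_at G p.
Proof.
move=> h cF e e0; have Ep := near_at_pt h.
by apply: near_atS (near_atI h (cF e e0)) => z [<-]; rewrite Ep.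
Qed.

Lemma ccts_atD F G p : ccts_at F p -> ccts_at G p -> ccts_at (fun z => F z + G z) p.
Proof.
move=> cF cG e e0; have e2 : 0 < e / 2 by rewrite divr_gt0.
apply: near_atS (near_atI (cF _ e2) (cG _ e2)) => z [h1 h2].
have -> : F z + G z - (F p + G p) = (F z - F p) + (G z - G p) by ring.
by apply: le_lt_trans (ler_abscD _ _) _; lra.
Qed.

Lemma ccts_atM F G p : ccts_at F p -> ccts_at G p -> ccts_at (fun z => F z * G z) p.
Proof.
move=> cF cG e e0.
have e2 x : 0 < e / 2 / (absc x + 1) by rewrite !divr_gt0 // ltr_wpDl ?absc_ge0.
apply: near_atS (near_atI (cF _ (e2 (G p))) (near_atI (cG _ (e2 (F p))) (cF _ ltr01))) => z [q0 [q1 q2]].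
have -> : F z * G z - F p * G p = F z * (G z - G p) + G p * (F z - F p) by ring.
have p0 x : 0 < absc x + 1 :> R by rewrite ltr_wpDl ?absc_ge0.
move: q0 q1; rewrite !ltr_pdivlMr // => q0 q1.
have q3 : absc (F z) <= absc (F p) + 1.
  by have := ler_abscD (F z - F p) (F p); rewrite subrK; lra.
apply: le_lt_trans (ler_abscD _ _) _; rewrite !abscM.
have z1 := absc_ge0 (F z - F p); have z2 := absc_ge0 (G z - G p).
have := absc_ge0 (G p).
have : absc (F z) * absc (G z - G p) <= (absc (F p) + 1) * absc (G z - G p) by rewrite ler_wpM2r.
nra.
Qed.

Lemma ccts_at_neq0 F p : F p != 0 -> ccts_at F p -> near_at p (fun z => F z != 0).
Proof.
rewrite -absc_gt0 => Fp cF; apply: near_atS (cF _ Fp) => z h; rewrite -absc_gt0.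
by have := ler_abscD (F p - F z) (F z); rewrite subrK abscB; lra.
Qed.

Lemma ccts_atV F p : F p != 0 -> ccts_at F p -> ccts_at (fun z => (F z)^-1) p.
Proof.
move=> Fp cF; have [r r0 hr] := ccts_at_neq0 Fp cF.
move=> e e0; have B0 : 0 < absc (F p) by rewrite absc_gt0.
have e1 : 0 < Num.min (absc (F p) / 2) (e * absc (F p) ^+ 2 / 4).
  by rewrite lt_min !divr_gt0 // mulr_gt0 // exprn_gt0.
apply: near_atS (near_atI (ccts_at_neq0 Fp cF) (cF _ e1)) => z [Fz]; rewrite lt_min => /andP[h1 h2].
set B := absc (F p) in B0 h1 h2.
have fs : B / 2 < absc (F z).
  by have := ler_abscD (F p - F z) (F z); rewrite subrK abscB -/B; lra.
have -> : (F z)^-1 - (F p)^-1 = - (F z - F p) / (F z * F p) by field; rewrite Fz Fp.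
rewrite abscM abscN abscV abscM -/B ltr_pdivrMr ?mulr_gt0 //; last by lra.
apply: lt_le_trans h2 _; rewrite -mulrA ler_pM2l // expr2.
have -> : B * B / 4 = B / 2 * B / 2 by field.
have : B / 2 * B <= absc (F z) * B by rewrite ler_pM2r // ltW.
have : 0 < B / 2 * B by rewrite mulr_gt0 // divr_gt0.
lra.
Qed.

(* Caratheodory's form of complex differentiability. *)
Definition cdiff F p : Prop := exists2 phi : C -> C, ccts_at phi p &
  near_at p (fun z => F z = F p + phi z * (z - p)).

Lemma cdiff_near F G p : near_at p (fun z => F z = G z) -> cdiff F p -> cdiff G p.
Proof.
move=> h [phi cphi hF]; have Ep := near_at_pt h; exists phi => //; rewrite -Ep.
by apply: near_atS (near_atI h hF) => z [<-].
Qed.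

Lemma ccts_at_sub p : ccts_at (fun z => z - p) p.
Proof. by move=> e e0; exists e => // z hz; rewrite subrr subr0. Qed.

Lemma cdiff_ccts F p : cdiff F p -> ccts_at F p.
Proof.
move=> [phi cphi hF]; apply: (@ccts_at_near (fun z => F p + phi z * (z - p))).
  by apply: near_atS hF => z ->.
apply: ccts_atD; first exact: ccts_at_cst.
by apply: ccts_atM => //; exact: ccts_at_sub.
Qed.

Lemma cdiff_cst (a : C) p : cdiff (fun=> a) p.
Proof. by exists (fun=> 0); [exact: ccts_at_cst|exists 1 => // z _; rewrite mul0r addr0]. Qed.

Lemma cdiff_id p : cdiff id p.
Proof. by exists (fun=> 1); [exact: ccts_at_cst|exists 1 => // z _; rewrite mul1r subrKC]. Qed.

Lemma cdiffM F G p : cdiff F p -> cdiff G p -> cdiff (fun z => F z * G z) p.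
Proof.
move=> dF; have cF := cdiff_ccts dF; case: dF => phi cphi hF [psi cpsi hG].
exists (fun z => phi z * G p + F z * psi z).
  by apply: ccts_atD; apply: ccts_atM => //; exact: ccts_at_cst.
by apply: near_atS (near_atI hF hG) => z [Ez ->]; rewrite Ez; ring.
Qed.

Lemma cdiffB F G p : cdiff F p -> cdiff G p -> cdiff (fun z => F z - G z) p.
Proof.
move=> [phi cphi hF] [psi cpsi hG]; exists (fun z => phi z + -1 * psi z).
  by apply: ccts_atD => //; apply: ccts_atM => //; exact: ccts_at_cst.
by apply: near_atS (near_atI hF hG) => z [-> ->]; ring.
Qed.

Lemma cdiffV F p : F p != 0 -> cdiff F p -> cdiff (fun z => (F z)^-1) p.
Proof.
move=> Fp dF; have cF := cdiff_ccts dF; case: dF => phi cphi hF.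
exists (fun z => (-1 * phi z) * ((F z)^-1 * (F p)^-1)).
  apply: ccts_atM; first by apply: ccts_atM => //; exact: ccts_at_cst.
  by apply: ccts_atM; [exact: ccts_atV|exact: ccts_at_cst].
apply: near_atS (near_atI hF (ccts_at_neq0 Fp cF)) => z [E Fz].
have {E} E : phi z * (z - p) = F z - F p by rewrite [in RHS]E [F p + _]addrC addrK.
rewrite mulrAC -[-1 * _ * _]mulrA E; field.
by rewrite Fp Fz.
Qed.

Lemma cdiffX F p k : cdiff F p -> cdiff (fun z => F z ^+ k) p.
Proof.
move=> dF; elim: k => [|k IH]; first exact: cdiff_cst.
apply: (cdiff_near _ (cdiffM dF IH)); exists 1 => // z _.
by rewrite exprS.
Qed.

Lemma differentiable_cdiff F p : differentiable F p -> cdiff F p.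
Proof.
move/derivable1_diffP => /cvg_ex[/= D hD].
exists (fun z => if z == p then D else (F z - F p) / (z - p)); last first.
  exists 1 => // z _; case: eqVneq => [->|zp]; first by rewrite subrr mulr0 addr0.
  by rewrite divfK ?subrKC // subr_eq0.
move=> e e0; have e0' : 0 < e%:C by rewrite ltcR.
have /cvgrPdist_lt/(_ _ e0') := hD; move=> /nbhs_abscP[r r0 hr]; exists r => // z hz.
rewrite eqxx; case: eqVneq => [_|zp]; first by rewrite subrr absc0.
have := hr (z - p); rewrite subr0 subr_eq0 => /(_ hz zp).
rewrite absc_norm ltcR abscB; congr (absc (_ - _) < _).
by rewrite /= [_ *: 1]mulr1 subrK mulrC.
Qed.

Lemma cdiff_rdiff a b c d F G p : cdiff G p -> in_rect a b c d p ->
  (forall z, in_rect a b c d z -> F z = G z) -> rdiff a b c d F p.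
Proof.
move=> [phi cphi hG] pin FG; exists (phi p) => e /cphi h.
have [r r0 hr] := near_atI hG h; exists r => // z zin /hr[Gz hz].
have -> : F z - F p - phi p * (z - p) = (phi z - phi p) * (z - p).
  by rewrite !FG // Gz; ring.
by rewrite abscM ler_wpM2r ?absc_ge0 // ltW.
Qed.

Definition clamp2 (t : R) : R := 4 * clamp ((t + 2) / 4) - 2.

Lemma clamp2_in t : - 2 <= clamp2 t <= 2.
Proof. by have := clamp_in ((t + 2) / 4); rewrite /clamp2 => /andP[]; lra. Qed.

Lemma clamp2_id t : - 2 <= t <= 2 -> clamp2 t = t.
Proof. by move=> ht; rewrite /clamp2 clamp_id; [field|lra]. Qed.

Lemma clamp2_lip s t : `|clamp2 s - clamp2 t| <= `|s - t|.
Proof.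
rewrite /clamp2 (_ : _ - _ = 4 * (clamp ((s + 2) / 4) - clamp ((t + 2) / 4))); last by ring.
rewrite normrM ger0_norm //; have := clamp_lip ((s + 2) / 4) ((t + 2) / 4).
have -> : (s + 2) / 4 - (t + 2) / 4 = (s - t) / 4 by field.
by rewrite normrM [`|4^-1|]ger0_norm ?invr_ge0 //; lra.
Qed.

(** The retraction of the plane onto the square of half-side 2. It turns a function continuous on
    the square into one continuous everywhere, as primitives along lines require. *)
Definition clampQ z : C := clamp2 (complex.Re z) +i* clamp2 (complex.Im z).

Local Notation Q := (in_rect (- 2) 2 (- 2) (2 : R)).

Lemma clampQ_in z : Q (clampQ z).
Proof. by split; exact: clamp2_in. Qed.

Lemma clampQ_id z : Q z -> clampQ z = z.
Proof. by case: z => x y [/= hx hy]; rewrite /clampQ /= !clamp2_id. Qed.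

Lemma clampQ_ccts F : (forall z, Q z -> ccts_at F z) -> ccts (F \o clampQ).
Proof.
move=> cF z e e0; have [r r0 hr] := cF _ (clampQ_in z) e e0.
exists (r / 2) => [|w hw]; first by rewrite divr_gt0.
apply: hr; apply: le_lt_trans (absc_le _) _; rewrite ReB ImB /=.
have := clamp2_lip (complex.Re w) (complex.Re z); have := clamp2_lip (complex.Im w) (complex.Im z).
rewrite -ReB -ImB; have := absc_Re (w - z); have := absc_Im (w - z); lra.
Qed.

Lemma rcts_bounded (f : R -> C) : rcts f -> exists2 B : R, 0 < B & forall t, - 2 <= t <= 2 -> absc (f t) <= B.
Proof.
move=> cf; have c : {within `[(- 2 : R), 2], continuous (fun t => absc (f t))}.
  apply: continuous_subspaceT => t; apply/cvgrPdist_lt => e e0; have [r r0 hr] := cf t Logic.I e e0.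
  apply/nbhs_ballP; exists r => // s hs /=; rewrite distrC.
  by apply: le_lt_trans (ler_abs_absc _ _) _; apply: hr => //; rewrite distrC.
have [|s _ hs] := EVT_max _ c; first by lra.
exists (absc (f s) + 1) => [|t ht]; first by rewrite ltr_wpDl ?absc_ge0.
by apply: le_trans (hs t _) _; rewrite ?in_itv // lerDl.
Qed.


(** The bottom, top, left and right sides of the square. On all of them [|z| >= 2] and
    [|z - 1| >= 1], and [ww g] is [1 / (z - 1)] along the side [g]. *)
Let gb (t : R) : C := t +i* (- 2).
Let gt (t : R) : C := t +i* 2.
Let gl (t : R) : C := (- 2) +i* t.
Let gr (t : R) : C := 2 +i* t.
Let ww (g : R -> C) (t : R) : C := (g t - 1)^-1.

Let mb (t : R) : 1 <= absc (gb t - 1).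
Proof. by apply: le_trans (absc_Im _); rewrite ImB /= subr0 normrN ger0_norm; lra. Qed.
Let mt (t : R) : 1 <= absc (gt t - 1).
Proof. by apply: le_trans (absc_Im _); rewrite ImB /= subr0 ger0_norm; lra. Qed.
Let ml (t : R) : 1 <= absc (gl t - 1).
Proof. by apply: le_trans (absc_Re _); rewrite ReB /= ler0_norm; lra. Qed.
Let mr (t : R) : 1 <= absc (gr t - 1).
Proof. by apply: le_trans (absc_Re _); rewrite ReB /= ger0_norm; lra. Qed.

Let ccts_id : @ccts R id.
Proof. by move=> z e e0; exists e. Qed.

Let rb : rcts gb := ccts_horiz _ ccts_id.
Let rt : rcts gt := ccts_horiz _ ccts_id.
Let rl : rcts gl := ccts_vert _ ccts_id.
Let rr : rcts gr := ccts_vert _ ccts_id.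

Let nz (g : R -> C) : (forall t, 1 <= absc (g t - 1)) -> forall t, g t - 1 != 0.
Proof. by move=> h t; rewrite -absc_gt0; apply: lt_le_trans (h t). Qed.

Let cw (g : R -> C) : rcts g -> (forall t, 1 <= absc (g t - 1)) -> rcts (ww g).
Proof.
move=> cg hg; apply: cts_inv => [t _|]; first exact: nz.
have -> : (fun t => g t - 1) = (fun t => 1 * g t + (-1) * (fun=> 1) t) by apply/funext => t; ring.
exact: (cts_comb _ _ cg (@cts_cst R (fun=> True) 1)).
Qed.

Let J : C := (prim (ww gb) 2 - prim (ww gb) (- 2)) + (0 +i* 1) * (prim (ww gr) 2 - prim (ww gr) (- 2))
  - (prim (ww gt) 2 - prim (ww gt) (- 2)) - (0 +i* 1) * (prim (ww gl) 2 - prim (ww gl) (- 2)).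

(* All four sides of the square contribute positively to the imaginary part of
   the integral of [dz / (z - 1)]. *)
Let J_neq0 : J != 0.
Proof.
have m3 (t : R) : - 2 <= t <= 2 -> `|t| < 3 by move=> ht; rewrite ltr_norml; lra.
pose Psi t := prim (ww gb) t + (0 +i* 1) * prim (ww gr) t + - prim (ww gt) t + - ((0 +i* 1) * prim (ww gl) t).
pose v t : C := ww gb t + (0 +i* 1) * ww gr t + - ww gt t + - ((0 +i* 1) * ww gl t).
have dPsi t : - 2 <= t <= 2 -> cderiv Psi (v t) t.
  move=> /m3 ht; have pd g : rcts g -> (forall t, 1 <= absc (g t - 1)) -> cderiv (prim (ww g)) (ww g t) t.
    by move=> cg hg; apply: prim_deriv => //; exact: cw.
  have pi g : rcts g -> (forall t, 1 <= absc (g t - 1)) ->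
      cderiv (fun t => (0 +i* 1) * prim (ww g) t) ((0 +i* 1) * ww g t) t.
    move=> cg hg; apply: cderiv_eq (cderivM (cderiv_cst _ _) (pd g cg hg)) _.
    by rewrite mul0r add0r.
  have d1 := pd gb rb mb; have d2 := pi gr rr mr; have d3 := pd gt rt mt; have d4 := pi gl rl ml.
  exact: (cderivD (cderivD (cderivD d1 d2) (cderivN d3)) (cderivN d4)).
have vE t : complex.Im (v t) = 4 / ((t - 1) ^+ 2 + 4) + 1 / (1 + t ^+ 2) + 3 / (9 + t ^+ 2).
  have h1 : (t - 1) ^+ 2 + 4 != 0 by rewrite gt_eqF // ltr_wpDl ?sqr_ge0.
  have h2 : 1 + t ^+ 2 != 0 by rewrite gt_eqF // ltr_pwDl ?sqr_ge0.
  have h3 : 9 + t ^+ 2 != 0 by rewrite gt_eqF // ltr_pwDl ?sqr_ge0.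
  rewrite /v /ww /gb /gr /gt /gl /=.
  have -> : (t - 1) ^+ 2 + (- 2 - 0) ^+ 2 = (t - 1) ^+ 2 + 4 by ring.
  have -> : (t - 1) ^+ 2 + (2 - 0) ^+ 2 = (t - 1) ^+ 2 + 4 by ring.
  have -> : (2 - 1) ^+ 2 + (t - 0) ^+ 2 = 1 + t ^+ 2 by ring.
  have -> : (- 2 - 1) ^+ 2 + (t - 0) ^+ 2 = 9 + t ^+ 2 by ring.
  by field; rewrite h1 h2 h3.
have vpos t : 0 < complex.Im (v t).
  rewrite vE; have := sqr_ge0 t; have := sqr_ge0 (t - 1) => h1 h2.
  by rewrite !addr_gt0 // divr_gt0 //; lra.
have c2 : (- 2 : R) <= 2 by lra.
have h1 (t : R) : t \in `](- 2), 2[ -> is_derive t 1 (fun t => complex.Im (Psi t)) (complex.Im (v t)).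
  by rewrite in_itv /= => /andP[t1 t2]; have [] := dPsi t; rewrite ?(ltW t1) ?(ltW t2).
have h2 : {within `[(- 2), 2], continuous (fun t => complex.Im (Psi t))}.
  by apply: derivable_within_continuous => t; rewrite in_itv /= => ht; have [_ []] := dPsi t ht.
have [s _] := MVT_segment c2 h1 h2.
rewrite -ImB (_ : Psi 2 - Psi (- 2) = J); last by rewrite /Psi /J; ring.
move=> E; apply/negP => /eqP J0; have := vpos s; move: E; rewrite J0 -[complex.Im 0]/(0 : R).
by move: (complex.Im (v s)) => w; lra.
Qed.

Section Quotient.
Variables (F : C -> C) (k : nat).
Hypotheses (dF : forall z, Q z -> cdiff F z) (F0 : near_at 0 (fun z => F z = 0)).

(** Vanishing of [F] near 0 makes this quotient differentiable there too, and [h 1 = F 1] for every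
    [k]. *)
Let h z := F z * (z ^+ k)^-1.

Let dh z : Q z -> cdiff h z.
Proof.
move=> hz; have [->|z0] := eqVneq z 0.
  by apply: (cdiff_near _ (cdiff_cst 0 0)); apply: near_atS F0 => w Fw; rewrite /h Fw mul0r.
apply: cdiffM; first exact: dF.
by apply: cdiffV; [rewrite expf_neq0|exact: cdiffX (cdiff_id z)].
Qed.

(** The difference quotient of [h] at 1 extends continuously by its Caratheodory slope;
    [goursat_except] applies with 1 as the exceptional point. *)
Lemma quotient_rectint : exists G : C -> C, [/\ ccts (G \o clampQ),
  rectint (G \o clampQ) (- 2) 2 (- 2) 2 = 0 &
  forall z, z != 1 -> G z = (h z - F 1) * (z - 1)^-1].
Proof.
have h1 : h 1 = F 1 by rewrite /h expr1n invr1 mulr1.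
have Q1 : Q 1 by split; rewrite /=; lra.
have [phi cphi hphi] := dh Q1; rewrite h1 in hphi.
pose G z := if z == 1 then phi 1 else (h z - F 1) * (z - 1)^-1.
have Gphi : near_at 1 (fun z => phi z = G z).
  apply: near_atS hphi => z E; rewrite /G; case: eqVneq => [->//|z1].
  by rewrite E addrC addKr mulfK // subr_eq0.
have dG z : Q z -> z != 1 -> cdiff G z.
  move=> hz z1; apply: (@cdiff_near (fun w => (h w - F 1) * (w - 1)^-1)).
    have z10 : z - 1 != 0 by rewrite subr_eq0.
    have [r r0 hr] := @ccts_at_neq0 (fun w => w - 1) z z10 (cdiff_ccts (cdiffB (cdiff_id z) (cdiff_cst 1 z))).
    exists r => // w /hr; rewrite /= subr_eq0 /G => /negPf w1.
    by rewrite w1.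
  apply: cdiffM; first by apply: cdiffB; [exact: dh|exact: cdiff_cst].
  by apply: cdiffV; [rewrite subr_eq0|apply: cdiffB; [exact: cdiff_id|exact: cdiff_cst]].
have cG : ccts (G \o clampQ).
  apply: clampQ_ccts => z hz; have [->|z1] := eqVneq z 1; first exact: ccts_at_near Gphi cphi.
  exact: cdiff_ccts (dG z hz z1).
exists G; split => //; last by move=> z /negPf; rewrite /G => ->.
apply: (@goursat_except _ _ 2 1 cG) => /=; [lra|rewrite normr1; lra|rewrite normr0; lra|].
move=> p hp p1; apply: cdiff_rdiff (dG p hp p1) hp _ => z hz /=.
by rewrite clampQ_id.
Qed.

(** On a side [h] is at most [B / 2^k], so the integral of [(h - F 1) / (z - 1)] is that of
    [- F 1 / (z - 1)] up to [2 (B / 2^k)] times the side length 4. *)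
Lemma quotient_edge (G : C -> C) (g f : R -> C) (B : R) : rcts g ->
  (forall t, 1 <= absc (g t - 1)) -> (forall t, - 2 <= t <= 2 -> Q (g t)) ->
  (forall t, 2 <= absc (g t)) -> (forall t, - 2 <= t <= 2 -> absc (F (clampQ (g t))) <= B) ->
  rcts f -> (forall t, f t = G (clampQ (g t))) ->
  (forall z, z != 1 -> G z = (h z - F 1) * (z - 1)^-1) ->
  absc (seg f (- 2) 2 - - F 1 * (prim (ww g) 2 - prim (ww g) (- 2))) <= 8 * B / 2 ^+ k.
Proof.
move=> cg g1 gQ g2 gB cf fE GE; rewrite mulrBr.
have -> : 8 * B / 2 ^+ k = 2 * (B / 2 ^+ k) * (2 - - 2) by ring.
apply: (@seg_close _ f (fun t => - F 1 * prim (ww g) t) (fun t => - F 1 * ww g t)) => //; [lra|lra|lra| |].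
  move=> t ht; apply: cderiv_eq (cderivM (cderiv_cst _ _) (prim_deriv (cw cg g1) _)) _.
    by rewrite ltr_norml; lra.
  by rewrite mul0r add0r.
move=> t ht; rewrite fE; have := gB t ht; rewrite clampQ_id; last exact: gQ.
move=> hB; have gt1 := nz g1 t.
have -> : G (g t) - - F 1 * ww g t = F (g t) * (g t ^+ k)^-1 * (g t - 1)^-1.
  by rewrite GE; [rewrite /h /ww; ring|rewrite -subr_eq0].
rewrite (abscM (F (g t) / _)) (abscM (F (g t))) (abscV (g t ^+ k)) (abscV (g t - 1)).
have a2 : 2 ^+ k <= absc (g t ^+ k).
  elim: (k) => [|j IH]; first by rewrite !expr0 absc1.
  by rewrite !exprS abscM ler_pM ?exprn_ge0.
have p2 : 0 < 2 ^+ k :> R by rewrite exprn_gt0.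
have h1 : (absc (g t - 1))^-1 <= 1 by rewrite invf_le1 // (lt_le_trans ltr01).
have h2 : (absc (g t ^+ k))^-1 <= (2 ^+ k)^-1 by rewrite lef_pV2 // posrE (lt_le_trans p2).
by rewrite -[leRHS]mulr1 !ler_pM ?mulr_ge0 ?invr_ge0 ?absc_ge0.
Qed.

Lemma quotient_bound (B : R) :
  (forall t, - 2 <= t <= 2 -> absc (F (clampQ (gb t))) <= B) ->
  (forall t, - 2 <= t <= 2 -> absc (F (clampQ (gt t))) <= B) ->
  (forall t, - 2 <= t <= 2 -> absc (F (clampQ (gl t))) <= B) ->
  (forall t, - 2 <= t <= 2 -> absc (F (clampQ (gr t))) <= B) ->
  absc (F 1 * J) <= 32 * B / 2 ^+ k.
Proof.
move=> hBb hBt hBl hBr; have [G [cG I0 GE]] := quotient_rectint.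
have nb (t : R) : 2 <= absc (gb t) by apply: le_trans (absc_Im _); rewrite /= normrN ger0_norm; lra.
have nt (t : R) : 2 <= absc (gt t) by apply: le_trans (absc_Im _); rewrite /= ger0_norm; lra.
have nl (t : R) : 2 <= absc (gl t) by apply: le_trans (absc_Re _); rewrite /= normrN ger0_norm; lra.
have nr (t : R) : 2 <= absc (gr t) by apply: le_trans (absc_Re _); rewrite /= ger0_norm; lra.
have s2 : - 2 <= (- 2 : R) <= 2 by lra.
have s2' : - 2 <= (2 : R) <= 2 by lra.
have bb := quotient_edge rb mb (fun t ht => conj ht s2) nb hBb (ccts_horiz (- 2) cG) (fun=> erefl) GE.
have bt := quotient_edge rt mt (fun t ht => conj ht s2') nt hBt (ccts_horiz 2 cG) (fun=> erefl) GE.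
have bl := quotient_edge rl ml (fun t ht => conj s2 ht) nl hBl (ccts_vert (- 2) cG) (fun=> erefl) GE.
have br := quotient_edge rr mr (fun t ht => conj s2' ht) nr hBr (ccts_vert 2 cG) (fun=> erefl) GE.
move: I0 bb bt bl br; rewrite /rectint /J.
set sb := seg (fun x => (G \o clampQ) (x +i* (- 2))) _ _; set sr := seg (fun y => (G \o clampQ) (2 +i* y)) _ _.
set st := seg (fun x => (G \o clampQ) (x +i* 2)) _ _; set sl := seg (fun y => (G \o clampQ) ((- 2) +i* y)) _ _.
set wb := prim (ww gb) 2 - _; set wt := prim (ww gt) 2 - _.
set wl := prim (ww gl) 2 - _; set wr := prim (ww gr) 2 - _.
have : absc (0 +i* 1 : C) = 1 by rewrite absc_i normr1.
move: (0 +i* 1 : C) => j j1 I0 bb bt bl br.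
have -> : F 1 * (wb + j * wr - wt - j * wl) = (sb - - F 1 * wb) + j * (sr - - F 1 * wr)
    - (st - - F 1 * wt) - j * (sl - - F 1 * wl).
  by apply/eqP; rewrite -subr_eq0 -[X in _ == X](oppr0) -I0; apply/eqP; ring.
apply: le_trans (ler_abscB _ _) _; apply: le_trans (lerD (ler_abscB _ _) (lexx _)) _.
apply: le_trans (lerD (lerD (ler_abscD _ _) (lexx _)) (lexx _)) _.
rewrite ![absc (j * _)]abscM j1 !mul1r.
have -> : 32 * B / 2 ^+ k = 8 * B / 2 ^+ k + 8 * B / 2 ^+ k + 8 * B / 2 ^+ k + 8 * B / 2 ^+ k by ring.
by rewrite !lerD.
Qed.

End Quotient.

(* Cauchy's formula for [F z / z^k] on the boundary of the square, where
   [|z| >= 2], as [k] tends to infinity. *)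
Lemma identity_square F : (forall z, Q z -> differentiable F z) -> near_at 0 (fun z => F z = 0) -> F 1 = 0.
Proof.
move=> dF F0; apply/eqP/negPn/negP => F1.
have dF' z : Q z -> cdiff F z by move/dF/differentiable_cdiff.
have cF := clampQ_ccts (fun z hz => cdiff_ccts (dF' z hz)).
have [Bb Bb0 hBb] := rcts_bounded (ccts_horiz (- 2) cF).
have [Bt Bt0 hBt] := rcts_bounded (ccts_horiz 2 cF).
have [Bl Bl0 hBl] := rcts_bounded (ccts_vert (- 2) cF).
have [Br Br0 hBr] := rcts_bounded (ccts_vert 2 cF).
pose B := Bb + Bt + Bl + Br.
have key k : absc (F 1 * J) <= 32 * B / 2 ^+ k.
  apply: quotient_bound => // t ht; rewrite /B.
  - by apply: le_trans (hBb t ht) _; lra.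
  - by apply: le_trans (hBt t ht) _; lra.
  - by apply: le_trans (hBl t ht) _; lra.
  - by apply: le_trans (hBr t ht) _; lra.
have FJ : 0 < absc (F 1 * J) by rewrite absc_gt0 mulf_neq0 // J_neq0.
have [k hk] := small_pow (32 * B) FJ.
by have := lt_le_trans hk (key k); rewrite ltxx.
Qed.

End IdentityTheorem.

(** Restriction to the complex line through [p] and [q], with [q] at parameter 1. Points of the
    square have modulus at most 4, whence the radius in the hypothesis. *)
Lemma identity_rV (R : realType) N (G : 'rV[R[i]]_N -> R[i]) p q :
  (forall x, nrm (x - p) <= 4 * nrm (q - p) -> differentiable G x) ->
  (exists2 r : R, 0 < r & forall x, nrm (x - p) < r -> G x = 0) -> G q = 0.
Proof.
move=> dG [r r0 hr]; pose F (z : R[i]) := G (p + z *: (q - p)).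
have <- : F 1 = G q by rewrite /F scale1r subrKC.
apply: identity_square.
  move=> z [/andP[h1 h2] /andP[h3 h4]]; apply: (@differentiable_comp _ _ _ _ (fun z : R[i] => p + z *: (q - p)) G).
    by apply: differentiableD; [exact: differentiable_cst|apply: differentiableZl; exact: ex_diff].
  apply: dG; rewrite addrC addKr nrmZ ler_wpM2r ?nrm_ge0 //.
  apply: le_trans (absc_le z) _; have : `|complex.Re z| <= 2 by rewrite ler_norml h1.
  have : `|complex.Im z| <= 2 by rewrite ler_norml h3.
  lra.
exists (r / (nrm (q - p) + 1)).
  by rewrite divr_gt0 // ltr_wpDl ?nrm_ge0.
move=> z; rewrite subr0 ltr_pdivlMr ?ltr_wpDl ?nrm_ge0 // => hz; apply: hr.
rewrite addrC addKr nrmZ; apply: le_lt_trans hz.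
by rewrite ler_wpM2l ?absc_ge0 // lerDl.
Qed.

(** * Rational lattices and the period matrix *)

Section RationalLattice.

Lemma common_denominator (k p : nat) (Q : 'M[rat]_(k, p)) :
  exists2 d : int, d != 0 & exists Z : 'M[int]_(k, p), d%:~R *: Q = map_mx intr Z.
Proof.
pose d : int := \prod_i \prod_j denq (Q i j).
have d0 : d != 0 by apply/prodf_neq0 => i _; apply/prodf_neq0 => j _; exact: denq_neq0.
exists d => //.
pose c i j : int := (\prod_(i' | i' != i) \prod_j' denq (Q i' j')) * \prod_(j' | j' != j) denq (Q i j').
have dE i j : d = c i j * denq (Q i j).
  by rewrite /d (bigD1 i) //= (bigD1 j) //= /c; ring.
exists (\matrix_(i, j) (c i j * numq (Q i j))); apply/matrixP => i j; rewrite !mxE.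
by rewrite (dE i j) -{2}(divq_num_den (Q i j)) !rmorphM /= mulrACA mulrA mulfK ?intr_eq0 ?denq_neq0 // mulrC mulrA.
Qed.

(* By the Smith normal form, a rational matrix of full row rank becomes, after a
   change of basis of its target, an integral matrix mapping onto the lattice. *)
Lemma row_free_lattice (k p : nat) (Q : 'M[rat]_(k, p)) : row_free Q ->
  exists (H : 'M[rat]_k) (a : 'M[int]_(k, p)) (s : 'M[int]_(p, k)),
    [/\ H \in unitmx, H *m Q = map_mx intr a & a *m s = 1%:M].
Proof.
move=> fQ; have [d d0 [Z hZ]] := common_denominator Q.
have dR : (d%:~R : rat) != 0 by rewrite intr_eq0.
have [L uL [T uT [ds _ ZE]]] := int_Smith_normal_form Z.
pose D : 'M[int]_(k, p) := \matrix_(i, j) (ds`_i *+ (i == j :> nat)).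
rewrite -/D in ZE.
have kp : (k <= p)%N by move/eqP: fQ => <-; exact: rank_leq_col.
have fZ : row_free (map_mx intr Z : 'M[rat]_(k, p)).
  by rewrite -hZ /row_free mxrank_scale_nz.
(* A vanishing invariant factor would put a non-zero row of the inverse of [L] into the left kernel
   of [Z]. *)
have ds0 (i : 'I_k) : ds`_i != 0.
  apply/eqP => di; have /row_free_inj inj := fZ.
  pose v : 'rV[rat]_k := map_mx intr (row i (invmx L)).
  have : v *m map_mx intr Z = 0 *m map_mx intr Z.
    rewrite mul0mx /v -map_mxM -row_mul ZE -mulmxA mulKmx //.
    apply/rowP => j; rewrite !mxE big1 ?mulr0z // => l _; rewrite !mxE.
    by rewrite di mul0rn mul0r.
  move/inj => v0; have : row i (invmx L) = 0.
    apply/rowP => j; move/rowP/(_ j): v0; rewrite !mxE => /eqP.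
    by rewrite intr_eq0 => /eqP.
  move/(congr1 (fun w => w *m L)); rewrite -row_mul mulVmx // mul0mx => /rowP/(_ i).
  by rewrite !mxE eqxx.
pose dd : 'rV[rat]_k := \row_i (ds`_i)%:~R.
(* [Z = L D T] and [Q = Z / d]: undoing [L], then dividing by the invariant factors and multiplying
   by [d], leaves the first [k] rows of the unimodular matrix [T], which have an integral right
   inverse. *)
pose H : 'M[rat]_k := diag_mx (\row_i (d%:~R / (dd 0 i))) *m map_mx intr (invmx L).
have udiag : diag_mx (\row_i (d%:~R / (dd 0 i))) \in unitmx.
  rewrite unitmxE unitfE det_diag; apply/prodf_neq0 => i _.
  by rewrite !mxE mulf_neq0 // invr_eq0 intr_eq0.
exists H, (pid_mx k *m T), (invmx T *m pid_mx k); split.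
- rewrite unitmx_mul udiag /=.
  have : map_mx intr (invmx L) *m map_mx intr L = 1%:M :> 'M[rat]_k by rewrite -map_mxM mulVmx // map_mx1.
  by case/mulmx1_unit.
- have -> : Q = d%:~R^-1 *: map_mx intr Z by rewrite -hZ scalerA mulVf // scale1r.
  have E : invmx L *m (L *m D *m T) = D *m T by rewrite -(mulmxA L) mulKmx.
  rewrite /H ZE -scalemxAr -(mulmxA (diag_mx _)) -(map_mxM _ (invmx L)) E map_mxM mulmxA scalemxAl map_mxM.
  congr (_ *m _); apply/matrixP => i j; rewrite mul_diag_mx !mxE.
  case: eqVneq => [_|_]; last by rewrite mulr0n !mulr0.
  by rewrite ltn_ord mulr1n mulrA mulrA mulVf // mul1r mulVf // intr_eq0.
- rewrite mulmxA -[_ *m T *m _]mulmxA mulmxV // mulmx1 pid_mx_id //.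
  by apply/matrixP => i j; rewrite !mxE ltn_ord andbT.
Qed.

End RationalLattice.

(** * Echelon forms and the rank of the period matrix *)

Section EchelonForm.
Context (F : fieldType).

Lemma leading_exists (r c : nat) (A : 'M[F]_(r, c)) i : row i A != 0 ->
  exists j, leading_entry A i j.
Proof.
move=> Ai; have [j Aij] : exists j, A i j != 0.
  apply: contrapT => no; case/eqP: Ai; apply/rowP => j; rewrite !mxE.
  by apply/eqP; apply: contrapT => /negP h; apply: no; exists j.
case: (@arg_minnP _ j (fun j => A i j != 0) (fun j : 'I_c => j : nat) Aij) => l Ail hl.
exists l; split => // j' lt; apply/eqP; apply: contraTT lt => h.
by rewrite -leqNgt; exact: hl.
Qed.

(** In a pivot column only its own row has a non-zero entry, so a vanishing combination of rows has
    all coefficients 0. *)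
Lemma echelon_row_free (r c : nat) (A : 'M[F]_(r, c)) :
  reduced_row_echelon A -> (forall i, row i A != 0) -> row_free A.
Proof.
move=> [_ _ lead1 lead0] nz; rewrite -kermx_eq0; apply/rowV0P => v /sub_kermxP vA.
apply/rowP => i; have [j lj] := leading_exists (nz i).
move/rowP/(_ j): vA; rewrite !mxE (bigD1 i) //= (lead1 i j lj) mulr1 big1 ?addr0 //.
by move=> i' i'i; rewrite (lead0 i i' j lj i'i) mulr0.
Qed.

End EchelonForm.

Section PeriodMatrix.
Context (R : realType) (k m n : nat).
Local Notation C := R[i].
Variables (A : 'M[rat]_(k, m)) (q : 'I_n -> rat).

Lemma widen_lift (l : 'I_n) : widen_ord (leqnSn n) l = lift ord_max l.
Proof. by apply: val_inj; rewrite /= /bump leqNgt ltn_ord. Qed.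

(** Suppose row [i] of [A] is zero. If the last entry of row [i] of [B] is 0, the whole row is zero
    and precedes the non-zero first row of [C]. Otherwise its pivot is in the last column, to the
    right of the pivot of that lower row. Both contradict the echelon form. *)
Lemma period_matrix_row_free (B : 'M[C]_(k, n.+1)) : (0 < n)%N ->
  (forall i l, l != ord_max -> B i l = 0) -> reduced_row_echelon A ->
  reduced_row_echelon (period_matrix A B q) -> row_free A.
Proof.
move=> n0 hB hA [zer ech _ _]; apply: echelon_row_free => // i; apply/negP => /eqP Ai.
pose i' : 'I_(k + n) := rshift k (Ordinal n0).
have lt : (lshift n i < i')%N by rewrite /= addn0.
have Ml j : period_matrix A B q (lshift n i) (lshift n.+1 j) = 0.
  by rewrite block_mxEul mxE; move/rowP/(_ j): Ai; rewrite !mxE => ->; rewrite rmorph0.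
have Mr l : period_matrix A B q (lshift n i) (rshift m l) = B i l by rewrite block_mxEur.
have Ni j : period_matrix A B q i' (lshift n.+1 j) = 0 by rewrite block_mxEdl mxE.
have Nr l : period_matrix A B q i' (rshift m l) = residue_rows R q (Ordinal n0) l by rewrite block_mxEdr.
pose l0 : 'I_n.+1 := Ordinal (ltnW n0 : (0 < n.+1)%N).
have l0m : l0 == ord_max = false by apply/negbTE; rewrite -val_eqE /= neq_ltn n0.
have N1 : period_matrix A B q i' (rshift m l0) = 1 by rewrite Nr mxE l0m eqxx.
have [Bi|Bi] := eqVneq (B i ord_max) 0.
  have : row (lshift n i) (period_matrix A B q) = 0.
    apply/rowP => j; rewrite mxE [RHS]mxE; case: (split_ordP j) => j' ->; first exact: Ml.
    by rewrite Mr; have [->//|/(hB i)] := eqVneq j' ord_max.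
  move=> /(zer _ _ lt)/rowP/(_ (rshift m l0)).
  by rewrite mxE N1 mxE => /eqP; rewrite oner_eq0.
have leadi : leading_entry (period_matrix A B q) (lshift n i) (rshift m ord_max).
  split; first by rewrite Mr.
  move=> j; case: (split_ordP j) => j' -> lt'; first exact: Ml.
  rewrite Mr hB //; apply/negP => /eqP E; move: lt'; rewrite E ltnn //.
have leadi' : leading_entry (period_matrix A B q) i' (rshift m l0).
  split; first by rewrite N1 oner_neq0.
  move=> j; case: (split_ordP j) => j' -> lt'; first exact: Ni.
  by move: lt'; rewrite /= ltn_add2l ltn0.
have := ech _ _ _ _ lt leadi leadi'; rewrite /= ltn_add2l.
by rewrite ltn0.
Qed.

(** The ratio of the residue at [y_l] to the one at [y_n] imposed by the rows [(I_n | q)]. *)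
Definition residue_ratio (l : 'I_n.+1) : rat := if unlift ord_max l is Some i then - q i else 1.

Lemma residue_ratio_lift i : residue_ratio (lift ord_max i) = - q i.
Proof. by rewrite /residue_ratio liftK. Qed.

Lemma residue_ratio_max : residue_ratio ord_max = 1.
Proof. by rewrite /residue_ratio unlift_none. Qed.

(** Only the last column of [B] contributes, and the lower rows fix the ratios of the entries [Rs].
    The scalar [t] is [2 pi i] for period vectors and 1 for arbitrary vectors. *)
Lemma period_matrixP (B : 'M[C]_(k, n.+1)) (P : 'I_m -> C) (Rs : 'I_n.+1 -> C) (t : C) : t != 0 ->
  (forall i l, l != ord_max -> B i l = 0) ->
  period_matrix A B q *m (row_mx (\row_j P j) (\row_l (t * Rs l)))^T = 0 <->
  (forall l, Rs l = ratr (residue_ratio l) * Rs ord_max) /\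
  (forall i, \sum_j ratr (A i j) * P j + t * B i ord_max * Rs ord_max = 0).
Proof.
move=> t0 hB; rewrite tr_row_mx mul_block_col mul0mx add0r.
have up : (map_mx ratr A *m (\row_j P j)^T + B *m (\row_l (t * Rs l))^T = 0) <->
    (forall i, \sum_j ratr (A i j) * P j + t * B i ord_max * Rs ord_max = 0).
  have E i : (map_mx ratr A *m (\row_j P j)^T + B *m (\row_l (t * Rs l))^T) i 0 =
      \sum_j ratr (A i j) * P j + t * B i ord_max * Rs ord_max.
    rewrite !mxE; congr (_ + _); first by apply: eq_bigr => j _; rewrite !mxE.
    rewrite (bigD1 ord_max) //= big1 => [|l lm]; last by rewrite hB // mul0r.
    by rewrite addr0 !mxE mulrCA mulrA.
  split => [h i|h]; first by rewrite -E h mxE.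
  by apply/colP => i; rewrite E h mxE.
have dn : (residue_rows R q *m (\row_l (t * Rs l))^T = 0) <->
    (forall l, Rs l = ratr (residue_ratio l) * Rs ord_max).
  have E i : (residue_rows R q *m (\row_l (t * Rs l))^T) i 0 =
      t * (Rs (lift ord_max i) + ratr (q i) * Rs ord_max).
    rewrite mxE big_ord_recr /= mulrDr; congr (_ + _); last by rewrite !mxE eqxx mulrCA.
    have Ew l : residue_rows R q i (widen_ord (leqnSn n) l) = (i == l)%:R.
      by rewrite mxE widen_lift eq_sym (negPf (neq_lift _ _)) lift_max.
    rewrite (bigD1 i) //= Ew eqxx mul1r big1 ?addr0 => [|l li]; first by rewrite !mxE widen_lift.
    by rewrite Ew eq_sym (negPf li) mul0r.
  split => [h l|h].
    case: (unliftP ord_max l) => [i ->|->]; last by rewrite residue_ratio_max rmorph1 mul1r.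
    move/colP/(_ i): h; rewrite E [RHS]mxE => /eqP; rewrite mulf_eq0 (negPf t0) /= addr_eq0 => /eqP ->.
    by rewrite residue_ratio_lift rmorphN mulNr.
  apply/colP => i; rewrite E [RHS]mxE h residue_ratio_lift rmorphN mulNr addNr mulr0 //.
split => [/eqP|[/dn h1 /up h2]]; last by rewrite h1 h2 col_mx0.
by rewrite col_mx_eq0 => /andP[/eqP/up ? /eqP/dn ?].
Qed.

(** The equations pair the logarithms [L_jl] with the products [A_ij r_l], seen as rows indexed by
    the pairs [(j, l)]. These rows are independent because [r_n = 1], so [row_free_lattice]
    applies. *)
Lemma lattice_exists : row_free A -> exists (H : 'M[rat]_k) (a : 'I_k -> 'I_m -> 'I_n.+1 -> int)
    (s : 'I_m -> 'I_n.+1 -> 'I_k -> int),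
  [/\ H \in unitmx, forall i j l, (H *m A) i j * residue_ratio l = (a i j l)%:~R &
      forall i i', \sum_j \sum_l a i j l * s j l i' = (i == i')%:R].
Proof.
move=> fA; pose Q : 'M[rat]_(k, m * n.+1) :=
  \matrix_(i, x) mxvec (\matrix_(j, l) (A i j * residue_ratio l)) 0 x.
have QE i j l : Q i (mxvec_index j l) = A i j * residue_ratio l by rewrite mxE mxvecE mxE.
have fQ : row_free Q.
  rewrite -kermx_eq0; apply/rowV0P => v /sub_kermxP vQ.
  apply: (row_free_inj fA); rewrite mul0mx; apply/rowP => j.
  move/rowP/(_ (mxvec_index j ord_max)): vQ; rewrite [LHS]mxE [RHS]mxE => E.
  rewrite !mxE -[RHS]E; apply: eq_bigr => i _.
  by rewrite QE residue_ratio_max mulr1.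
have [H [a [s [uH HQ as1]]]] := row_free_lattice fQ.
exists H, (fun i j l => a i (mxvec_index j l)), (fun j l i => s (mxvec_index j l) i); split => //.
- move=> i j l; move/matrixP/(_ i (mxvec_index j l)): HQ; rewrite !mxE => <-.
  by rewrite mulr_suml; apply: eq_bigr => i' _; rewrite QE mulrA.
- move=> i i'; move/matrixP/(_ i i'): as1; rewrite !mxE => <-.
  by rewrite pair_bigA (reindex _ (curry_mxvec_bij _ _)) /=; apply: eq_bigr => -[j l].
Qed.

End PeriodMatrix.

(** * Equations of the period locus *)

Section PeriodLocus.
Context (R : realType) (m n k : nat) (e : 'I_m.+1 -> nat).
Hypotheses (he : forall i, (0 < e i)%N) (hsum : (\sum_(i < m.+1) e i)%N = n).
Local Notation C := R[i].
Local Notation point := 'rV[C]_(1 + (m + n)).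
Local Notation tpi := (two_pi_i R).
Context (A : 'M[rat]_(k, m)) (B : 'M[C]_(k, n.+1)) (q : 'I_n -> rat).
Hypothesis hB : forall i l, l != ord_max -> B i l = 0.
Context (H : 'M[rat]_k) (a : 'I_k -> 'I_m -> 'I_n.+1 -> int) (s : 'I_m -> 'I_n.+1 -> 'I_k -> int).
Hypotheses (uH : H \in unitmx)
  (ha : forall i j l, (H *m A) i j * residue_ratio q l = (a i j l)%:~R)
  (hs : forall i i', \sum_j \sum_l a i j l * s j l i' = (i == i')%:R).
Implicit Types (p : point) (v : 'I_k -> int).

Definition resid_cond p : Prop :=
  forall l, resid e p l = ratr (residue_ratio q l) * resid e p ord_max.

Definition log_sum (L : 'I_m -> 'I_n.+1 -> C) (i : 'I_k) : C := \sum_j \sum_l L j l *~ a i j l.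

(** The last column of [B] after the first [k] equations have been multiplied by [H]. *)
Definition twist (b : 'I_k -> C) (i : 'I_k) : C := \sum_i' ratr (H i i') * b i'.

Definition charts_log (c : point -> 'I_m -> R -> C) p (j : 'I_m) (l : 'I_n.+1) : C :=
  logint (c p j) (pole_at p l).

Lemma chart_avoids U c p : period_chart e U c -> U p -> [/\ stratum p,
  forall j, C1_path (c p j), forall j l, avoids (c p j) (pole_at p l) &
  forall j l, cexp (charts_log c p j l) = pole_ratio p j l].
Proof.
move=> [_ US paths _ _] Up; have av j l : avoids (c p j) (pole_at p l).
  by move=> t ht; have [_ _ _ h] := paths p Up j; apply: h.
have c1 j : C1_path (c p j) by have [] := paths p Up j.
split => //; first exact: US.
move=> j l; rewrite /charts_log logint_exp // /pole_ratio.
by have [_ -> -> _] := paths p Up j.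
Qed.

Lemma period_coord U c p : period_chart e U c -> U p ->
  period_map e c p = row_mx (\row_j \sum_l resid e p l * charts_log c p j l)
    (\row_l (tpi * resid e p l)).
Proof.
by move=> ch Up; have [sp c1 av _] := chart_avoids ch Up; exact: period_mapE.
Qed.

Lemma twistP (b : 'I_k -> C) (P : 'I_m -> C) (t : C) :
  (forall i, \sum_j ratr (A i j) * P j + b i * t = 0) <->
  (forall i, \sum_j ratr ((H *m A) i j) * P j + twist b i * t = 0).
Proof.
pose w i := \sum_j ratr (A i j) * P j + b i * t.
pose HC : 'M[C]_k := map_mx ratr H.
pose W : 'cV[C]_k := \col_i w i.
have uHC : HC \in unitmx by rewrite /HC map_unitmx.
have E i : \sum_j ratr ((H *m A) i j) * P j + twist b i * t = (HC *m W) i 0.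
  rewrite mxE /twist mulr_suml.
  under [in RHS]eq_bigr => i' _ do rewrite !mxE /w mulrDr.
  rewrite big_split /=; congr (_ + _); last by apply: eq_bigr => i' _; rewrite mulrA.
  under eq_bigr => j _ do rewrite mxE rmorph_sum /= mulr_suml.
  rewrite exchange_big /=; apply: eq_bigr => i' _; rewrite mulr_sumr; apply: eq_bigr => j _.
  by rewrite rmorphM /= -mulrA.
split => [h i|h].
  rewrite E; suff -> : W = 0 by rewrite mulmx0 mxE.
  by apply/colP => i'; rewrite [LHS]mxE [RHS]mxE; exact: h.
have HW : HC *m W = 0 by apply/colP => i; rewrite -E h mxE.
have W0 : W = 0 by rewrite -(mulKmx uHC W) HW mulmx0.
by move=> i; move/colP/(_ i): W0; rewrite !mxE.
Qed.

Lemma log_sumE p (L : 'I_m -> 'I_n.+1 -> C) i : resid_cond p ->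
  \sum_j ratr ((H *m A) i j) * (\sum_l resid e p l * L j l) = resid e p ord_max * log_sum L i.
Proof.
move=> rc; rewrite /log_sum mulr_sumr; apply: eq_bigr => j _; rewrite !mulr_sumr; apply: eq_bigr => l _.
rewrite rc -mulrzl -(ratr_int C (a i j l)) -ha rmorphM /=; ring.
Qed.

Lemma cexp_log_sum p (L : 'I_m -> 'I_n.+1 -> C) i : (forall j l, cexp (L j l) = pole_ratio p j l) ->
  cexp (log_sum L i) = \prod_j \prod_l pole_ratio p j l ^ a i j l.
Proof.
move=> hL; rewrite /log_sum cexp_sum; apply: eq_bigr => j _; rewrite cexp_sum; apply: eq_bigr => l _.
by rewrite cexp_mulz hL.
Qed.

(* [v] records the ambiguity of the logarithms under monodromy. *)
Definition shifted_matrix v : 'M[C]_(k + n, m + n.+1) :=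
  period_matrix A (B - (\col_i \sum_i' ratr (invmx H i i') * (v i')%:~R) *m delta_mx 0 ord_max) q.

Lemma shifted_matrix0 : shifted_matrix (fun=> 0) = period_matrix A B q.
Proof.
rewrite /shifted_matrix (_ : \col_i _ = 0) ?mul0mx ?subr0 //.
by apply/colP => i; rewrite !mxE big1 // => i' _; rewrite mulr0.
Qed.

Lemma col_deltaE (b : 'cV[C]_k) i l :
  (b *m (delta_mx 0 ord_max : 'rV_n.+1)) i l = if l == ord_max then b i 0 else 0.
Proof.
by rewrite !mxE big_ord1 !mxE eqxx /=; case: eqP => _; rewrite ?mulr1 ?mulr0.
Qed.

(** Multiplying the upper equations by [H] and dividing by the non-zero residue at [y_n] makes them
    integral in the logarithms. The correction of the last column is the preimage of [v] under [H],
    so it contributes exactly [2 pi i v]. *)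
Lemma shifted_matrix_chart U c p v : period_chart e U c -> U p ->
  shifted_matrix v *m (period_map e c p)^T = 0 <->
  resid_cond p /\ (forall i, log_sum (charts_log c p) i +
     tpi * twist (fun i' => B i' ord_max) i = tpi *~ v i).
Proof.
move=> ch Up; have [sp _ _ _] := chart_avoids ch Up.
have R0 : resid e p ord_max != 0 by apply: resid_neq0.
rewrite (period_coord ch Up) /shifted_matrix; set u := \col_i _.
have hB' i l : l != ord_max -> (B - u *m delta_mx 0 ord_max) i l = 0.
  by move=> lm; rewrite mxE hB // mxE col_deltaE (negPf lm) subrr.
apply: iff_trans (period_matrixP _ _ _ _ (two_pi_i_neq0 R) hB') _.
have E0 : (forall i, \sum_j ratr (A i j) * (\sum_l resid e p l * charts_log c p j l) +
      tpi * (B - u *m delta_mx 0 ord_max) i ord_max * resid e p ord_max = 0) <->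
    (forall i, \sum_j ratr (A i j) * (\sum_l resid e p l * charts_log c p j l) +
      (B - u *m delta_mx 0 ord_max) i ord_max * (tpi * resid e p ord_max) = 0).
  by split => h i; rewrite -[RHS](h i); congr (_ + _); ring.
have E1 i : twist (fun i' => (B - u *m delta_mx 0 ord_max) i' ord_max) i =
    twist (fun i' => B i' ord_max) i - (v i)%:~R.
  have -> : (v i)%:~R = \sum_i' ratr (H i i') * u i' 0 :> C.
    have : map_mx ratr (H *m invmx H) *m (\col_i' (v i')%:~R : 'cV[C]_k) = \col_i' (v i')%:~R.
      by rewrite mulmxV // map_mx1 mul1mx.
    move/colP/(_ i); rewrite [RHS]mxE => <-; rewrite map_mxM -mulmxA mxE; apply: eq_bigr => i' _.
    by rewrite !mxE; congr (_ * _); apply: eq_bigr => l _; rewrite !mxE.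
  rewrite /twist -sumrB; apply: eq_bigr => i' _.
  by rewrite [X in _ * X]mxE [X in _ * (_ + X)]mxE col_deltaE eqxx mulrBr.
have E2 : resid_cond p -> (forall i, \sum_j ratr ((H *m A) i j) * (\sum_l resid e p l * charts_log c p j l) +
      twist (fun i' => (B - u *m delta_mx 0 ord_max) i' ord_max) i * (tpi * resid e p ord_max) = 0) <->
    (forall i, log_sum (charts_log c p) i + tpi * twist (fun i' => B i' ord_max) i = tpi *~ v i).
  move=> rc; have E3 i : \sum_j ratr ((H *m A) i j) * (\sum_l resid e p l * charts_log c p j l) +
      twist (fun i' => (B - u *m delta_mx 0 ord_max) i' ord_max) i * (tpi * resid e p ord_max) =
      resid e p ord_max * (log_sum (charts_log c p) i + tpi * twist (fun i' => B i' ord_max) i - tpi *~ v i).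
    by rewrite log_sumE // E1 -[tpi *~ _]mulrzr; ring.
  split => h i.
    by move: (h i); rewrite E3 => /eqP; rewrite mulf_eq0 (negPf R0) subr_eq0 => /eqP.
  by rewrite E3 h subrr mulr0.
split => [[rc /E0/twistP h]|[rc h]]; split => //; first exact/(E2 rc).
by apply/E0/twistP/(E2 rc).
Qed.

Definition monomial_cond p : Prop := forall i,
  \prod_j \prod_l pole_ratio p j l ^ a i j l = cexp (- (tpi * twist (fun i' => B i' ord_max) i)).

Lemma monomial_condP p (L : 'I_m -> 'I_n.+1 -> C) :
  (forall j l, cexp (L j l) = pole_ratio p j l) ->
  monomial_cond p <-> exists v, forall i, log_sum L i + tpi * twist (fun i' => B i' ord_max) i = tpi *~ v i.
Proof.
move=> hL; have E i : cexp (log_sum L i + tpi * twist (fun i' => B i' ord_max) i) = 1 <->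
    \prod_j \prod_l pole_ratio p j l ^ a i j l = cexp (- (tpi * twist (fun i' => B i' ord_max) i)).
  rewrite cexpD -(cexp_log_sum _ hL) cexpN; split => [h|->]; last by rewrite mulVf ?cexp_neq0.
  by rewrite -[LHS]mulr1 -(mulfV (cexp_neq0 (tpi * twist (fun i' => B i' ord_max) i))) mulrA h mul1r.
split => [h|[v hv] i]; last by apply/E/cexp_eq1; exists (v i).
have hv i : exists z : int, log_sum L i + tpi * twist (fun i' => B i' ord_max) i = tpi *~ z.
  by apply/cexp_eq1/E/h.
by have [v hv'] := choice hv; exists v.
Qed.

Lemma log_exists p : stratum p -> exists L, forall j l, cexp (L j l) = pole_ratio p j l.
Proof.
move=> [_ _ inj sep].
have hL j : exists Lj : 'I_n.+1 -> C, forall l, cexp (Lj l) = pole_ratio p j l.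
  have [L [c [[c1 h0 h1] av hl]]] := @log_vector_segment R _ (@pole_at R m n p) (zero_at p ord0) (zero_at p (lift ord0 j))
    (fun l => sep _ l) (fun l => sep _ l).
  by exists L => l; rewrite -hl logint_exp // (h0 0) // (h1 1).
by have [L h] := choice hL; exists L.
Qed.

(** On a chart the equations imply their exponentials. Conversely, any logarithms satisfy the
    equations up to an integral vector [v]; they are corrected by integral multiples of [2 pi i],
    and [chart_exists] realizes the corrected ones by paths. *)
Lemma period_locusP p : period_locus e (period_matrix A B q) p <->
  [/\ stratum p, resid_cond p & monomial_cond p].
Proof.
split => [[U [c [ch Up]]]|[sp rc mc]].
  rewrite -shifted_matrix0 => /(shifted_matrix_chart _ ch Up)[rc hv].
  have [sp _ _ hL] := chart_avoids ch Up; split => //.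
  by apply/(monomial_condP hL); exists (fun=> 0).
have [L hL] := log_exists sp; have [v hv] := (monomial_condP hL).1 mc.
(* [w = s v] satisfies [a w = v] because [s] is a right inverse of [a]. *)
pose w j l : int := \sum_i s j l i * v i.
pose L' j l := L j l - tpi *~ w j l.
have hL' j l : cexp (L' j l) = pole_ratio p j l.
  by rewrite /L' -mulrNz cexpD hL cexp_mulz cexp_two_pi_i exp1rz mulr1.
have [U [c [ch Up hc]]] := chart_exists he hsum sp hL'.
exists U, c; split => //; rewrite -shifted_matrix0; apply/(shifted_matrix_chart _ ch Up); split => //.
move=> i; rewrite mulr0z.
have -> : log_sum (charts_log c p) i = log_sum L i - tpi *~ v i.
  have -> : log_sum (charts_log c p) i = log_sum L' i.
    by apply: eq_bigr => j _; apply: eq_bigr => l _; rewrite /charts_log hc.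
  have -> : v i = \sum_j \sum_l a i j l * w j l.
    transitivity (\sum_i' (\sum_j \sum_l a i j l * s j l i') * v i').
      rewrite (bigD1 i) //= hs eqxx mul1r big1 ?addr0 // => i' i'i.
      by rewrite hs eq_sym (negPf i'i) mul0r.
    under eq_bigr => i' _ do rewrite mulr_suml.
    rewrite exchange_big /=; apply: eq_bigr => j _.
    under eq_bigr => i' _ do rewrite mulr_suml.
    rewrite exchange_big /=; apply: eq_bigr => l _.
    by rewrite /w mulr_sumr; apply: eq_bigr => i' _; rewrite mulrA.
  rewrite /log_sum -[in RHS]mulrzr rmorph_sum /= mulr_sumr -sumrB; apply: eq_bigr => j _.
  rewrite rmorph_sum /= mulr_sumr -sumrB; apply: eq_bigr => l _.
  by rewrite /L' mulrzBl -mulrzA mulrzr mulrC.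
by rewrite addrAC hv subrr.
Qed.

End PeriodLocus.

(** * Polynomial equations of the locus and their gradients *)

Section StratumPolynomials.
Context (R : realType) (m n : nat) (e : 'I_m.+1 -> nat).
Local Notation C := R[i].
Local Notation N := (1 + (m + n))%N.
Local Notation point := 'rV[C]_(1 + (m + n)).
Local Notation mp := (mpoly (1 + (m + n)) C).
Implicit Types (p : point).

Definition coordX (x : 'I_(1 + (m + n))) : mp := mpolyX C (mnm1 x).
Definition lambda_poly : mp := coordX (lshift _ 0).
Definition zero_poly (i : 'I_m.+1) : mp :=
  if unlift ord0 i is Some j then coordX (rshift 1 (lshift n j)) else 0.
Definition pole_poly (l : 'I_n.+1) : mp :=
  if unlift ord0 l is Some j then coordX (rshift 1 (rshift m j)) else 1.

Lemma ev_lambda p : ev p lambda_poly = lambda_of p.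
Proof. by rewrite evX lambda_ofE. Qed.

Lemma ev_zero p i : ev p (zero_poly i) = zero_at p i.
Proof.
rewrite /zero_poly; case: unliftP => [j ->|->]; last by rewrite ev0 zero_at0.
by rewrite evX zero_at_lift.
Qed.

Lemma ev_pole p l : ev p (pole_poly l) = pole_at p l.
Proof.
rewrite /pole_poly; case: unliftP => [j ->|->]; last by rewrite ev1 pole_at0.
by rewrite evX pole_at_lift.
Qed.

Lemma ev_diff p i l : ev p (zero_poly i - pole_poly l) = zero_at p i - pole_at p l.
Proof. by rewrite evB ev_zero ev_pole. Qed.

Lemma ev_subCM p (f g : mp) c : ev p (f - mpolyC _ c * g) = ev p f - c * ev p g.
Proof. by rewrite evB (evM p (mpolyC _ _)) evC. Qed.

Definition discr_poly : mp := lambda_poly *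
  (\prod_i \prod_(i' | i' != i) (zero_poly i - zero_poly i')) *
  (\prod_l \prod_(l' | l' != l) (pole_poly l - pole_poly l')) *
  (\prod_i \prod_l (zero_poly i - pole_poly l)).

Lemma ev_discr p : ev p discr_poly = discr p.
Proof.
rewrite /discr_poly evM (evM p (_ * _)) (evM p lambda_poly) ev_lambda /discr.
congr (_ * _ * _ * _); rewrite ev_prod; apply: eq_bigr => i _; rewrite ev_prod; apply: eq_bigr => j _;
  by rewrite evB ?ev_zero ?ev_pole.
Qed.

Definition resid_num (l : 'I_n.+1) : mp := lambda_poly * \prod_i (pole_poly l - zero_poly i) ^+ e i.
Definition resid_den (l : 'I_n.+1) : mp := \prod_(l' | l' != l) (pole_poly l - pole_poly l').

Lemma ev_resid_den p l : stratum p -> ev p (resid_den l) != 0.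
Proof.
move=> [_ _ inj _]; rewrite ev_prod; apply/prodf_neq0 => l' l'l.
by rewrite evB !ev_pole subr_eq0 (inj_eq inj) eq_sym.
Qed.

Lemma ev_resid p l : resid e p l = ev p (resid_num l) / ev p (resid_den l).
Proof.
rewrite residE /resid_num evM ev_lambda !ev_prod; congr (_ * _ / _).
  by apply: eq_bigr => i _; rewrite evXn evB ev_pole ev_zero.
by apply: eq_bigr => i _; rewrite evB !ev_pole.
Qed.

(** The numerator of [(u / w) ^ z] without negative exponents; its denominator is the same
    expression with [u] and [w] exchanged. *)
Definition power_num (S : nzSemiRingType) (u w : S) (z : int) : S :=
  match z with Posz t => u ^+ t | Negz t => w ^+ t.+1 end.

Lemma power_num_ratio (u w : C) (z : int) : u != 0 -> w != 0 ->
  power_num u w z = power_num w u z * (u / w) ^ z.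
Proof.
move=> u0 w0; case: z => t.
  by rewrite -[(u / w) ^ _]/((u / w) ^+ t) /= exprMn exprVn mulrCA mulfV ?mulr1 // expf_neq0.
rewrite -[(u / w) ^ _]/((u / w) ^- t.+1) /= exprMn exprVn invfM invrK mulrA mulfV ?mul1r //.
by rewrite expf_neq0.
Qed.

Lemma ev_power_num p (u w : mp) (z : int) : ev p (power_num u w z) = power_num (ev p u) (ev p w) z.
Proof. by case: z => t /=; rewrite evXn. Qed.

Lemma power_num_neq0 (u w : C) (z : int) : u != 0 -> w != 0 -> power_num u w z != 0.
Proof. by move=> u0 w0; case: z => t /=; rewrite expf_neq0. Qed.

Definition monomial_num (a : 'I_m -> 'I_n.+1 -> int) : mp := \prod_j \prod_l
  power_num (zero_poly (lift ord0 j) - pole_poly l) (zero_poly ord0 - pole_poly l) (a j l).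
Definition monomial_den (a : 'I_m -> 'I_n.+1 -> int) : mp := \prod_j \prod_l
  power_num (zero_poly ord0 - pole_poly l) (zero_poly (lift ord0 j) - pole_poly l) (a j l).

Lemma ev_monomial_den p a : stratum p -> ev p (monomial_den a) != 0.
Proof.
move=> [_ _ _ sep]; rewrite ev_prod; apply/prodf_neq0 => j _; rewrite ev_prod; apply/prodf_neq0 => l _.
by rewrite ev_power_num !ev_diff power_num_neq0 // subr_eq0.
Qed.

Lemma ev_monomial p a : stratum p -> ev p (monomial_num a) =
  ev p (monomial_den a) * \prod_j \prod_l pole_ratio p j l ^ a j l.
Proof.
move=> [_ _ _ sep].
have E1 j l : ev p (power_num (zero_poly (lift ord0 j) - pole_poly l) (zero_poly ord0 - pole_poly l) (a j l)) =
    ev p (power_num (zero_poly ord0 - pole_poly l) (zero_poly (lift ord0 j) - pole_poly l) (a j l)) * pole_ratio p j l ^ a j l.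
  apply: etrans (ev_power_num _ _ _ _) _; apply: etrans (congr2 (fun u w => power_num u w _) (ev_diff _ _ _) (ev_diff _ _ _)) _.
  apply: etrans (power_num_ratio _ _ _) _; [by rewrite subr_eq0|by rewrite subr_eq0|congr (_ * _); apply/esym].
  apply: etrans (ev_power_num _ _ _ _) _; 
  exact: (congr2 (fun u w => power_num u w (a j l)) (ev_diff _ _ _) (ev_diff _ _ _)).
have split_ev (I : finType) (f g : I -> mp) (h : I -> C) : (forall i, ev p (f i) = ev p (g i) * h i) ->
    ev p (\prod_i f i) = ev p (\prod_i g i) * \prod_i h i.
  move=> E; apply: etrans (ev_prod p _ _ _) _; apply/esym; apply: etrans (congr2 *%R (ev_prod p _ _ _) erefl) _.
  by apply: etrans (esym (big_split _ _ _ _ _)) _; apply: eq_bigr => i _; exact/esym/E.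
by apply: (split_ev _ _ _ (fun j => \prod_l _)) => j; apply: (split_ev _ _ _ (fun l => _)) => l; exact: E1.
Qed.

Lemma ldiffXz (f : point -> C) p d (z : int) : ldiff f p d -> ldiff (fun x => f x ^ z) p (z%:~R *: d).
Proof.
case: z => t h; first exact: ldiffX.
have := ldiffV (ldiffX t.+1 h); congr ldiff.
by rewrite NegzE mulrNz scaleNr.
Qed.

Lemma ldiff_monomial p a : stratum p ->
  ldiff (fun x => \prod_j \prod_l pole_ratio x j l ^ a j l) p
    (\sum_j \sum_l (a j l)%:~R *: dratio p j l).
Proof.
move=> sp; apply: ldiff_prod => j _; apply: ldiff_prod => l _.
exact/ldiffXz/ldiff_pole_ratio.
Qed.

(* Clearing a denominator only rescales the gradient on the zero locus. *)
Lemma grad_cleared p (f D : mp) (g : point -> C) dg : stratum p ->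
  (forall q, stratum q -> ev q f = ev q D * g q) -> g p = 0 -> sdiff1 g p dg ->
  grad f p = ev p D *: dg.
Proof.
move=> sp fE gp dgp; apply: (sdiff1_unique (sdiff1_ev f p)).
have [r r0 hr] := stratum_ball sp.
apply: (@sdiff1_near _ _ (fun q => ev q D * g q)).
  by exists r => // x hx; rewrite fE //; exact: hr.
apply: sdiff1_ext (sdiff1_mul (sdiff1_ev D p) dgp) => //.
by rewrite gp scale0r add0r.
Qed.

End StratumPolynomials.

(* Unfolding these polynomials makes unification intractable. *)
Opaque resid_num resid_den monomial_num monomial_den discr_poly.

Section LocusPolynomials.
Context (R : realType) (m n k : nat) (e : 'I_m.+1 -> nat).
Hypotheses (he : forall i, (0 < e i)%N) (hsum : (\sum_(i < m.+1) e i)%N = n) (hk : (k <= m)%N).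
Local Notation C := R[i].
Local Notation point := 'rV[C]_(1 + (m + n)).
Local Notation mp := (mpoly (1 + (m + n)) C).
Local Notation tpi := (two_pi_i R).
Context (A : 'M[rat]_(k, m)) (B : 'M[C]_(k, n.+1)) (q : 'I_n -> rat).
Hypothesis hB : forall i l, l != ord_max -> B i l = 0.
Hypothesis fA : row_free A.
Context (H : 'M[rat]_k) (a : 'I_k -> 'I_m -> 'I_n.+1 -> int) (s : 'I_m -> 'I_n.+1 -> 'I_k -> int).
Hypotheses (uH : H \in unitmx)
  (ha : forall i j l, (H *m A) i j * residue_ratio q l = (a i j l)%:~R)
  (hs : forall i i', \sum_j \sum_l a i j l * s j l i' = (i == i')%:R).
Implicit Types (p : point).

Let S : set point := period_locus e (period_matrix A B q).
Let hS p : S p <-> [/\ stratum p, resid_cond e q p & monomial_cond B H a p] :=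
  period_locusP he hsum hB uH ha hs p.

Let cst i : C := cexp (- (tpi * twist H (fun i' => B i' ord_max) i)).

(** The monomial conditions and then the residue conditions, multiplied by denominators that do not
    vanish on the stratum. *)
Definition locus_eq (x : 'I_(k + n)) : mp :=
  match fintype.split x with
  | inl i => monomial_num R (a i) - mpolyC _ (cst i) * monomial_den R (a i)
  | inr i => resid_num R e (lift ord_max i) * resid_den R m ord_max -
      mpolyC _ (ratr (residue_ratio q (lift ord_max i))) * (resid_num R e ord_max * resid_den R m (lift ord_max i))
  end.

Lemma locus_eq_l i : locus_eq (lshift n i) = monomial_num R (a i) - mpolyC _ (cst i) * monomial_den R (a i).
Proof. by rewrite /locus_eq (unsplitK (inl _ i)). Qed.

Lemma locus_eq_r i : locus_eq (rshift k i) = resid_num R e (lift ord_max i) * resid_den R m ord_max -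
  mpolyC _ (ratr (residue_ratio q (lift ord_max i))) * (resid_num R e ord_max * resid_den R m (lift ord_max i)).
Proof. by rewrite /locus_eq (unsplitK (inr _ i)). Qed.

Lemma ev_locus_eq_l p i : stratum p -> ev p (locus_eq (lshift n i)) =
  ev p (monomial_den R (a i)) * (\prod_j \prod_l pole_ratio p j l ^ a i j l - cst i).
Proof.
move=> sp; rewrite locus_eq_l; apply: etrans (ev_subCM _ _ _ _) _.
apply: etrans (congr1 (fun z => z - _) (ev_monomial (a i) sp)) _.
by rewrite mulrBr [cst i * _]mulrC.
Qed.

Lemma ev_locus_eq_r p i : stratum p -> ev p (locus_eq (rshift k i)) =
  ev p (resid_den R m (lift ord_max i) * resid_den R m ord_max) *
  (resid e p (lift ord_max i) - ratr (residue_ratio q (lift ord_max i)) * resid e p ord_max).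
Proof.
move=> sp; rewrite locus_eq_r; apply: etrans (ev_subCM _ _ _ _) _; rewrite !ev_resid.
set r := ratr _; set u := resid_num _ _ _; set v := resid_den _ _ _; set u' := resid_num _ _ _; set v' := resid_den _ _ _.
rewrite (evM p u) (evM p u') (evM p v').
have d1 := ev_resid_den (lift ord_max i) sp; have d2 := ev_resid_den ord_max sp.
rewrite -/v -/v' in d1 d2 *; move: (ev p u) (ev p u') (ev p v) (ev p v') r d1 d2 => x x' y y' r y0 y'0.
by field; rewrite y0 y'0.
Qed.

Definition locus_eqs : seq mp := [tuple locus_eq x | x < k + n].

Lemma period_locus_locus : S = locus (discr_poly R m n) locus_eqs.
Proof.
apply/seteqP; split => p.
  move=> /hS[sp rc mc]; split; first by rewrite ev_discr; exact/stratumP.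
  move=> g /tnthP[x ->]; rewrite tnth_mktuple; case: (split_ordP x) => i ->.
    by rewrite ev_locus_eq_l // mc subrr mulr0.
  by rewrite ev_locus_eq_r // rc subrr mulr0.
move=> [hd hg]; have sp : stratum p by apply/stratumP; rewrite -ev_discr.
have hx x : ev p (locus_eq x) = 0 by apply: hg; apply/tnthP; exists x; rewrite tnth_mktuple.
apply/hS; split => //.
- move=> l; case: (unliftP ord_max l) => [i ->|->]; last by rewrite residue_ratio_max rmorph1 mul1r.
  have /eqP := hx (rshift k i); rewrite ev_locus_eq_r // mulf_eq0 evM mulf_eq0.
  by rewrite !(negPf (ev_resid_den _ sp)) /= subr_eq0 => /eqP.
- move=> i; have /eqP := hx (lshift n i); rewrite ev_locus_eq_l // mulf_eq0.
  by rewrite (negPf (ev_monomial_den _ sp)) /= subr_eq0 => /eqP.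
Qed.

(** The gradients are the columns of [J T]. Here [J] consists of the covectors of
    [period_covectors_inj], hence is invertible, and [T] is block diagonal with explicit left
    inverses of its blocks. The rows of the resulting left inverse of [J T] form the dual family. *)
Lemma locus_full_rank p : S p -> full_rank locus_eqs p.
Proof.
move=> /hS[sp rc mc]; have R0 : resid e p ord_max != 0 by apply: resid_neq0.
have hR l : exists d, sdiff1 (fun p' => resid e p' l) p d by exact: sdiffable_resid.
have [dR hdR] := choice hR.
pose J1 : 'M[C]_(1 + (m + n), m) := \matrix_(x, j) (\sum_l resid e p l *: dratio p j l) x 0.
pose J2 : 'M[C]_(1 + (m + n), n.+1) := \matrix_(x, l) dR l x 0.
pose J : 'M[C]_(1 + (m + n), m + n.+1) := row_mx J1 J2.
have Jl j : col (lshift n.+1 j) J = \sum_l resid e p l *: dratio p j l.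
  by apply/colP => x; rewrite mxE row_mxEl mxE.
have Jr l : col (rshift m l) J = dR l.
  by apply/colP => x; rewrite mxE row_mxEr mxE.
have [|v vJ|E [JE EJ]] := @injective_inverse R _ _ J.
- by rewrite add1n addnS.
- apply: (period_covectors_inj he hsum sp hdR) => [l|j].
    by rewrite -Jr mulmx_colE vJ mxE.
  have := congr1 (fun u : 'rV_(m + n.+1) => u 0 (lshift n.+1 j)) vJ.
  rewrite /= -mulmx_colE Jl [X in _ = X]mxE mulmx_sumr summxE => E; rewrite -[RHS]E.
  by apply: eq_bigr => l _; rewrite mulmx_scaleE.
(* On the locus the monomial equals [cst i], so its differential is [cst i] times the sum of the
   [a_ijl dratio_jl]. With [a_ijl = (H A)_ij r_l] and [r_l = R_l / R_n] this is a multiple of a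
   combination of the columns of [J1]; [monomial_den] comes from clearing denominators. *)
pose x i : C := ev p (monomial_den R (a i)) * cst i / resid e p ord_max.
have x0 i : x i != 0.
  apply: mulf_neq0; last by rewrite invr_eq0.
  by apply: mulf_neq0; [exact: ev_monomial_den|exact: cexp_neq0].
pose y i : C := ev p (resid_den R m (lift ord_max i) * resid_den R m ord_max).
have y0 i : y i != 0 by rewrite /y evM mulf_neq0 // ev_resid_den.
pose rr i : C := ratr (residue_ratio q (lift ord_max i)).
pose T1 : 'M[C]_(m, k) := \matrix_(j, i) (x i * ratr ((H *m A) i j)).
pose T2 : 'M[C]_(n.+1, n) := \matrix_(l, i) (y i * ((l == lift ord_max i)%:R - rr i * (l == ord_max)%:R)).
pose T : 'M[C]_(m + n.+1, k + n) := block_mx T1 0 0 T2.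
have gradT z : grad (locus_eq z) p = col z (J *m T).
  have -> : col z (J *m T) = J *m col z T by rewrite !colE mulmxA.
  case: (split_ordP z) => i ->.
    have -> : col (lshift n i) T = col_mx (col i T1) 0.
      by apply/colP => w; rewrite mxE; case: (split_ordP w) => w' ->; rewrite ?block_mxEul ?block_mxEdl ?col_mxEu ?col_mxEd !mxE.
    rewrite mul_row_col mulmx0 addr0.
    have dm := ldiff_monomial (a i) sp; have [_ dm'] := dm.
    have ds := sdiff1_sub dm' (sdiff1_cst (cst i) p); rewrite subr0 mc -/(cst i) in ds.
    rewrite (grad_cleared sp (fun q sq => ev_locus_eq_l i sq) _ ds); last by rewrite mc subrr.
    apply/colP => w; rewrite scalerA mxE summxE mulr_sumr [RHS]mxE; apply: eq_bigr => j _.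
    have -> : J1 w j = \sum_l resid e p l * dratio p j l w 0.
      by rewrite mxE summxE; apply: eq_bigr => l _; rewrite mxE.
    have -> : col i T1 j 0 = x i * ratr ((H *m A) i j) by rewrite mxE mxE.
    rewrite summxE mulr_sumr mulr_suml; apply: eq_bigr => l _.
    rewrite mxE rc -(ratr_int C (a i j l)) -ha rmorphM /= /x -/(cst i).
    by field.
  have -> : col (rshift k i) T = col_mx 0 (col i T2).
    by apply/colP => w; rewrite mxE; case: (split_ordP w) => w' ->; rewrite ?block_mxEur ?block_mxEdr ?col_mxEu ?col_mxEd !mxE.
  rewrite mul_row_col mulmx0 add0r.
  have ds := sdiff1_sub (hdR (lift ord_max i)) (sdiff1_scale (rr i) (hdR ord_max)).
  rewrite (grad_cleared sp (fun q sq => ev_locus_eq_r i sq) _ ds); last by rewrite rc subrr.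
  apply/colP => w; rewrite mxE [RHS]mxE (bigD1 (lift ord_max i)) //= (bigD1 ord_max) /=; last exact: neq_lift.
  rewrite big1 ?addr0 => [|l /andP[l1 l2]]; last by rewrite !mxE (negPf l1) (negPf l2) mulr0 subr0 !mulr0.
  rewrite !mxE !eqxx (negPf (neq_lift _ _)) eq_sym (negPf (neq_lift _ _)) /y /= mulr1n mulr0n.
  by move: (ev p _) => u; ring.
(* Full row rank of [A] enters here: a right inverse of [H A] provides the left inverse of [T1]. *)
have [Y HAY] : exists Y, H *m A *m Y = 1%:M.
  apply/row_freeP; rewrite /row_free mxrankMfree // mxrank_unit //.
pose W1 : 'M[C]_(k, m) := \matrix_(i, j) ((x i)^-1 * ratr (Y j i)).
pose W2 : 'M[C]_(n, n.+1) := \matrix_(i, l) ((y i)^-1 * (l == lift ord_max i)%:R).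
have W1T : W1 *m T1 = 1%:M.
  apply/matrixP => i i'; move/matrixP/(_ i' i): HAY; rewrite !mxE => E1.
  transitivity ((x i)^-1 * x i' * ratr (\sum_j (H *m A) i' j * Y j i)).
    by rewrite rmorph_sum mulr_sumr; apply: eq_bigr => j _; rewrite !mxE rmorphM /=; ring.
  rewrite E1 eq_sym; case: eqVneq => [->|_]; last by rewrite rmorph0 mulr0.
  by rewrite mulVf // rmorph1 mulr1.
have W2T : W2 *m T2 = 1%:M.
  apply/matrixP => i i'; rewrite mxE (bigD1 (lift ord_max i)) //= big1 ?addr0 => [|l li]; last first.
    by rewrite !mxE (negPf li) mulr0 mul0r.
  rewrite !mxE eqxx (inj_eq lift_inj) eq_sym [lift _ _ == _]eq_sym (negPf (neq_lift _ _)) mulr1 mulr0 subr0 eq_sym.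
  case: eqVneq => [->|_]; last by rewrite !mulr0.
  by rewrite mulr1 mulVf.
pose W := block_mx W1 0 0 W2 *m E.
have WJT : W *m (J *m T) = 1%:M.
  rewrite mulmxA /W -[_ *m E *m J]mulmxA EJ mulmx1 mulmx_block W1T W2T !mulmx0 !mul0mx !addr0 add0r.
  by rewrite -scalar_mx_block.
exists (fun i => if insub i is Some i' then row i' W else 0) => i j.
rewrite size_tuple => hi hj; rewrite insubT.
have -> : nth 0 locus_eqs j = locus_eq (Ordinal hj) by rewrite -(nth_mktuple _ 0 (Ordinal hj)).
rewrite gradT mulmx_colE -row_mul WJT !mxE -val_eqE /=.
by [].
Qed.

Lemma period_locus_pure_codim : pure_codim S (k + n).
Proof.
move=> Z; rewrite period_locus_locus; apply: has_dim_component.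
  by rewrite size_tuple; lia.
by move=> p; rewrite -period_locus_locus; exact: locus_full_rank.
Qed.

Lemma period_locus_has_dim : S !=set0 -> has_dim S (m + n.+1 - (k + n)).
Proof.
rewrite period_locus_locus; apply: locus_has_dim.
  by rewrite size_tuple; lia.
by move=> p; rewrite -period_locus_locus; exact: locus_full_rank.
Qed.

Lemma period_locus_algebraic : algebraic S.
Proof.
rewrite period_locus_locus; have [F cF ->] := locus_closed (discr_poly R m n) locus_eqs.
exists F => //; apply/seteqP; split => p [h Fp]; split => //.
  by apply/stratumP; rewrite -ev_discr.
by rewrite /= ev_discr; exact/stratumP.
Qed.

Lemma period_locus_closed p : stratum p -> ~ S p ->
  exists2 r : R, 0 < r & forall p', nrm (p' - p) < r -> ~ S p'.
Proof.
move=> sp; rewrite period_locus_locus => nS.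
have [g gin gp] : exists2 g, g \in locus_eqs & ev p g != 0.
  apply: contrapT => no; apply: nS; split; first by rewrite ev_discr; exact/stratumP.
  by move=> g gin; apply/eqP; apply: contrapT => /negP h; apply: no; exists g.
have [r r0 hr] := ev_near_neq0 gp; exists r => // p' /hr gp' [_ /(_ g gin)/eqP].
by rewrite (negPf gp').
Qed.

End LocusPolynomials.

(** * The locus inside a period chart *)

Section ChartLocus.
Context (R : realType) (m n k : nat) (e : 'I_m.+1 -> nat).
Hypotheses (he : forall i, (0 < e i)%N) (hsum : (\sum_(i < m.+1) e i)%N = n) (hk : (k <= m)%N).
Local Notation C := R[i].
Local Notation point := 'rV[C]_(1 + (m + n)).
Local Notation tpi := (two_pi_i R).
Context (A : 'M[rat]_(k, m)) (B : 'M[C]_(k, n.+1)) (q : 'I_n -> rat).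
Hypothesis hB : forall i l, l != ord_max -> B i l = 0.
Context (H : 'M[rat]_k) (a : 'I_k -> 'I_m -> 'I_n.+1 -> int) (s : 'I_m -> 'I_n.+1 -> 'I_k -> int).
Hypotheses (uH : H \in unitmx)
  (ha : forall i j l, (H *m A) i j * residue_ratio q l = (a i j l)%:~R)
  (hs : forall i i', \sum_j \sum_l a i j l * s j l i' = (i == i')%:R).
Implicit Types (p : point) (v : 'I_k -> int) (U : set point) (c : point -> 'I_m -> R -> C).

Let S : set point := period_locus e (period_matrix A B q).
Let hS p : S p <-> [/\ stratum p, resid_cond e q p & monomial_cond B H a p] :=
  period_locusP he hsum hB uH ha hs p.
Let b i : C := twist H (fun i' => B i' ord_max) i.

Lemma chart_continuous U c p : period_chart e U c -> U p -> forall eps : R, 0 < eps ->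
  exists2 r : R, 0 < r & forall p', nrm (p' - p) < r ->
    U p' /\ nrm (period_map e c p' - period_map e c p) < eps.
Proof.
move=> [oU _ _ _ [dP _ _]] Up eps eps0.
have /nbhs_nrmP[r1 r10 hr1] : nbhs p U by exact: open_nbhs_nbhs.
have cP := differentiable_continuous (dP p Up).
have /cP/nbhs_nrmP[r2 r20 hr2] : nbhs (period_map e c p) [set v | nrm (v - period_map e c p) < eps].
  by apply/nbhs_nrmP; exists eps.
exists (Num.min r1 r2); first by rewrite lt_min r10.
by move=> p'; rewrite lt_min => /andP[/hr1 ? /hr2].
Qed.

Lemma resid_chart U c p l : period_chart e U c -> U p ->
  period_map e c p 0 (rshift m l) = tpi * resid e p l.
Proof. by move=> ch Up; rewrite (period_coord hsum ch Up) row_mxEr mxE. Qed.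

(* On the locus the defect [E] below takes values in [2 pi i R_n Z], hence it is
   locally constant. *)
Lemma chart_locus_near U c p v : period_chart e U c -> U p -> S p ->
  (forall i, log_sum a (charts_log c p) i + tpi * b i = tpi *~ v i) ->
  exists2 r : R, 0 < r & forall p', nrm (p' - p) < r -> U p' /\
    (S p' <-> shifted_matrix A B q H v *m (period_map e c p')^T = 0).
Proof.
move=> ch Up Sp hv; have [sp rc mc] := (hS p).1 Sp.
have t0 := two_pi_i_neq0 R.
(* Linear forms on the period space whose values, once the residue ratios hold, are the residue at
   [y_n] times the defect of the equations for the shift [v]. *)
pose D : 'M[C]_(m + n.+1, k) := col_mx (\matrix_(j, i) ratr ((H *m A) i j))
  (\matrix_(l, i) if l == ord_max then b i - (v i)%:~R else 0).
have DE p' i : U p' -> resid_cond e q p' -> (period_map e c p' *m D) 0 i =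
    resid e p' ord_max * (log_sum a (charts_log c p') i + tpi * b i - tpi *~ v i).
  move=> Up' rc'; rewrite (period_coord hsum ch Up') mul_row_col mxE.
  have -> : ((\row_j \sum_l resid e p' l * charts_log c p' j l) *m (\matrix_(j, i) ratr ((H *m A) i j))) 0 i =
      resid e p' ord_max * log_sum a (charts_log c p') i.
    rewrite -(log_sumE ha _ _ rc') mxE; apply: eq_bigr => j _.
    by rewrite [X in X * _]mxE [X in _ * X]mxE mulrC.
  rewrite mxE (bigD1 ord_max) //= big1 => [|l lm]; last by rewrite !mxE (negPf lm) mulr0.
  by rewrite !mxE eqxx -[tpi *~ _]mulrzr; ring.
have Rp : resid e p ord_max != 0 by apply: resid_neq0.
pose mu := absc (tpi * resid e p ord_max).
have mu0 : 0 < mu by rewrite absc_gt0 mulf_neq0.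
have [K K0 hK] := mulmx_bounded D.
(* Within this distance [|2 pi i R_n|] stays above [mu / 2] while the defect drops below [mu / 2];
   an integral multiple of [2 pi i R_n] that small is 0. *)
have eps0 : 0 < Num.min (mu / 2) (mu / (4 * K)) by rewrite lt_min !divr_gt0 // mulr_gt0.
have [r r0 hr] := chart_continuous ch Up eps0; exists r; first exact: r0.
move=> p' /hr[Up' near]; split; first exact: Up'.
have [sp' _ _ hL'] := chart_avoids ch Up'.
split => [Sp'|/(shifted_matrix_chart hsum hB uH ha v ch Up')[rc' hv']]; last first.
  by apply/hS; split => //; apply: (monomial_condP B H a hL').2; exists v.
have [_ rc' mc'] := (hS p').1 Sp'.
have [v' hv'] := (monomial_condP B H a hL').1 mc'.
apply/(shifted_matrix_chart hsum hB uH ha v ch Up'); split; first exact: rc'.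
move=> i; rewrite -/(b i) hv'; congr (_ *~ _).
move: near; rewrite lt_min => /andP[near1 near2].
have mu2 : mu / 2 < absc (tpi * resid e p' ord_max).
  have := ler_abscD (tpi * resid e p' ord_max) (tpi * resid e p ord_max - tpi * resid e p' ord_max).
  rewrite addrC subrK -/mu abscB.
  have := ler_coord_nrm (period_map e c p' - period_map e c p) (rshift m ord_max).
  have -> : (period_map e c p' - period_map e c p) 0 (rshift m ord_max) =
      tpi * resid e p' ord_max - tpi * resid e p ord_max.
    have rB (X Y : 'rV[C]_(m + n.+1)) x : (X - Y) 0 x = X 0 x - Y 0 x by rewrite !mxE.
    apply: etrans (rB _ _ _) _.
    exact: (congr2 (fun x y => x - y) (resid_chart ord_max ch Up') (resid_chart ord_max ch Up)).
  by move: near1; set X := nrm _; lra.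
have : absc ((period_map e c p' *m D) 0 i) < mu / 2.
  have -> : (period_map e c p' *m D) 0 i = ((period_map e c p' - period_map e c p) *m D) 0 i.
    have -> : (period_map e c p' - period_map e c p) *m D = period_map e c p' *m D - period_map e c p *m D by exact: mulmxBl.
    have rB (X Y : 'rV[C]_k) x : (X - Y) 0 x = X 0 x - Y 0 x by rewrite !mxE.
    apply/esym; apply: etrans (rB _ _ _) _.
    have z0 := DE p i Up rc; rewrite (hv i) subrr mulr0 in z0.
    by apply: etrans (congr1 (fun z => _ - z) z0) _; exact: subr0.
  apply: le_lt_trans (ler_coord_nrm _ _) _; apply: le_lt_trans (hK _) _.
  move: near2; rewrite ltr_pdivlMr ?mulr_gt0 //.
  set X := nrm _; move=> near2; have -> : K * X = X * (4 * K) / 4 by field.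
  by lra.
have -> := DE p' i Up' rc'; rewrite hv' -mulrzBr -[tpi *~ _]mulrzr mulrCA mulrA abscM.
move=> small; apply/eqP; rewrite -subr_eq0; apply: contraTT small => z0.
rewrite -leNgt; apply: le_trans (ltW mu2) _.
rewrite -[leLHS]mulr1 ler_wpM2l ?absc_ge0 //.
have -> : ((v' i - v i)%:~R : C) = ((v' i - v i)%:~R : R)%:C by rewrite rmorph_int.
rewrite absc_real -intr_norm -[1]/(1%:~R) ler_int.
by rewrite -gtz0_ge1 normr_gt0.
Qed.

Lemma period_locus_well_defined : well_defined e (period_matrix A B q).
Proof.
split; first exact: (period_locus_algebraic he hsum hB uH ha hs).
move=> U c p ch Up Mp; have Sp : S p by exists U, c.
have hv : forall i, log_sum a (charts_log c p) i + tpi * b i = tpi *~ 0.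
  by move: Mp; rewrite -(shifted_matrix0 _ _ _ H) => /(shifted_matrix_chart hsum hB uH ha _ ch Up)[].
have [r r0 hr] := @chart_locus_near U c p (fun=> 0) ch Up Sp hv.
apply/nbhs_nrmP; exists r; first exact: r0.
by move=> p' /hr[_ E]; rewrite shifted_matrix0 in E.
Qed.

(** Near a point of the locus a single subspace suffices, the kernel for the shift [v] found there;
    [pid_mx] pads the matrix with zero rows to make it square. Off the locus, which is closed in the
    stratum, the empty union works. *)
Lemma period_locus_linear_over (K : {pred C}) :
  (forall v, (pid_mx (k + n) : 'M[C]_(m + n.+1, k + n)) *m shifted_matrix A B q H v \is a mxOver K) ->
  linear_over e K S.
Proof.
move=> hK U c p ch Up; have [sp _ _ hL] := chart_avoids ch Up.
have [Sp|nS] := pselect (S p); last first.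
  exists [::]; split => //; have [r r0 hr] := period_locus_closed he hsum hB uH ha hs sp nS.
  apply/nbhs_nrmP; exists r; first exact: r0.
  by move=> p' /hr nS'; split=> [/nS' []|[X]]; rewrite ?in_nil.
have [_ rc mc] := (hS p).1 Sp; have [v hv] := (monomial_condP B H a hL).1 mc.
have [r r0 hr] := @chart_locus_near U c p v ch Up Sp hv.
pose T : 'M[C]_(m + n.+1, k + n) := pid_mx (k + n).
exists [:: T *m shifted_matrix A B q H v]; split; first by move=> X; rewrite inE => /eqP ->; exact: hK.
apply/nbhs_nrmP; exists r; first exact: r0.
move=> p' /hr[Up' E].
have TT : (pid_mx (k + n) : 'M[C]_(k + n, m + n.+1)) *m T = 1%:M.
  rewrite pid_mx_id; last by lia.
  by apply/matrixP => i j; rewrite !mxE ltn_ord andbT.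
split => [/E Mp|[X]].
  by eexists; [exact: mem_head|rewrite -mulmxA Mp mulmx0].
rewrite inE => /eqP -> Mp; apply/E.
by rewrite -[LHS]mul1mx -TT -!mulmxA [T *m (_ *m _)]mulmxA Mp mulmx0.
Qed.

Lemma shifted_matrix_over (K : divringClosed C) v : B \is a mxOver K ->
  (pid_mx (k + n) : 'M[C]_(m + n.+1, k + n)) *m shifted_matrix A B q H v \is a mxOver K.
Proof.
move=> BK; have ratK (x : rat) : ratr x \in K.
  rewrite /ratr; apply: rpred_div; exact: rpred_int.
apply/mxOverP => i j; rewrite mxE; apply: rpred_sum => l _; apply: rpredM.
  by rewrite mxE rpred_nat.
rewrite /shifted_matrix /period_matrix; case: (split_ordP l) => l' ->; case: (split_ordP j) => j' ->.
- by rewrite block_mxEul mxE.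
- rewrite block_mxEur mxE [X in _ + X]mxE col_deltaE rpredD ?(mxOverP BK) // rpredN.
  by case: ifP => _; rewrite ?rpred0 // mxE rpred_sum // => i' _; rewrite rpredM ?rpred_int.
- by rewrite block_mxEdl mxE rpred0.
- by rewrite block_mxEdr mxE; case: ifP => _; rewrite ?ratK // rpred_nat.
Qed.

End ChartLocus.

(** * Bi-algebraicity *)

Section LinearSubspace.
Context (R : realType) (r N : nat) (M : 'M[R[i]]_(r, N)).
Local Notation C := R[i].
Implicit Types (w x : 'rV[C]_N).

Definition kernel_of : set 'rV[C]_N := [set w | M *m w^T = 0].

Lemma kernelP w : kernel_of w <-> w *m M^T = 0.
Proof. by split => [h|h]; apply: trmx_inj; rewrite trmx_mul ?trmxK trmx0. Qed.

Lemma kernelD w w' : kernel_of w -> kernel_of w' -> kernel_of (w + w').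
Proof. by move=> h h'; rewrite /kernel_of /= linearD /= mulmxDr h h' addr0. Qed.

Lemma kernelZ (z : C) w : kernel_of w -> kernel_of (z *: w).
Proof. by move=> h; rewrite /kernel_of /= linearZ /= -scalemxAr h scaler0. Qed.

Lemma kernelB w w' : kernel_of w -> kernel_of w' -> kernel_of (w - w').
Proof. by move=> h h'; rewrite -scaleN1r; apply: kernelD => //; exact: kernelZ. Qed.

(** A linear projection onto the kernel; composing with it turns a statement about functions on the
    kernel into one about functions on the ambient space. *)
Lemma kernel_projection : exists Pi : 'M[C]_N,
  (forall x, kernel_of (x *m Pi)) /\ (forall w, kernel_of w -> w *m Pi = w).
Proof.
exists (pinvmx (kermx M^T) *m kermx M^T); split => [x|w /kernelP h].
  by apply/kernelP/sub_kermxP; rewrite mulmxA submxMl.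
by rewrite mulmxA mulmxKpV // sub_kermx h.
Qed.

(** The identity theorem relative to the linear space: [identity_rV] applied to [G] after the
    projection centred at [p0]. Here [K] depends on the projection alone, so shrinking by [K] is
    uniform in [G]. *)
Lemma identity_kernel p0 : kernel_of p0 -> exists2 K : R, 0 < K &
  forall (G : 'rV[C]_N -> C) (eps : R) w' w, 0 < eps ->
    (forall x, nrm (x - p0) < eps -> differentiable G x) ->
    nrm (w' - p0) < eps / K -> nrm (w - p0) < eps / K -> kernel_of w' -> kernel_of w ->
    (exists2 rho : R, 0 < rho & forall x, nrm (x - w') < rho -> kernel_of x -> G x = 0) -> G w = 0.
Proof.
move=> kp0; have [Pi [Pi1 Pi2]] := kernel_projection; have [K K0 hK] := mulmx_bounded Pi.
have c0 : 0 < 9 * K + 1 by lra.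
(* With [b] and [c] the distances of [w'] and [w] from [p0], the ball of radius [4 nrm (w - w')]
   around [w'] lies within [5 b + 4 c] of [p0]; the projection multiplies this by at most [K]. *)
exists (9 * K + 1) => // G eps w' w e0 dG; rewrite !ltr_pdivlMr //; move=> hw' hw kw' kw [rho rho0 hG].
have piE x : kernel_of x -> p0 + (x - p0) *m Pi = x.
  by move=> kx; rewrite Pi2 ?subrKC //; exact: kernelB.
have n1 := nrm_ge0 (w' - p0); have n2 := nrm_ge0 (w - p0).
rewrite -[w]piE //; apply: (@identity_rV R N (fun x => G (p0 + (x - p0) *m Pi)) w' w); last first.
  exists (rho / K) => [|x hx]; first by rewrite divr_gt0.
  apply: hG; last by apply: kernelD.
  have -> : p0 + (x - p0) *m Pi - w' = (x - w') *m Pi.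
    transitivity (p0 + (x - p0) *m Pi - (p0 + (w' - p0) *m Pi)); first by rewrite (piE w').
    by rewrite opprD addrACA subrr add0r -mulmxBl opprB addrA subrK.
  by apply: le_lt_trans (hK _) _; rewrite mulrC -ltr_pdivlMr.
move=> x hx; apply: (@differentiable_comp _ _ _ _ (fun x => p0 + (x - p0) *m Pi) G); last first.
  apply: dG; rewrite addrC addKr; apply: le_lt_trans (hK _) _.
  have h1 := ler_nrm_trans w' x p0; have h2 := ler_nrm_trans p0 w w'.
  rewrite (nrmBC p0) in h2.
  set a := nrm (x - p0) in h1 *; set b := nrm (w' - p0) in h1 h2 hw' n1 *; set c := nrm (w - p0) in h2 hw n2 *.
  have ac : a <= 5 * b + 4 * c by lra.
  have : K * a <= K * (5 * b + 4 * c) by rewrite ler_wpM2l // ltW.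
  move=> h3; apply: le_lt_trans h3 _.
  have k1 : K * b * 9 + b < eps by move: hw'; rewrite mulrDr mulr1 mulrCA mulrC; lra.
  have k2 : K * c * 9 + c < eps by move: hw; rewrite mulrDr mulr1 mulrCA mulrC; lra.
  lra.
apply: (@sdiff_differentiable R N N _ x Pi) => eps' eps'0; exists 1 => // u v _ _.
have -> : p0 + (u - p0) *m Pi - (p0 + (v - p0) *m Pi) - (u - v) *m Pi = 0.
  by rewrite opprD addrACA subrr add0r -mulmxBl opprB addrA subrK subrr.
by rewrite nrm0 mulr_ge0 ?nrm_ge0 // ltW.
Qed.

Definition linear_form (j : 'I_r) : mpoly N C := \sum_x mpolyC N (M j x) * mpolyX C (mnm1 x).

Lemma ev_linear_form w j : ev w (linear_form j) = (M *m w^T) j 0.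
Proof.
rewrite ev_sum mxE; apply: eq_bigr => x _; rewrite mxE.
by rewrite (evM w (mpolyC _ _)) evC evX.
Qed.

Lemma kernel_locus : kernel_of = locus 1 [tuple linear_form j | j < r].
Proof.
apply/seteqP; split => w.
  move=> h; split; first by rewrite ev1 oner_eq0.
  by move=> g /tnthP[j ->]; rewrite tnth_mktuple ev_linear_form h mxE.
move=> [_ h]; apply/colP => j; rewrite -ev_linear_form mxE; apply: h.
by apply/tnthP; exists j; rewrite tnth_mktuple.
Qed.

Lemma kernel_has_dim d : (r + d)%N = N -> row_free M -> has_dim kernel_of d.
Proof.
move=> hN /row_freeP[Y MY]; rewrite kernel_locus; apply: locus_has_dim.
- by rewrite size_tuple.
- move=> p _; exists (fun i => if insub i is Some i' then (col i' Y)^T else 0) => i j.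
  rewrite size_tuple => hi hj; rewrite insubT.
  have -> : nth 0 [tuple linear_form j | j < r] j = linear_form (Ordinal hj) by rewrite -(nth_mktuple _ 0 (Ordinal hj)).
  have -> : grad (linear_form (Ordinal hj)) p = (row (Ordinal hj) M)^T.
    have ds : sdiff1 (fun w => ev w (linear_form (Ordinal hj))) p (\sum_x M (Ordinal hj) x *: delta_mx x 0).
      have ds := @sdiff1_sum R N 'I_N (index_enum _) xpredT (fun (x : 'I_N) (w : 'rV[C]_N) => M (Ordinal hj) x * w 0 x)
        (fun x : 'I_N => M (Ordinal hj) x *: delta_mx x 0) p (fun (x : 'I_N) _ => sdiff1_scale _ (sdiff1_coord x p)).
      apply: (sdiff1_ext _ erefl ds) => w.
      by rewrite ev_linear_form mxE; apply: eq_bigr => x _; rewrite mxE.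
    rewrite (sdiff1_unique (sdiff1_ev _ _) ds); apply/colP => x.
    rewrite summxE (bigD1 x) //= big1 => [|y yx]; last by rewrite !mxE eq_sym (negPf yx) mulr0.
    by rewrite !mxE !eqxx mulr1 addr0.
  rewrite -trmx_mul -row_mul.
  move/matrixP/(_ (Ordinal hj) (Ordinal hi)): MY; rewrite !mxE eq_sym -val_eqE /= => <-.
  by apply: eq_bigr => x _; rewrite !mxE.
- by exists 0; split; [rewrite ev1 oner_eq0|move=> g /tnthP[j ->]; rewrite tnth_mktuple ev_linear_form trmx0 mulmx0 mxE].
Qed.

(** A polynomial vanishing on a ball of the linear space vanishes on all of it by [identity_kernel],
    and the linear space is itself closed. *)
Lemma zariski_closure_ball (X : set 'rV[C]_N) p0 (eps : R) : kernel_of p0 -> 0 < eps ->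
  X `<=` kernel_of -> (forall w, nrm (w - p0) < eps -> kernel_of w -> X w) ->
  zariski_closure X = kernel_of.
Proof.
move=> kp0 e0 Xk ball; apply/seteqP; split => [w|w kw F [[I FI] XF]].
  apply; split => //; rewrite kernel_locus.
  by exists [set g | g \in [tuple linear_form j | j < r]]; apply/seteqP; split => x;
    [move=> [_ h] g /h|move=> h; split => [|g /h //]; rewrite ev1 oner_eq0].
rewrite FI => f If; have [K K0 idK] := identity_kernel kp0.
(* Polynomials are differentiable everywhere, so the radius is free; this one puts the given [w]
   within [e1 / K] of [p0]. *)
pose e1 := (nrm (w - p0) + 1) * K.
apply: (idK (fun w => ev w f) e1 p0 w) => //.
- by rewrite mulr_gt0 // ltr_wpDl ?nrm_ge0.
- by move=> x _; exact: sdiff1_differentiable (sdiff1_ev f x).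
- by rewrite subrr nrm0 mulfK ?gt_eqF // ltr_wpDl ?nrm_ge0.
- by rewrite mulfK ?gt_eqF // ltrDl.
- exists eps => // x hx kx; have : F x by apply: XF; exact: ball.
  by rewrite FI; apply.
Qed.

End LinearSubspace.

Lemma differentiable_pullback (R : realType) (N N' : nat) (f : 'rV[R[i]]_N -> 'rV[R[i]]_N') p
    (P : set 'rV[R[i]]_N') : differentiable f p -> nbhs (f p) P ->
  exists2 d : R, 0 < d & forall x, nrm (x - p) < d -> P (f x).
Proof. by move=> /differentiable_continuous cf /cf/nbhs_nrmP. Qed.

(** * Analytic components of a set that is linear in local coordinates *)

Section AnalyticComponent.
Context (R : realType) (r N N' : nat) (T : topologicalType).
Local Notation C := R[i].
Context (pr : T -> 'rV[C]_N) (phi : T -> 'rV[C]_N') (Y : set T) (gs : seq (mpoly N C)).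
Implicit Types (t u : T) (w : 'rV[C]_N') (Z : set T).

(* [gamma] inverts [phi] near [t], and there the coordinates [phi] carry [Y] to
   the linear space [kernel_of M]. *)
Definition linear_chart t (M : 'M[C]_(r, N')) (gamma : 'rV[C]_N' -> T)
    (psi : 'rV[C]_N' -> 'rV[C]_N) (eps : R) : Prop :=
  [/\ 0 < eps, gamma (phi t) = t,
      forall w, nrm (w - phi t) < eps -> [/\ phi (gamma w) = w, pr (gamma w) = psi w,
        Y (gamma w) <-> kernel_of M w,
        forall V, nbhs (gamma w) V -> exists2 d : R, 0 < d & forall w', nrm (w' - w) < d -> V (gamma w')
        & differentiable psi w]
    & \forall u \near t, u = gamma (phi u)].

(** [good] is the family of matrices occurring in charts, later the shifted ones. By [good_uniq] two
    of them whose kernels share a point of the image of [phi] coincide, so the linear space cannot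
    change along a connected component. *)
Variable good : 'M[C]_(r, N') -> Prop.
Hypotheses (pr_cts : forall t (eps : R), 0 < eps -> \forall u \near t, nrm (pr u - pr t) < eps)
  (phi_cts : forall t (eps : R), 0 < eps -> \forall u \near t, nrm (phi u - phi t) < eps)
  (Y_eq : forall t, Y t <-> forall g, g \in gs -> ev (pr t) g = 0)
  (charts : forall t, Y t -> exists M gamma psi eps, good M /\ linear_chart t M gamma psi eps)
  (good_uniq : forall M M' t, good M -> good M' -> kernel_of M (phi t) -> kernel_of M' (phi t) -> M = M').
Variable t0 : T.
Hypothesis Yt0 : Y t0.

Let Z : set T := connected_component Y t0.

Lemma chart_kernel t M gamma psi eps : Y t -> linear_chart t M gamma psi eps -> kernel_of M (phi t).
Proof.
move=> Yt [e0 gt hw _]; have [|_ _ E _ _] := hw (phi t); first by rewrite subrr nrm0.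
by apply/E; rewrite gt.
Qed.

(** The segment from [phi t] to [w] stays in the ball and in the kernel, and [gamma] carries it to a
    connected subset of [Y]. *)
Lemma chart_connected t M gamma psi eps w : Y t -> linear_chart t M gamma psi eps ->
  nrm (w - phi t) < eps -> kernel_of M w -> connected_component Y t (gamma w).
Proof.
move=> Yt ch hw kw; have kt := chart_kernel Yt ch; case: ch => e0 gt ball _.
pose f (s : R) : T := gamma (phi t + s%:C *: (w - phi t)).
have inb (s : R) : 0 <= s <= 1 -> nrm (phi t + s%:C *: (w - phi t) - phi t) < eps.
  move=> /andP[s0 s1]; rewrite addrC addKr nrmZ absc_real ger0_norm //.
  by apply: le_lt_trans hw; rewrite ler_piMl ?nrm_ge0.
have cf : {within `[0, 1], continuous f}.
  apply: continuous_in_subspaceT => s; rewrite inE /= in_itv /= => hs V fV.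
  have [_ _ _ cg _] := ball _ (inb s hs); have [d d0 hd] := cg _ fV.
  apply/nbhs_ballP; exists (d / (nrm (w - phi t) + 1)).
    by rewrite /= divr_gt0 // ltr_wpDl ?nrm_ge0.
  move=> s' hs' /=; apply: hd; rewrite opprD addrACA subrr add0r -scalerBl nrmZ -rmorphB absc_real.
  have hs2 : `|s - s'| < d / (nrm (w - phi t) + 1) := hs'.
  move: hs2; rewrite ltr_pdivlMr ?ltr_wpDl ?nrm_ge0 // distrC => hs2.
  by apply: le_lt_trans hs2; rewrite ler_wpM2l // lerDl.
exists (f @` `[0, 1]%classic); last first.
  by exists 1; rewrite /= ?in_itv /= ?lexx ?ler01 // /f scale1r subrKC.
split.
- by exists 0; rewrite /= ?in_itv /= ?lexx ?ler01 // /f scale0r addr0.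
- move=> x [s]; rewrite /= in_itv /= => hs Ex; have [_ _ E _ _] := ball _ (inb s hs).
  by rewrite -Ex; apply/E; apply: kernelD => //; apply: kernelZ; exact: kernelB.
- by apply: connected_continuous_connected => //; exact: segment_connected.
Qed.

Lemma chart_near t M gamma psi eps (d : R) : 0 < d -> linear_chart t M gamma psi eps ->
  \forall u \near t, nrm (phi u - phi t) < d /\ u = gamma (phi u).
Proof. by move=> d0 [_ _ _ h]; apply: filterI => //; exact: phi_cts. Qed.

Lemma near_same_component t : Y t -> \forall u \near t, Y u -> connected_component Y t u.
Proof.
move=> Yt; have [M [gamma [psi [eps [_ ch]]]]] := charts Yt; have e0 : 0 < eps by case: ch.
apply: filterS (chart_near e0 ch) => u [hu ug] Yu; rewrite ug.
have [_ _ ball _] := ch; have [_ _ E _ _] := ball _ hu.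
by apply: (chart_connected Yt ch) => //; apply/E; rewrite -ug.
Qed.

Lemma near_off_set t : ~ Y t -> \forall u \near t, ~ Y u.
Proof.
move=> nY; have [g gin gt] : exists2 g, g \in gs & ev (pr t) g != 0.
  apply: contrapT => no; apply: nY; apply/Y_eq => g gin; apply/eqP; apply: contrapT => /negP h.
  by apply: no; exists g.
have [d d0 hd] := ev_near_neq0 gt.
apply: filterS (pr_cts t d0) => u /hd gu /Y_eq/(_ g gin)/eqP.
by rewrite (negPf gu).
Qed.

Lemma near_in_component t : Z t -> \forall u \near t, Y u -> Z u.
Proof.
move=> Zt; have Yt := connected_component_sub Zt.
by apply: filterS (near_same_component Yt) => u h /h; apply: connected_component_trans.
Qed.

Lemma near_off_component t : ~ Z t -> \forall u \near t, ~ Z u.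
Proof.
move=> nZ; have [Yt|nY] := pselect (Y t); last first.
  by apply: filterS (near_off_set nY) => u nYu /connected_component_sub.
apply: filterS (near_same_component Yt) => u h Zu; apply: nZ.
apply: (connected_component_trans Zu); apply: connected_component_sym; apply: h.
exact: connected_component_sub Zu.
Qed.

Lemma analytic_empty_near t (P : set T) : (\forall u \near t, ~ P u) -> exists (s : nat) (g : 'I_s -> 'rV[C]_N -> C),
    (forall i, \forall q \near pr t, differentiable (g i) q) /\
    (\forall u \near t, P u <-> forall i, g i (pr u) = 0).
Proof.
move=> h; exists 1, (fun _ _ => 1); split.
  by move=> _; apply: filterE => q; exact: differentiable_cst.
apply: filterS h => u nP; split => // /(_ ord0)/eqP; by rewrite oner_eq0.
Qed.

Lemma component_analytic : analytic_subset pr Z.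
Proof.
move=> t; have [Zt|nZ] := pselect (Z t); last exact/analytic_empty_near/near_off_component.
exists (size gs), (fun i x => ev x (tnth (in_tuple gs) i)); split.
  by move=> i; apply: filterE => x; exact: sdiff1_differentiable (sdiff1_ev _ x).
apply: filterS (near_in_component Zt) => u h; split => [/connected_component_sub/Y_eq hY i|hi].
  by apply: hY; exact: mem_tnth.
by apply/h/Y_eq => g /(tnthP (in_tuple gs))[i ->].
Qed.

Lemma analytic_closed Z1 t : analytic_subset pr Z1 -> ~ Z1 t -> \forall u \near t, ~ Z1 u.
Proof.
move=> an nZ; have [s [g [dg hZ]]] := an t.
have [i gi] : exists i, g i (pr t) != 0.
  apply: contrapT => no; apply: nZ; apply/(nbhs_singleton hZ) => i; apply/eqP.
  by apply: contrapT => /negP h; apply: no; exists i.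
have cg := differentiable_continuous (nbhs_singleton (dg i)).
have gp0 : 0 < absc (g i (pr t)) by rewrite absc_gt0.
have /cg/nbhs_nrmP[d d0 hd] : nbhs (g i (pr t)) [set z | absc (z - g i (pr t)) < absc (g i (pr t))].
  by apply/nbhs_abscP; exists (absc (g i (pr t))).
apply: filterS (filterI (pr_cts t d0) hZ) => u [/hd hu Zu] /Zu/(_ i) E.
by move: hu; rewrite /= E sub0r abscN ltxx.
Qed.

(** Connectedness as an induction principle: a condition that holds at one point of [Z] and is open
    and closed relative to [Z] holds on [Z]. *)
Lemma component_clopen_ind (W : set T) : (exists2 t, Z t & W t) ->
  (forall t, Z t -> W t -> \forall u \near t, Z u -> W u) ->
  (forall t, Z t -> (forall V, nbhs t V -> exists u, [/\ V u, Z u & W u]) -> W t) ->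
  forall t, Z t -> W t.
Proof.
move=> [t1 Zt1 Wt1] op cl.
have E : Z `&` W = Z.
  apply: (component_connected (x := t0) (A := Y)); first by exists t1.
  - exists ([set u | Z u -> W u]°); first exact: open_interior.
    apply/seteqP; split => u [Zu Wu]; split => //; first exact: op.
    by have := interior_subset Wu; apply.
  - exists (closure (Z `&` W)); first exact: closed_closure.
    apply/seteqP; split => u [Zu Wu]; split => //; first exact: subset_closure.
    apply: cl => // V /Wu[x [[Zx Wx] Vx]]; by exists x.
by move=> t Zt; have [] : (Z `&` W) t by rewrite E.
Qed.

(* Two analytic sets covering [Z]: the set of points near which [Z] lies in the
   second one is closed by the identity theorem. *)
Lemma component_irreducible : analytic_irreducible pr Z.
Proof.
split; first exact: component_analytic.
  by exists t0; exact: connected_component_refl.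
move=> Z1 Z2 an1 an2 ZE; have [sub|] := pselect (Z `<=` Z1).
  by left; apply/seteqP; split => // u; rewrite ZE; left.
move=> /existsNP[t1 /not_implyP[Zt1 nZ1]]; right.
apply/seteqP; split => [|u]; last by rewrite ZE; right.
pose W : set T := [set t : T | \forall u \near t, Z u -> Z2 u].
suff h t : Z t -> W t by move=> t Zt; exact: nbhs_singleton (h t Zt) Zt.
move: t; apply: (component_clopen_ind (W := W)).
- exists t1 => //; apply: filterS (analytic_closed an1 nZ1) => u nu.
  by rewrite ZE => -[].
- move=> t _ Wt; apply: filterS (nbhs_interior Wt) => u hu _; exact: hu.
move=> t Zt clW; have Yt := connected_component_sub Zt.
have [M [gamma [psi [eps [_ ch]]]]] := charts Yt.
have kt := chart_kernel Yt ch; have [e0 gt ball near] := ch.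
have [s [g [dg hZ2]]] := an2 t.
have b0 : nrm (phi t - phi t) < eps by rewrite subrr nrm0.
have [_ prt _ cgt dpsit] := ball _ b0; rewrite gt in prt.
have nbV : nbhs (gamma (phi t)) [set u | Z2 u <-> forall i, g i (pr u) = 0] by rewrite gt.
have [d1 d10 hd1] := cgt _ nbV.
have [d2 d20 hd2] : exists2 d2 : R, 0 < d2 & forall w, nrm (w - phi t) < d2 -> forall i, differentiable (g i) (psi w).
  have nb : nbhs (pr t) [set x | forall i, differentiable (g i) x].
    exact: (@filter_forall _ _ (fun i x => differentiable (g i) x) (nbhs (pr t)) _ dg).
  rewrite prt in nb; exact: (differentiable_pullback dpsit nb).
pose eps' := Num.min eps (Num.min d1 d2).
have eps'0 : 0 < eps' by rewrite !lt_min e0 d10.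
have [K K0 idK] := identity_kernel kt.
have eK : 0 < eps' / K by rewrite divr_gt0.
have eKe : Num.min eps (eps' / K) <= eps by rewrite ge_min lexx.
have mn0 : 0 < Num.min eps' (eps' / K) by rewrite lt_min eps'0.
have [t' [[ht' t'g] Zt' Wt']] := clW _ (chart_near mn0 ch).
move: ht'; rewrite lt_min => /andP[ht'1 ht'2].
have inball w : nrm (w - phi t) < eps' -> [/\ nrm (w - phi t) < eps, nrm (w - phi t) < d1 & nrm (w - phi t) < d2].
  by rewrite !lt_min => /and3P[].
have Yker u : Y u -> u = gamma (phi u) -> nrm (phi u - phi t) < eps -> kernel_of M (phi u).
  by move=> Yu ug hu; have [_ _ E _ _] := ball _ hu; apply/E; rewrite -ug.
have kt' : kernel_of M (phi t').
  by apply: Yker => //; [exact: connected_component_sub Zt'|have [] := inball _ ht'1].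
(* Near [phi t'] the functions [g i] composed with [psi] vanish on the kernel, because [Z] lies in
   [Z2] around [t']. The identity theorem spreads this over a ball around [phi t]. *)
have main w i : nrm (w - phi t) < eps' / K -> kernel_of M w -> g i (psi w) = 0.
  move=> hw kw; apply: (idK (fun w => g i (psi w)) eps' (phi t') w eps'0 _ ht'2 hw kt' kw).
    move=> x /inball[h1 _ h3]; have [_ _ _ _ dx] := ball _ h1.
    exact: (differentiable_comp dx (hd2 x h3 i)).
  have [h1 _ _] := inball _ ht'1; have [_ _ _ cg' _] := ball _ h1.
  have nb : nbhs (gamma (phi t')) [set u | (Z u -> Z2 u) /\ (Y u -> Z u)].
    by rewrite -t'g; apply: filterI => //; exact: near_in_component.
  have [d3 d30 hd3] := cg' _ nb.
  exists (Num.min d3 (eps' - nrm (phi t' - phi t))); first by rewrite lt_min d30 subr_gt0.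
  move=> x; rewrite lt_min => /andP[hx1 hx2] kx.
  have hx : nrm (x - phi t) < eps' by have := ler_nrm_trans (phi t') x (phi t); lra.
  have [k1 k2 k3] := inball _ hx; have [_ prx EY _ _] := ball _ k1.
  have [z2 yz] := hd3 x hx1.
  by rewrite -prx; apply: (hd1 x k2).1; apply/z2/yz/EY.
apply: filterS (chart_near mn0 ch) => u [hu ug] Zu.
move: hu; rewrite lt_min => /andP[hu1 hu2].
have [k1 k2 k3] := inball _ hu1; have [_ prx _ _ _] := ball _ k1.
have ku : kernel_of M (phi u) by apply: Yker => //; exact: connected_component_sub Zu.
rewrite ug; apply: (hd1 _ k2).2 => i; rewrite prx; exact: main.
Qed.

(** [Z] is open and closed in [Y], so for a larger irreducible [Z'] both [Z] and its complement in
    [Z'] are analytic; irreducibility leaves only [Z' = Z]. *)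
Lemma component_analytic_component : analytic_component pr Y Z.
Proof.
split; [exact: connected_component_sub|exact: component_irreducible|].
move=> Z' [an' _ irr'] ZZ' Z'Y.
have an2 : analytic_subset pr (Z' `\` Z).
  move=> t; have [Zt|nZ] := pselect (Z t).
    apply: analytic_empty_near; apply: filterS (near_in_component Zt) => u h [/Z'Y/h Zu nZu]; exact: nZu.
  have [s [g [dg hZ]]] := an' t; exists s, g; split => //.
  apply: filterS (filterI (near_off_component nZ) hZ) => u [nZu E].
  split => [[/E]//|/E ?]; by split.
have E : Z' = Z `|` (Z' `\` Z).
  apply/seteqP; split => u; last by case=> [/ZZ'|[]].
  by move=> Z'u; have [Zu|nZu] := pselect (Z u); [left|right].
have [//|E2] := irr' Z (Z' `\` Z) component_analytic an2 E.
have Zt0 : Z t0 by exact: connected_component_refl.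
by have := ZZ' _ Zt0; rewrite E2 => -[_ /(_ Zt0)].
Qed.

(** The points of [Z] that [phi] sends into the kernel at [t0] form an open and closed subset by
    [good_uniq]. So all of [phi Z] lies in that kernel and contains a ball of it. *)
Lemma component_zariski_closure : exists2 M, good M & zariski_closure (phi @` Z) = kernel_of M.
Proof.
have [M [gamma [psi [eps [gM ch]]]]] := charts Yt0.
have kt := chart_kernel Yt0 ch; have [e0 gt ball near] := ch.
exists M => //; apply: (@zariski_closure_ball R r N' M _ (phi t0) eps) => //; last first.
  move=> w hw kw; have [pw _ _ _ _] := ball w hw; exists (gamma w) => //.
  exact: chart_connected ch hw kw.
move=> _ [t Zt <-]; move: t Zt; apply: (component_clopen_ind (W := [set t | kernel_of M (phi t)])).
- by exists t0 => //; exact: connected_component_refl.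
- move=> t Zt Wt; have Yt := connected_component_sub Zt.
  have [M' [gamma' [psi' [eps' [gM' ch']]]]] := charts Yt.
  have e'0 : 0 < eps' by case: ch'.
  have MM : M' = M by apply: good_uniq (chart_kernel Yt ch') Wt.
  apply: filterS (chart_near e'0 ch') => u [hu ug] Zu /=; rewrite -MM.
  case: ch' => _ _ ball' _; have [_ _ E _ _] := ball' _ hu.
  by apply/E; rewrite -ug; exact: connected_component_sub Zu.
- move=> t Zt cl; have Yt := connected_component_sub Zt.
  have [M' [gamma' [psi' [eps' [gM' ch']]]]] := charts Yt.
  have e'0 : 0 < eps' by case: ch'.
  have [u [[hu ug] Zu Wu]] := cl _ (chart_near e'0 ch').
  have ku : kernel_of M' (phi u).
    case: (ch') => _ _ ball' _; have [_ _ E _ _] := ball' _ hu.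
    by apply/E; rewrite -ug; exact: connected_component_sub Zu.
  have <- : M' = M by apply: good_uniq ku Wu.
  exact: chart_kernel Yt ch'.
Qed.

End AnalyticComponent.

Section Bialgebraic.
Context (R : realType) (m n k : nat) (e : 'I_m.+1 -> nat).
Hypotheses (he : forall i, (0 < e i)%N) (hsum : (\sum_(i < m.+1) e i)%N = n) (hk : (k <= m)%N).
Local Notation C := R[i].
Local Notation point := 'rV[C]_(1 + (m + n)).
Local Notation periods := 'rV[C]_(m + n.+1).
Local Notation tpi := (two_pi_i R).
Context (A : 'M[rat]_(k, m)) (B : 'M[C]_(k, n.+1)) (q : 'I_n -> rat).
Hypothesis hB : forall i l, l != ord_max -> B i l = 0.
Hypothesis fA : row_free A.
Context (H : 'M[rat]_k) (a : 'I_k -> 'I_m -> 'I_n.+1 -> int) (s : 'I_m -> 'I_n.+1 -> 'I_k -> int).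
Hypotheses (uH : H \in unitmx)
  (ha : forall i j l, (H *m A) i j * residue_ratio q l = (a i j l)%:~R)
  (hs : forall i i', \sum_j \sum_l a i j l * s j l i' = (i == i')%:R).

Let S : set point := period_locus e (period_matrix A B q).

Definition shifted (M : 'M[C]_(k + n, m + n.+1)) : Prop := exists v, M = shifted_matrix A B q H v.

Lemma shifted_row_free M : shifted M -> row_free M.
Proof.
move=> [v ->]; rewrite /shifted_matrix /period_matrix; set B' := B - _.
have /row_freeP[A' AA'] : row_free (map_mx ratr A : 'M[C]_(k, m)) by rewrite row_free_map.
pose D : 'M[C]_(n.+1, n) := \matrix_(l, i) (l == lift ord_max i)%:R.
have CD : residue_rows R q *m D = 1%:M.
  apply/matrixP => i i'; rewrite mxE (bigD1 (lift ord_max i')) //= big1 => [|l li]; last first.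
    by rewrite [D _ _]mxE (negPf li) mulr0.
  rewrite !mxE eqxx addr0 mulr1 eq_sym (negPf (neq_lift _ _)) lift_max.
  by [].
apply/row_freeP; exists (block_mx A' (- (A' *m B' *m D)) 0 D).
rewrite mulmx_block !mul0mx !mulmx0 !addr0 add0r AA' CD mulmxN !mulmxA AA' mul1mx addNr.
by rewrite -scalar_mx_block.
Qed.

(** Subtracting the upper equations of the two matrices leaves the difference of their last columns
    times the last entry of [w], which is non-zero. *)
Lemma shifted_uniq M M' (w : periods) : w 0 (rshift m ord_max) != 0 -> shifted M -> shifted M' ->
  kernel_of M w -> kernel_of M' w -> M = M'.
Proof.
have hB' (b : 'cV[C]_k) i l : l != ord_max -> (B - b *m delta_mx 0 ord_max) i l = 0.
  by move=> lm; rewrite mxE hB // mxE col_deltaE (negPf lm) subrr.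
have wE : w = row_mx (\row_j w 0 (lshift n.+1 j)) (\row_l (1 * w 0 (rshift m l))).
  apply/rowP => x; case: (split_ordP x) => x' ->; rewrite ?row_mxEl ?row_mxEr !mxE //.
  by rewrite mul1r.
have uniq (B1 B2 : 'M[C]_(k, n.+1)) : w 0 (rshift m ord_max) != 0 ->
    (forall i l, l != ord_max -> B1 i l = 0) -> (forall i l, l != ord_max -> B2 i l = 0) ->
    kernel_of (period_matrix A B1 q) w -> kernel_of (period_matrix A B2 q) w -> B1 = B2.
  move=> R0 h1 h2; rewrite /kernel_of /= wE.
  move=> /(period_matrixP _ _ _ _ (oner_neq0 C) h1)[_ E1] /(period_matrixP _ _ _ _ (oner_neq0 C) h2)[_ E2].
  apply/matrixP => i l; have [->|lm] := eqVneq l ord_max; last by rewrite h1 // h2.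
  by apply: (mulIf R0); have := etrans (E1 i) (esym (E2 i)); rewrite !mul1r; exact: addrI.
move=> w0 [v ->] [v' ->] h h'; rewrite /shifted_matrix.
exact: (congr1 (fun X => period_matrix A X q) (uniq _ _ w0 (hB' _) (hB' _) h h')).
Qed.

Section Cover.
Context (T : topologicalType) (pr : T -> point) (phi : T -> periods).
Hypotheses (cov : covering (@stratum R m n) pr) (gp : global_period_map e pr phi).

Lemma cover_stratum t : stratum (pr t).
Proof. by have [_ <- _] := cov; exists t. Qed.

Lemma cover_cts t (eps : R) : 0 < eps -> \forall u \near t, nrm (pr u - pr t) < eps.
Proof.
move=> e0; have [c _ _] := cov; apply: (c t [set x | nrm (x - pr t) < eps]).
by apply/nbhs_nrmP; exists eps.
Qed.

Lemma global_period_cts t (eps : R) : 0 < eps -> \forall u \near t, nrm (phi u - phi t) < eps.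
Proof.
move=> e0; have [U [c [ch Up near]]] := gp t.
have [d d0 hd] := chart_continuous ch Up e0.
have pt : phi t = period_map e c (pr t) := nbhs_singleton near.
apply: filterS (filterI near (cover_cts t d0)) => u [-> /hd[_]].
by rewrite pt.
Qed.

Lemma local_section t : exists (sigma : point -> T) (d : R), [/\ 0 < d, sigma (pr t) = t,
  forall p, nrm (p - pr t) < d -> pr (sigma p) = p /\
    forall V, nbhs (sigma p) V -> exists2 d' : R, 0 < d' & forall p', nrm (p' - p) < d' -> V (sigma p')
  & \forall u \near t, u = sigma (pr u)].
Proof.
have [_ _ loc] := cov; have [V [oV Vp VS [I [sg [cts opn sec uniq]]]]] := loc _ (cover_stratum t).
have [i [it _]] := uniq t Vp.
have /nbhs_nrmP[d d0 hd] : nbhs (pr t) V by exact: open_nbhs_nbhs.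
exists (sg i), d; split => //.
- move=> p hp; split; first by apply: sec; exact: hd.
  move=> W hW; have cp : {for p, continuous (sg i)}.
    have := cts i; rewrite continuous_open_subspace // => h; apply: h; rewrite inE; exact: hd.
  by have /nbhs_nrmP := cp _ hW.
- have nb : nbhs t (sg i @` V).
    by apply: open_nbhs_nbhs; split; [exact: opn|exists (pr t)].
  by apply: filterS nb => u [x Vx <-]; rewrite sec.
Qed.

(** [gamma] is a local section of the covering after the inverse [psi] of a period chart. The matrix
    is shifted by the integral vector that the logarithms of this chart produce at [pr t]. *)
Lemma cover_chart t : S (pr t) -> exists M gamma psi eps, shifted M /\
  linear_chart pr phi (pr @^-1` S) t M gamma psi eps.
Proof.
move=> St; have [U [c [ch Up near]]] := gp t.
have pt : phi t = period_map e c (pr t) := nbhs_singleton near.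
have [sp rc mc] := (period_locusP he hsum hB uH ha hs (pr t)).1 St.
have [_ _ _ hL] := chart_avoids ch Up; have [v hv] := (monomial_condP B H a hL).1 mc.
have [r1 r10 hr1] := chart_locus_near he hsum hB uH ha hs ch Up St hv.
have [sigma [d [d0 st sec nst]]] := local_section t.
have [|_ cs] := sec (pr t); first by rewrite subrr nrm0.
have nb : nbhs (sigma (pr t)) [set u | phi u = period_map e c (pr u)] by rewrite st.
have [d' d'0 hd'] := cs _ nb.
have [_ _ _ _ [_ opn [psi [psi1 psi2]]]] := ch.
have im : (period_map e c @` U) (phi t) by exists (pr t).
pose r3 := Num.min r1 (Num.min d d').
have r30 : 0 < r3 by rewrite !lt_min r10 d0.
have psit : psi (phi t) = pr t by rewrite pt psi1.
have nb3 : nbhs (psi (phi t)) [set x | nrm (x - pr t) < r3].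
  by rewrite psit; apply/nbhs_nrmP; exists r3.
have [e1 e10 he1] := differentiable_pullback (psi2 _ im) nb3.
have /nbhs_nrmP[e2 e20 he2] : nbhs (phi t) (period_map e c @` U) by exact: open_nbhs_nbhs.
have e0 : 0 < Num.min e1 e2 by rewrite lt_min e10.
exists (shifted_matrix A B q H v), (fun w => sigma (psi w)), psi, (Num.min e1 e2); split; first by exists v.
split; first exact: e0.
- by rewrite psit st.
- move=> w; rewrite lt_min => /andP[/he1 hw /he2 imw].
  have [U' E] : U (psi w) /\ period_map e c (psi w) = w.
    have [x Ux Ex] := imw; have psx : psi w = x by rewrite -Ex; exact: psi1.
    by rewrite psx.
  move: hw; rewrite /= !lt_min => /and3P[hw1 hw2 hw3].
  have [ps ns] := sec _ hw2; split.
  + by have := hd' _ hw3; rewrite /= ps E.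
  + exact: ps.
  + have [_ E1] := hr1 _ hw1; rewrite E in E1.
    by rewrite /preimage /= ps.
  + move=> V /ns[d3 d30 hd3].
    have nbw : nbhs (psi w) [set x | nrm (x - psi w) < d3] by apply/nbhs_nrmP; exists d3.
    have [d4 d40 hd4] := differentiable_pullback (psi2 _ imw) nbw.
    by exists d4 => // w' /hd4; exact: hd3.
  + exact: psi2.
- have [r4 r40 hr4] := chart_continuous ch Up e0.
  apply: filterS (filterI nst (filterI near (cover_cts t r40))) => u [us [pu /hr4[Uu _]]].
  by rewrite pu (psi1 _ Uu) -us.
Qed.


End Cover.

Lemma period_locus_bialgebraic : S !=set0 -> bialgebraic e S.
Proof.
move=> S0; exists (m + n.+1 - (k + n))%N.
  exact: (period_locus_has_dim he hsum hk hB fA uH ha hs S0).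
move=> T pr phi [cov _] gp; have [p0 Sp0] := S0.
have pl := period_locus_locus he hsum hB uH ha hs.
have [t0 _ pt0] : range pr p0.
  by have [_ -> _] := cov; have [] := (period_locusP he hsum hB uH ha hs p0).1 Sp0.
have Y_eq t : (pr @^-1` S) t <-> forall g, g \in locus_eqs e B q H a -> ev (pr t) g = 0.
  have E : S = locus (discr_poly R m n) (locus_eqs e B q H a) := pl.
  rewrite /preimage /= E; split => [[_]//|h]; split => //.
  by rewrite ev_discr; apply/stratumP; exact: (cover_stratum cov).
have uniq M M' t : shifted M -> shifted M' -> kernel_of M (phi t) -> kernel_of M' (phi t) -> M = M'.
  apply: shifted_uniq; have [U [c [ch Up near]]] := gp t.
  have -> : phi t = period_map e c (pr t) := nbhs_singleton near.
  rewrite (resid_chart hsum ord_max ch Up) mulf_neq0 ?two_pi_i_neq0 //.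
  apply: resid_neq0 => //; exact: (cover_stratum cov).
have Y0 : (pr @^-1` S) t0 by rewrite /preimage /= pt0.
have ccts := cover_cts cov; have pcts := global_period_cts cov gp; have chs := cover_chart cov gp.
exists (connected_component (pr @^-1` S) t0).
  exact: (component_analytic_component ccts pcts Y_eq chs Y0).
have [M gM ->] := component_zariski_closure pcts chs uniq Y0.
apply: kernel_has_dim; last exact: shifted_row_free.
by lia.
Qed.

End Bialgebraic.

Theorem proposition8p4 (R : realType) (m n k : nat) (e : 'I_m.+1 -> nat)
  (he : forall i, (0 < e i)%N) (hsum : (\sum_(i < m.+1) e i)%N = n)
  (hk : (k <= m)%N)
  (A : 'M[rat]_(k, m)) (B : 'M[R[i]]_(k, n.+1)) (q : 'I_n -> rat)
  (hA : reduced_row_echelon A)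
  (hB : forall i l, l != ord_max -> B i l = 0)
  (hq : forall i, q i != 0)
  (hM : reduced_row_echelon (period_matrix A B q)) :
  let M := period_matrix A B q in
  let S := period_locus e M in
  [/\ well_defined e M,
      S !=set0 -> bialgebraic e S,
      pure_codim S (k + n),
      linear_over e predT S
    & forall K : divringClosed R[i], B \is a mxOver K -> linear_over e K S].
Proof.
move=> M S.
(* A zero of positive order forces [n > 0], so the block [C] has a row to compare with the rows of
   [A]. *)
have n0 : (0 < n)%N by rewrite -hsum big_ord_recl addn_gt0 he.
have fA := period_matrix_row_free n0 hB hA hM.
have [H [a [s [uH ha hs]]]] := lattice_exists q fA.
have lin := period_locus_linear_over he hsum hk hB uH ha hs.
split.
- exact: (period_locus_well_defined he hsum hB uH ha hs).
- exact: (period_locus_bialgebraic he hsum hk hB fA uH ha hs).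
- exact: (period_locus_pure_codim he hsum hk hB fA uH ha hs).
- by apply: lin => v; apply/mxOverP.
- by move=> K BK; apply: lin => v; exact: shifted_matrix_over.
Qed.
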